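(* Let $1/3<\gamma\le 1/2$, let $\Omega$ be a bounded neighborhood of $0$ in $\bar\Pi^+$, let $X$ be a path on $\Omega$ admitting a Lévy area $\mathbf X^{\mathbf 2}$ in the sense given in the context, and let $\sigma:\mathbb C^l\to\mathbb C^{d,l}$ be an analytic function. Let $a\in\mathbb C^l$. Consider the equation $$y_0=a,\qquad (\delta y)_{ts}=\mathcal J_{ts}(dX^*\,\sigma(y)).\qquad (\mathrm E)$$ Then: (1) There exists a neighborhood $\Omega_0$ of $0$ in $\bar\Pi^+$ such that equation (E), required for all $s,t\in\Omega_0$, admits a unique solution $y$ in $\mathcal Q_{\kappa,a}(\Omega_0;\mathbb C^l)$ for any $1/3<\kappa<\gamma$. (2) The mapping $(a,X,\mathbf X^{\mathbf 2})\mapsto y$ is continuous from $\mathbb C^l\times\mathcal C_1^{\gamma}(\Omega_0;\mathbb C^d)\times\mathcal C_2^{2\gamma}(\Omega_0;\mathbb C^{d,d})$ to $\mathcal Q_{\kappa,a}(\Omega_0;\mathbb C^l)$.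
   Context: $\Pi^+=\{z\in\mathbb C:\Im z>0\}$, $\bar\Pi^+$ its closure; $[s,t]$ is the straight segment. $\mathbb C^{m,n}$ denotes $m\times n$ complex matrices. Increments: $\mathcal C_k(\Omega;V)$ is the set of $g:\Omega^k\to V$ with $g_{t_1\cdots t_k}=0$ whenever $t_i=t_{i+1}$ for some $i\le k-1$; $(\delta g)_{t_1\cdots t_{k+1}}=\sum_{i=1}^{k+1}(-1)^ig_{t_1\cdots\hat t_i\cdots t_{k+1}}$, so $(\delta g)_{ts}=g_t-g_s$ for $g\in\mathcal C_1$ and $(\delta h)_{tus}=h_{ts}-h_{tu}-h_{us}$ for $h\in\mathcal C_2$ (for $g\in\mathcal C_3$ the same formula applies with four arguments). $\mathcal C_2^\mu(\Omega;V)$: those $f\in\mathcal C_2$ with norm $\mathcal N[f;\mathcal C_2^\mu]=\sup_{s,t\in\Omega}|f_{ts}|/|t-s|^\mu<\infty$; $\mathcal C_1^\mu$: those $f$ with $\mathcal N[f;\mathcal C_1^\mu]=\mathcal N[\delta f;\mathcal C_2^\mu]<\infty$; $\mathcal N[f;\mathcal C_1^0]=\sup_\Omega|f|$. $\mathcal C_3^\mu(\Omega;V)$: those $h\in\mathcal C_3$ which are sums $\sum_ih_i$ with $h_i\in\mathcal C_3$, $0<\rho_i<\mu$ and $\sum_i\sup_{s,u,t}\frac{|(h_i)_{tus}|}{|u-s|^{\rho_i}|t-u|^{\mu-\rho_i}}<\infty$. $\mathcal C_j^{\mathrm m,\beta}(\Omega;V)$: those $h\in\mathcal C_j$ with $\sup\{\varepsilon^{-\beta}|h_{s_1+\imath\varepsilon,\ldots,s_j+\imath\varepsilon}-h_{s_1,\ldots,s_j}|:\varepsilon\in(0,1],s_i\in\Omega\}<\infty$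 (over $\varepsilon$ for which the shifted points lie in $\Omega$). Assumptions on $X$: $X\in\mathcal C_1^\gamma(\Omega;\mathbb C^d)$, its restriction to $\Omega\cap\Pi^+$ is analytic, and it admits a Lévy area, i.e. an increment $\mathbf X^{\mathbf 2}\in\mathcal C_2^{2\gamma}(\Omega;\mathbb C^{d,d})\cap\mathcal C_2^{\mathrm m,\gamma}(\Omega;\mathbb C^{d,d})$, analytic on $\Pi^+\times\Pi^+$, formally given by the iterated integral $\mathbf X^{\mathbf 2}_{ts}(i,j)=\int_{[s,t]}dX_u(i)\,(X_u(j)-X_s(j))$, with $(\delta\mathbf X^{\mathbf 2})_{tus}(i,j)=(\delta X)_{tu}(i)\,(\delta X)_{us}(j)$ for all $t,u,s\in\Omega$. Analytic controlled paths: for $1/3<\kappa\le\gamma$ and $a\in\mathbb C^k$, $\mathcal Q_{\kappa,a}(\Omega;\mathbb C^k)$ is the set of $z\in\mathcal C_1^\kappa(\Omega;\mathbb C^k)$ with $z_0=a$ and $(\delta z)_{ts}(i)=\sum_j(\delta X)_{ts}(j)\,\zeta_s(j,i)+r_{ts}(i)$, where $\zeta\in\mathcal C_1^\kappa(\Omega;\mathbb C^{d,k})$ is bounded, $r\in\mathcal C_2^{2\kappa}(\Omega;\mathbb C^k)$, and $z$, $\zeta$, $u\mapsto r_{us}$ (any $s\in\Pi^+$) are analytic on $\Pi^+$. Such a $z$ is considered as a couple $(z,\zeta)$, with semi-norm $\mathcal N[z;\mathcal Q_{\kappa,a}]=\mathcal N[z;\mathcal C_1^\kappa]+\mathcal N[\zeta;\mathcal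 C_1^0]+\mathcal N[\zeta;\mathcal C_1^\kappa]+\mathcal N[r;\mathcal C_2^{2\kappa}]$. Sewing map $\Lambda$: for $h\in\mathcal C_3^\mu\cap\mathcal C_3^{\mathrm m,\beta}$ ($\mu>1$, $\beta>0$) with $\delta h=0$, such that on $\Pi^+$ $h=\delta(\int df\,r)$ with $f$ analytic, $r\in\mathcal C_2$ and $u\mapsto r_{us}$ analytic (where $(\int df\, r)_{ts}=\int_{[s,t]}df_u\,r_{us}$), $\Lambda h$ is the unique element of $\mathcal C_2^\nu$ (any $1<\nu<\mu$) with $\delta(\Lambda h)=h$. Integral: for $m\in\mathcal Q_{\kappa,b}(\Omega;\mathbb C^d)$ with $\delta m(i)=\sum_j\delta X(j)\mu(j,i)+r(i)$, $$\mathcal J_{ts}(dX^*m)=\sum_i(\delta X)_{ts}(i)m_s(i)+\sum_{i,j}\mathbf X^{\mathbf 2}_{ts}(i,j)\mu_s(j,i)+\Lambda(h)_{ts},$$ $h_{tus}=\sum_i(\delta X)_{tu}(i)r_{us}(i)+\sum_{i,j}\mathbf X^{\mathbf 2}_{tu}(i,j)(\delta\mu)_{us}(j,i)$. As a controlled path, the integral has derivative $\zeta=m$. For $\mathbb C^{d,l}$-valued $m$ the integral is taken column by column. Composition: for $y\in\mathcal Q_{\kappa,a}(\Omega;\mathbb C^l)$ with decomposition $(\zeta,r)$, each $\sigma^{i,c}(y)$ is a controlled path with derivative $\sum_p\zeta(j,p)\,\partial_p\sigma^{i,c}(y)$, $j=1,\dots,d$, and remainder $\sum_pr(p)\partial_p\sigma^{i,c}(y)+[\delta(\sigma^{i,c}(y))-\sum_p\delta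 y(p)\,\partial_p\sigma^{i,c}(y)]$ (factors without increments evaluated at the base point $s$). Equation (E) is understood between controlled paths considered as couples $(y,\zeta)$, so that for a solution $\zeta=\sigma(y)$. *)

(* Defs.v *)
From HB Require Import structures.
From mathcomp Require Import all_boot all_order all_algebra.
From mathcomp Require Import complex.
From mathcomp Require Import all_classical all_reals all_analysis.
Import Order.TTheory GRing.Theory Num.Theory.
Import numFieldNormedType.Exports.

Set Implicit Arguments.
Unset Strict Implicit.
Unset Printing Implicit Defensive.

Local Open Scope classical_set_scope.
Local Open Scope ring_scope.

(* R[i] seen as an abstract [numClosedFieldType], so that the topology of
   [numFieldNormedType] (the usual one of the complex plane) is inferred. *)
Definition Cplx (R : realType) : numClosedFieldType := R[i].

(* The norm of a normed module over [Cplx R] takes its values in [Cplx R]. On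
   [Cplx R] itself it is the modulus, on matrices the maximum of the moduli of
   the entries. *)
Definition nrm (R : realType) (V : normedModType (Cplx R)) (v : V) : R :=
  complex.Re `|v|.

Definition upper_half (R : realType) : set (Cplx R) :=
  [set z | 0 < complex.Im z].

Definition closed_upper_half (R : realType) : set (Cplx R) :=
  [set z | 0 <= complex.Im z].

Definition half_nbhd0 (R : realType) (Om : set (Cplx R)) : Prop :=
  Om `<=` @closed_upper_half R /\
  within (@closed_upper_half R) (nbhs (0 : Cplx R)) Om.

(* [Om] need not be relatively open, hence the interior; when it is, this is
   the intersection of [Om] with the upper half-plane. *)
Definition upper (R : realType) (Om : set (Cplx R)) : set (Cplx R) :=
  (Om `&` @upper_half R)°.

(* Meant for an open set [A]. [differentiable] is Frechet differentiability
   over the complex field, i.e. holomorphy. *)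
Definition analytic_on (R : realType) (V W : normedModType (Cplx R))
    (A : set V) (f : V -> W) : Prop :=
  forall x, A x -> differentiable f x.

(* Increments on [Om] are total functions of which only the values at points of
   [Om] matter. *)

Definition delta1 (R : realType) (V : normedModType (Cplx R))
    (g : Cplx R -> V) (t s : Cplx R) : V := g t - g s.

Definition delta2 (R : realType) (V : normedModType (Cplx R))
    (h : Cplx R -> Cplx R -> V) (t u s : Cplx R) : V := h t s - h t u - h u s.

Definition delta3 (R : realType) (V : normedModType (Cplx R))
    (h : Cplx R -> Cplx R -> Cplx R -> V) (t v u s : Cplx R) : V :=
  - h v u s + h t u s - h t v s + h t v u.

Definition incr2 (R : realType) (V : normedModType (Cplx R))
    (Om : set (Cplx R)) (f : Cplx R -> Cplx R -> V) : Prop :=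
  forall t, Om t -> f t t = 0.

Definition incr3 (R : realType) (V : normedModType (Cplx R))
    (Om : set (Cplx R)) (h : Cplx R -> Cplx R -> Cplx R -> V) : Prop :=
  forall t s, Om t -> Om s -> h t t s = 0 /\ h t s s = 0.

Definition supnorm (R : realType) (V : normedModType (Cplx R))
    (Om : set (Cplx R)) (f : Cplx R -> V) : \bar R :=
  ereal_sup [set (nrm (f s))%:E | s in Om].

(* The terms with t = s are 0 / 0 = 0. *)
Definition holder2 (R : realType) (V : normedModType (Cplx R)) (mu : R)
    (Om : set (Cplx R)) (f : Cplx R -> Cplx R -> V) : \bar R :=
  ereal_sup [set (nrm (f t s) / nrm (t - s) `^ mu)%:E | t in Om & s in Om].

Definition holder1 (R : realType) (V : normedModType (Cplx R)) (mu : R)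
    (Om : set (Cplx R)) (f : Cplx R -> V) : \bar R :=
  holder2 mu Om (delta1 f).

Definition holder3 (R : realType) (V : normedModType (Cplx R)) (rho rho' : R)
    (Om : set (Cplx R)) (h : Cplx R -> Cplx R -> Cplx R -> V) : \bar R :=
  ereal_sup [set e | exists t u s, [/\ Om t, Om u, Om s &
    e = (nrm (h t u s) / (nrm (u - s) `^ rho * nrm (t - u) `^ rho'))%:E]].

Definition inC1 (R : realType) (V : normedModType (Cplx R)) (mu : R)
    (Om : set (Cplx R)) (f : Cplx R -> V) : Prop :=
  (holder1 mu Om f < +oo)%E.

Definition inC2 (R : realType) (V : normedModType (Cplx R)) (mu : R)
    (Om : set (Cplx R)) (f : Cplx R -> Cplx R -> V) : Prop :=
  incr2 Om f /\ (holder2 mu Om f < +oo)%E.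

Definition inC3 (R : realType) (V : normedModType (Cplx R)) (mu : R)
    (Om : set (Cplx R)) (h : Cplx R -> Cplx R -> Cplx R -> V) : Prop :=
  incr3 Om h /\
  exists (h_ : nat -> Cplx R -> Cplx R -> Cplx R -> V) (rho : nat -> R),
    [/\ forall i, incr3 Om (h_ i) /\ 0 < rho i < mu,
        forall t u s, Om t -> Om u -> Om s ->
          series (fun i => h_ i t u s) @ \oo --> h t u s
      & (\sum_(0 <= i <oo) holder3 (rho i) (mu - rho i)%R Om (h_ i) < +oo)%E].

Definition up_shift (R : realType) (eps : R) (z : Cplx R) : Cplx R :=
  z + (Complex 0 eps : Cplx R).

Definition shift_norm2 (R : realType) (V : normedModType (Cplx R)) (beta : R)
    (Om : set (Cplx R)) (h : Cplx R -> Cplx R -> V) : \bar R :=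
  ereal_sup [set e | exists (eps : R) t s,
    [/\ 0 < eps <= 1, Om t /\ Om s,
        Om (up_shift eps t) /\ Om (up_shift eps s) &
        e = (eps `^ (- beta) *
             nrm (h (up_shift eps t) (up_shift eps s) - h t s))%:E]].

Definition shift_norm3 (R : realType) (V : normedModType (Cplx R)) (beta : R)
    (Om : set (Cplx R)) (h : Cplx R -> Cplx R -> Cplx R -> V) : \bar R :=
  ereal_sup [set e | exists (eps : R) t u s,
    [/\ 0 < eps <= 1, [/\ Om t, Om u & Om s],
        [/\ Om (up_shift eps t), Om (up_shift eps u) & Om (up_shift eps s)] &
        e = (eps `^ (- beta) *
             nrm (h (up_shift eps t) (up_shift eps u) (up_shift eps s)
                  - h t u s))%:E]].

Definition inCm2 (R : realType) (V : normedModType (Cplx R)) (beta : R)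
    (Om : set (Cplx R)) (h : Cplx R -> Cplx R -> V) : Prop :=
  incr2 Om h /\ (shift_norm2 beta Om h < +oo)%E.

Definition inCm3 (R : realType) (V : normedModType (Cplx R)) (beta : R)
    (Om : set (Cplx R)) (h : Cplx R -> Cplx R -> Cplx R -> V) : Prop :=
  incr3 Om h /\ (shift_norm3 beta Om h < +oo)%E.

Definition seg (R : realType) (s t : Cplx R) (tau : R) : Cplx R :=
  s + (Complex tau 0 : Cplx R) * (t - s).

Definition seg_in (R : realType) (A : set (Cplx R)) (s t : Cplx R) : Prop :=
  forall tau : R, 0 <= tau <= 1 -> A (seg s t tau).

Definition cint01 (R : realType) (phi : R -> Cplx R) : Cplx R :=
  Complex (\int[lebesgue_measure]_(tau in `[0, 1]) complex.Re (phi tau))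
          (\int[lebesgue_measure]_(tau in `[0, 1]) complex.Im (phi tau)).

(* the integral of g df along [s, t], for f analytic *)
Definition line_int (R : realType) (f g : Cplx R -> Cplx R) (s t : Cplx R) :
    Cplx R :=
  cint01 (fun tau => derive1 f (seg s t tau) * g (seg s t tau) * (t - s)).

Record levy_area (R : realType) (d : nat) (gamma : R) (Om : set (Cplx R))
    (X : Cplx R -> 'rV[Cplx R]_d) (X2 : Cplx R -> Cplx R -> 'M[Cplx R]_d) :
    Prop := LevyArea {
  levy_path_holder : inC1 gamma Om X;
  levy_path_analytic : analytic_on (upper Om) X;
  levy_holder : inC2 (2 * gamma) Om X2;
  levy_shift : inCm2 gamma Om X2;
  levy_analytic : analytic_on (upper Om `*` upper Om)
    (fun p : (Cplx R * Cplx R)%type => X2 p.1 p.2);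
  (* [X] is analytic along the segment, so the iterated integral makes sense *)
  levy_iterated : forall s t, seg_in (upper Om) s t -> forall i j,
    X2 t s i j =
      line_int (fun u => X u 0 i) (fun u => X u 0 j - X s 0 j) s t;
  levy_chen : forall t u s, Om t -> Om u -> Om s -> forall i j,
    delta2 X2 t u s i j = delta1 X t u 0 i * delta1 X u s 0 j
}.

(* The remainder r of a couple (z, zeta) is determined by the couple. *)
Definition remainder (R : realType) (d k : nat) (X : Cplx R -> 'rV[Cplx R]_d)
    (z : Cplx R -> 'rV[Cplx R]_k) (zeta : Cplx R -> 'M[Cplx R]_(d, k))
    (t s : Cplx R) : 'rV[Cplx R]_k :=
  delta1 z t s - delta1 X t s *m zeta s.

Record controlled (R : realType) (d k : nat) (kappa : R) (Om : set (Cplx R))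
    (X : Cplx R -> 'rV[Cplx R]_d) (a : 'rV[Cplx R]_k)
    (z : Cplx R -> 'rV[Cplx R]_k) (zeta : Cplx R -> 'M[Cplx R]_(d, k)) :
    Prop := Controlled {
  ctrl_holder : inC1 kappa Om z;
  ctrl_init : z 0 = a;
  ctrl_deriv_holder : inC1 kappa Om zeta;
  ctrl_deriv_bounded : (supnorm Om zeta < +oo)%E;
  ctrl_rem_holder : inC2 (2 * kappa) Om (remainder X z zeta);
  ctrl_analytic : analytic_on (upper Om) z;
  ctrl_deriv_analytic : analytic_on (upper Om) zeta;
  ctrl_rem_analytic : forall s, Om s -> upper_half s ->
    analytic_on (upper Om) (fun u => remainder X z zeta u s)
}.

Definition Qnorm (R : realType) (d k : nat) (kappa : R) (Om : set (Cplx R))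
    (z : Cplx R -> 'rV[Cplx R]_k) (zeta : Cplx R -> 'M[Cplx R]_(d, k))
    (r : Cplx R -> Cplx R -> 'rV[Cplx R]_k) : \bar R :=
  (holder1 kappa Om z + supnorm Om zeta + holder1 kappa Om zeta
   + holder2 (2 * kappa)%R Om r)%E.

(* Two couples controlled by different paths [X] and [X'] are compared through
   their three components: path, derivative and remainder. *)
Definition Qdist (R : realType) (d k : nat) (kappa : R) (Om : set (Cplx R))
    (X X' : Cplx R -> 'rV[Cplx R]_d)
    (z : Cplx R -> 'rV[Cplx R]_k) (zeta : Cplx R -> 'M[Cplx R]_(d, k))
    (z' : Cplx R -> 'rV[Cplx R]_k) (zeta' : Cplx R -> 'M[Cplx R]_(d, k)) :
    \bar R :=
  Qnorm kappa Om (fun s => z' s - z s) (fun s => zeta' s - zeta s)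
    (fun t s => remainder X' z' zeta' t s - remainder X z zeta t s).

(* On the upper half-plane, h is the coboundary of the increment obtained by
   integrating df r, where df r is a sum of products over coordinates. *)
Definition delta_of_integral (R : realType) (Om : set (Cplx R))
    (h : Cplx R -> Cplx R -> Cplx R -> Cplx R) : Prop :=
  exists (n : nat) (f : Cplx R -> 'rV[Cplx R]_n)
         (r : Cplx R -> Cplx R -> 'rV[Cplx R]_n),
    [/\ analytic_on (upper Om) f,
        incr2 (upper Om) r,
        forall s, upper Om s -> analytic_on (upper Om) (fun u => r u s)
      & forall t u s, seg_in (upper Om) s t -> seg_in (upper Om) u t ->
          seg_in (upper Om) s u ->
          h t u s = delta2 (V := Cplx R) (fun t' s' =>
            \sum_(i < n) line_int (fun v => f v 0 i) (fun v => r v s' 0 i)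
                                  s' t') t u s].

(* [is_Lambda Om h L] means that h is in the domain of the sewing map and that
   L is the value of the map at h. *)
Definition is_Lambda (R : realType) (Om : set (Cplx R))
    (h : Cplx R -> Cplx R -> Cplx R -> Cplx R)
    (L : Cplx R -> Cplx R -> Cplx R) : Prop :=
  exists mu beta : R,
  [/\ [/\ 1 < mu, 0 < beta, inC3 (V := Cplx R) mu Om h,
          inCm3 (V := Cplx R) beta Om h
        & delta_of_integral Om h],
      forall t v u s, Om t -> Om v -> Om u -> Om s ->
        delta3 (V := Cplx R) h t v u s = 0,
      forall nu, 1 < nu < mu -> inC2 (V := Cplx R) nu Om L,
      forall t u s, Om t -> Om u -> Om s ->
        delta2 (V := Cplx R) L t u s = h t u s
    & forall nu L', 1 < nu < mu -> inC2 (V := Cplx R) nu Om L' ->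
        (forall t u s, Om t -> Om u -> Om s ->
           delta2 (V := Cplx R) L' t u s = h t u s) ->
        forall t s, Om t -> Om s -> L' t s = L t s].

Definition rough_germ (R : realType) (d : nat) (X : Cplx R -> 'rV[Cplx R]_d)
    (X2 : Cplx R -> Cplx R -> 'M[Cplx R]_d) (m : Cplx R -> 'rV[Cplx R]_d)
    (mu : Cplx R -> 'M[Cplx R]_d) (t u s : Cplx R) : Cplx R :=
  \sum_i delta1 X t u 0 i * remainder X m mu u s 0 i
  + \sum_i \sum_j X2 t u i j * delta1 mu u s j i.

Definition is_rough_int (R : realType) (d : nat) (kappa : R)
    (Om : set (Cplx R)) (X : Cplx R -> 'rV[Cplx R]_d)
    (X2 : Cplx R -> Cplx R -> 'M[Cplx R]_d) (m : Cplx R -> 'rV[Cplx R]_d)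
    (mu : Cplx R -> 'M[Cplx R]_d) (J : Cplx R -> Cplx R -> Cplx R) : Prop :=
  controlled kappa Om X (m 0) m mu /\
  exists2 L, is_Lambda Om (rough_germ X X2 m mu) L &
    forall t s, Om t -> Om s ->
      J t s = \sum_i delta1 X t s 0 i * m s 0 i
              + \sum_i \sum_j X2 t s i j * mu s j i + L t s.

(* The derivative of the c-th column of sigma(y). The remainder of this couple
   is the one displayed for compositions, since
   delta y = delta X *m zeta + r. *)
Definition comp_deriv (R : realType) (d l : nat)
    (sigma : 'rV[Cplx R]_l -> 'M[Cplx R]_(d, l))
    (y : Cplx R -> 'rV[Cplx R]_l) (zeta : Cplx R -> 'M[Cplx R]_(d, l))
    (c : 'I_l) (s : Cplx R) : 'M[Cplx R]_d :=
  \matrix_(j, i) \sum_p zeta s j p *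
    'D_(delta_mx 0 p) (fun v => sigma v i c : Cplx R) (y s).

(* (y, zeta) solves y_0 = a, delta y = J(dX^* sigma(y)) on [Om], as an equation
   between couples; the integral is taken column by column. *)
Definition solves (R : realType) (d l : nat) (kappa : R) (Om : set (Cplx R))
    (sigma : 'rV[Cplx R]_l -> 'M[Cplx R]_(d, l)) (a : 'rV[Cplx R]_l)
    (X : Cplx R -> 'rV[Cplx R]_d) (X2 : Cplx R -> Cplx R -> 'M[Cplx R]_d)
    (y : Cplx R -> 'rV[Cplx R]_l) (zeta : Cplx R -> 'M[Cplx R]_(d, l)) :
    Prop :=
  [/\ controlled kappa Om X a y zeta,
      forall s, Om s -> zeta s = sigma (y s)
    & forall c : 'I_l,
        is_rough_int kappa Om X X2 (fun s => (col c (sigma (y s)))^T)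
          (comp_deriv sigma y zeta c) (fun t s => delta1 y t s 0 c)].

Definition close_data (R : realType) (d l : nat) (gamma eta : R)
    (Om : set (Cplx R)) (a a' : 'rV[Cplx R]_l)
    (X X' : Cplx R -> 'rV[Cplx R]_d)
    (X2 X2' : Cplx R -> Cplx R -> 'M[Cplx R]_d) : Prop :=
  [/\ nrm (a' - a) < eta,
      (holder1 gamma Om (fun s => X' s - X s)%R < eta%:E)%E
    & (holder2 (2 * gamma)%R Om (fun t s => X2' t s - X2 t s)%R < eta%:E)%E].

(* Main.v *)
(* The equation is treated by almost flows. Write E_ts(v) for the second-order
   Euler step v + sum_i (dX)_ts(i) f_i(v) + sum_ij X2_ts(i,j) (D f_i . f_j)(v),
   where f_i is the i-th row of sigma. Chen's relation and the Taylor expansion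
   of the entire map sigma give |E_tu E_us - E_ts| <= C |t - s|^(3 gamma), and
   3 gamma > 1, so compositions of E along a segment stay O(|t - s|^(3 gamma))
   close to E_ts and converge; since E is holomorphic in v, Cauchy's estimate
   turns sup bounds on the compositions into Lipschitz bounds.

   A path solves (E) exactly when it satisfies Davie's estimate
   |y_t - E_ts(y_s)| <= C |t - s|^nu for some nu > 1: the left-hand side is then
   Lambda(h), which the germ h determines because an additive increment of order
   nu > 1 vanishes. Following the flow along the ray from 0 gives uniqueness and
   stability. For existence, on a small half disc, y_t is the limit of the
   compositions along [0, t]. These are holomorphic in t, hence so is y; Davie's
   estimate holds along rays, which gives the differential equation
   y' = X' sigma(y) inside the upper half-plane, hence Davie's estimate between
   interior points, and it passes to the boundary with a uniform constant.
   Continuity in the Hoelder norms follows from sup-norm stability by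
   interpolation with the uniform gamma-Hoelder bounds. *)
Require Import Defs.
From HB Require Import structures.
From mathcomp Require Import all_boot all_order all_algebra.
From mathcomp Require Import complex.
From mathcomp Require Import all_classical all_reals all_analysis.
From mathcomp Require Import ring lra zify.
Import Order.TTheory GRing.Theory Num.Theory.
Import numFieldNormedType.Exports.
Local Open Scope classical_set_scope.
Local Open Scope ring_scope.
Set Implicit Arguments.
Unset Strict Implicit.

(** * The real-valued norm *)

Section NormBasics.
Variable R : realType.
Local Notation C := (Cplx R).

(** The entire map [sigma] is bounded only on balls, so every estimate lives on a ball for [v], with
    unit margins left for Cauchy's estimate and for the displacement of a step: this is the origin
    of the radii from [B - 3] to [B + 4]. Cauchy's estimate itself is derived from pointwise complex
    differentiability, by Goursat's argument on squares.

    Two difficulties have the same remedy. Inside the half disc the differential equation gives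
    Davie's estimate with a constant that depends on the distance to the boundary; and a competing
    solution satisfies Davie's estimate with an exponent and a constant of its own. But on a segment
    cut into many pieces such errors add up to nothing in the limit, so any Davie estimate improves
    to exponent [3 * gam] with a constant fixed by the almost flow ([flow_follow]). This requires
    the path to stay in the ball on which the almost flow is controlled, which is obtained by a
    bootstrap along the segment ([flow_trapped]). *)

Definition RtoC (x : R) : C := Complex x 0.

Lemma CReD (x y : C) : complex.Re (x + y) = complex.Re x + complex.Re y.
Proof. by case: x y => [a b] [c e]. Qed.
Lemma CImD (x y : C) : complex.Im (x + y) = complex.Im x + complex.Im y.
Proof. by case: x y => [a b] [c e]. Qed.
Lemma CReN (x : C) : complex.Re (- x) = - complex.Re x.
Proof. by case: x. Qed.
Lemma CImN (x : C) : complex.Im (- x) = - complex.Im x.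
Proof. by case: x. Qed.
Lemma CReM (x y : C) : complex.Re (x * y) =
  complex.Re x * complex.Re y - complex.Im x * complex.Im y.
Proof. by case: x y => [a b] [c e]. Qed.
Lemma CImM (x y : C) : complex.Im (x * y) =
  complex.Re x * complex.Im y + complex.Im x * complex.Re y.
Proof. by case: x y => [a b] [c e]. Qed.

Definition ReImE := (CReD, CImD, CReN, CImN, CReM, CImM).

Lemma Cplx_eq (x y : C) :
  complex.Re x = complex.Re y -> complex.Im x = complex.Im y -> x = y.
Proof. by case: x y => [a b] [c e] /= -> ->. Qed.

Lemma Cplx_eta (x : C) : Complex (complex.Re x) (complex.Im x) = x.
Proof. by case: x. Qed.

(** A norm is nonnegative for the order of the complex numbers, which forces its imaginary part to
    vanish; passing to the real number [nrm v] loses nothing. *)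
Lemma norm_RtoC (V : normedModType C) (v : V) : `|v| = RtoC (nrm v).
Proof.
apply: Cplx_eq => //=.
by have := normr_ge0 v; rewrite lecE /= => /andP[/eqP].
Qed.

Lemma RtoC_le (x y : R) : (RtoC x <= RtoC y) = (x <= y).
Proof. by rewrite lecE /= eqxx. Qed.
Lemma RtoC_lt (x y : R) : (RtoC x < RtoC y) = (x < y).
Proof. by rewrite ltcE /= eqxx. Qed.
Lemma RtoC0 : RtoC 0 = 0. Proof. by []. Qed.
Lemma RtoC1 : RtoC 1 = 1. Proof. by []. Qed.
Lemma RtoCD x y : RtoC (x + y) = RtoC x + RtoC y.
Proof. by apply: Cplx_eq; rewrite !ReImE /= ?addr0. Qed.
Lemma RtoCN x : RtoC (- x) = - RtoC x.
Proof. by apply: Cplx_eq; rewrite !ReImE /= ?oppr0. Qed.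
Lemma RtoCM x y : RtoC (x * y) = RtoC x * RtoC y.
Proof. by apply: Cplx_eq; rewrite !ReImE /=; ring. Qed.
Lemma RtoCV x : RtoC x^-1 = (RtoC x)^-1.
Proof.
have [->|x0] := eqVneq x 0; first by rewrite !RtoC0 !invr0.
have x0' : RtoC x != 0 by apply: contra x0 => /eqP[->].
by apply: (mulfI x0'); rewrite divff// -RtoCM divff.
Qed.
Lemma RtoC_eq0 x : (RtoC x == 0) = (x == 0).
Proof. by apply/eqP/eqP => [[->]|->]. Qed.
Lemma RtoC_nat n : RtoC n%:R = n%:R.
Proof. by elim: n => // n IH; rewrite -addn1 !natrD RtoCD IH. Qed.

Lemma posC (e : C) : 0 < e -> e = RtoC (complex.Re e) /\ 0 < complex.Re e.
Proof.
rewrite ltcE /= => /andP[/eqP ei er]; split => //.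
by apply: Cplx_eq.
Qed.

Section V.
Variable V : normedModType C.
Implicit Types v w : V.

Lemma nrm_ge0 v : 0 <= nrm v.
Proof. by rewrite -RtoC_le -norm_RtoC RtoC0. Qed.
Hint Resolve nrm_ge0 : core.
Lemma nrm0 : nrm (0 : V) = 0.
Proof. by rewrite /nrm normr0. Qed.
Lemma nrm_eq0 v : nrm v = 0 -> v = 0.
Proof. by move=> h; apply/normr0_eq0; rewrite norm_RtoC h. Qed.
Lemma nrm_gt0 v : (0 < nrm v) = (v != 0).
Proof.
rewrite lt_def nrm_ge0 andbT; congr negb; apply/eqP/eqP => [|->].
  exact: nrm_eq0.
exact: nrm0.
Qed.
Lemma nrmD v w : nrm (v + w) <= nrm v + nrm w.
Proof. by rewrite -RtoC_le RtoCD -!norm_RtoC ler_normD. Qed.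
Lemma nrmD_le v w c c' : nrm v <= c -> nrm w <= c' -> nrm (v + w) <= c + c'.
Proof. by move=> h1 h2; apply: le_trans (nrmD _ _) (lerD h1 h2). Qed.
Lemma nrmN v : nrm (- v) = nrm v.
Proof. by rewrite /nrm normrN. Qed.
Lemma nrmB v w : nrm (v - w) <= nrm v + nrm w.
Proof. by rewrite -(nrmN w) nrmD. Qed.
Lemma nrmB_le v w c c' : nrm v <= c -> nrm w <= c' -> nrm (v - w) <= c + c'.
Proof. by move=> h1 h2; apply: le_trans (nrmB _ _) (lerD h1 h2). Qed.
Lemma nrmBC v w : nrm (v - w) = nrm (w - v).
Proof. by rewrite -nrmN opprB. Qed.
Lemma nrm_tri u v w : nrm (v - w) <= nrm (v - u) + nrm (u - w).
Proof. by have := nrmD (v - u) (u - w); rewrite addrA subrK. Qed.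
Lemma nrm_shift v w : nrm v <= nrm w + nrm (v - w).
Proof. by have := nrmD w (v - w); rewrite addrC subrK. Qed.
Lemma nrmZ (k : C) v : nrm (k *: v) = nrm k * nrm v.
Proof.
have : `|k *: v| = `|k| * `|v| by rewrite normrZ.
by rewrite !norm_RtoC -RtoCM => -[].
Qed.
Lemma nrm_sum (I : Type) (r : seq I) (P : pred I) (F : I -> V) :
  nrm (\sum_(i <- r | P i) F i) <= \sum_(i <- r | P i) nrm (F i).
Proof.
elim/big_ind2: _ => [|x1 x2 y1 y2 h1 h2|//]; first by rewrite nrm0.
by apply: (le_trans (nrmD _ _)); apply: lerD.
Qed.

Lemma nrm_nbhs (x : V) (P : set V) : nbhs x P <->
  exists2 e : R, 0 < e & forall y, nrm (y - x) < e -> P y.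
Proof.
split.
  move/nbhs_normP => [e /= e0 h]; have [eE re0] := posC e0.
  exists (complex.Re e) => // y hy; apply: h => /=.
  by rewrite eE norm_RtoC RtoC_lt nrmBC.
move=> [e e0 h]; apply/nbhs_normP; exists (RtoC e) => /=.
  by rewrite -RtoC0 RtoC_lt.
by move=> y /=; rewrite norm_RtoC RtoC_lt nrmBC; apply: h.
Qed.

End V.

Lemma nrmM (x y : C) : nrm (x * y) = nrm x * nrm y.
Proof. by have := nrmZ x (y : C^o). Qed.
Lemma nrm1 : nrm (1 : C) = 1.
Proof. by rewrite /nrm normr1. Qed.
Lemma nrmV (x : C) : nrm x^-1 = (nrm x)^-1.
Proof.
have : `|x^-1| = `|x|^-1 by rewrite normfV.
by rewrite !norm_RtoC -RtoCV => -[].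
Qed.
Lemma nrmE (x : C) : nrm x = Num.sqrt (complex.Re x ^+ 2 + complex.Im x ^+ 2).
Proof. by rewrite /nrm normc_def. Qed.
Lemma nrm_RtoC x : nrm (RtoC x) = `|x|.
Proof. by rewrite nrmE /= expr0n addr0 sqrtr_sqr. Qed.
Lemma sqrt_mono (a b : R) : a <= b -> Num.sqrt a <= Num.sqrt b.
Proof. by move=> ab; apply: ler_wsqrtr. Qed.
Lemma Re_le (x : C) : `|complex.Re x| <= nrm x.
Proof.
have h : complex.Re x ^+ 2 <= complex.Re x ^+ 2 + complex.Im x ^+ 2 by rewrite lerDl sqr_ge0.
by rewrite nrmE -sqrtr_sqr (sqrt_mono h).
Qed.
Lemma Im_le (x : C) : `|complex.Im x| <= nrm x.
Proof.
have h : complex.Im x ^+ 2 <= complex.Re x ^+ 2 + complex.Im x ^+ 2 by rewrite lerDr sqr_ge0.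
by rewrite nrmE -sqrtr_sqr (sqrt_mono h).
Qed.
Lemma nrm_le_ReIm (x : C) : nrm x <= `|complex.Re x| + `|complex.Im x|.
Proof.
have h : complex.Re x ^+ 2 + complex.Im x ^+ 2 <= (`|complex.Re x| + `|complex.Im x|) ^+ 2.
  by rewrite sqrrD !real_normK ?num_real// addrAC lerDl pmulrn_lge0// mulr_ge0.
by rewrite nrmE (le_trans (sqrt_mono h))// sqrtr_sqr ger0_norm// addr_ge0.
Qed.

Lemma mx_nrm_le (m n : nat) (A : 'M[C]_(m, n)) (c : R) : 0 <= c ->
  (nrm A <= c) <-> (forall i j, nrm (A i j) <= c).
Proof.
move=> c0.
have c0' : 0 <= RtoC c by rewrite -RtoC0 RtoC_le.
rewrite -RtoC_le -norm_RtoC [`|A|]/Num.norm /= mx_normE.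
have -> : (RtoC c : C) = (NngNum c0')%:num by [].
rewrite num_le; split.
  move/bigmax_leP => [_ h] i j.
  by have := h (i, j) isT; rewrite -num_le /= norm_RtoC RtoC_le.
move=> h; apply/bigmax_leP; split; first by rewrite -num_le /=.
by move=> [i j] _; rewrite -num_le /= norm_RtoC RtoC_le.
Qed.
Lemma mx_nrm_coord (m n : nat) (A : 'M[C]_(m, n)) i j : nrm (A i j) <= nrm A.
Proof. exact: (mx_nrm_le A (nrm_ge0 A)).1. Qed.

Lemma differentiable_nrm (V W : normedModType C) (f : V -> W) x :
  differentiable f x -> forall e, 0 < e -> exists2 d, 0 < d & forall h,
    nrm h < d -> nrm (f (x + h) - f x - 'd f x h) <= e * nrm h.
Proof.
move=> /diff_locallyP[_ /eqaddoP h] e e0.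
have := h (RtoC e); rewrite -RtoC0 RtoC_lt => /(_ e0)/nrm_nbhs[d d0 H].
exists d => // y yd; have := H y; rewrite subr0 => /(_ yd).
by rewrite !norm_RtoC -RtoCM RtoC_le (addrC x) -addrA -opprD.
Qed.

(** The bound [M] supplies the continuity of [A], which Frechet differentiability demands besides
    the remainder estimate and which is not automatic for a linear map between arbitrary normed
    modules. *)
Lemma nrm_differentiable (V W : normedModType C) (f : V -> W) x
  (A : {linear V -> W}) (M : R) :
  (forall v, nrm (A v) <= M * nrm v) ->
  (forall e, 0 < e -> exists2 d, 0 < d & forall h,
    nrm h < d -> nrm (f (x + h) - f x - A h) <= e * nrm h) ->
  differentiable f x /\ 'd f x = A :> (V -> W).
Proof.
move=> AM H.
have cA : continuous A.
  move=> v; apply/cvgrPdist_lt => e /posC[-> e0].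
  apply/nrm_nbhs; exists (complex.Re e / (1 + `|M|)); first by rewrite divr_gt0// ltr_pwDl.
  move=> y yv; rewrite norm_RtoC RtoC_lt -raddfB; apply: (le_lt_trans (AM _)).
  have : M * nrm (v - y) <= (1 + `|M|) * nrm (v - y).
    by rewrite ler_wpM2r// ?nrm_ge0// (le_trans (ler_norm _))// lerDr.
  move/le_lt_trans; apply; by rewrite mulrC -ltr_pdivlMr ?ltr_pwDl// nrmBC.
have E : f \o shift x = cst (f x) + A +o_ (0 : V) id.
  apply/eqaddoP => e /posC[-> e0]; have [d d0 h] := H _ e0.
  apply/nrm_nbhs; exists d => // y; rewrite subr0 => yd.
  have := h _ yd; by rewrite !norm_RtoC -RtoCM RtoC_le (addrC x) -addrA -opprD.
have dE := diff_unique cA E; split => //.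
by apply/diff_locallyP; rewrite dE.
Qed.

End NormBasics.
#[global] Hint Extern 0 (is_true (0 <= nrm _)) => exact: nrm_ge0 : core.

(** * The Cauchy estimate *)

Section CauchyEstimate.
Variable R : realType.
Local Notation C := (Cplx R).
Local Notation Re := complex.Re.
Local Notation Im := complex.Im.

(** Vertical sides become horizontal ones after exchanging the coordinates; the factor [iC] of [dz]
    on a vertical side is restored in [perim]. *)
Definition swapC (z : C) : C := Complex (Im z) (Re z).
Definition iC : C := Complex 0 1.

(* Left Riemann sums of [k dz] over [3 ^ n] equal pieces of a horizontal segment
   of length [l] starting at [Complex x y]. Cutting into thirds is exact
   ([perimS]), so Cauchy's theorem is proved on these sums without integrals. *)
Fixpoint hsum (k : C -> C) (n : nat) (x y l : R) : C :=
  if n is n'.+1 then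
    hsum k n' x y (l / 3) + hsum k n' (x + l / 3) y (l / 3)
    + hsum k n' (x + l / 3 + l / 3) y (l / 3)
  else RtoC l * k (Complex x y).

Definition vsum (k : C -> C) n x y l := hsum (k \o swapC) n y x l.

(* Around the square of side [l] with lower left corner [Complex x y]. *)
Definition perim (k : C -> C) n x y l :=
  hsum k n x y l + iC * vsum k n (x + l) y l
  - hsum k n x (y + l) l - iC * vsum k n x y l.

Lemma third (u : R) : (u + u + u) / 3 = u.
Proof. by field. Qed.

Lemma hsumS k n x y u : hsum k n.+1 x y (u + u + u) =
  hsum k n x y u + hsum k n (x + u) y u + hsum k n (x + u + u) y u.
Proof. by rewrite /= third. Qed.

(** Neighbouring small squares sample their common side at the same points, so the interior sides
    cancel exactly at every level. The central square is kept apart because it is the one that may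
    contain a singularity. *)
Lemma perimS k n x y u : perim k n.+1 x y (u + u + u) =
  perim k n (x + u) (y + u) u +
  (perim k n x y u + perim k n (x + u) y u + perim k n (x + u + u) y u
  + perim k n x (y + u) u + perim k n (x + u + u) (y + u) u
  + perim k n x (y + u + u) u + perim k n (x + u) (y + u + u) u
  + perim k n (x + u + u) (y + u + u) u).
Proof. rewrite /perim /vsum !hsumS !addrA; ring. Qed.

Lemma hsumD k1 k2 n x y l :
  hsum (fun z => k1 z + k2 z) n x y l = hsum k1 n x y l + hsum k2 n x y l.
Proof. by elim: n x y l => [|n IH] x y l /=; rewrite ?mulrDr// !IH; ring. Qed.

Lemma hsumZ a k n x y l : hsum (fun z => a * k z) n x y l = a * hsum k n x y l.
Proof. by elim: n x y l => [|n IH] x y l /=; rewrite ?IH; ring. Qed.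

Lemma perimD k1 k2 n x y l :
  perim (fun z => k1 z + k2 z) n x y l = perim k1 n x y l + perim k2 n x y l.
Proof.
have E n' x' y' l' : hsum ((fun z => k1 z + k2 z) \o swapC) n' x' y' l' = _ :=
  hsumD (k1 \o swapC) (k2 \o swapC) n' x' y' l'.
by rewrite /perim /vsum !E !hsumD; ring.
Qed.

Lemma perimZ a k n x y l : perim (fun z => a * k z) n x y l = a * perim k n x y l.
Proof.
have E n' x' y' l' : hsum ((fun z => a * k z) \o swapC) n' x' y' l' = _ :=
  hsumZ a (k \o swapC) n' x' y' l'.
by rewrite /perim /vsum !E !hsumZ; ring.
Qed.

(* The left-endpoint error on an affine function; it cancels around a square. *)
Fixpoint cc (n : nat) : R := if n is n'.+1 then (cc n' + 1) / 3 else 0.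

Lemma hsum_affine (k : C -> C) (b : C) n x y l :
  (forall x y h, k (Complex (x + h) y) = k (Complex x y) + RtoC h * b) ->
  hsum k n x y l = RtoC l * k (Complex x y) + RtoC (cc n * l ^+ 2) * b.
Proof.
move=> hk; elim: n x y l => [|n IH] x y l /=; first by rewrite mul0r mul0r addr0.
rewrite !IH !hk; apply: Cplx_eq; rewrite !ReImE /=; by field.
Qed.

Lemma perim_affine a b n x y l : perim (fun z => a + b * z) n x y l = 0.
Proof.
have E1 : forall x y h, a + b * Complex (x + h) y = a + b * Complex x y + RtoC h * b.
  by move=> *; apply: Cplx_eq; rewrite !ReImE /=; ring.
have E2 : forall x y h, ((fun z => a + b * z) \o swapC) (Complex (x + h) y) =
   ((fun z => a + b * z) \o swapC) (Complex x y) + RtoC h * (iC * b).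
  by move=> *; apply: Cplx_eq; rewrite !ReImE /=; ring.
rewrite /perim /vsum !(@hsum_affine (fun z => a + b * z) b _ _ _ _ E1) !(@hsum_affine _ (iC * b) _ _ _ _ E2) /=.
by apply: Cplx_eq; rewrite !ReImE /=; ring.
Qed.

Lemma hsum_bound k n x y l M : 0 <= l ->
  (forall t, x <= t <= x + l -> nrm (k (Complex t y)) <= M) ->
  nrm (hsum k n x y l) <= l * M.
Proof.
elim: n x y l => [|n IH] x y l l0 h /=.
  by rewrite nrmM nrm_RtoC ger0_norm// ler_wpM2l// h// lexx lerDl.
have l3 : 0 <= l / 3 by rewrite divr_ge0.
rewrite (le_trans (nrmD _ _))// (le_trans (lerD (nrmD _ _) (lexx _)))//.
have -> : l * M = l / 3 * M + l / 3 * M + l / 3 * M by field.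
by apply: lerD; [apply: lerD|]; apply: IH => // t /andP[t1 t2]; apply: h; lra.
Qed.

Definition bdry (x y l : R) (z : C) : Prop :=
  [/\ x <= Re z <= x + l, y <= Im z <= y + l &
    [\/ Re z = x, Re z = x + l, Im z = y | Im z = y + l]].

Lemma perim_bound k n x y l M : 0 <= l ->
  (forall z, bdry x y l z -> nrm (k z) <= M) ->
  nrm (perim k n x y l) <= 4 * (l * M).
Proof.
move=> l0 h; rewrite /perim.
have i1 : nrm iC = 1 by rewrite nrmE /= expr0n expr1n add0r sqrtr1.
have H1 : nrm (hsum k n x y l) <= l * M.
  by apply: hsum_bound => // t ht; apply: h; split => //=; [lra|constructor 3].
have H2 : nrm (hsum k n x (y + l) l) <= l * M.
  by apply: hsum_bound => // t ht; apply: h; split => //=; [lra|constructor 4].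
have H3 : nrm (iC * vsum k n (x + l) y l) <= l * M.
  rewrite nrmM i1 mul1r; apply: hsum_bound => // t ht; apply: h; split => //=; first lra.
  by constructor 2.
have H4 : nrm (iC * vsum k n x y l) <= l * M.
  rewrite nrmM i1 mul1r; apply: hsum_bound => // t ht; apply: h; split => //=; first lra.
  by constructor 1.
rewrite (le_trans (nrmB _ _))// (le_trans (lerD (nrmB _ _) (lexx _)))//.
rewrite (le_trans (lerD (lerD (nrmD _ _) (lexx _)) (lexx _)))//; lra.
Qed.

(** Meant for the sums of [1 / (z - c)], which have to stay away from zero. *)
Lemma hsum_Im_ge (al : C) k n x y l m : 0 <= l ->
  (forall t, x <= t <= x + l -> m <= Im (al * k (Complex t y))) ->
  l * m <= Im (al * hsum k n x y l).
Proof.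
elim: n x y l => [|n IH] x y l l0 h /=.
  have -> : Im (al * (RtoC l * k (Complex x y))) = l * Im (al * k (Complex x y)).
    by rewrite !ReImE /=; ring.
  by rewrite ler_wpM2l// h// lexx lerDl.
have l3 : 0 <= l / 3 by rewrite divr_ge0.
rewrite !mulrDr !CImD.
have -> : l * m = l / 3 * m + l / 3 * m + l / 3 * m by field.
by apply: lerD; [apply: lerD|]; apply: IH => // t /andP[t1 t2]; apply: h; lra.
Qed.

Lemma nested_point (a l : nat -> R) : (forall m, 0 <= l m) ->
  (forall m, a m <= a m.+1 /\ a m.+1 + l m.+1 <= a m + l m) ->
  exists c, forall m, a m <= c <= a m + l m.
Proof.
move=> l0 h.
have mono m n : (m <= n)%N -> a m <= a n /\ a n + l n <= a m + l m.
  elim: n => [|n IH]; first by rewrite leqn0 => /eqP->.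
  rewrite leq_eqVlt => /orP[/eqP->//|]; rewrite ltnS => /IH[h1 h2].
  by have [h3 h4] := h n; split; [apply: le_trans h3|apply: le_trans h2].
have ub n m : a n <= a m + l m.
  have [/mono[h1 h2]|/ltnW/mono[h1 h2]] := leqP n m.
    by rewrite (le_trans h1)// lerDl.
  by rewrite (le_trans _ h2)// lerDl.
exists (sup (range a)) => m; apply/andP; split.
  by apply: ub_le_sup; [exists (a 0 + l 0) => _ [n _ <-]|exists m].
by apply: ge_sup; [exists (a 0), 0%N|move=> _ [n _ <-]].
Qed.

Definition insq (x y l : R) (z : C) : Prop :=
  x <= Re z <= x + l /\ y <= Im z <= y + l.

Lemma insq_dist x y l z z' : insq x y l z -> insq x y l z' -> nrm (z' - z) <= 2 * l.
Proof.
move=> [z1 z2] [z3 z4]; rewrite (le_trans (nrm_le_ReIm _))// !ReImE.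
suff : `|Re z' - Re z| <= l /\ `|Im z' - Im z| <= l by lra.
by split; rewrite ler_norml; lra.
Qed.

Lemma diffC1 (k : C -> C) z h : 'd k z h = 'd k z 1 * h.
Proof.
have -> : 'd k z h = 'd k z (h *: (1 : C^o)) by rewrite /GRing.scale /= mulr1.
by rewrite linearZ mulrC.
Qed.

Lemma exists_pow3 (d : R) : 0 < d -> exists m : nat, 3^-m < d.
Proof.
move=> d0; exists (Num.truncn d^-1).+1.
have h : d^-1 < (Num.truncn d^-1).+1%:R by rewrite truncnS_gt.
rewrite invf_plt ?posrE ?exprn_gt0//; apply: lt_le_trans h _.
by rewrite -natrX ler_nat ltnW// ltn_expl.
Qed.

Lemma nearS (P : nat -> Prop) :
  (\forall n \near \oo, P n.+1) -> \forall n \near \oo, P n.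
Proof. by move=> [N _ h]; exists N.+1 => // -[//|n] /= ; apply: h. Qed.

(** The disjunction says that the small square has a side on the boundary of the large one, as the
    eight outer squares do; nothing is asked of the central one. *)
Lemma near9 (k : C -> C) x y u e :
  (forall a b, x <= a -> a + u <= x + (u + u + u) -> y <= b ->
     b + u <= y + (u + u + u) -> [|| a == x, a == x + u + u, b == y | b == y + u + u] ->
     \forall n \near \oo, nrm (perim k n a b u) <= e) -> 0 < u ->
  \forall n \near \oo, nrm (perim k n.+1 x y (u + u + u) -
     perim k n (x + u) (y + u) u) <= 8 * e.
Proof.
move=> H u0.
near=> n.
rewrite perimS addrAC subrr add0r.
have -> : 8 * e = e + e + e + e + e + e + e + e by ring.
do 7 (apply: nrmD_le; last by near: n; apply: H; rewrite ?eqxx ?orbT //; lra).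
by near: n; apply: H; rewrite ?eqxx ?orbT //; lra.
Unshelve. all: by end_near. Qed.

(** Goursat's argument. The sums converge only as [n] grows, so a square is called bad when its sums
    are not eventually small relative to its area. A bad square has a bad ninth; the nested bad
    squares shrink to a point, and differentiability there contradicts badness, since affine
    functions contribute nothing. *)
Lemma goursat k x y l : 0 < l ->
  (forall z, insq x y l z -> differentiable k z) ->
  forall eta, 0 < eta -> \forall n \near \oo, nrm (perim k n x y l) <= eta.
Proof.
move=> l0 dk eta eta0; apply: contrapT => bad0.
pose bad (p : R * R) m := ~ \forall n \near \oo,
  nrm (perim k n p.1 p.2 (l / 3 ^+ m)) <= eta / 9 ^+ m.
pose nest (p q : R * R) m := [/\ p.1 <= q.1,
  q.1 + l / 3 ^+ m.+1 <= p.1 + l / 3 ^+ m, p.2 <= q.2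
  & q.2 + l / 3 ^+ m.+1 <= p.2 + l / 3 ^+ m].
have lm0 m : 0 < l / 3 ^+ m by rewrite divr_gt0// exprn_gt0.
(* The implication stands under the existential so that [choice] yields a total selection
   function. *)
have step (mp : nat * (R * R)) : exists q, bad mp.2 mp.1 ->
    nest mp.2 q mp.1 /\ bad q mp.1.+1.
  case: mp => m [a b] /=.
  set u := l / 3 ^+ m.+1; have u0 : 0 < u := lm0 _.
  have lE : l / 3 ^+ m = u + u + u.
    by rewrite /u exprS; field; rewrite expf_neq0.
  have [B|] := pselect (bad (a, b) m); last by exists (a, b).
  apply: contrapT => /forallNP nq; apply: B => /=.
  have H a' b' : a <= a' -> a' + u <= a + (u + u + u) -> b <= b' ->
     b' + u <= b + (u + u + u) ->
     \forall n \near \oo, nrm (perim k n a' b' u) <= eta / 9 ^+ m.+1.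
    move=> h1 h2 h3 h4; apply: contrapT => B; apply: (nq (a', b')) => _.
    by split => //; rewrite /nest /= -/u lE.
  have H9 := @near9 k a b u _ (fun a' b' h1 h2 h3 h4 _ => H a' b' h1 h2 h3 h4) u0.
  have Hc := H (a + u) (b + u); rewrite lE; apply: nearS; near=> n.
  rewrite (le_trans (nrm_shift _ (perim k n (a + u) (b + u) u)))//.
  have -> : eta / 9 ^+ m = eta / 9 ^+ m.+1 + 8 * (eta / 9 ^+ m.+1).
    by rewrite exprS; field; rewrite expf_neq0.
  apply: lerD; near: n => //; apply: Hc; lra.
have [F hF] := choice step.
pose fix s m := if m is m'.+1 then F (m', s m') else (x, y).
have sbad m : bad (s m) m.
  elim: m => [|m IH]; first by rewrite /bad /= !expr0 !divr1.
  by have [] := hF (m, s m) IH.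
have snest m : nest (s m) (s m.+1) m by have [] := hF (m, s m) (sbad m).
have [x' hx'] : exists c, forall m, (s m).1 <= c <= (s m).1 + l / 3 ^+ m.
  by apply: nested_point => m; [exact: ltW|have [] := snest m].
have [y' hy'] : exists c, forall m, (s m).2 <= c <= (s m).2 + l / 3 ^+ m.
  by apply: nested_point => m; [exact: ltW|have [] := snest m].
pose z' : C := Complex x' y'.
have insq' m : insq (s m).1 (s m).2 (l / 3 ^+ m) z' by [].
(* A square of side [lm] has perimeter [4 * lm] and all its points within [2 * lm] of [z']; with the
   factor 16 the total is half of [eta / 9 ^+ m]. *)
have /dk/differentiable_nrm/(_ (eta / (16 * l ^+ 2))) : insq x y l z'.
  by have := insq' 0%N; rewrite expr0 divr1.
have e0 : 0 < eta / (16 * l ^+ 2) by rewrite divr_gt0// mulr_gt0// exprn_gt0.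
move=> /(_ e0)[d d0 hd].
have [m hm] : exists m, 3 ^- m < d / (2 * l).
  by apply: exists_pow3; rewrite divr_gt0// mulr_gt0.
apply: (sbad m); near=> n; set x0 := (s m).1; set y0 := (s m).2.
set lm := l / 3 ^+ m.
set D := 'd k z' 1 : C.
pose rest z : C := k z - k z' - D * (z - z').
have -> : k = (fun z => ((k z' - D * z') + D * z) + rest z).
  by apply/funext => z; rewrite /rest; ring.
rewrite perimD perim_affine add0r.
have lm20 : lm ^+ 2 = l ^+ 2 / 9 ^+ m.
  by rewrite /lm expr_div_n -exprM mulnC exprM; congr (_ / _ ^+ _); ring.
apply: (@le_trans _ _ (4 * (lm * (eta / (16 * l ^+ 2) * (2 * lm))))).
  apply: perim_bound; first exact: ltW (lm0 m).
  move=> z [z1 z2 _].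
  have zz : nrm (z - z') <= 2 * lm by apply: insq_dist (insq' m) _.
  have zd : nrm (z - z') < d.
    apply: le_lt_trans zz _; move: hm; rewrite ltr_pdivlMr ?mulr_gt0//.
    by have -> : 2 * lm = 3 ^- m * (2 * l) by rewrite /lm; ring.
  rewrite /rest; have := hd _ zd.
  rewrite diffC1 -/D (addrC z') subrK => h.
  by apply: le_trans h _; rewrite ler_pM2l.
have -> : 4 * (lm * (eta / (16 * l ^+ 2) * (2 * lm))) = lm ^+ 2 * eta / (2 * l ^+ 2).
  by field; rewrite gt_eqF.
rewrite lm20.
have -> : l ^+ 2 / 9 ^+ m * eta / (2 * l ^+ 2) = (eta / 9 ^+ m) / 2.
  by field; rewrite ?expf_neq0 ?gt_eqF.
have : 0 < eta / 9 ^+ m by rewrite divr_gt0// exprn_gt0.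
lra.
Unshelve. all: by end_near. Qed.

Section Center.
Variables (k : C -> C) (c : C).
Local Notation qperim n r := (perim k n (Re c - r) (Im c - r) (2 * r)).

(** The eight outer squares avoid [c], so their sums become small although [k] may be singular at
    [c]. *)
Lemma perim_center r e : 0 < r -> 0 < e ->
  (forall z, insq (Re c - r) (Im c - r) (2 * r) z -> z <> c ->
    differentiable k z) ->
  \forall n \near \oo, nrm (qperim n.+1 r - qperim n (r / 3)) <= e.
Proof.
move=> r0 e0 dk.
set x := Re c - r; set y := Im c - r; set u := 2 * (r / 3).
have u0 : 0 < u by rewrite /u; lra.
have -> : 2 * r = u + u + u by rewrite /u; field.
have -> : Re c - r / 3 = x + u by rewrite /x /u; field.
have -> : Im c - r / 3 = y + u by rewrite /y /u; field.
have -> : e = 8 * (e / 8) by field.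
apply: near9 => // a b h1 h2 h3 h4 h5.
apply: goursat => //; last by rewrite divr_gt0.
move=> z [z1 z2]; apply: dk.
  by split; move: h1 h2 h3 h4 z1 z2; rewrite /x /y /u => ? ? ? ? /andP[? ?] /andP[? ?]; lra.
move=> zc; move: z1 z2; rewrite zc => /andP[w1 w2] /andP[w3 w4].
by move: h5 => /or4P[] /eqP h5; move: h5 h1 h2 h3 h4 w1 w2 w3 w4; rewrite /x /y /u; lra.
Qed.

(** Each passage to the central ninth uses up one level of subdivision, whence [n + m] against
    [n]. *)
Lemma perim_centerX r : 0 < r ->
  (forall z, insq (Re c - r) (Im c - r) (2 * r) z -> z <> c ->
    differentiable k z) -> forall m e, 0 < e ->
  \forall n \near \oo, nrm (qperim (n + m) r - qperim n (r / 3 ^+ m)) <= e.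
Proof.
move=> r0 dk; elim=> [|m IH] e e0.
  by near=> n; rewrite addn0 expr0 divr1 subrr nrm0 ltW.
have e2 : 0 < e / 2 by rewrite divr_gt0.
have [N _ hN] := IH _ e2.
have q0 : 0 < r / 3 ^+ m by rewrite divr_gt0// exprn_gt0.
have qr : r / 3 ^+ m <= r.
  have h3 : 1 <= 3 ^+ m :> R by rewrite exprn_ege1// ler1n.
  by rewrite ler_pdivrMr ?exprn_gt0// ler_peMr// ltW.
have [|M _ hM] := @perim_center (r / 3 ^+ m) _ q0 e2.
  by move=> z [z1 z2]; apply: dk; split; lra.
near=> n.
have -> : r / 3 ^+ m.+1 = r / 3 ^+ m / 3.
  by rewrite exprSr invfM mulrA.
have -> : e = e / 2 + e / 2 by field.
apply: le_trans (nrm_tri (qperim n.+1 (r / 3 ^+ m)) _ _) (lerD _ _).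
  rewrite addnS -addSn; apply: hN => /=.
  by rewrite ltnW// ltnS; near: n; exists N.
by apply: hM => /=; near: n; exists M.
Unshelve. all: by end_near. Qed.

End Center.

(** On a side travelled in the direction [al], the imaginary part of [al / (z - c)] is
    [r / |z - c| ^ 2], hence at least [1 / (2 r)]; so each of the four sides, of length [2 r],
    contributes at least 1 at every level. The exact integral has modulus [2 pi]. *)
Lemma perim_inv_ge (c : C) n r : 0 < r ->
  4 <= nrm (perim (fun z => (z - c)^-1) n (Re c - r) (Im c - r) (2 * r)).
Proof.
move=> r0; rewrite (le_trans _ (le_trans (ler_norm _) (Im_le _)))//.
have H a b (al : C) : a ^+ 2 <= r ^+ 2 -> b ^+ 2 <= r ^+ 2 -> r ^+ 2 <= a ^+ 2 + b ^+ 2 ->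
    Im al * a - Re al * b = r ->
    (2 * r)^-1 <= Im (al * (Complex (Re c + a) (Im c + b) - c)^-1).
  move=> ha hb hab hal.
  have -> : Complex (Re c + a) (Im c + b) - c = Complex a b.
    by apply: Cplx_eq; rewrite !ReImE /=; ring.
  have ab0 : 0 < a ^+ 2 + b ^+ 2 by rewrite (lt_le_trans _ hab)// exprn_gt0.
  have -> : (Complex a b)^-1 = Complex (a / (a ^+ 2 + b ^+ 2)) (- b / (a ^+ 2 + b ^+ 2)) :> C.
    by apply: Cplx_eq => //=; rewrite mulNr.
  rewrite CImM /=.
  have -> : Re al * (- b / (a ^+ 2 + b ^+ 2)) + Im al * (a / (a ^+ 2 + b ^+ 2)) =
    r / (a ^+ 2 + b ^+ 2) by rewrite -hal; ring.
  rewrite ler_pdivlMr// mulrC ler_pdivrMr ?mulr_gt0//.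
  by apply: le_trans (lerD ha hb) _; rewrite expr2; lra.
have sq_le a b : `|a| <= b -> a ^+ 2 <= b ^+ 2 :> R.
  by move=> ab; rewrite -[leLHS]real_normK ?num_real// lerXn2r ?nnegrE// (le_trans _ ab).
have S (x t : R) : x - r <= t <= x - r + 2 * r -> (t - x) ^+ 2 <= r ^+ 2.
  by move=> /andP[? ?]; apply: sq_le; rewrite ler_norml; lra.
have T (x t : R) : x + (t - x) = t by ring.
have E1 : 1 = 2 * r * (2 * r)^-1 by field; rewrite gt_eqF.
have i0 : 0 <= 2 * r by lra.
have P (al : C) (g : C -> C) (x y : R) : (forall t, x <= t <= x + 2 * r ->
     (2 * r)^-1 <= Im (al * g (Complex t y))) -> 1 <= Im (al * hsum g n x y (2 * r)).
  by move=> h; rewrite [leLHS]E1; apply: hsum_Im_ge.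
have H1 : 1 <= Im (1 * hsum (fun z => (z - c)^-1) n (Re c - r) (Im c - r) (2 * r)).
  apply: P => t ht; rewrite -(T (Re c) t) -(T (Im c) (Im c - r)).
  by apply: H; rewrite ?(S _ _ ht) //= ?(addrC (Im c)) ?addrK ?sqrrN ?lerDr ?sqr_ge0//; ring.
have H2 : 1 <= Im (iC * vsum (fun z => (z - c)^-1) n (Re c - r + 2 * r) (Im c - r) (2 * r)).
  apply: P => t ht /=; rewrite -(T (Im c) t).
  have -> : Re c - r + 2 * r = Re c + r by ring.
  by apply: H; rewrite ?(S _ _ ht) ?lerDl ?sqr_ge0//=; ring.
have H3 : 1 <= Im (-1 * hsum (fun z => (z - c)^-1) n (Re c - r) (Im c - r + 2 * r) (2 * r)).
  apply: P => t ht /=; rewrite -(T (Re c) t).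
  have -> : Im c - r + 2 * r = Im c + r by ring.
  by apply: H; rewrite ?(S _ _ ht) ?lerDr ?sqr_ge0//=; ring.
have H4 : 1 <= Im (- iC * vsum (fun z => (z - c)^-1) n (Re c - r) (Im c - r) (2 * r)).
  apply: P => t ht /=; rewrite -(T (Im c) t).
  by apply: H; rewrite ?(S _ _ ht) ?sqrrN ?lerDl ?sqr_ge0//=; ring.
move: H1 H2 H3 H4; rewrite /perim mul1r mulN1r mulNr !CImD; lra.
Qed.

Lemma le_of_forall_eps (a b : R) : (forall e, 0 < e -> a <= b + e) -> a <= b.
Proof. by move=> h; apply/ler_addgt0Pr. Qed.

Lemma diffC_sub (c z : C) : differentiable (fun w : C => w - c) z.
Proof.
have -> : (fun w : C => w - c) = (id : C -> C) - (cst c : C -> C) by [].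
apply: differentiableB.
- by [].
- exact: differentiable_cst.
Qed.
Lemma diffC_subV (c z : C) : z <> c -> differentiable (fun w : C => (w - c)^-1) z.
Proof.
move=> zc.
have -> : (fun w : C => (w - c)^-1) = (fun w : C => w^-1) \o (fun w : C => w - c) by [].
apply: differentiable_comp; first exact: diffC_sub.
apply: differentiable_Rinv.
by apply/eqP => /subr0_eq.
Qed.

(* Near [c] the function [(f z - f c) / (z - c) ^ 2] is [f' c / (z - c)] up to
   [o(1 / |z - c|)]: its sums around a large and a small square centred at [c]
   agree, and those of [1 / (z - c)] are bounded below. *)
Lemma cauchy_estimate (f : C -> C) (c : C) r M : 0 < r ->
  (forall z, insq (Re c - r) (Im c - r) (2 * r) z ->
    differentiable f z /\ nrm (f z) <= M) ->
  nrm ('d f c 1 : C) <= 4 * M / r.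
Proof.
move=> r0 hf; set D := 'd f c 1 : C.
have cin : insq (Re c - r) (Im c - r) (2 * r) c by split; lra.
have [dfc fcM] := hf _ cin.
have M0 : 0 <= M := le_trans (nrm_ge0 _) fcM.
pose k z : C := (f z - f c) * ((z - c)^-1 * (z - c)^-1).
have dk z : insq (Re c - r) (Im c - r) (2 * r) z -> z <> c -> differentiable k z.
  move=> /hf[dfz _] zc; have dV := @diffC_subV c z zc.
  have -> : k = (f - cst (f c)) * ((fun w : C => (w - c)^-1) * (fun w : C => (w - c)^-1)) by [].
  apply: differentiableM; last exact: (differentiableM dV dV).
  by apply: (differentiableB dfz); exact: differentiable_cst.
apply: le_of_forall_eps => e e0.
have [d d0 hd] := differentiable_nrm dfc (divr_gt0 e0 (ltr0n R 4)).
(* The small square, of half side [q], has to lie where the first-order expansion of [f] at [c] is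
   valid. *)
have [m hm] : exists m, 3 ^- m < d / (2 * r).
  by apply: exists_pow3; rewrite divr_gt0// mulr_gt0.
set q := r / 3 ^+ m.
have q0 : 0 < q by rewrite divr_gt0// exprn_gt0.
have qd : 2 * q < d.
  move: hm; rewrite ltr_pdivlMr ?mulr_gt0//.
  by have -> : 2 * q = 3 ^- m * (2 * r) by rewrite /q; ring.
have [N _ hN] := @perim_centerX k c r r0 dk m _ e0.
have {}hN := hN N (leqnn N); rewrite /= -/q in hN.
have bq z rho : bdry (Re c - rho) (Im c - rho) (2 * rho) z -> rho <= nrm (z - c).
  move=> [_ _ h].
  have := Re_le (z - c); have := Im_le (z - c); rewrite !ReImE !ler_norml.
  move=> /andP[? ?] /andP[? ?].
  by case: h => h; lra.
have zc_neq0 z rho : 0 < rho -> rho <= nrm (z - c) -> z - c != 0.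
  by move=> ? ?; rewrite -nrm_gt0; lra.
have big : nrm (perim k (N + m) (Re c - r) (Im c - r) (2 * r)) <= 16 * M / r.
  have -> : 16 * M / r = 4 * ((2 * r) * ((M + M) * (r^-1 * r^-1))).
    by field; rewrite gt_eqF.
  apply: perim_bound; first by rewrite mulr_ge0// ltW.
  move=> z zb; have zr := bq _ _ zb; case: zb => z1 z2 _.
  rewrite /k nrmM; apply: ler_pM => //.
    by apply: nrmB_le => //; have [] := hf z.
  have zV : nrm (z - c)^-1 <= r^-1 by rewrite nrmV lef_pV2 ?posrE//; lra.
  by rewrite nrmM; apply: ler_pM.
pose rest z : C := k z - D * (z - c)^-1.
have small : nrm (perim rest N (Re c - q) (Im c - q) (2 * q)) <= 2 * e.
  have -> : 2 * e = 4 * ((2 * q) * (e / 4 * q^-1)).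
    by field; rewrite gt_eqF.
  apply: perim_bound; first by rewrite mulr_ge0// ltW.
  move=> z zb; have zr := bq _ _ zb; have zc0 := zc_neq0 _ _ q0 zr.
  have zd : nrm (z - c) < d.
    case: zb => z1 z2 _; apply: le_lt_trans qd.
    have h : insq (Re c - q) (Im c - q) (2 * q) z by [].
    rewrite (le_trans (nrm_le_ReIm _))// !ReImE.
    suff : `|Re z - Re c| <= q /\ `|Im z - Im c| <= q by lra.
    by split; rewrite ler_norml; lra.
  have -> : rest z = (f (c + (z - c)) - f c - 'd f c (z - c)) * ((z - c)^-1 * (z - c)^-1).
    rewrite /rest /k diffC1 -/D (addrC c) subrK; by field.
  have zV : nrm (z - c)^-1 <= q^-1 by rewrite nrmV lef_pV2 ?posrE//; lra.
  rewrite mulrA nrmM; apply: ler_pM => //.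
  rewrite nrmM nrmV ler_pdivrMr; first exact: hd.
  by rewrite nrm_gt0.
have kE : k = (fun z => D * (z - c)^-1 + rest z).
  by apply/funext => z; rewrite /rest; ring.
have := hN; rewrite {2}kE perimD perimZ => {}hN.
have inv4 := perim_inv_ge c N q0; set P := perim _ N _ _ _ in inv4 hN.
(* [D * P] is the sum around the large square up to [3 * e]; dividing by the 4 of [inv4] turns
   [16 * M / r] into [4 * M / r]. *)
have : nrm (D * P) <= 16 * M / r + (e + 2 * e).
  have -> : D * P = perim k (N + m) (Re c - r) (Im c - r) (2 * r) -
     ((perim k (N + m) (Re c - r) (Im c - r) (2 * r) - (D * P +
      perim rest N (Re c - q) (Im c - q) (2 * q))) + perim rest N (Re c - q) (Im c - q) (2 * q)).
    ring.
  by apply: nrmB_le => //; apply: nrmD_le.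
rewrite nrmM => h.
have : nrm D * 4 <= nrm D * nrm P by rewrite ler_wpM2l.
have -> : 4 * M / r = 16 * M / r / 4 by field; rewrite gt_eqF.
lra.
Qed.

End CauchyEstimate.

(** * Holomorphic functions on balls *)

Section Holomorphic.
Variable R : realType.
Local Notation C := (Cplx R).
Local Notation Re := complex.Re.
Local Notation Im := complex.Im.

Lemma is_derive_nrm (phi : R -> R) (t D : R) :
  (forall e, 0 < e -> exists2 d, 0 < d & forall h, `|h| < d ->
     `|phi (t + h) - phi t - D * h| <= e * `|h|) -> is_derive t 1 phi D.
Proof.
move=> H.
have Hc : (fun h : R => h^-1 *: ((phi \o shift t) (h *: (1 : R)) - phi t)) @ 0^' --> D.
  apply/cvgrPdist_le => e e0; have [d d0 hd] := H _ e0.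
  apply/nbhs_ballP; exists d => //= h; rewrite /ball /= sub0r normrN => hh h0.
  have := hd _ hh; rewrite /GRing.scale /= mulr1 (addrC t) => h2.
  have -> : D - h^-1 * (phi (h + t) - phi t) = - (h^-1 * (phi (h + t) - phi t - D * h)).
    by field.
  by rewrite normrN normrM normfV mulrC ler_pdivrMr// normr_gt0.
by apply: DeriveDef; [apply/cvg_ex; exists D|apply: cvg_lim].
Qed.

Section MeanValue.
Variables (V : normedModType C).

Lemma is_derive_line (f : V -> C) (v h : V) (t : R) (al : C) :
  differentiable f (v + RtoC t *: h) ->
  is_derive t 1 (fun t : R => Re (al * f (v + RtoC t *: h)))
    (Re (al * 'd f (v + RtoC t *: h) h)).
Proof.
move=> df; apply: is_derive_nrm => e e0.
have K0 : 0 < 1 + nrm al * nrm h by rewrite ltr_pwDl// mulr_ge0.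
have [d d0 hd] := differentiable_nrm df (divr_gt0 e0 K0).
exists (d / (1 + nrm h)); first by rewrite divr_gt0// ltr_pwDl.
move=> s hs.
have sd : nrm (RtoC s *: h) < d.
  rewrite nrmZ nrm_RtoC; move: hs; rewrite ltr_pdivlMr ?ltr_pwDl// => hs.
  by apply: le_lt_trans hs; rewrite ler_wpM2l// lerDr.
have := hd _ sd.
have -> : v + RtoC t *: h + RtoC s *: h = v + RtoC (t + s) *: h.
  by rewrite RtoCD scalerDl addrA.
rewrite linearZ => H.
have -> : Re (al * f (v + RtoC (t + s) *: h)) - Re (al * f (v + RtoC t *: h)) -
     Re (al * 'd f (v + RtoC t *: h) h) * s =
   Re (al * (f (v + RtoC (t + s) *: h) - f (v + RtoC t *: h) -
     RtoC s *: 'd f (v + RtoC t *: h) h)).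
  by rewrite /GRing.scale !ReImE /=; ring.
rewrite (le_trans (Re_le _))// nrmM (le_trans (ler_wpM2l _ H))//.
rewrite nrmZ nrm_RtoC.
have -> : nrm al * (e / (1 + nrm al * nrm h) * (`|s| * nrm h)) =
  e * `|s| * ((nrm al * nrm h) / (1 + nrm al * nrm h)) by ring.
rewrite ler_piMr ?mulr_ge0 ?(ltW e0)//.
by rewrite ler_pdivrMr// mul1r lerDr.
Qed.

(** The mean value theorem fails for complex values; it is applied to the real and to the imaginary
    part, which costs the factor 2. *)
Lemma mean_value (f : V -> C) (v h : V) (M : R) :
  (forall t : R, 0 <= t <= 1 -> differentiable f (v + RtoC t *: h) /\
     nrm ('d f (v + RtoC t *: h) h) <= M) ->
  nrm (f (v + h) - f v) <= 2 * M.
Proof.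
move=> H.
have P (al : C) : nrm al = 1 -> `|Re (al * (f (v + h) - f v))| <= M.
  move=> al1; set phi := fun t : R => Re (al * f (v + RtoC t *: h)).
  have dphi (t : R) : 0 <= t <= 1 ->
      is_derive t 1 phi (Re (al * 'd f (v + RtoC t *: h) h)).
    by move=> /H[df _]; exact: is_derive_line.
  have [||c] := @MVT_segment R phi (fun t => Re (al * 'd f (v + RtoC t *: h) h)) 0 1 ler01.
  - by move=> x; rewrite in_itv /= => /andP[x0 x1]; apply: dphi; rewrite !ltW.
  - apply: derivable_within_continuous => x; rewrite in_itv /= => hx.
    by have [] := dphi x hx.
  rewrite in_itv /= subr0 mulr1 => /H[_ hM].
  rewrite /phi RtoC1 RtoC0 scale1r scale0r addr0 mulrBr CReD CReN => ->.
  by rewrite (le_trans (Re_le _))// nrmM al1 mul1r.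
rewrite (le_trans (nrm_le_ReIm _))//.
have h1 := P 1 (nrm1 R); rewrite mul1r in h1.
have i1 : nrm (- iC R) = 1 by rewrite nrmN nrmE /= expr0n expr1n add0r sqrtr1.
have h2 := P _ i1; rewrite mulNr CReN CReM /= mul0r mul1r sub0r opprK in h2.
lra.
Qed.

Lemma diff_line (f : V -> C) (v h : V) (z : C) :
  differentiable f (v + z *: h) ->
  differentiable (fun z : C => f (v + z *: h)) z /\
  'd (fun z : C => f (v + z *: h)) z 1 = 'd f (v + z *: h) h.
Proof.
move=> df.
have dg : is_diff z (fun z : C => v + z *: h) (fun z : C => 0 + z *: h).
  by apply: is_diffD; apply: is_diff_scalel.
have ex : differentiable (fun z : C => v + z *: h) z by apply: ex_diff.
have E : (fun z : C => f (v + z *: h)) = f \o (fun z : C => v + z *: h) by [].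
split; first by rewrite E; apply: differentiable_comp.
by rewrite E diff_comp//= diff_val /= add0r scale1r.
Qed.

End MeanValue.
Definition holo (V : normedModType C) (x : V) (rho M : R) (f : V -> C) : Prop :=
  forall v, nrm (v - x) < rho -> differentiable f v /\ nrm (f v) <= M.

Section HoloBounds.
Variables (V : normedModType C).
Implicit Types (f : V -> C) (x v w h : V).

Lemma holo_sub x y rho rho' M f : nrm (y - x) + rho' <= rho ->
  holo x rho M f -> holo y rho' M f.
Proof.
by move=> h H v hv; apply: H; have := nrm_tri y v x; lra.
Qed.

Lemma holo_M_ge0 x rho M f : 0 < rho -> holo x rho M f -> 0 <= M.
Proof.
move=> r0 /(_ x); rewrite subrr nrm0 => /(_ r0)[_]; exact: le_trans.
Qed.

Lemma holo_diff_le x rho M f h : 0 < rho -> holo x rho M f ->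
  nrm ('d f x h) <= 12 * M / rho * nrm h.
Proof.
move=> r0 H.
have M0 := holo_M_ge0 r0 H.
have [->|h0] := eqVneq h 0; first by rewrite linear0 nrm0 mulr0 nrm0.
have hn : 0 < nrm h by rewrite nrm_gt0.
pose g (z : C) := f (x + z *: h).
have xx : nrm (x - x) < rho by rewrite subrr nrm0.
have [dx _] := H _ xx.
have x0 : x + (0 : C) *: h = x by rewrite scale0r addr0.
have [dg0 dgE] : differentiable g (0 : C) /\ 'd g (0 : C) 1 = 'd f (x + (0 : C) *: h) h.
  by apply: diff_line; rewrite x0; exact: dx.
rewrite x0 in dgE; rewrite -dgE.
(* A square of half side [r] lies in the disc of radius [2 * r], so this choice keeps [x + z *: h]
   within [2 / 3 * rho] of [x]; together with the 4 of [cauchy_estimate] it produces the 12. *)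
have r3 : 0 < rho / (3 * nrm h) by rewrite divr_gt0// mulr_gt0.
have -> : 12 * M / rho * nrm h = 4 * M / (rho / (3 * nrm h)).
  by field; rewrite !gt_eqF.
apply: (cauchy_estimate r3) => z; set r := rho / (3 * nrm h) => -[/= z1 z2].
have zr : nrm z <= 2 * r.
  rewrite (le_trans (nrm_le_ReIm _))//.
  suff : `|Re z| <= r /\ `|Im z| <= r by lra.
  by split; rewrite ler_norml; lra.
have zin : nrm (x + z *: h - x) < rho.
  rewrite addrAC subrr add0r nrmZ; apply: (le_lt_trans (ler_wpM2r (nrm_ge0 _) zr)).
  have -> : 2 * r * nrm h = rho * (2 / 3) by rewrite /r; field; rewrite gt_eqF.
  lra.
have [dz Mz] := H _ zin; split; last exact: Mz.
exact: (diff_line dz).1.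
Qed.

Lemma seg_ball x v h rho (t : R) : 0 <= t <= 1 ->
  nrm (v - x) < rho -> nrm (v + h - x) < rho -> nrm (v + RtoC t *: h - x) < rho.
Proof.
move=> /andP[t0 t1] h1 h2.
have -> : v + RtoC t *: h - x = RtoC (1 - t) *: (v - x) + RtoC t *: (v + h - x).
  by rewrite [v + h - x]addrAC (scalerDr (RtoC t)) addrA -scalerDl -RtoCD subrK RtoC1 scale1r addrAC.
apply: (le_lt_trans (nrmD _ _)); rewrite !nrmZ !nrm_RtoC !ger0_norm ?subr_ge0//.
have [->|tn] := eqVneq t 0; first by rewrite mul0r addr0 subr0 mul1r.
have tp : 0 < t by rewrite lt_def tn.
have : (1 - t) * nrm (v - x) <= (1 - t) * rho by rewrite ler_wpM2l ?subr_ge0// ltW.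
have : t * nrm (v + h - x) < t * rho by rewrite ltr_pM2l.
lra.
Qed.

(** Each point of the half ball is the centre of a ball of radius [rho / 2], which doubles the 12 of
    [holo_diff_le]; the mean value inequality doubles it again. *)
Lemma holo_lip x rho M f v w : 0 < rho -> holo x rho M f ->
  nrm (v - x) < rho / 2 -> nrm (w - x) < rho / 2 ->
  nrm (f v - f w) <= 48 * M / rho * nrm (v - w).
Proof.
move=> r0 H hv hw.
have -> : v = w + (v - w) by rewrite addrC subrK.
rewrite [w + _ - w]addrAC subrr add0r.
have -> : 48 * M / rho * nrm (v - w) = 2 * (12 * M / (rho / 2) * nrm (v - w)).
  by field; rewrite gt_eqF.
apply: mean_value => t t01.
have hp : nrm (w + RtoC t *: (v - w) - x) < rho / 2.
  apply: seg_ball => //.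
  by have -> : w + (v - w) = v by rewrite addrC subrK.
have H' : holo (w + RtoC t *: (v - w)) (rho / 2) M f by apply: holo_sub H; lra.
have r2 : 0 < rho / 2 by lra.
split; last exact: holo_diff_le.

by have [] := H' (w + RtoC t *: (v - w)); first by rewrite subrr nrm0.
Qed.

Lemma diff_shiftB f u k : differentiable f (u + k) -> differentiable f u ->
  differentiable (fun u => f (u + k) - f u) u /\
  forall h, 'd (fun u => f (u + k) - f u) u h = 'd f (u + k) h - 'd f u h.
Proof.
move=> d1 d2.
have ds : is_diff u (fun u : V => u + k) (id : V -> V).
  have -> : (id : V -> V) = id + 0 by rewrite addr0.
  by apply: (@is_diffD _ _ _ id (cst k) id 0).
have [dsu dsE] := ds.
have dc : differentiable (f \o (fun u : V => u + k)) u.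
  exact: (differentiable_comp dsu d1).
have -> : (fun u => f (u + k) - f u) = (f \o (fun u : V => u + k)) - f by [].
split; first exact: (differentiableB dc d2).
move=> h.
have E1 := congr1 (@^~ h) (diffB dc d2).
have E2 := congr1 (@^~ h) (diff_comp dsu d1).
have E3 : 'd (f \o (fun u : V => u + k)) u h = 'd f (u + k) h.
  by rewrite [LHS]E2 /= dsE.
by rewrite [LHS]E1 /= [X in X - _]E3.
Qed.

(** Second derivatives are avoided: [f (u + k) - f u] is holomorphic in [u] and bounded through
    [holo_lip], so Cauchy's estimate on a ball of radius [rho / 4] bounds its derivative, and 2304
    is [12 * 48 * 4]. *)
Lemma holo_diff_lip x rho M f v w h : 0 < rho -> holo x rho M f ->
  nrm (v - x) < rho / 4 -> nrm (w - x) < rho / 4 ->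
  nrm ('d f v h - 'd f w h) <= 2304 * M / rho ^+ 2 * nrm (v - w) * nrm h.
Proof.
move=> r0 H hv hw; set k := v - w.
have vE : w + k = v by rewrite /k addrC subrK.
have hv' : nrm (w + k - x) < rho by rewrite vE; lra.
have hw' : nrm (w - x) < rho by lra.
have [d1 _] := H _ hv'; have [d2 _] := H _ hw'.
have [dF dFE] := diff_shiftB d1 d2.
rewrite -[in 'd f v]vE -dFE.
have -> : 2304 * M / rho ^+ 2 * nrm k * nrm h =
  12 * (48 * M / rho * nrm k) / (rho / 4) * nrm h by field; rewrite gt_eqF.
apply: holo_diff_le; first lra.
move=> u hu.
have h1 : nrm (u - x) < rho / 2 by have := nrm_tri w u x; lra.
have h2 : nrm (u + k - x) < rho / 2.
  have -> : u + k - x = (u - w) + (v - x) by rewrite /k -!addrA; congr (_ + _); rewrite addrCA.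
  by have := nrmD (u - w) (v - x); lra.
have h1' : nrm (u - x) < rho by lra.
have h2' : nrm (u + k - x) < rho by lra.
have [d1' _] := H _ h1'; have [d2' _] := H _ h2'.
split; first exact: (diff_shiftB d2' d1').1.
have := holo_lip r0 H h2 h1.
by rewrite [u + k - u]addrAC subrr add0r.
Qed.

(** The mean value inequality for [f] minus its derivative at [x], a function whose derivative is
    small by [holo_diff_lip]. *)
Lemma holo_taylor x rho M f h : 0 < rho -> holo x rho M f -> nrm h < rho / 4 ->
  nrm (f (x + h) - f x - 'd f x h) <= 4608 * M / rho ^+ 2 * nrm h ^+ 2.
Proof.
move=> r0 H hh.
have xx : nrm (x - x) < rho by rewrite subrr nrm0.
have [dx _] := H _ xx.
pose A := 'd f x.
have cA : continuous A by exact: diff_continuous.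
have -> : f (x + h) - f x - 'd f x h = (fun v => f v - A v) (x + h) - (fun v => f v - A v) x.
  by rewrite /A linearD; ring.
have -> : 4608 * M / rho ^+ 2 * nrm h ^+ 2 = 2 * (2304 * M / rho ^+ 2 * nrm h * nrm h).
  by ring.
have M0 := holo_M_ge0 r0 H.
apply: (@mean_value V (fun v => f v - A v)) => t /andP[t0 t1]; set p := x + _.
have px : nrm (p - x) <= nrm h.
  rewrite /p addrAC subrr add0r nrmZ nrm_RtoC ger0_norm//.
  by rewrite ler_piMl.
have pr : nrm (p - x) < rho by lra.
have [dp _] := H _ pr.
have dA : differentiable A p by exact: linear_differentiable.
split; first exact: (differentiableB dp dA).
have E1 := congr1 (@^~ h) (diffB dp dA).
have E2 := congr1 (@^~ h) (diff_lin p cA).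
have E : 'd (fun v => f v - A v) p h = 'd f p h - 'd f x h.
  by rewrite [LHS]E1 /= [X in _ - X]E2.
rewrite E.
have p4 : nrm (p - x) < rho / 4 := le_lt_trans px hh.
have x4 : nrm (x - x) < rho / 4 by rewrite subrr nrm0 divr_gt0.
have K0 : 0 <= 2304 * M / rho ^+ 2.
  exact: divr_ge0 (mulr_ge0 (ler0n R _) M0) (exprn_ge0 2 (ltW r0)).
apply: le_trans (holo_diff_lip h r0 H p4 x4) _.
exact: (ler_wpM2r (nrm_ge0 h) (ler_wpM2l K0 px)).
Qed.

End HoloBounds.
End Holomorphic.

(** * Uniform limits of holomorphic functions *)

Section HoloLimits.
Variable R : realType.
Local Notation C := (Cplx R).
Local Notation Re := complex.Re.
Local Notation Im := complex.Im.

Lemma real_complete (u r : nat -> R) :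
  (forall m n, (m <= n)%N -> `|u n - u m| <= r m) ->
  (forall e, 0 < e -> exists n, r n <= e) ->
  exists l, forall n, `|u n - l| <= r n.
Proof.
move=> ur r0.
have cu : cvg (u @ \oo).
  apply/cauchy_cvgP; apply: cauchy_exP => e e0.
  have [N hN] := r0 _ (divr_gt0 e0 (ltr0n R 2)).
  exists (u N); exists N => // n /= Nn.
  rewrite /ball /= distrC (le_lt_trans (ur _ _ Nn))//; lra.
exists (lim (u @ \oo)) => n; apply: le_of_forall_eps => e e0.
have /cvgrPdist_le/(_ _ e0)[N _ hN] : u @ \oo --> lim (u @ \oo) := cu.
have h1 := hN (maxn n N) (leq_maxr _ _); have h2 := ur _ _ (leq_maxl n N).
rewrite distrC in h2; rewrite distrC in h1.
by have := ler_normD (u n - u (maxn n N)) (u (maxn n N) - lim (u @ \oo)); rewrite addrA subrK; lra.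
Qed.

Lemma cplx_complete (u : nat -> C) (r : nat -> R) :
  (forall m n, (m <= n)%N -> nrm (u n - u m) <= r m) ->
  (forall e, 0 < e -> exists n, r n <= e) ->
  exists l, forall n, nrm (u n - l) <= r n.
Proof.
move=> ur r0.
have [a ha] : exists l, forall n, `|Re (u n) - l| <= r n.
  apply: real_complete => // m n mn; rewrite (le_trans _ (ur _ _ mn))//.
  by rewrite (le_trans _ (Re_le _))// CReD CReN.
have [b hb] : exists l, forall n, `|Im (u n) - l| <= r n.
  apply: real_complete => // m n mn; rewrite (le_trans _ (ur _ _ mn))//.
  by rewrite (le_trans _ (Im_le _))// CImD CImN.
exists (Complex a b : C) => n; apply: le_of_forall_eps => e e0.
(* Adding the two coordinate bounds doubles the rate; this loss is taken only at a far index [N],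
   where it is absorbed by [e]. *)
have [N hN] := r0 _ (divr_gt0 e0 (ltr0n R 4)).
have hm : nrm (u N - Complex a b) <= r N + r N.
  rewrite (le_trans (nrm_le_ReIm _))//.
  by rewrite CReD CReN CImD CImN lerD.
set m := maxn n N.
have h1 := ur _ m (leq_maxl n N); have h2 := ur _ m (leq_maxr n N).
have := nrm_tri (u m) (u n) (Complex a b); rewrite (nrmBC (u n) (u m)).
by have := nrm_tri (u N) (u m) (Complex a b); lra.
Qed.

Lemma row_complete l (u : nat -> 'rV[C]_l) (r : nat -> R) :
  (forall m n, (m <= n)%N -> nrm (u n - u m) <= r m) ->
  (forall e, 0 < e -> exists n, r n <= e) ->
  exists v, forall n, nrm (u n - v) <= r n.
Proof.
move=> ur r0.
have rge0 n : 0 <= r n by apply: le_trans (nrm_ge0 _) (ur n n (leqnn n)).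
have H (j : 'I_l) : exists z : C, forall n, nrm (u n 0 j - z) <= r n.
  apply: cplx_complete => // m n mn; rewrite (le_trans _ (ur _ _ mn))//.
  by have := mx_nrm_coord (u n - u m) 0 j; rewrite !mxE.
have [F hF] := choice H.
exists (\row_j F j) => n; apply/mx_nrm_le => // i j.
by rewrite !mxE (ord1 i).
Qed.

Section Limits.
Variables (V : normedModType C).

Lemma diffB_app (f g : V -> C) x h : differentiable f x -> differentiable g x ->
  'd (fun v => f v - g v) x h = 'd f x h - 'd g x h.
Proof. by move=> df dg; exact: (congr1 (@^~ h) (diffB df dg)). Qed.

(** Weierstrass' theorem. Cauchy's estimate for [F n - F m] makes the derivatives at [x] converge;
    their limit [A] is linear and bounded, and Taylor's estimate, being uniform in [n], passes to
    the limit. *)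
Lemma holo_limit (F : nat -> V -> C) (G : V -> C) x rho M (r : nat -> R) :
  0 < rho -> (forall n, holo x rho M (F n)) ->
  (forall m n, (m <= n)%N -> r n <= r m) ->
  (forall e, 0 < e -> exists n, r n <= e) ->
  (forall n v, nrm (v - x) < rho -> nrm (F n v - G v) <= r n) ->
  differentiable G x.
Proof.
move=> r0 HF rdec rlim FG.
have xx : nrm (x - x) < rho by rewrite subrr nrm0.
have rge0 n : 0 <= r n by apply: le_trans (nrm_ge0 _) (FG n x xx).
have dF n : differentiable (F n) x by have [] := HF n _ xx.
have diffB_le m n h : (m <= n)%N ->
    nrm ('d (F n) x h - 'd (F m) x h) <= 24 / rho * r m * nrm h.
  move=> mn.
  have H : holo x rho (2 * r m) (fun v => F n v - F m v).
    move=> v hv; have [d1 _] := HF n _ hv; have [d2 _] := HF m _ hv.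
    split; first exact: (differentiableB d1 d2).
    have := nrm_tri (G v) (F n v) (F m v); rewrite (nrmBC (G v) (F m v)).
    by have := FG n v hv; have := FG m v hv; have := rdec _ _ mn; lra.
  have H1 := holo_diff_le h r0 H.
  have E := diffB_app h (dF n) (dF m).
  have K1 : 12 * (2 * r m) / rho * nrm h = 24 / rho * r m * nrm h by ring.
  rewrite K1 in H1.
  rewrite -E.
  exact: H1.
have K0 (h : V) : 0 <= 24 / rho * nrm h.
  exact: (mulr_ge0 (divr_ge0 (ler0n R _) (ltW r0)) (nrm_ge0 h)).
have HA h : exists z : C, forall n,
    nrm ('d (F n) x h - z) <= 24 / rho * nrm h * r n.
  apply: cplx_complete.
    by move=> m n mn; rewrite [leRHS]mulrAC; exact: diffB_le.
  move=> e e0; have [n hn] := rlim (e / (1 + 24 / rho * nrm h)) (divr_gt0 e0 (ltr_pwDl ltr01 (K0 h))).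
  exists n; rewrite ler_pdivlMr ?ltr_pwDl// in hn.
  by have := rge0 n; have := K0 h; nra.
have [A hA] := choice HA.
have Alin : linear A.
  move=> a u v; apply/eqP; rewrite -subr_eq0; apply/eqP/nrm_eq0/eqP.
  rewrite eq_le nrm_ge0 andbT; apply: le_of_forall_eps => e e0; rewrite add0r.
  set K := 24 / rho * nrm (a *: u + v) + nrm a * (24 / rho * nrm u) + 24 / rho * nrm v.
  have K0' : 0 <= K by rewrite !addr_ge0// mulr_ge0.
  have [n hn] := rlim (e / (1 + K)) (divr_gt0 e0 (ltr_pwDl ltr01 K0')).
  rewrite ler_pdivlMr ?ltr_pwDl// in hn.
  have h1 := hA (a *: u + v) n; have h2 := hA u n; have h3 := hA v n.
  have -> : A (a *: u + v) - (a *: A u + A v) =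
     a *: ('d (F n) x u - A u) + ('d (F n) x v - A v) - ('d (F n) x (a *: u + v) - A (a *: u + v)).
    have -> : 'd (F n) x (a *: u + v) = a * 'd (F n) x u + 'd (F n) x v.
      by rewrite linearD linearZ.
    have sE (z : C) : a *: z = a * z by [].
    rewrite !sE; ring.
  have := nrmB (a *: ('d (F n) x u - A u) + ('d (F n) x v - A v)) ('d (F n) x (a *: u + v) - A (a *: u + v)).
  have := nrmD (a *: ('d (F n) x u - A u)) ('d (F n) x v - A v).
  rewrite nrmZ; have := ler_wpM2l (nrm_ge0 a) h2.
  have : K * r n <= e by have := rge0 n; lra.
  rewrite /K; lra.
have := @nrm_differentiable R V C G x.
pose AM := GRing.isLinear.Build _ _ _ _ A Alin.
pose A' : {linear V -> C} := HB.pack A AM.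
have M0 := holo_M_ge0 r0 (HF 0%N).
pose K1 := 12 * M / rho + 24 / rho * r 0%N.
move=> /(_ A' K1) H; apply: (H _ _).1.
  move=> v /=; have := hA v 0%N; have := holo_diff_le v r0 (HF 0%N).
  by have := nrm_shift (A v) ('d (F 0%N) x v); rewrite (nrmBC (A v) _) /K1; lra.
move=> e e0 /=.
pose K2 := 4608 * M / rho ^+ 2.
have K20 : 0 <= K2 by exact: divr_ge0 (mulr_ge0 (ler0n R _) M0) (exprn_ge0 2 (ltW r0)).
exists (Num.min (rho / 4) (e / (1 + K2))).
  by rewrite lt_min !divr_gt0// ltr_pwDl.
move=> h; rewrite lt_min => /andP[h4 he].
rewrite ltr_pdivlMr ?ltr_pwDl// in he.
have hr : nrm (x + h - x) < rho by rewrite addrAC subrr add0r; lra.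
have T : nrm (G (x + h) - G x - A h) <= K2 * nrm h ^+ 2.
  apply: le_of_forall_eps => e' e'0.
  have L0 : 0 <= 2 + 24 / rho * nrm h by rewrite addr_ge0.
  have [n hn] := rlim (e' / (1 + (2 + 24 / rho * nrm h))) (divr_gt0 e'0 (ltr_pwDl ltr01 L0)).
  rewrite ler_pdivlMr ?ltr_pwDl// in hn.
  have t1 := holo_taylor r0 (HF n) h4.
  have t2 := FG n _ hr; have t3 := FG n _ xx; have t4 := hA h n.
  have -> : G (x + h) - G x - A h = (F n (x + h) - F n x - 'd (F n) x h)
    - (F n (x + h) - G (x + h)) + ((F n x - G x) + ('d (F n) x h - A h)) by ring.
  apply: le_trans (nrmD _ _) _; apply: le_trans (lerD (nrmB _ _) (nrmD _ _)) _.
  rewrite -/K2 in t1; have := rge0 n; lra.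
apply: le_trans T _; rewrite expr2 mulrA ler_wpM2r//.
by have := nrm_ge0 h; lra.
Qed.

Lemma diff_bounded_near (f : V -> C) x : differentiable f x ->
  exists2 d, 0 < d & forall v, nrm (v - x) < d -> nrm (f v) <= nrm (f x) + 1.
Proof.
move=> /differentiable_continuous /cvgrPdist_le /(_ (RtoC 1)).
rewrite -RtoC0 RtoC_lt => /(_ ltr01)/nrm_nbhs[d d0 hd]; exists d => // v /hd.
rewrite norm_RtoC RtoC_le => h; have := nrm_shift (f v) (f x).
by rewrite (nrmBC (f v)); lra.
Qed.

Lemma entire_holo (f : V -> C) x : (forall v, differentiable f v) ->
  exists rho M, 0 < rho /\ holo x rho M f.
Proof.
move=> df; have [d d0 hd] := diff_bounded_near (df x).
by exists d, (nrm (f x) + 1); split => // v hv; split; [exact: df|exact: hd].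
Qed.

(** A directional derivative is a locally uniform limit of difference quotients, so [holo_limit]
    applies. The differentiability of [gf], and hence of the Euler step in [v], rests on this. *)
Lemma entire_partial (f : V -> C) (h : V) : (forall v, differentiable f v) ->
  forall x, differentiable (fun v => 'd f v h) x.
Proof.
move=> df x; have [rho [M [r0 H]]] := entire_holo x df.
have M0 := holo_M_ge0 r0 H.
(* The inverse of the step of the [n]-th difference quotient; its first term keeps the displacement
   of the argument below [rho / 8] from the start. *)
pose q n : R := 8 * (1 + nrm h) / rho + n.+1%:R.
have q0 n : 0 < q n.
  by rewrite ltr_wpDl ?ltr0n// divr_ge0 ?(ltW r0)// mulr_ge0// addr_ge0.
pose F n v := RtoC (q n) * (f (v + RtoC (q n)^-1 *: h) - f v).
have hq n : nrm (RtoC (q n)^-1 *: h) < rho / 8.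
  rewrite nrmZ nrm_RtoC ger0_norm ?invr_ge0 ?(ltW (q0 n))//.
  rewrite mulrC ltr_pdivrMr//.
  have : rho / 8 * (8 * (1 + nrm h) / rho) <= rho / 8 * q n.
    by rewrite ler_wpM2l ?divr_ge0 ?(ltW r0)// lerDl.
  have -> : rho / 8 * (8 * (1 + nrm h) / rho) = 1 + nrm h by field; rewrite gt_eqF.
  lra.
pose K := 4608 * M / (rho / 2) ^+ 2 * nrm h ^+ 2.
have K0 : 0 <= K.
  apply: mulr_ge0 (exprn_ge0 _ (nrm_ge0 _)).
  by apply: divr_ge0 (mulr_ge0 (ler0n R _) M0) (exprn_ge0 2 _); rewrite divr_ge0 ?(ltW r0).
have FG n v : nrm (v - x) < rho / 2 -> nrm (F n v - 'd f v h) <= K / n.+1%:R.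
  move=> hv; have Hv : holo v (rho / 2) M f by apply: holo_sub H; lra.
  have r2 : 0 < rho / 2 by lra.
  have hq' : nrm (RtoC (q n)^-1 *: h) < rho / 2 / 4 by have := hq n; lra.
  have := holo_taylor r2 Hv hq'.
  rewrite linearZ => T.
  have qn0 : RtoC (q n) != 0 by rewrite RtoC_eq0 gt_eqF.
  have -> : F n v - 'd f v h = RtoC (q n) * (f (v + RtoC (q n)^-1 *: h) - f v - RtoC (q n)^-1 * 'd f v h).
    rewrite [RHS]mulrBr [X in _ = _ - X]mulrA -RtoCM divff ?gt_eqF// RtoC1 mul1r; reflexivity.
  rewrite nrmM nrm_RtoC gtr0_norm//.
  apply: (le_trans (ler_wpM2l (ltW (q0 n)) T)).
  rewrite nrmZ nrm_RtoC gtr0_norm ?invr_gt0//.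
  have -> : q n * (4608 * M / (rho / 2) ^+ 2 * ((q n)^-1 * nrm h) ^+ 2) = K / q n.
    by rewrite /K; field; rewrite !gt_eqF.
  apply: ler_wpM2l => //; rewrite lef_pV2 ?posrE ?ltr0n//.
  by rewrite /q lerDr divr_ge0 ?(ltW r0)// mulr_ge0// addr_ge0.
have r8 : 0 < rho / 2 by lra.
have rate0 e : 0 < e -> exists n : nat, K / n.+1%:R <= e.
  move=> e0; exists (Num.truncn (K / e)).
  have := truncnS_gt (K / e).
  by rewrite ler_pdivrMr ?ltr0n// ltr_pdivrMr// mulrC => /ltW.
apply: (@holo_limit F _ x (rho / 2) (K + 12 * M / (rho / 2) * nrm h) (fun n => K / n.+1%:R) r8).
- move=> n v hv.
  have dF : differentiable (F n) v.
    have d1 := (diff_shiftB (df (v + RtoC (q n)^-1 *: h)) (df v)).1.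
    exact: (differentiableZ (RtoC (q n)) d1).
  split; first exact: dF.
  have Hv : holo v (rho / 2) M f by apply: holo_sub H; lra.
  have r2 : 0 < rho / 2 by lra.
  have KK : K / n.+1%:R <= K by rewrite ler_pdivrMr ?ltr0n// ler_peMr// ler1n.
  apply: le_trans (nrm_shift _ ('d f v h)) _; rewrite addrC.
  exact: lerD (le_trans (FG n v hv) KK) (holo_diff_le h r2 Hv).
- move=> m n mn; apply: ler_wpM2l => //.
  by rewrite lef_pV2 ?posrE ?ltr0n// ler_nat ltnS.
- exact: rate0.
- exact: FG.
Qed.

End Limits.
End HoloLimits.

(** * Estimates on closed balls with a unit margin *)

Section BallEstimates.
Variable R : realType.
Local Notation C := (Cplx R).

Lemma diff_coord (V : normedModType C) m n (f : V -> 'M[C]_(m, n)) x i j :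
  differentiable f x -> differentiable (fun v => f v i j : C) x.
Proof.
move=> df; have dc := @differentiable_coord C m n (f x) i j.
exact: (differentiable_comp df dc).
Qed.

Lemma diff_mx (V : normedModType C) m n (f : V -> 'M[C]_(m, n)) x :
  (forall i j, differentiable (fun v => f v i j : C) x) -> differentiable f x.
Proof.
move=> df.
have -> : f = \sum_(i < m) \sum_(j < n) (fun v => f v i j *: delta_mx i j).
  apply/funext => v; rewrite fct_sumE [LHS]matrix_sum_delta.
  by apply: eq_bigr => i _; rewrite fct_sumE.
apply: differentiable_sum => i; apply: differentiable_sum => j.
exact: (differentiableZl _ (df i j)).
Qed.

Section Ball.
Variables (V : normedModType C).
Implicit Types (v w h : V).

Definition bholo (r M : R) (f : V -> C) : Prop :=
  forall v, nrm v <= r -> differentiable f v /\ nrm (f v) <= M.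

Lemma bholo_holo r M f v : bholo (r + 1) M f -> nrm v <= r -> holo v 1 M f.
Proof.
by move=> H hv w hw; apply: H; have := nrm_shift w v; lra.
Qed.

Lemma ball_diff r M f v h : bholo (r + 1) M f -> nrm v <= r ->
  nrm ('d f v h) <= 12 * M * nrm h.
Proof.
move=> H hv; have := holo_diff_le h ltr01 (bholo_holo H hv).
by rewrite divr1.
Qed.

Lemma ball_lip r M f v w : bholo (r + 1) M f -> nrm v <= r -> nrm w <= r ->
  nrm (f v - f w) <= 24 * M * nrm (v - w).
Proof.
move=> H hv hw.
have vE : w + (v - w) = v by rewrite addrC subrK.
have := @mean_value R V f w (v - w) (12 * M * nrm (v - w)) _.
rewrite vE => h.
have -> : 24 * M * nrm (v - w) = 2 * (12 * M * nrm (v - w)) by ring.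
apply: h => t /andP[t0 t1].
have hp : nrm (w + RtoC t *: (v - w)) <= r.
  have -> : w + RtoC t *: (v - w) = RtoC (1 - t) *: w + RtoC t *: v.
    by rewrite RtoCD RtoCN RtoC1 scalerBr scalerBl scale1r addrA addrAC.
  apply: le_trans (nrmD _ _) _; rewrite !nrmZ !nrm_RtoC !ger0_norm ?subr_ge0//.
  have : (1 - t) * nrm w <= (1 - t) * r by rewrite ler_wpM2l ?subr_ge0.
  have : t * nrm v <= t * r by rewrite ler_wpM2l.
  lra.
have hp1 : nrm (w + RtoC t *: (v - w)) <= r + 1 by lra.
by split; [exact: (H _ hp1).1|exact: (ball_diff _ H hp)].
Qed.

(** [holo_taylor] covers distances below 1/4; beyond that the crude bound on each term is absorbed
    by the square of the distance, so that [w - v] is not restricted. *)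
Lemma ball_taylor r M f v w : bholo (r + 1) M f -> nrm v <= r -> nrm w <= r ->
  nrm (f w - f v - 'd f v (w - v)) <= 4608 * M * nrm (w - v) ^+ 2.
Proof.
move=> H hv hw.
have [h4|h4] := ltP (nrm (w - v)) (1 / 4).
  have vE : v + (w - v) = w by rewrite addrC subrK.
  by have := holo_taylor ltr01 (bholo_holo H hv) h4; rewrite vE expr1n divr1.
have hv1 : nrm v <= r + 1 by lra.
have hw1 : nrm w <= r + 1 by lra.
have M0 : 0 <= M := le_trans (nrm_ge0 _) (H _ hv1).2.
have h1 := ball_diff (w - v) H hv.
have h2 := nrmB_le (H _ hw1).2 (H _ hv1).2.
apply: le_trans (nrmB_le h2 h1) _.
set d := nrm (w - v) in h4 *.
have d2 : d / 4 <= d ^+ 2 by nra.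
have : M * (d / 4) <= M * d ^+ 2 by rewrite ler_wpM2l.
have : M * (1 / 4) <= M * d by rewrite ler_wpM2l.
lra.
Qed.

Lemma ball_lip_row l r M (f : V -> 'rV[C]_l) v w :
  (forall v, nrm v <= r + 1 -> differentiable f v /\ nrm (f v) <= M) ->
  nrm v <= r -> nrm w <= r ->
  nrm (f v - f w) <= 24 * M * nrm (v - w).
Proof.
move=> H hv hw.
have hv1 : nrm v <= r + 1 by lra.
have M0 : 0 <= M := le_trans (nrm_ge0 _) (H _ hv1).2.
apply/mx_nrm_le; first by rewrite !mulr_ge0.
move=> i j; rewrite !mxE.
apply: (@ball_lip r M (fun v => f v i j)) => // u hu.
have [d1 d2] := H u hu; split; first exact: diff_coord.
by apply: le_trans d2; apply: mx_nrm_coord.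
Qed.

End Ball.

(** Compactness is used in real coordinates: the complex ball is contained in the image under [psi]
    of a product of real segments. *)
Lemma entire_bounded l (f : 'rV[C]_l -> C) (r : R) :
  (forall v, differentiable f v) -> exists M, forall v, nrm v <= r -> nrm (f v) <= M.
Proof.
move=> df; have [r0|r0] := ltP r 0.
  by exists 0 => v hv; have := nrm_ge0 v; lra.
pose psi (w : 'rV[R]_(l + l)) : 'rV[C]_l :=
  \row_j Complex (w 0 (lshift l j)) (w 0 (rshift l j)).
pose A := [set w : 'rV[R]_(l + l) | forall i, `[- r, r]%classic (w ord0 i)].
have cA : compact A by apply: (rV_compact (A := fun=> `[-r, r]%classic)) => _; exact: segment_compact.
have A0 : A !=set0.
  by exists 0 => i; rewrite mxE /= in_itv /=; lra.
have cf : continuous (fun w => nrm (f (psi w))).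
  move=> w; have Fw : Filter (nbhs w) by exact: nbhs_filter.
  apply/(@cvgrPdist_le _ _ _ (nbhs w) Fw) => e e0.
  have /differentiable_continuous/cvgrPdist_le/(_ (RtoC e)) := df (psi w).
  rewrite -RtoC0 RtoC_lt => /(_ e0)/nrm_nbhs[d d0 hd].
  apply/nbhs_ballP; exists (d / 4) => /= [|w' ww']; first by rewrite divr_gt0.
  have {}ww' i : `|w 0 i - w' 0 i| < d / 4 by exact: (ww'.2 0 i).
  have h : nrm (f (psi w) - f (psi w')) <= e.
    rewrite -RtoC_le -norm_RtoC; apply: hd.
    have : nrm (psi w' - psi w) <= d / 2.
      apply/mx_nrm_le => [|i j]; first by lra.
      rewrite !mxE; apply: le_trans (nrm_le_ReIm _) _.
      rewrite CReD CReN CImD CImN /= distrC (distrC (w' _ _)).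
      by have := ww' (lshift l j); have := ww' (rshift l j); lra.
    lra.
  apply: le_trans h.
  have := nrm_shift (f (psi w)) (f (psi w')); have := nrm_shift (f (psi w')) (f (psi w)).
  by rewrite (nrmBC (f (psi w')) (f (psi w))) ler_norml; lra.
have [c cAc hc] := compact_EVT_max A0 cA (continuous_subspaceT cf).
exists (nrm (f (psi c))) => v hv.
pose w : 'rV[R]_(l + l) := row_mx (\row_j complex.Re (v 0 j)) (\row_j complex.Im (v 0 j)).
have -> : v = psi w.
  by apply/rowP => j; rewrite /psi mxE row_mxEl row_mxEr !mxE Cplx_eta.
apply: hc; rewrite inE /A /= => i; rewrite in_itv /= -ler_norml.
case: (split_ordP i) => j ->; rewrite ?row_mxEl ?row_mxEr mxE.
  by apply: le_trans (Re_le _) (le_trans (mx_nrm_coord v 0 j) hv).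
by apply: le_trans (Im_le _) (le_trans (mx_nrm_coord v 0 j) hv).
Qed.

End BallEstimates.

(** * Almost flows *)

(** The worst case is [k = 3], split as 1 + 2; it imposes the ratio 2/3 in the geometric series
    below. *)
Lemma near_halves (k : nat) : (1 < k)%N -> exists j m,
  [/\ (j + m)%N = k, (0 < j)%N, (0 < m)%N, (3 * j <= 2 * k)%N & (3 * m <= 2 * k)%N].
Proof. by move=> k1; exists k./2, (k - k./2)%N; split; lia. Qed.

Section AlmostFlow.
Variables (R : realType) (l : nat).
Local Notation C := (Cplx R).
Local Notation V := 'rV[C]_l.

Lemma powR_mono (x y p : R) : 0 <= p -> 0 <= x <= y -> x `^ p <= y `^ p.
Proof. by move=> p0 /andP[x0 xy]; apply: ge0_ler_powR; rewrite ?nnegrE// (le_trans x0). Qed.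

Lemma powR_small (A p e : R) : 0 <= A -> 0 < p -> 0 < e ->
  exists2 d, 0 < d & forall x, 0 <= x <= d -> A * x `^ p <= e.
Proof.
move=> A0 p0 e0; exists ((e / (1 + A)) `^ p^-1).
  by rewrite powR_gt0// divr_gt0// ltr_pwDl.
move=> x /andP[x0 xd].
have A1 : 0 < 1 + A by rewrite ltr_pwDl.
have : x `^ p <= e / (1 + A).
  have -> : e / (1 + A) = ((e / (1 + A)) `^ p^-1) `^ p.
    by rewrite -powRrM mulVf ?gt_eqF// powRr1// divr_ge0 ?ltW.
  by apply: ge0_ler_powR => //; rewrite ?nnegrE ?powR_ge0// ltW.
rewrite ler_pdivlMr// => h; have := powR_ge0 x p; nra.
Qed.

Lemma powR_1x (p : R) : 1 `^ p = 1 :> R.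
Proof. by rewrite powR1. Qed.

Lemma powR_le1 (x p : R) : 0 <= p -> 0 <= x <= 1 -> x `^ p <= 1.
Proof.
move=> p0 /andP[x0 x1]; rewrite -[leRHS](powR_1x p).
by apply: ge0_ler_powR; rewrite ?nnegrE.
Qed.

Lemma powR_split (x p q : R) : 0 <= x -> 0 < p < q -> x `^ q = x `^ (q - p) * x `^ p.
Proof.
move=> x0 /andP[p0 pq].
have [->|xn] := eqVneq x 0; first by rewrite !powR0 ?mulr0//; lra.
by rewrite -powRD ?subrK// xn implybT.
Qed.

Definition convexC (D : set C) : Prop :=
  forall s t, D s -> D t -> forall tau : R, 0 <= tau <= 1 -> D (seg s t tau).

(* [E t s] is close to the identity, and it is a flow up to an error of order
   [th > 1]. *)
Record almost_flow (D : set C) (E : C -> C -> V -> V) (B K1 K2 gam th del : R) : Prop :=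
  AlmostFlow {
    af_convex : convexC D;
    af_gam : 0 < gam < th;
    af_th : 1 < th;
    af_K1 : 0 <= K1;
    af_K2 : 0 <= K2;
    af_del : 0 < del <= 1;
    af_diff : forall t s v, D t -> D s -> differentiable (E t s) v;
    af_move : forall t s v, D t -> D s -> nrm (t - s) <= del -> nrm v <= B + 4 ->
      nrm (E t s v - v) <= K1 * nrm (t - s) `^ gam;
    af_cons : forall t u s v, D t -> D u -> D s -> nrm (t - s) <= del ->
      nrm (t - u) <= nrm (t - s) -> nrm (u - s) <= nrm (t - s) -> nrm v <= B + 3 ->
      nrm (E t u (E u s v) - E t s v) <= K2 * nrm (t - s) `^ th
  }.

(* A chain of steps is split near its middle, into pieces of at most 2/3 of its
   length: [qth], [K3c] and [K4c] come from the resulting geometric series. *)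
Definition qth (th : R) : R := (2 / 3) `^ (th - 1).
Definition K3c (K1 gam : R) : R := (1 + K1) / (1 - (2 / 3) `^ gam).
Definition K4c (K2 th : R) : R := 2 * K2 / (1 - qth th).

(** [ss_lip] closes the induction of [flow_near]; [ss_K4] makes the error of a composition at most
    the power [gam] of its length; [ss_K3] keeps compositions within distance 1 of their starting
    value; [ss_sum] bounds the Lipschitz constant of compositions by 2. *)
Record small_step (K1 K2 gam th del : R) : Prop := SmallStep {
  ss_lip : (1 + 24 * K1 * del `^ gam) * qth th <= (1 + qth th) / 2;
  ss_K4 : K4c K2 th * del `^ (th - gam) <= 1;
  ss_K3 : K3c K1 gam * del `^ gam <= 1;
  ss_sum : 24 * K1 * del `^ gam + 24 * K4c K2 th * del `^ th <= 1
}.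

Lemma pow23_lt1 (p : R) : 0 < p -> 0 < (2 / 3 : R) `^ p < 1.
Proof.
move=> p0; rewrite powR_gt0//= -[ltRHS](powR_1x p).
by apply: gt0_ltr_powR; rewrite ?nnegrE; lra.
Qed.

Lemma exists_small_step (K1 K2 gam th : R) : 0 <= K1 -> 0 <= K2 -> 0 < gam < th -> 1 < th ->
  exists2 d, 0 < d <= 1 & forall del, 0 < del <= d -> small_step K1 K2 gam th del.
Proof.
move=> K10 K20 gt th1.
have [g0 t0] : 0 < gam /\ 0 < th by lra.
have /pow23_lt1/andP[q0 q1] : 0 < th - 1 by lra.
have /pow23_lt1/andP[r0 r1] := g0.
have K40 : 0 <= K4c K2 th by rewrite divr_ge0 ?mulr_ge0// subr_ge0 ltW.
have K30 : 0 <= K3c K1 gam by apply: divr_ge0; [exact: addr_ge0|rewrite subr_ge0 ltW].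
have A0 : 0 <= 24 * K1 by rewrite mulr_ge0.
have B0 : 0 <= 24 * K4c K2 th by rewrite mulr_ge0.
have qe : 0 < (1 - qth th) / 2 by rewrite divr_gt0// subr_gt0.
have [d1 d10 h1] := powR_small A0 g0 qe.
have tg : 0 < th - gam by lra.
have [d2 d20 h2] := powR_small K40 tg ltr01.
have [d3 d30 h3] := powR_small K30 g0 ltr01.
have half0 : 0 < (1 / 2 : R) by lra.
have [d4 d40 h4] := powR_small A0 g0 half0.
have [d5 d50 h5] := powR_small B0 t0 half0.
exists (Num.min 1 (Num.min d1 (Num.min d2 (Num.min d3 (Num.min d4 d5))))).
  by rewrite !lt_min ltr01 d10 d20 d30 d40 d50/= ge_min lexx.
move=> del /andP[del0]; rewrite !le_min => /and5P[_ e1 e2 e3 /andP[e4 e5]].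
have D (x : R) : del <= x -> 0 <= del <= x by move=> ->; rewrite ltW.
split.
- have := h1 _ (D _ e1); rewrite /qth in q0 q1 *; have := powR_ge0 del gam; nra.
- exact: h2 (D _ e2).
- exact: h3 (D _ e3).
- have := h4 _ (D _ e4); have := h5 _ (D _ e5); lra.
Qed.

Fixpoint flow (E : C -> C -> V -> V) (k : nat) (s h : C) (v : V) : V :=
  if k is k'.+1 then flow E k' (s + h) h (E (s + h) s v) else v.

Lemma flowD E j k s h v :
  flow E (j + k) s h v = flow E k (s + j%:R * h) h (flow E j s h v).
Proof.
elim: j s v => [|j IH] s v /=; first by rewrite mul0r addr0.
by rewrite IH -addrA -nat1r mulrDl mul1r.
Qed.

Lemma convex_step (D : set C) s h j k : convexC D -> (j <= k)%N -> D s ->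
  D (s + k%:R * h) -> D (s + j%:R * h).
Proof.
move=> cD jk Ds Dk; case: k jk Dk => [|k] jk Dk; first by move: jk Dk; rewrite leqn0 => /eqP->.
have h0 : 0 <= (j%:R / k.+1%:R : R) <= 1.
  by rewrite divr_ge0//= ler_pdivrMr ?ltr0n// mul1r ler_nat.
have := cD _ _ Ds Dk _ h0.
rewrite /seg addrAC subrr add0r mulrA.
have -> : (Complex (j%:R / k.+1%:R) 0 : C) * k.+1%:R = j%:R; last by [].
by rewrite -[Complex _ 0]/(RtoC _) -!RtoC_nat -RtoCM divfK//.
Qed.

Lemma nrm_natM (n : nat) (h : C) : nrm (n%:R * h) = n%:R * nrm h.
Proof. by rewrite nrmM -RtoC_nat nrm_RtoC ger0_norm. Qed.

Section Flow.
Variables (D : set C) (E : C -> C -> V -> V) (B K1 K2 gam th del : R).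
Hypothesis AF : almost_flow D E B K1 K2 gam th del.
Hypothesis SS : small_step K1 K2 gam th del.
Local Notation K3 := (K3c K1 gam).
Local Notation K4 := (K4c K2 th).
Local Notation q := (qth th).

Let K10 := af_K1 AF.
Let K20 := af_K2 AF.
Let del0 : 0 < del. Proof. by have /andP[] := af_del AF. Qed.
Let gam0 : 0 < gam. Proof. by have /andP[] := af_gam AF. Qed.
Let th1 : 1 < th := af_th AF.
Let th0 : 0 < th. Proof. by have := th1; lra. Qed.
Let thg : gam < th. Proof. by have /andP[] := af_gam AF. Qed.

Let r01 : 0 < (2 / 3 : R) `^ gam < 1. Proof. exact: pow23_lt1. Qed.
Lemma q01 : 0 < q < 1. Proof. by apply: pow23_lt1; have := th1; lra. Qed.
Lemma K4_ge0 : 0 <= K4.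
Proof. by have /andP[_ q1] := q01; rewrite divr_ge0 ?mulr_ge0// subr_ge0 ltW. Qed.
Lemma K3_ge : 1 + K1 <= K3.
Proof.
have /andP[? ?] := r01; rewrite ler_pdivlMr ?subr_gt0//.
by rewrite ler_piMr ?addr_ge0//; lra.
Qed.
Let K40 := K4_ge0.
Let K30 : 0 <= K3. Proof. by have := K3_ge; have := K10; lra. Qed.
Let powle (x y p : R) : 0 <= p -> 0 <= x <= y -> x `^ p <= y `^ p.
Proof. by move=> p0 /andP[x0 xy]; apply: ge0_ler_powR; rewrite ?nnegrE// (le_trans x0). Qed.

Lemma move_small : (1 + K1) * del `^ gam <= 1.
Proof.
exact: le_trans (ler_wpM2r (powR_ge0 _ _) K3_ge) (ss_K3 SS).
Qed.

(** The map [E t s - id] is small on the ball of radius [B + 4] by [af_move]; Cauchy's estimate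
    turns this into a Lipschitz bound on the ball of radius [B + 3], although no bound on
    derivatives is assumed. *)
Lemma E_lip t s v w : D t -> D s -> nrm (t - s) <= del -> nrm v <= B + 3 -> nrm w <= B + 3 ->
  nrm (E t s v - E t s w) <= (1 + 24 * K1 * nrm (t - s) `^ gam) * nrm (v - w).
Proof.
move=> Dt Ds ts hv hw.
have := @ball_lip_row R _ l (B + 3) (K1 * nrm (t - s) `^ gam) (fun v => E t s v - v) v w.
have -> : B + 3 + 1 = B + 4 by ring.
move=> /(_ _ hv hw) H.
have {}H : nrm (E t s v - v - (E t s w - w)) <= 24 * (K1 * nrm (t - s) `^ gam) * nrm (v - w).
  apply: H => u hu; split; last exact: af_move AF _ _ _ _ _ _ _.
  by have d1 := af_diff AF u Dt Ds; apply: (differentiableB d1).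
have -> : E t s v - E t s w = (v - w) + (E t s v - v - (E t s w - w)).
  by apply/rowP => j; rewrite !mxE; ring.
apply: le_trans (nrmD _ _) _; rewrite mulrDl mul1r lerD2l.
by move: H; rewrite [24 * (K1 * _)]mulrA.
Qed.

Lemma flow_diff k s h v : D s -> D (s + k%:R * h) -> differentiable (flow E k s h) v.
Proof.
elim: k s v => [|k IH] s v Ds Dk; first exact: ex_diff.
have E1 : s + k.+1%:R * h = s + h + k%:R * h by rewrite -nat1r mulrDl mul1r addrA.
have D1 : D (s + h).
  have := @convex_step D s h 1 k.+1 (af_convex AF) (ltn0Sn k) Ds Dk.
  by rewrite mul1r.
have dE := af_diff AF v D1 Ds.
have dF : differentiable (flow E k (s + h) h) (E (s + h) s v).
  by apply: IH; rewrite -?E1.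
exact: (differentiable_comp dE dF).
Qed.

End Flow.
End AlmostFlow.

(** Induction on the number of steps: the chain is cut near its middle, and the errors of the two
    parts are added to one use of [af_cons]. The term with [K3c] is a budget: it guarantees that the
    intermediate values stay in the ball on which [E] is controlled, and it is inherited by both
    parts. *)
Lemma flow_near (R : realType) (l : nat) (D : set (Cplx R))
    (E : Cplx R -> Cplx R -> 'rV[Cplx R]_l -> 'rV[Cplx R]_l)
    (B K1 K2 gam th del : R) (k : nat) (s h : Cplx R) (v : 'rV[Cplx R]_l) :
  almost_flow D E B K1 K2 gam th del -> small_step K1 K2 gam th del -> (0 < k)%N -> D s -> D (s + k%:R * h) ->
  k%:R * nrm h <= del -> nrm v + K3c K1 gam * (k%:R * nrm h) `^ gam <= B + 3 ->
  nrm (flow E k s h v - E (s + k%:R * h) s v) <= K4c K2 th * (k%:R * nrm h) `^ th.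
Proof.
move=> AF SS.
have powle := @powR_mono R.
have K10 := af_K1 AF; have K20 := af_K2 AF; have th1 := af_th AF.
have /andP[gam0 thg] := af_gam AF.
have th0 : 0 < th := lt_trans ltr01 th1.
have r01 := pow23_lt1 gam0; have q1 := q01 AF.
have K31 := K3_ge AF; have K30 : 0 <= K3c K1 gam := le_trans (addr_ge0 ler01 K10) K31.
have K40 := K4_ge0 AF.
set K3 := K3c K1 gam in K31 K30 *; set K4 := K4c K2 th in K40 *; set q := qth th in q1 *.
elim/ltn_ind: k s v => k IH s v k0 Ds Dk kd hv.
have [k1|k2] := leqP k 1.
  have -> : k = 1%N by apply/eqP; rewrite eqn_leq k1.
  by rewrite /= mul1r subrr nrm0 mulr_ge0// powR_ge0.
have [j [m [kE j0 m0 j23 m23]]] := near_halves k2.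
have jk : (j < k)%N by rewrite -kE -addn1 leq_add2l.
have mk : (m < k)%N by rewrite -kE -add1n leq_add2r.
set u := s + j%:R * h; set t := s + k%:R * h.
have tE : t = u + m%:R * h by rewrite /t /u -kE natrD mulrDl addrA.
have Du : D u by apply: (convex_step (af_convex AF) (ltnW jk) Ds).
set x := flow E j s h v.
have [a aE] : exists a, a = j%:R * nrm h by exists (j%:R * nrm h).
have [b bE] : exists b, b = m%:R * nrm h by exists (m%:R * nrm h).
have [c cE] : exists c, c = k%:R * nrm h by exists (k%:R * nrm h).
have abc : a + b = c by rewrite aE bE cE -kE natrD mulrDl.
have nh := nrm_ge0 h.
rewrite -cE in hv kd *.
have a0 : 0 <= a by rewrite aE mulr_ge0.
have b0 : 0 <= b by rewrite bE mulr_ge0.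
have le23 (i : nat) : (3 * i <= 2 * k)%N -> i%:R * nrm h <= 2 / 3 * c.
  rewrite -(ler_nat R) !natrM => h3.
  rewrite cE mulrA; apply: ler_wpM2r => //; clear -h3; lra.
have a23 : a <= 2 / 3 * c by rewrite aE; apply: le23.
have b23 : b <= 2 / 3 * c by rewrite bE; apply: le23.
have c0 : 0 <= c by rewrite -abc addr_ge0.
have ac' : a <= c by rewrite -abc lerDl.
have bc' : b <= c by rewrite -abc lerDr.
have ad : a <= del := le_trans ac' kd.
have bd : b <= del := le_trans bc' kd.
have us : nrm (u - s) = a by rewrite /u addrAC subrr add0r nrm_natM aE.
have tu : nrm (t - u) = b by rewrite tE addrAC subrr add0r nrm_natM bE.
have ts : nrm (t - s) = c by rewrite /t addrAC subrr add0r nrm_natM cE.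
have g0 := ltW gam0.
have cg0 := powR_ge0 c gam.
have ac : a `^ gam <= c `^ gam by apply: powle; rewrite ?a0.
have b23g : b `^ gam <= (2 / 3) `^ gam * c `^ gam.
  by rewrite -powRM//; apply: powle; rewrite ?b0.
have xE : nrm (x - E u s v) <= K4 * a `^ th.
  rewrite aE; apply: IH => //; rewrite -aE//.
  apply: le_trans hv; rewrite lerD2l; exact: ler_wpM2l.
have Ev : nrm (E u s v - v) <= K1 * a `^ gam.
  rewrite -us; apply: (af_move AF) => //; rewrite ?us//.
  by have := mulr_ge0 K30 cg0; clear -hv; lra.
have agam : K4 * a `^ th <= a `^ gam.
  rewrite (@powR_split R a gam th) ?gam0//.
  rewrite mulrA ler_piMl ?powR_ge0//; apply: le_trans (ss_K4 SS).
  apply: ler_wpM2l => //; apply: powle; [by rewrite subr_ge0 ltW|by rewrite a0].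
have xv : nrm (x - v) <= (1 + K1) * c `^ gam.
  have := nrm_tri (E u s v) x v.
  have : (1 + K1) * a `^ gam <= (1 + K1) * c `^ gam by rewrite ler_wpM2l// addr_ge0.
  clear -agam xE Ev; lra.
(* [K3] solves [K3 = (1 + K1) + (2 / 3) ^ gam * K3]: the displacement over the first part and the
   budget of the second fit into the budget of the whole. *)
have K3E : (1 + K1) * c `^ gam + K3 * b `^ gam <= K3 * c `^ gam.
  have -> : 1 + K1 = K3 * (1 - (2 / 3) `^ gam).
    by rewrite /K3c divfK// subr_eq0 gt_eqF//; have /andP[] := r01.
  have : K3 * b `^ gam <= K3 * ((2 / 3) `^ gam * c `^ gam) by rewrite ler_wpM2l.
  clear; lra.
have hx : nrm x + K3 * b `^ gam <= B + 3.
  by have := nrm_shift x v; clear -xv K3E hv; lra.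
have K3b : 0 <= K3 * b `^ gam by rewrite mulr_ge0// powR_ge0.
have flE : flow E k s h v = flow E m u h x by rewrite -kE flowD.
rewrite flE.
have fl : nrm (flow E m u h x - E t u x) <= K4 * b `^ th.
  by rewrite tE bE; apply: IH => //; rewrite -?tE -?bE.
have El : nrm (E t u x - E t u (E u s v)) <= (1 + 24 * K1 * del `^ gam) * (K4 * a `^ th).
  have Evb : nrm (E u s v) <= B + 3.
    have := nrm_shift (E u s v) v.
    have K13 : K1 <= K3 by apply: le_trans K31; rewrite lerDr.
    have := ler_pM K10 (powR_ge0 a gam) K13 ac.
    clear -hv Ev; lra.
  apply: (le_trans (E_lip AF Dk Du _ _ _)) => //; rewrite ?tu//; first by clear -hx K3b; lra.
  apply: ler_pM => //.
    exact: addr_ge0 ler01 (mulr_ge0 (mulr_ge0 (ler0n R 24) K10) (powR_ge0 b gam)).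
  rewrite lerD2l; apply: ler_wpM2l; first exact: mulr_ge0 (ler0n R 24) K10.
  by apply: powle; rewrite ?b0.
have Ec : nrm (E t u (E u s v) - E t s v) <= K2 * c `^ th.
  rewrite -ts; apply: (af_cons AF) => //; rewrite ?ts ?tu ?us//.
  by have := mulr_ge0 K30 cg0; clear -hv; lra.
(* Here [th > 1] enters: both parts are at most two thirds of the whole, so that splitting gains the
   factor [q < 1]. *)
have abth : a `^ th + b `^ th <= q * c `^ th.
  have P (y : R) : 0 <= y <= 2 / 3 * c -> y `^ th <= y * (q * c `^ (th - 1)).
    move=> /andP[y0 yc].
    have -> : y `^ th = y * y `^ (th - 1).
      rewrite (@powR_split R y 1 th) ?ltr01// powRr1//; ring.
    apply: ler_wpM2l => //; rewrite /qth -powRM//.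
    by apply: powle; [by rewrite subr_ge0 ltW|by rewrite y0].
  have -> : q * c `^ th = (a + b) * (q * c `^ (th - 1)).
    by rewrite abc (@powR_split R c 1 th) ?ltr01// powRr1//; ring.
  by rewrite [leRHS]mulrDl; apply: lerD; apply: P; rewrite ?a0 ?b0.
have tot : nrm (flow E m u h x - E t s v) <= (1 + 24 * K1 * del `^ gam) * K4 * (a `^ th + b `^ th) + K2 * c `^ th.
  have := nrm_tri (E t u x) (flow E m u h x) (E t s v).
  have := nrm_tri (E t u (E u s v)) (E t u x) (E t s v).
  have := mulr_ge0 (mulr_ge0 (mulr_ge0 (ler0n R 24) K10) (powR_ge0 del gam)) (mulr_ge0 K40 (powR_ge0 b th)).
  clear -El Ec fl; lra.
apply: (le_trans tot).
have L0 : 0 <= (1 + 24 * K1 * del `^ gam) * K4.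
  exact: mulr_ge0 (addr_ge0 ler01 (mulr_ge0 (mulr_ge0 (ler0n R 24) K10) (powR_ge0 del gam))) K40.
have s1 : (1 + 24 * K1 * del `^ gam) * K4 * (a `^ th + b `^ th) <=
    (1 + 24 * K1 * del `^ gam) * K4 * (q * c `^ th) by exact: ler_wpM2l.
have s2 : (1 + 24 * K1 * del `^ gam) * q * (K4 * c `^ th) <= (1 + q) / 2 * (K4 * c `^ th).
  by apply: ler_wpM2r (ss_lip SS); rewrite mulr_ge0// powR_ge0.
(* The definition of [K4] read backwards: the share [(1 - q) / 2] left over by [ss_lip] pays exactly
   for the consistency error [K2]. *)
have K2E : K2 = K4 * (1 - q) / 2.
  by rewrite /K4 /K4c -/q; field; rewrite subr_eq0 gt_eqF//; have /andP[] := q1.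
rewrite [in leLHS]K2E; clear -s1 s2; lra.
Qed.

Lemma inv_rate (R : realType) (A p e : R) : 0 <= A -> 0 < p -> 0 < e ->
  exists n : nat, forall m, (n <= m)%N -> A * (m.+1%:R^-1) `^ p <= e.
Proof.
move=> A0 p0 e0; have [d d0 hd] := powR_small A0 p0 e0.
exists (Num.truncn d^-1) => m nm; apply: hd; rewrite invr_ge0 ler0n /=.
have h := truncnS_gt d^-1.
have h2 : d^-1 <= m.+1%:R by apply: le_trans (ltW h) _; rewrite ler_nat ltnS.
by rewrite -[leRHS]invrK lef_pV2 ?posrE ?ltr0n ?invr_gt0.
Qed.

(** The left side is the total of [n + 1] errors, one for each piece of length [c / (n + 1)]; by
    [inv_rate] the right side tends to zero. *)
Lemma powR_divn (R : realType) (c th : R) (n : nat) : 0 <= c -> 1 < th ->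
  n.+1%:R * (c / n.+1%:R) `^ th = c `^ th * (n.+1%:R^-1) `^ (th - 1).
Proof.
move=> c0 th1; rewrite powRM ?invr_ge0//.
rewrite (@powR_split R n.+1%:R^-1 1 th) ?ltr01 ?invr_ge0// powRr1 ?invr_ge0//.
by field; rewrite nat1r pnatr_eq0.
Qed.

Section FlowClaims.
Variables (R : realType) (l : nat).
Local Notation C := (Cplx R).
Local Notation V := 'rV[C]_l.

Lemma E_move_le (D : set C) (E : C -> C -> V -> V) (B K1 K2 gam th del : R)
    (c : R) (u v w : V) : almost_flow D E B K1 K2 gam th del ->
  small_step K1 K2 gam th del -> 0 <= c <= del ->
  nrm (w - u) <= K4c K2 th * c `^ th -> nrm (u - v) <= K1 * c `^ gam ->
  nrm (w - v) <= (1 + K1) * c `^ gam.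
Proof.
move=> AF SS /andP[c0 cd] h1 h2.
have /andP[g0 gt] := af_gam AF.
have K40 := K4_ge0 AF.
have h3 : K4c K2 th * c `^ th <= c `^ gam.
  rewrite (@powR_split R c gam th) ?g0// mulrA ler_piMl ?powR_ge0//.
  apply: le_trans (ss_K4 SS); apply: ler_wpM2l => //.
  by apply: powR_mono; [rewrite subr_ge0 ltW|rewrite c0].
have := nrm_tri u w v; lra.
Qed.

Lemma flow_near2 (D : set C) (E : C -> C -> V -> V) (B K1 K2 gam th del : R)
    k s h v : almost_flow D E B K1 K2 gam th del ->
  small_step K1 K2 gam th del -> (0 < k)%N -> D s -> D (s + k%:R * h) ->
  k%:R * nrm h <= del -> nrm v <= B + 2 ->
  nrm (flow E k s h v - E (s + k%:R * h) s v) <= K4c K2 th * (k%:R * nrm h) `^ th.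
Proof.
move=> AF SS k0 Ds Dk kd hv; apply: (flow_near AF SS) => //.
have : K3c K1 gam * (k%:R * nrm h) `^ gam <= 1.
  apply: le_trans (ss_K3 SS); apply: ler_wpM2l.
    by apply: le_trans (K3_ge AF); rewrite addr_ge0// (af_K1 AF).
  apply: powR_mono; last by rewrite kd mulr_ge0.
  by have /andP[/ltW] := af_gam AF.
clear -hv; lra.
Qed.

Lemma flow_move (D : set C) (E : C -> C -> V -> V) (B K1 K2 gam th del : R)
    k s h v : almost_flow D E B K1 K2 gam th del ->
  small_step K1 K2 gam th del -> D s -> D (s + k%:R * h) ->
  k%:R * nrm h <= del -> nrm v <= B + 2 ->
  nrm (flow E k s h v - v) <= (1 + K1) * (k%:R * nrm h) `^ gam.
Proof.
move=> AF SS Ds Dk kd hv; have K10 := af_K1 AF.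
have [->|k0] := posnP k.
  by rewrite /= subrr nrm0 mulr_ge0 ?powR_ge0// addr_ge0.
apply: (E_move_le AF SS _ (flow_near2 AF SS k0 Ds Dk kd hv)).
  by rewrite kd mulr_ge0.
have E1 : nrm (s + k%:R * h - s) = k%:R * nrm h by rewrite addrAC subrr add0r nrm_natM.
rewrite -E1; apply: (af_move AF) => //; rewrite ?E1//.
by apply: le_trans hv _; rewrite lerD2l ler_nat.
Qed.

Lemma small_move (D : set C) (E : C -> C -> V -> V) (B K1 K2 gam th del c : R) :
  almost_flow D E B K1 K2 gam th del ->
  small_step K1 K2 gam th del -> 0 <= c <= del -> (1 + K1) * c `^ gam <= 1.
Proof.
move=> AF SS cd; apply: le_trans (move_small AF SS).
apply: ler_wpM2l; first by rewrite addr_ge0// (af_K1 AF).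
by apply: powR_mono => //; have /andP[/ltW] := af_gam AF.
Qed.

(** Multiplying the Lipschitz constants of the steps could diverge as the mesh tends to zero.
    Instead Cauchy's estimate is applied to the composition minus the single step, which is small by
    [flow_near2]; the result does not depend on the number of steps. *)
Lemma flow_lip (D : set C) (E : C -> C -> V -> V) (B K1 K2 gam th del : R)
    k s h v w : almost_flow D E B K1 K2 gam th del ->
  small_step K1 K2 gam th del -> D s -> D (s + k%:R * h) ->
  k%:R * nrm h <= del -> nrm v <= B + 1 -> nrm w <= B + 1 ->
  nrm (flow E k s h v - flow E k s h w) <= 2 * nrm (v - w).
Proof.
move=> AF SS Ds Dk kd hv hw.
have [->|k0] := posnP k; first by rewrite ler_peMl// ler1n.
set t := s + k%:R * h.
have ts : nrm (t - s) = k%:R * nrm h by rewrite /t addrAC subrr add0r nrm_natM.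
have K10 := af_K1 AF; have K40 := K4_ge0 AF.
have /andP[g0 gt] := af_gam AF; have th0 := lt_trans ltr01 (af_th AF).
have kd' : 0 <= k%:R * nrm h <= del by rewrite kd mulr_ge0.
have B12 : B + 1 + 1 = B + 2 by rewrite -addrA.
have H : nrm (flow E k s h v - E t s v - (flow E k s h w - E t s w)) <=
    24 * (K4c K2 th * del `^ th) * nrm (v - w).
  apply: (@ball_lip_row R V l (B + 1) _ (fun v => flow E k s h v - E t s v) v w _ hv hw) => u hu.
  rewrite B12 in hu; split.
    have d1 := flow_diff AF u Ds Dk; have d2 := af_diff AF u Dk Ds.
    exact: (differentiableB d1 d2).
  apply: le_trans (flow_near2 AF SS k0 Ds Dk kd hu) _.
  apply: ler_wpM2l => //; apply: powR_mono => //; exact: ltW.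
have B13 (u : V) : nrm u <= B + 1 -> nrm u <= B + 3.
  by move=> hu; apply: le_trans hu _; rewrite lerD2l ler1n.
have tsd : nrm (t - s) <= del by rewrite ts.
have L := E_lip AF Dk Ds tsd (B13 _ hv) (B13 _ hw).
have M : (1 + 24 * K1 * nrm (t - s) `^ gam) * nrm (v - w) <= (1 + 24 * K1 * del `^ gam) * nrm (v - w).
  apply: ler_wpM2r => //; rewrite lerD2l; apply: ler_wpM2l; first exact: mulr_ge0 (ler0n R 24) K10.
  by rewrite ts; apply: powR_mono => //; exact: ltW.
have S := ler_wpM2r (nrm_ge0 (v - w)) (ss_sum SS).
have -> : flow E k s h v - flow E k s h w =
  (E t s v - E t s w) + (flow E k s h v - E t s v - (flow E k s h w - E t s w)).
  by apply/rowP => j; rewrite !mxE; ring.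
apply: le_trans (nrmD _ _) _.
move: H L M S; clear.
set a := nrm (_ - _ - (_ - _)); set b := nrm (E t s v - E t s w); set e := nrm (v - w).
lra.
Qed.

Lemma D_step (D : set C) s h n : convexC D -> D s -> D (s + n.+1%:R * h) -> D (s + h).
Proof.
move=> cD Ds Dn; have := @convex_step R D s h 1 n.+1 cD (ltn0Sn n) Ds Dn.
by rewrite mul1r.
Qed.

Lemma stepS (s h : C) n : s + n.+1%:R * h = s + h + n%:R * h.
Proof. by rewrite -nat1r mulrDl mul1r addrA. Qed.

(** Each error is carried to the end by one whole composition, at the cost of the factor 2 of
    [flow_lip], so that errors add up instead of growing exponentially. *)
Lemma flow_shadow (D : set C) (E : C -> C -> V -> V) (B K1 K2 gam th del e : R)
    n s h (x : nat -> V) : almost_flow D E B K1 K2 gam th del ->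
  small_step K1 K2 gam th del -> 0 <= e -> D s -> D (s + n%:R * h) ->
  n%:R * nrm h <= del -> (forall k, (k <= n)%N -> nrm (x k) <= B) ->
  (forall k, (k < n)%N ->
    nrm (x k.+1 - E (s + k.+1%:R * h) (s + k%:R * h) (x k)) <= e) ->
  nrm (x n - flow E n s h (x 0%N)) <= 2 * n%:R * e.
Proof.
move=> AF SS e0; elim: n s x => [|n IH] s x Ds Dn nd xB xE.
  by rewrite /= subrr nrm0 mulr0 mul0r.
have D1 := D_step (af_convex AF) Ds Dn.
rewrite stepS in Dn.
have nd1 : n%:R * nrm h <= del.
  by apply: le_trans nd; apply: ler_wpM2r => //; rewrite ler_nat.
have h1 : nrm h <= del.
  by apply: le_trans nd; rewrite ler_peMl// ler1n.
have I := IH (s + h) (fun k => x k.+1) D1 Dn nd1 _ _.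
have {}I : nrm (x n.+1 - flow E n (s + h) h (x 1%N)) <= 2 * n%:R * e.
  by apply: I => k kn; [exact: xB|rewrite -!stepS; exact: xE].
have x1 : nrm (x 1%N - E (s + h) s (x 0%N)) <= e.
  by have := xE 0%N (ltn0Sn _); rewrite mul1r mul0r addr0.
have hsh : nrm (s + h - s) = nrm h by rewrite addrAC subrr add0r.
have K10 := af_K1 AF.
have xB0 := xB 0%N (leq0n _).
have Ex : nrm (E (s + h) s (x 0%N)) <= B + 1.
  have m1 : nrm (E (s + h) s (x 0%N) - x 0%N) <= K1 * nrm h `^ gam.
    rewrite -hsh; apply: (af_move AF) => //; rewrite ?hsh//.
    by apply: le_trans xB0 _; rewrite lerDl.
  have m2 := @small_move D E B K1 K2 gam th del (nrm h) AF SS.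
  have {}m2 : (1 + K1) * nrm h `^ gam <= 1 by apply: m2; rewrite nrm_ge0.
  have m3 := powR_ge0 (nrm h) gam.
  have := nrm_shift (E (s + h) s (x 0%N)) (x 0%N).
  move: m1 m2 m3 xB0; clear; lra.
have xB1 : nrm (x 1%N) <= B + 1.
  by apply: le_trans (xB 1%N _) _ => //; rewrite lerDl.
have F := flow_lip AF SS D1 Dn nd1 xB1 Ex.
rewrite /=.
have := nrm_tri (flow E n (s + h) h (x 1%N)) (x n.+1) (flow E n (s + h) h (E (s + h) s (x 0%N))).
rewrite -natr1.
move: I x1 F; clear; lra.
Qed.

(** The fine chain, observed at the coarse times, follows [E] with the error of [flow_near2] on one
    coarse step, and [flow_shadow] adds up these errors. *)
Lemma flow_refine (D : set C) (E : C -> C -> V -> V) (B K1 K2 gam th del : R)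
    n m s t v : almost_flow D E B K1 K2 gam th del ->
  small_step K1 K2 gam th del -> D s -> D t -> nrm (t - s) <= del -> nrm v <= B - 1 ->
  nrm (flow E (n.+1 * m.+1) s ((t - s) / (n.+1 * m.+1)%:R) v
       - flow E n.+1 s ((t - s) / n.+1%:R) v) <=
  2 * (K4c K2 th * del `^ th * (n.+1%:R^-1) `^ (th - 1)).
Proof.
move=> AF SS Ds Dt ts hv.
set h' := (t - s) / (n.+1 * m.+1)%:R; set h := (t - s) / n.+1%:R.
have n0 : n.+1%:R != 0 :> C by rewrite pnatr_eq0.
have m0 : m.+1%:R != 0 :> C by rewrite pnatr_eq0.
have hh' : m.+1%:R * h' = h by rewrite /h' /h natrM; field; rewrite !nat1r n0.
have nh : n.+1%:R * h = t - s by rewrite /h mulrC divfK.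
have tE : s + n.+1%:R * h = t by rewrite nh addrC subrK.
have Dk k : (k <= n.+1)%N -> D (s + k%:R * h).
  by move=> kn; apply: (convex_step (af_convex AF) kn Ds); rewrite tE.
have nnh : n.+1%:R * nrm h = nrm (t - s) by rewrite -nrm_natM nh.
have hd : nrm h <= del.
  by apply: le_trans ts; rewrite -nnh ler_peMl// ler1n.
pose x k := flow E (k * m.+1) s h' v.
have kh' k : (k * m.+1)%:R * h' = k%:R * h by rewrite natrM -mulrA hh'.
have nkh' k : (k * m.+1)%:R * nrm h' = k%:R * nrm h.
  by rewrite -!nrm_natM kh'.
have K10 := af_K1 AF; have K40 := K4_ge0 AF; have th1 := af_th AF.
have hv2 : nrm v <= B + 2 by apply: le_trans hv _; rewrite lerD2l; lra.
have xB k : (k <= n.+1)%N -> nrm (x k) <= B.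
  move=> kn; have kd : k%:R * nrm h <= del.
    by apply: le_trans ts; rewrite -nnh ler_wpM2r// ler_nat.
  have Dk' := Dk k kn; rewrite -kh' in Dk'; rewrite -nkh' in kd.
  have M := flow_move AF SS Ds Dk' kd hv2.
  have S := @small_move D E B K1 K2 gam th del ((k * m.+1)%:R * nrm h') AF SS.
  have {}S : (1 + K1) * ((k * m.+1)%:R * nrm h') `^ gam <= 1.
    by apply: S; rewrite kd mulr_ge0.
  have := nrm_shift (x k) v; rewrite -/(x k) in M.
  move: M S hv; clear; lra.
have xE k : (k < n.+1)%N -> nrm (x k.+1 - E (s + k.+1%:R * h) (s + k%:R * h) (x k)) <=
    K4c K2 th * nrm h `^ th.
  move=> kn; have Dk1 := Dk k (ltnW kn); have Dk2 := Dk k.+1 kn.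
  have e1 : s + k.+1%:R * h = s + k%:R * h + m.+1%:R * h'.
    by rewrite hh' stepS addrAC.
  have e2 : x k.+1 = flow E m.+1 (s + k%:R * h) h' (x k).
    by rewrite /x mulSn addnC flowD kh'.
  have e3 : m.+1%:R * nrm h' = nrm h by rewrite -nrm_natM hh'.
  rewrite e1 e2 -e3; apply: (flow_near2 AF SS) => //; rewrite -?e1 ?e3//.
  by apply: le_trans (xB k (ltnW kn)) _; rewrite lerDl.
have := @flow_shadow D E B K1 K2 gam th del (K4c K2 th * nrm h `^ th) n.+1 s h x AF SS.
rewrite {1}/x => /(_ _ Ds _ _ xB xE) H.
apply: (le_trans (H _ _ _)).
- by rewrite mulr_ge0// powR_ge0.
- by rewrite tE.
- by rewrite nnh.
have nhE : nrm h = nrm (t - s) / n.+1%:R.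
  by rewrite -nnh mulrC mulKf// pnatr_eq0.
have P := @powR_divn R (nrm (t - s)) th n (nrm_ge0 _) th1.
rewrite -nhE in P.
have -> : 2 * n.+1%:R * (K4c K2 th * nrm h `^ th) = 2 * (K4c K2 th * (n.+1%:R * nrm h `^ th)) by ring.
rewrite P ler_wpM2l// mulrA ler_wpM2r ?powR_ge0// ler_wpM2l//.
by apply: powR_mono; [lra|rewrite ts nrm_ge0].
Qed.

Lemma flow_limit (D : set C) (E : C -> C -> V -> V) (B K1 K2 gam th del : R)
    s t v : almost_flow D E B K1 K2 gam th del ->
  small_step K1 K2 gam th del -> D s -> D t -> nrm (t - s) <= del -> nrm v <= B - 1 ->
  exists z, forall n, nrm (flow E n.+1 s ((t - s) / n.+1%:R) v - z) <=
  4 * (K4c K2 th * del `^ th * (n.+1%:R^-1) `^ (th - 1)).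
Proof.
move=> AF SS Ds Dt ts hv.
have K40 := K4_ge0 AF; have th1 := af_th AF.
have A0 : 0 <= 4 * (K4c K2 th * del `^ th).
  exact: mulr_ge0 (ler0n R 4) (mulr_ge0 K40 (powR_ge0 _ _)).
have th10 : 0 < th - 1 by lra.
apply: row_complete => [m n mn|e e0]; last first.
  have [n hn] := inv_rate A0 th10 e0; exists n; rewrite mulrA; exact: hn.
(* Two subdivisions are compared through their common refinement. *)
have r1 := flow_refine n m AF SS Ds Dt ts hv.
have r2 := flow_refine m n AF SS Ds Dt ts hv.
rewrite mulnC in r2.
have r3 : K4c K2 th * del `^ th * n.+1%:R^-1 `^ (th - 1) <=
    K4c K2 th * del `^ th * m.+1%:R^-1 `^ (th - 1).
  apply: ler_wpM2l; first by rewrite mulr_ge0// powR_ge0.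
  apply: powR_mono; first exact: ltW.
  by rewrite invr_ge0 ler0n/= lef_pV2 ?posrE ?ltr0n// ler_nat ltnS.
have := nrm_tri (flow E (n.+1 * m.+1) s ((t - s) / (n.+1 * m.+1)%:R) v)
  (flow E n.+1 s ((t - s) / n.+1%:R) v) (flow E m.+1 s ((t - s) / m.+1%:R) v).
rewrite (nrmBC (flow E n.+1 _ _ _) (flow E (n.+1 * m.+1) _ _ _)).
move: r1 r2 r3; clear; lra.
Qed.

End FlowClaims.

(** * Paths that satisfy Davie's estimate *)

Section Davie.
Variables (R : realType) (l : nat).
Local Notation C := (Cplx R).
Local Notation V := 'rV[C]_l.

(* Davie's form of the statement that [y] is driven by [E] on [S], for
   [nu > 1]. *)
Definition davie (S : set C) (E : C -> C -> V -> V) (y : C -> V) (c nu : R) : Prop :=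
  forall a b, S a -> S b -> nrm (y b - E b a (y a)) <= c * nrm (b - a) `^ nu.

Lemma segE (s t : C) (tau : R) : seg s t tau = s + RtoC tau * (t - s).
Proof. by []. Qed.

Lemma seg0 (s t : C) : seg s t 0 = s.
Proof. by rewrite segE RtoC0 mul0r addr0. Qed.

Lemma seg1 (s t : C) : seg s t 1 = t.
Proof. by rewrite segE RtoC1 mul1r addrC subrK. Qed.

Lemma seg_dist (s t : C) (a b : R) : nrm (seg s t b - seg s t a) = `|b - a| * nrm (t - s).
Proof.
rewrite !segE.
have -> : s + RtoC b * (t - s) - (s + RtoC a * (t - s)) = RtoC (b - a) * (t - s).
  by rewrite RtoCD RtoCN; ring.
by rewrite nrmM nrm_RtoC.
Qed.

Lemma seg_seg (s t : C) (a b : R) : seg s (seg s t a) b = seg s t (b * a).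
Proof. by rewrite !segE RtoCM; ring. Qed.

Lemma seg_natdiv (s t : C) (n k : nat) :
  s + k%:R * ((t - s) / n.+1%:R) = seg s t (k%:R / n.+1%:R).
Proof. by rewrite segE RtoCM RtoCV !RtoC_nat; ring. Qed.

Lemma natdiv01 (n k : nat) : (k <= n.+1)%N -> 0 <= (k%:R / n.+1%:R : R) <= 1.
Proof.
by move=> kn; rewrite divr_ge0//= ler_pdivrMr ?ltr0n// mul1r ler_nat.
Qed.

Lemma nrm_divn (x : C) n : nrm (x / n.+1%:R) = nrm x / n.+1%:R.
Proof. by rewrite nrmM nrmV -RtoC_nat nrm_RtoC ger0_norm. Qed.

Lemma flow_follow_eps (D : set C) (E : C -> C -> V -> V) (B K1 K2 gam th del : R)
    (e : R) n s t (y : C -> V) : almost_flow D E B K1 K2 gam th del ->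
  small_step K1 K2 gam th del -> 0 <= e -> D s -> D t -> nrm (t - s) <= del ->
  (forall tau : R, 0 <= tau <= 1 -> nrm (y (seg s t tau)) <= B) ->
  (forall a b : R, 0 <= a <= 1 -> 0 <= b <= 1 ->
     nrm (seg s t b - seg s t a) = nrm (t - s) / n.+1%:R ->
     nrm (y (seg s t b) - E (seg s t b) (seg s t a) (y (seg s t a))) <= e) ->
  nrm (y t - flow E n.+1 s ((t - s) / n.+1%:R) (y s)) <= 2 * n.+1%:R * e.
Proof.
move=> AF SS e0 Ds Dt ts yB yE; set h := (t - s) / n.+1%:R.
have tE : s + n.+1%:R * h = t by rewrite seg_natdiv divff ?pnatr_eq0// seg1.
pose x k := y (s + k%:R * h).
have -> : y s = x 0%N by rewrite /x mul0r addr0.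
have -> : y t = x n.+1 by rewrite /x tE.
apply: (flow_shadow AF SS e0 Ds); rewrite ?tE//.
- by rewrite nrm_divn mulrC divfK// pnatr_eq0.
- by move=> k kn; rewrite /x seg_natdiv; apply: yB; apply: natdiv01.
- move=> k kn; rewrite /x !seg_natdiv; apply: yE; rewrite ?natdiv01//.
    exact: ltnW.
  rewrite seg_dist -mulrBl -natr1 addrAC subrr add0r mul1r ger0_norm ?invr_ge0//.
  by rewrite mulrC.
Qed.

(** With [n + 1] pieces the errors allowed by [c] and [nu] total a multiple of [(n + 1) ^ (1 - nu)]
    and vanish in the limit, while the composition stays within the bound [K4c] of the single step
    for every [n]. So [c] and [nu] disappear from the conclusion. *)
Lemma flow_follow (D : set C) (E : C -> C -> V -> V) (B K1 K2 gam th del : R)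
    (S : set C) (c nu : R) s t (y : C -> V) : almost_flow D E B K1 K2 gam th del ->
  small_step K1 K2 gam th del -> S `<=` D -> convexC S -> davie S E y c nu ->
  1 < nu -> 0 <= c -> S s -> S t -> nrm (t - s) <= del ->
  (forall tau : R, 0 <= tau <= 1 -> nrm (y (seg s t tau)) <= B) ->
  nrm (y t - E t s (y s)) <= K4c K2 th * nrm (t - s) `^ th.
Proof.
move=> AF SS SD cS yS nu1 c0 Ss St ts yB.
have F n : nrm (y t - flow E n.+1 s ((t - s) / n.+1%:R) (y s)) <=
    2 * (c * nrm (t - s) `^ nu) * n.+1%:R^-1 `^ (nu - 1).
  have -> : 2 * (c * nrm (t - s) `^ nu) * n.+1%:R^-1 `^ (nu - 1) =
      2 * n.+1%:R * (c * (nrm (t - s) / n.+1%:R) `^ nu).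
    rewrite [RHS](_ : _ = 2 * (c * (n.+1%:R * (nrm (t - s) / n.+1%:R) `^ nu))); last by ring.
    by rewrite powR_divn//; ring.
  apply: (flow_follow_eps AF SS); rewrite ?mulr_ge0 ?powR_ge0//; try exact: SD.
  by move=> a b ha hb <-; apply: yS; apply: cS.
apply: le_of_forall_eps => e e0.
have A0 : 0 <= 2 * (c * nrm (t - s) `^ nu).
  exact: mulr_ge0 (ler0n R 2) (mulr_ge0 c0 (powR_ge0 _ _)).
have nu10 : 0 < nu - 1 by rewrite subr_gt0.
have [n hn] := inv_rate A0 nu10 e0.
have tE : s + n.+1%:R * ((t - s) / n.+1%:R) = t.
  by rewrite seg_natdiv divff ?pnatr_eq0// seg1.
have nE : n.+1%:R * nrm ((t - s) / n.+1%:R) = nrm (t - s).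
  by rewrite nrm_divn mulrC divfK// pnatr_eq0.
have ysB : nrm (y s) <= B + 2.
  by have := yB 0; rewrite lexx ler01 seg0 => /(_ isT) h; apply: le_trans h _; rewrite lerDl.
have := @flow_near2 R l D E B K1 K2 gam th del n.+1 s ((t - s) / n.+1%:R) (y s) AF SS isT (SD _ Ss).
rewrite tE nE => /(_ (SD _ St) ts ysB) G.
have := nrm_tri (flow E n.+1 s ((t - s) / n.+1%:R) (y s)) (y t) (E t s (y s)).
by move: G (hn n (leqnn n)) (F n); clear; lra.
Qed.

Lemma follow_move (D : set C) (E : C -> C -> V -> V) (B K1 K2 gam th del : R)
    s t (y : C -> V) : almost_flow D E B K1 K2 gam th del ->
  small_step K1 K2 gam th del -> D s -> D t -> nrm (t - s) <= del ->
  nrm (y s) <= B + 4 ->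
  nrm (y t - E t s (y s)) <= K4c K2 th * nrm (t - s) `^ th ->
  nrm (y t - y s) <= (1 + K1) * nrm (t - s) `^ gam /\ nrm (y t - y s) <= 1.
Proof.
move=> AF SS Ds Dt ts ys yt.
have c01 : 0 <= nrm (t - s) <= del by rewrite ts nrm_ge0.
have M : nrm (y t - y s) <= (1 + K1) * nrm (t - s) `^ gam.
  by apply: (E_move_le AF SS c01 yt); apply: (af_move AF).
by split => //; apply: le_trans M (small_move AF SS c01).
Qed.

(** A continuity argument along the segment. As far as the bound [B] holds, [flow_follow] improves
    it to [B - 1]; the Hoelder bound lets the path drift by at most 1 over the next fraction
    [1 / (n + 1)] of the segment, so the bound [B] extends to it. *)
Lemma flow_trapped (D : set C) (E : C -> C -> V -> V) (B K1 K2 gam th del : R)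
    (c nu H kap : R) s t (y : C -> V) : almost_flow D E B K1 K2 gam th del ->
  small_step K1 K2 gam th del -> davie D E y c nu -> 1 < nu -> 0 <= c ->
  0 <= H -> 0 < kap ->
  (forall a b, D a -> D b -> nrm (y b - y a) <= H * nrm (b - a) `^ kap) ->
  D s -> D t -> nrm (t - s) <= del -> nrm (y s) <= B - 2 ->
  forall tau : R, 0 <= tau <= 1 -> nrm (y (seg s t tau)) <= B.
Proof.
move=> AF SS yD nu1 c0 H0 kap0 yH Ds Dt ts ysB.
have Dseg (tau : R) : 0 <= tau <= 1 -> D (seg s t tau) by exact: (af_convex AF).
have A0 : 0 <= H * nrm (t - s) `^ kap by rewrite mulr_ge0// powR_ge0.
have [n /(_ n (leqnn n)) hn] := inv_rate A0 kap0 ltr01.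
have n0 : 0 < (n.+1%:R : R) by rewrite ltr0n.
suff P m : forall tau : R, 0 <= tau <= 1 -> tau <= m%:R / n.+1%:R ->
    nrm (y (seg s t tau)) <= B.
  by move=> tau htau; apply: (P n.+1) => //; rewrite divff ?gt_eqF//; case/andP: htau.
elim: m => [|m IH] tau /andP[t0 t1].
  rewrite mul0r => t00; have -> : tau = 0 by apply/eqP; rewrite eq_le t00.
  by rewrite seg0; apply: le_trans ysB _; rewrite lerBlDr lerDl.
move=> htau; have [tm|mt] := leP tau (m%:R / n.+1%:R); first by apply: IH; rewrite ?t0.
set sg := m%:R / n.+1%:R in IH mt.
have s01 : 0 <= sg <= 1 by rewrite divr_ge0//= ltW// (lt_le_trans mt).
have Dp := Dseg _ s01.
have ps : nrm (seg s t sg - s) <= del.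
  apply: le_trans ts; have := seg_dist s t 0 sg; rewrite seg0 => ->.
  by rewrite subr0 ler_piMl//; case/andP: s01 => ? ?; rewrite ger0_norm.
have F : nrm (y (seg s t sg) - E (seg s t sg) s (y s)) <=
    K4c K2 th * nrm (seg s t sg - s) `^ th.
  apply: (flow_follow AF SS _ (af_convex AF) yD nu1 c0 Ds Dp ps) => // b /andP[b0 b1].
  rewrite seg_seg; case/andP: s01 => s0 s1; apply: IH; first by rewrite mulr_ge0//= mulr_ile1.
  exact: (ler_piMl s0 b1).
have ysB4 : nrm (y s) <= B + 4 by apply: le_trans ysB _; rewrite lerD2l; lra.
have [_ M1] := follow_move AF SS Ds Dp ps ysB4 F.
have M2 : nrm (y (seg s t tau) - y (seg s t sg)) <= 1.
  have Dtau : D (seg s t tau) by apply: Dseg; rewrite t0.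
  apply: le_trans (yH _ _ Dp Dtau) _; apply: le_trans hn.
  rewrite -mulrA; apply: ler_wpM2l => //; rewrite -powRM ?invr_ge0//.
  apply: powR_mono; first exact: ltW.
  rewrite nrm_ge0 /= seg_dist mulrC; apply: ler_wpM2l => //.
  rewrite ger0_norm ?subr_ge0 ?(ltW mt)// lerBlDl.
  by apply: le_trans htau _; rewrite -natr1 mulrDl mul1r.
have := nrm_shift (y (seg s t sg)) (y s).
have := nrm_shift (y (seg s t tau)) (y (seg s t sg)).
by move: M1 M2 ysB; clear; lra.
Qed.

(** The order of the quantifiers is the point: [eta] may depend on [y1], but not on [E2], [y2] or
    the constants of [y2]. This is possible because [flow_follow] replaces [c2] and [nu2] by
    constants of the almost flow. *)
Lemma flow_compare (D : set C) (E1 : C -> C -> V -> V) (B K1 K2 gam th del : R)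
    (c1 nu1 eps : R) (y1 : C -> V) :
  small_step K1 K2 gam th del -> 0 <= K2 -> 1 < th -> davie D E1 y1 c1 nu1 -> 1 < nu1 ->
  0 <= c1 -> 0 < del -> (forall p, D p -> nrm (y1 p) <= B) -> 0 < eps ->
  exists2 eta : R, 0 < eta & forall E2 y2 c2 nu2 H kap s t,
    almost_flow D E2 B K1 K2 gam th del ->
    (forall t s v, D t -> D s -> nrm v <= B -> nrm (E1 t s v - E2 t s v) <= eta) ->
    davie D E2 y2 c2 nu2 -> 1 < nu2 -> 0 <= c2 -> 0 <= H -> 0 < kap ->
    (forall a b, D a -> D b -> nrm (y2 b - y2 a) <= H * nrm (b - a) `^ kap) ->
    D s -> D t -> nrm (t - s) <= del -> nrm (y2 s) <= B - 2 ->
    nrm (y1 t - y2 t) <= 2 * nrm (y1 s - y2 s) + eps.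
Proof.
move=> SS K20 th1 y1D n1 c10 del0 y1B eps0.
have K40 : 0 <= K4c K2 th.
  have /pow23_lt1/andP[_ h] : 0 < th - 1 by rewrite subr_gt0.
  by rewrite divr_ge0 ?mulr_ge0// subr_ge0 ltW.
have A0 : 0 <= 2 * (c1 * del `^ nu1) by exact: mulr_ge0 (ler0n R 2) (mulr_ge0 c10 (powR_ge0 _ _)).
have B0 : 0 <= 2 * (K4c K2 th * del `^ th) by exact: mulr_ge0 (ler0n R 2) (mulr_ge0 K40 (powR_ge0 _ _)).
have nu10 : 0 < nu1 - 1 by rewrite subr_gt0.
have th10 : 0 < th - 1 by rewrite subr_gt0.
have e30 : 0 < eps / 3 by rewrite divr_gt0.
have [na hna] := inv_rate A0 nu10 e30.
have [nb hnb] := inv_rate B0 th10 e30.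
set n := maxn na nb.
have {}hna := hna n (leq_maxl _ _); have {}hnb := hnb n (leq_maxr _ _).
have n0 : 0 < (n.+1%:R : R) by rewrite ltr0n.
(* [n] is fixed first, from the vanishing errors of both paths; then [eta] is so small that [n + 1]
   perturbed steps cost at most [eps / 3]. *)
exists (eps / 3 / (2 * n.+1%:R)); first by rewrite divr_gt0// mulr_gt0.
move=> {}E2 y2 c2 nu2 H kap s t AF EE y2D n2 c20 H0 kap0 y2H Ds Dt ts y2s.
set eta := eps / 3 / (2 * n.+1%:R) in EE *.
have eta0 : 0 < eta by rewrite divr_gt0// mulr_gt0.
have cD := af_convex AF.
have y2B := flow_trapped AF SS y2D n2 c20 H0 kap0 y2H Ds Dt ts y2s.
have le_del (x p : R) : 1 < p -> 0 <= x <= del -> x `^ p <= del `^ p.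
  by move=> p1 hx; apply: powR_mono => //; lra.
have tsd : 0 <= nrm (t - s) <= del by rewrite ts nrm_ge0.
have tn : nrm (t - s) / n.+1%:R <= nrm (t - s).
  by rewrite ler_pdivrMr// ler_peMr// ler1n.
have F1 : nrm (y1 t - flow E2 n.+1 s ((t - s) / n.+1%:R) (y1 s)) <=
    2 * n.+1%:R * (c1 * (nrm (t - s) / n.+1%:R) `^ nu1 + eta).
  apply: (flow_follow_eps AF SS) => //.
  - by rewrite addr_ge0 ?(ltW eta0)// mulr_ge0// powR_ge0.
  - by move=> tau htau; apply: y1B; apply: cD.
  move=> a b ha hb abn.
  have Da : D (seg s t a) by apply: cD.
  have Db : D (seg s t b) by apply: cD.
  have := nrm_tri (E1 (seg s t b) (seg s t a) (y1 (seg s t a))) (y1 (seg s t b)) (E2 (seg s t b) (seg s t a) (y1 (seg s t a))).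
  have := y1D _ _ Da Db; rewrite abn.
  have := EE _ _ _ Db Da (y1B _ Da).
  by clear; lra.
have F2 : nrm (y2 t - flow E2 n.+1 s ((t - s) / n.+1%:R) (y2 s)) <=
    2 * n.+1%:R * (K4c K2 th * (nrm (t - s) / n.+1%:R) `^ th).
  apply: (flow_follow_eps AF SS) => //.
    by rewrite mulr_ge0// powR_ge0.
  move=> a b ha hb abn.
  have Da : D (seg s t a) by apply: cD.
  have Db : D (seg s t b) by apply: cD.
  rewrite -abn; apply: (flow_follow AF SS _ cD y2D n2 c20) => //.
    by rewrite abn (le_trans tn).
  move=> tau /andP[t0 t1].
  have -> : seg (seg s t a) (seg s t b) tau = seg s t ((1 - tau) * a + tau * b).
    by rewrite !segE !RtoCD !RtoCM RtoCD RtoCN RtoC1; ring.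
  apply: y2B; case/andP: ha => a0 a1; case/andP: hb => b0 b1.
  have t1' : 0 <= 1 - tau by rewrite subr_ge0.
  rewrite addr_ge0 ?mulr_ge0//=.
  have := ler_wpM2l t1' a1; have := ler_wpM2l t0 b1; lra.
have P1 := @powR_divn R (nrm (t - s)) nu1 n (nrm_ge0 _) n1.
have P2 := @powR_divn R (nrm (t - s)) th n (nrm_ge0 _) th1.
have Q1 : 2 * n.+1%:R * (c1 * (nrm (t - s) / n.+1%:R) `^ nu1 + eta) <= eps / 3 + eps / 3.
  have -> : 2 * n.+1%:R * (c1 * (nrm (t - s) / n.+1%:R) `^ nu1 + eta) =
    2 * (c1 * (n.+1%:R * (nrm (t - s) / n.+1%:R) `^ nu1)) + 2 * n.+1%:R * eta by ring.
  apply: lerD; last first.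
    by rewrite /eta mulrC divfK// mulf_neq0// ?gt_eqF.
  apply: le_trans hna; rewrite P1 -!mulrA; apply: ler_wpM2l => //; apply: ler_wpM2l => //.
  by apply: ler_wpM2r; [exact: powR_ge0|exact: le_del].
have Q2 : 2 * n.+1%:R * (K4c K2 th * (nrm (t - s) / n.+1%:R) `^ th) <= eps / 3.
  have -> : 2 * n.+1%:R * (K4c K2 th * (nrm (t - s) / n.+1%:R) `^ th) =
    2 * (K4c K2 th * (n.+1%:R * (nrm (t - s) / n.+1%:R) `^ th)) by ring.
  apply: le_trans hnb; rewrite P2.
  have := ler_wpM2l K40 (ler_wpM2r (powR_ge0 n.+1%:R^-1 (th - 1)) (le_del _ _ th1 tsd)).
  by move/(ler_wpM2l (ler0n R 2)); rewrite !mulrA.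
have hn1 : n.+1%:R * nrm ((t - s) / n.+1%:R) <= del.
  by rewrite nrm_divn mulrC divfK ?gt_eqF.
have y1s1 : nrm (y1 s) <= B + 1 by apply: le_trans (y1B _ Ds) _; rewrite lerDl.
have y2s1 : nrm (y2 s) <= B + 1 by apply: le_trans y2s _; rewrite lerD2l; lra.
have Dt' : D (s + n.+1%:R * ((t - s) / n.+1%:R)).
  by rewrite seg_natdiv divff ?gt_eqF// seg1.
have L := flow_lip AF SS Ds Dt' hn1 y1s1 y2s1.
have := nrm_tri (flow E2 n.+1 s ((t - s) / n.+1%:R) (y1 s)) (y1 t) (y2 t).
have := nrm_tri (flow E2 n.+1 s ((t - s) / n.+1%:R) (y2 s)) (flow E2 n.+1 s ((t - s) / n.+1%:R) (y1 s)) (y2 t).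
rewrite (nrmBC (flow E2 _ _ _ (y2 s)) (y2 t)).
by move: F1 F2 Q1 Q2 L; clear; lra.
Qed.

End Davie.

(** * The Euler step *)

Lemma fin_bound (R : realType) (T : finType) (A : Type) (P : A -> Prop) (F : T -> A -> R) :
  (forall i, exists M, forall a, P a -> F i a <= M) ->
  exists2 M, 1 <= M & forall i a, P a -> F i a <= M.
Proof.
move=> H; have [G hG] := choice H.
exists (1 + \sum_i `|G i|); first by rewrite lerDl sumr_ge0.
move=> i a Pa; apply: le_trans (hG i a Pa) _; rewrite (bigD1 i)//=.
apply: le_trans (ler_norm _) _; rewrite addrCA lerDl addr_ge0// sumr_ge0//.
Qed.

Section Euler.
Variables (R : realType) (d l : nat).
Local Notation C := (Cplx R).
Local Notation V := 'rV[C]_l.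
Variable sigma : V -> 'M[C]_(d, l).

Definition vf (i : 'I_d) (v : V) : V := row i (sigma v).
Definition gf (i j : 'I_d) (v : V) : V :=
  \row_c \sum_p sigma v j p * 'D_(delta_mx 0 p) (fun v => sigma v i c : C) v.

(* The second-order Euler step: [gf i j] is the derivative of [vf i] along
   [vf j]. *)
Definition euler (X : C -> 'rV[C]_d) (X2 : C -> C -> 'M[C]_d) (t s : C) (v : V) : V :=
  v + (\sum_i delta1 X t s 0 i *: vf i v + \sum_i \sum_j X2 t s i j *: gf i j v).

Hypothesis dsigma : forall v, differentiable sigma v.

Lemma dsig i c v : differentiable (fun v => sigma v i c : C) v.
Proof. exact: diff_coord. Qed.

Lemma gfE i j v c : gf i j v 0 c = 'd (fun v => sigma v i c : C) v (vf j v).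
Proof.
rewrite mxE [vf j v]row_sum_delta linear_sum; apply: eq_bigr => p _.
rewrite linearZ mxE; congr (_ * _).
exact: (deriveE _ (dsig i c v)).
Qed.

Lemma gf_diff i j c v : differentiable (fun v => gf i j v 0 c : C) v.
Proof.
have -> : (fun v => gf i j v 0 c : C) =
    \sum_(p < l) (fun v => sigma v j p * 'd (fun v => sigma v i c : C) v (delta_mx 0 p)).
  apply/funext => u; rewrite fct_sumE mxE; apply: eq_bigr => p _.
  by congr (_ * _); exact: (deriveE _ (dsig i c u)).
apply: differentiable_sum => p.
have d1 := dsig j p v.
have d2 := @entire_partial R V (fun v => sigma v i c) (delta_mx 0 p) (dsig i c) v.
exact: (differentiableM d1 d2).
Qed.

(** The margin 1 beyond [r] is what Cauchy's estimate consumes when it bounds derivatives on the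
    ball of radius [r]. *)
Record sigma_bound (r S : R) : Prop := SigmaBound {
  sb_S : 1 <= S;
  sb_vf : forall i c v, nrm v <= r + 1 -> nrm (sigma v i c : C) <= S;
  sb_gf : forall i j c v, nrm v <= r + 1 -> nrm (gf i j v 0 c) <= S
}.

Lemma exists_sigma_bound r : exists S, sigma_bound r S.
Proof.
have [M1 M11 h1] : exists2 M, 1 <= M & forall (ic : 'I_d * 'I_l) v, nrm v <= r + 1 ->
    nrm (sigma v ic.1 ic.2 : C) <= M.
  apply: (@fin_bound R _ V (fun v => nrm v <= r + 1)) => -[i c]; exact: (entire_bounded (r + 1) (dsig i c)).
have [M2 M21 h2] : exists2 M, 1 <= M & forall (ic : 'I_d * 'I_d * 'I_l) v, nrm v <= r + 1 ->
    nrm (gf ic.1.1 ic.1.2 v 0 ic.2) <= M.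
  apply: (@fin_bound R _ V (fun v => nrm v <= r + 1)) => -[[i j] c]; exact: (entire_bounded (r + 1) (gf_diff i j c)).
exists (M1 + M2); split.
- by apply: le_trans M11 _; rewrite lerDl (le_trans _ M21).
- by move=> i c v hv; apply: le_trans (h1 (i, c) v hv) _; rewrite lerDl (le_trans _ M21).
- by move=> i j c v hv; apply: le_trans (h2 (i, j, c) v hv) _; rewrite lerDr (le_trans _ M11).
Qed.

Lemma sum_nrm_le (I : finType) (n : nat) (F : I -> 'rV[C]_n) (M : R) :
  (forall i, nrm (F i) <= M) -> nrm (\sum_i F i) <= #|I|%:R * M.
Proof.
move=> h; apply: le_trans (nrm_sum _ _ _) _.
apply: le_trans (ler_sum _ (fun i _ => h i)) _.
by rewrite sumr_const mulr_natl.
Qed.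

Section Bounds.
Variables (r S : R).
Hypothesis SB : sigma_bound r S.

Let S0 : 0 <= S. Proof. exact: le_trans ler01 (sb_S SB). Qed.
Let r1 (v : V) : nrm v <= r -> nrm v <= r + 1.
Proof. by move=> h; apply: le_trans h _; rewrite lerDl. Qed.

Lemma sg_bholo i c : bholo (r + 1) S (fun v => sigma v i c).
Proof. by move=> v hv; split; [exact: dsig|exact: (sb_vf SB)]. Qed.

Lemma gf_bholo i j c : bholo (r + 1) S (fun v => gf i j v 0 c).
Proof. by move=> v hv; split; [exact: gf_diff|exact: (sb_gf SB)]. Qed.

Lemma vf_le i v : nrm v <= r + 1 -> nrm (vf i v) <= S.
Proof.
move=> hv; apply/mx_nrm_le => // a b; rewrite mxE; exact: (sb_vf SB).
Qed.

Lemma gf_le i j v : nrm v <= r + 1 -> nrm (gf i j v) <= S.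
Proof.
move=> hv; apply/mx_nrm_le => // a b; rewrite (ord1 a); exact: (sb_gf SB).
Qed.

Lemma vf_lip i v w : nrm v <= r -> nrm w <= r -> nrm (vf i v - vf i w) <= 24 * S * nrm (v - w).
Proof.
move=> hv hw; apply/mx_nrm_le; first exact: mulr_ge0 (mulr_ge0 (ler0n R 24) S0) (nrm_ge0 _).
by move=> a b; rewrite !mxE; exact: (ball_lip (sg_bholo i b) hv hw).
Qed.

Lemma gf_lip i j v w : nrm v <= r -> nrm w <= r -> nrm (gf i j v - gf i j w) <= 24 * S * nrm (v - w).
Proof.
move=> hv hw; apply/mx_nrm_le; first exact: mulr_ge0 (mulr_ge0 (ler0n R 24) S0) (nrm_ge0 _).
move=> a b; rewrite (ord1 a).
have -> : (gf i j v - gf i j w) 0 b = gf i j v 0 b - gf i j w 0 b.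
  by rewrite [LHS]mxE [X in _ + X = _]mxE.
exact: (ball_lip (gf_bholo i j b) hv hw).
Qed.

(** The derivative of [vf i] in the direction [vf j v] is [gf i j v], so the sum removes the
    first-order effect of [x]; what remains is the Taylor error and the linear effect of [z]. *)
Lemma vf_expand i v w (x : 'I_d -> C) (z : V) :
  nrm v <= r -> nrm w <= r -> w - v = \sum_j x j *: vf j v + z ->
  nrm (vf i w - vf i v - \sum_j x j *: gf i j v) <=
  4608 * S * nrm (w - v) ^+ 2 + 12 * S * nrm z.
Proof.
move=> hv hw wv; apply/mx_nrm_le.
  apply: addr_ge0; first exact: mulr_ge0 (mulr_ge0 (ler0n R _) S0) (exprn_ge0 _ (nrm_ge0 _)).
  exact: mulr_ge0 (mulr_ge0 (ler0n R _) S0) (nrm_ge0 _).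
move=> a c; rewrite (ord1 a).
have E1 : 'd (fun v => sigma v i c : C) v (w - v) =
    (\sum_j x j *: gf i j v) 0 c + 'd (fun v => sigma v i c : C) v z.
  rewrite wv linearD linear_sum summxE; congr (_ + _); apply: eq_bigr => j _.
  by rewrite linearZ mxE gfE.
have T := ball_taylor (sg_bholo i c) hv hw.
have L := ball_diff z (sg_bholo i c) hv.
have -> : (vf i w - vf i v - \sum_j x j *: gf i j v) 0 c =
   (sigma w i c - sigma v i c - 'd (fun v => sigma v i c : C) v (w - v)) + 'd (fun v => sigma v i c : C) v z.
  rewrite E1 !mxE; ring.
exact: nrmD_le.
Qed.

End Bounds.
End Euler.

Lemma euler_diff_algebra (K : comRingType) l (w v e a z pw gw pv gv q : 'rV[K]_l) :
  w = v + (a + z) -> e = v + (pv + a + (gv + z + q)) ->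
  w + (pw + gw) - e = (pw - pv - q) + (gw - gv).
Proof. by move=> -> ->; apply/rowP => c; rewrite !mxE; ring. Qed.

Section EulerStep.
Variables (R : realType) (d l : nat).
Local Notation C := (Cplx R).
Local Notation V := 'rV[C]_l.

Record rough_data (D : set C) (X : C -> 'rV[C]_d) (X2 : C -> C -> 'M[C]_d) (K gam : R) : Prop :=
  RoughData {
    rd_X : forall t s, D t -> D s -> nrm (X t - X s) <= K * nrm (t - s) `^ gam;
    rd_X2 : forall t s, D t -> D s -> nrm (X2 t s) <= K * nrm (t - s) `^ (2 * gam);
    rd_chen : forall t u s, D t -> D u -> D s -> forall i j,
      X2 t s i j = X2 t u i j + X2 u s i j + delta1 X t u 0 i * delta1 X u s 0 j
  }.

Lemma rough_data_widen D X X2 (K K' gam : R) : K <= K' ->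
  rough_data D X X2 K gam -> rough_data D X X2 K' gam.
Proof.
move=> KK [h1 h2 h3]; split => //.
- by move=> t s Dt Ds; apply: le_trans (h1 _ _ Dt Ds) _; rewrite ler_wpM2r// powR_ge0.
- by move=> t s Dt Ds; apply: le_trans (h2 _ _ Dt Ds) _; rewrite ler_wpM2r// powR_ge0.
Qed.

Variable sigma : V -> 'M[C]_(d, l).
Hypothesis dsigma : forall v, differentiable sigma v.
Local Notation vf := (vf sigma).
Local Notation gf := (gf sigma).
Local Notation euler := (euler sigma).
Local Notation n := (d%:R : R).

Lemma sum_ord_le (m k : nat) (F : 'I_m -> 'rV[C]_k) (M : R) :
  (forall i, nrm (F i) <= M) -> nrm (\sum_i F i) <= m%:R * M.
Proof. by move=> /sum_nrm_le; rewrite card_ord. Qed.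

Lemma scale_le (m : nat) (z : C) (v : 'rV[C]_m) (a b : R) : nrm z <= a -> nrm v <= b ->
  nrm (z *: v) <= a * b.
Proof. by move=> h1 h2; rewrite nrmZ; apply: ler_pM. Qed.

Definition K1e (K S : R) : R := (n + n * n) * (K * S).
(** The powers of [d] count the terms of the sums over coordinates; the two summands are the bounds
    of the two sums in [e5] of [euler_cons]. *)
Definition K2e (K S : R) : R :=
  n * (K * (4608 * S * K1e K S ^+ 2 + 12 * S * (n * n * (K * S))))
  + n * n * (K * (24 * S * K1e K S)).

Section Data.
Variables (r S : R) (SB : sigma_bound sigma r S).
Variables (D : set C) (X : C -> 'rV[C]_d) (X2 : C -> C -> 'M[C]_d) (K gam : R).
Hypothesis RD : rough_data D X X2 K gam.
Hypothesis K0 : 0 <= K.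
Hypothesis gam0 : 0 < gam.

Let S0 : 0 <= S. Proof. exact: le_trans ler01 (sb_S SB). Qed.

Lemma X_coord t s i : D t -> D s -> nrm (delta1 X t s 0 i) <= K * nrm (t - s) `^ gam.
Proof. by move=> Dt Ds; apply: le_trans (mx_nrm_coord _ _ _) (rd_X RD Dt Ds). Qed.

Lemma X2_coord t s i j : D t -> D s -> nrm (X2 t s i j) <= K * nrm (t - s) `^ (2 * gam).
Proof. by move=> Dt Ds; apply: le_trans (mx_nrm_coord _ _ _) (rd_X2 RD Dt Ds). Qed.

Lemma second_le t s v : D t -> D s -> nrm v <= r + 1 ->
  nrm (\sum_i \sum_j X2 t s i j *: gf i j v) <= n * n * (K * S) * nrm (t - s) `^ (2 * gam).
Proof.
move=> Dt Ds hv.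
have -> : n * n * (K * S) * nrm (t - s) `^ (2 * gam) = n * (n * (K * nrm (t - s) `^ (2 * gam) * S)) by ring.
apply: sum_ord_le => i; apply: sum_ord_le => j; apply: scale_le; first exact: X2_coord.
exact: (gf_le SB).
Qed.

Lemma pow2_le (x : R) : 0 <= x <= 1 -> x `^ (2 * gam) <= x `^ gam.
Proof.
move=> /andP[x0 x1].
have g2 : gam < 2 * gam by rewrite mulr_natl mulr2n ltrDl.
rewrite (@powR_split R x gam (2 * gam)) ?gam0//.
rewrite ler_piMl ?powR_ge0//; apply: powR_le1; last by rewrite x0.
by rewrite subr_ge0 ltW.
Qed.

Lemma euler_move t s v : D t -> D s -> nrm (t - s) <= 1 -> nrm v <= r + 1 ->
  nrm (euler X X2 t s v - v) <= K1e K S * nrm (t - s) `^ gam.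
Proof.
move=> Dt Ds ts hv; rewrite /euler addrAC subrr add0r.
have -> : K1e K S * nrm (t - s) `^ gam =
    n * (K * nrm (t - s) `^ gam * S) + n * n * (K * S) * nrm (t - s) `^ gam.
  by rewrite /K1e; ring.
apply: nrmD_le.
  by apply: sum_ord_le => i; apply: scale_le; [exact: X_coord|exact: (vf_le SB)].
apply: le_trans (second_le Dt Ds hv) _; apply: ler_wpM2l.
  by rewrite !mulr_ge0.
by apply: pow2_le; rewrite nrm_ge0.
Qed.

Lemma K1e_ge0 : 0 <= K1e K S.
Proof. by rewrite /K1e mulr_ge0 ?addr_ge0 ?mulr_ge0. Qed.

(** Chen's relation for [X2] and the additivity of [delta1 X] make all terms of order below
    [3 * gam] cancel. *)
Lemma euler_cons t u s v : D t -> D u -> D s -> nrm (t - s) <= 1 ->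
  nrm (t - u) <= nrm (t - s) -> nrm (u - s) <= nrm (t - s) ->
  nrm v <= r -> nrm (euler X X2 u s v) <= r ->
  nrm (euler X X2 t u (euler X X2 u s v) - euler X X2 t s v) <=
  K2e K S * nrm (t - s) `^ (3 * gam).
Proof.
move=> Dt Du Ds ts tu us hv.
have [w wE] : exists w, w = euler X X2 u s v by exists (euler X X2 u s v).
rewrite -wE => hw.
have r1 (z : V) : nrm z <= r -> nrm z <= r + 1.
  by move=> h; apply: le_trans h _; rewrite lerDl.
have K1 := K1e_ge0.
set c := nrm (t - s) in ts tu us *.
have c0 : 0 <= c by exact: nrm_ge0.
have pg (x p : R) : 0 <= p -> 0 <= x <= c -> x `^ p <= c `^ p by move=> *; exact: powR_mono.
have g2 : 0 <= 2 * gam by rewrite mulr_ge0// ltW.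
set z := \sum_i \sum_j X2 u s i j *: gf i j v.
have wv : w - v = \sum_j delta1 X u s 0 j *: vf j v + z by rewrite wE /euler addrAC subrr add0r.
have EX i : nrm (vf i w - vf i v - \sum_j delta1 X u s 0 j *: gf i j v) <=
   (4608 * S * K1e K S ^+ 2 + 12 * S * (n * n * (K * S))) * c `^ (2 * gam).
  apply: le_trans (vf_expand dsigma SB i hv hw wv) _.
  rewrite [leRHS]mulrDl; apply: lerD.
    rewrite -[leRHS]mulrA; apply: ler_wpM2l; first exact: mulr_ge0 (ler0n R _) S0.
    have -> : c `^ (2 * gam) = c `^ gam ^+ 2.
      by rewrite -powR_mulrn ?powR_ge0// -powRrM mulrC.
    rewrite -exprMn; apply: lerXn2r; rewrite ?nnegrE ?mulr_ge0 ?powR_ge0//.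
    rewrite wE; apply: le_trans (euler_move Du Ds (le_trans us ts) (r1 _ hv)) _.
    by apply: ler_wpM2l => //; apply: pg; [exact: ltW|rewrite nrm_ge0].
  rewrite -[leRHS]mulrA; apply: ler_wpM2l; first exact: mulr_ge0 (ler0n R _) S0.
  apply: le_trans (second_le Du Ds (r1 _ hv)) _.
  by apply: ler_wpM2l; [rewrite !mulr_ge0|apply: pg => //; rewrite nrm_ge0].
have c3 : c `^ (3 * gam) = c `^ gam * c `^ (2 * gam).
  have g3 : 0 < gam < 3 * gam by rewrite gam0 -subr_gt0 [X in 0 < X](_ : _ = 2 * gam) ?mulr_gt0//; ring.
  rewrite (@powR_split R c gam (3 * gam)) // [LHS]mulrC.
  by congr (_ * _ `^ _); ring.
have e1 : \sum_i delta1 X t s 0 i *: vf i v =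
    \sum_i delta1 X t u 0 i *: vf i v + \sum_i delta1 X u s 0 i *: vf i v.
  rewrite -big_split; apply: eq_bigr => i _ /=; rewrite -scalerDl; congr (_ *: _).
  by rewrite /delta1 !mxE addrA subrK.
have e2 : \sum_i \sum_j X2 t s i j *: gf i j v =
    \sum_i \sum_j X2 t u i j *: gf i j v + z +
    \sum_i delta1 X t u 0 i *: (\sum_j delta1 X u s 0 j *: gf i j v).
  rewrite /z -!big_split; apply: eq_bigr => i _ /=.
  rewrite scaler_sumr -!big_split; apply: eq_bigr => j _ /=.
  by rewrite (rd_chen RD Dt Du Ds) !scalerDl scalerA.
have e3 : \sum_i delta1 X t u 0 i *: (vf i w - vf i v - \sum_j delta1 X u s 0 j *: gf i j v) =
   \sum_i delta1 X t u 0 i *: vf i w - \sum_i delta1 X t u 0 i *: vf i v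
   - \sum_i delta1 X t u 0 i *: (\sum_j delta1 X u s 0 j *: gf i j v).
  by rewrite -!sumrB; apply: eq_bigr => i _; rewrite !scalerBr.
have e4 : \sum_i \sum_j X2 t u i j *: (gf i j w - gf i j v) =
   \sum_i \sum_j X2 t u i j *: gf i j w - \sum_i \sum_j X2 t u i j *: gf i j v.
  rewrite -!sumrB; apply: eq_bigr => i _; rewrite -sumrB; apply: eq_bigr => j _.
  by rewrite scalerBr.
(* The first sum pairs increments of order [gam] with Taylor remainders of order [2 * gam], the
   second pairs areas of order [2 * gam] with variations of order [gam]. *)
have e5 : euler X X2 t u w - euler X X2 t s v =
    \sum_i delta1 X t u 0 i *: (vf i w - vf i v - \sum_j delta1 X u s 0 j *: gf i j v)
  + \sum_i \sum_j X2 t u i j *: (gf i j w - gf i j v).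
  have w1 : w = v + (\sum_i delta1 X u s 0 i *: vf i v + z) := wE.
  have w2 : euler X X2 t s v = v + (\sum_i delta1 X t u 0 i *: vf i v
      + \sum_i delta1 X u s 0 i *: vf i v + (\sum_i \sum_j X2 t u i j *: gf i j v + z +
    \sum_i delta1 X t u 0 i *: (\sum_j delta1 X u s 0 j *: gf i j v))).
    by rewrite -e1 -e2.
  rewrite e3 e4; exact: (euler_diff_algebra _ _ w1 w2).
rewrite e5.
rewrite /K2e mulrDl c3; apply: nrmD_le.
  have -> : n * (K * (4608 * S * K1e K S ^+ 2 + 12 * S * (n * n * (K * S)))) * (c `^ gam * c `^ (2 * gam)) =
    n * ((K * c `^ gam) * ((4608 * S * K1e K S ^+ 2 + 12 * S * (n * n * (K * S))) * c `^ (2 * gam))) by ring.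
  apply: sum_ord_le => i; apply: scale_le; last exact: EX.
  apply: le_trans (X_coord i Dt Du) _; apply: ler_wpM2l => //.
  by apply: pg; [exact: ltW|rewrite nrm_ge0].
have -> : n * n * (K * (24 * S * K1e K S)) * (c `^ gam * c `^ (2 * gam)) =
    n * (n * ((K * c `^ (2 * gam)) * (24 * S * (K1e K S * c `^ gam)))) by ring.
apply: sum_ord_le => i; apply: sum_ord_le => j; apply: scale_le.
  apply: le_trans (X2_coord i j Dt Du) _; apply: ler_wpM2l => //.
  by apply: pg => //; rewrite nrm_ge0.
apply: le_trans (gf_lip dsigma SB i j hw hv) _; apply: ler_wpM2l; first exact: mulr_ge0 (ler0n R _) S0.
rewrite wE; apply: le_trans (euler_move Du Ds (le_trans us ts) (r1 _ hv)) _.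
by apply: ler_wpM2l => //; apply: pg; [exact: ltW|rewrite nrm_ge0].
Qed.

End Data.
End EulerStep.

Section EulerFlow.
Variables (R : realType) (d l : nat).
Local Notation C := (Cplx R).
Local Notation V := 'rV[C]_l.
Variable sigma : V -> 'M[C]_(d, l).
Hypothesis dsigma : forall v, differentiable sigma v.
Local Notation vf := (vf sigma).
Local Notation gf := (gf sigma).
Local Notation euler := (euler sigma).
Local Notation n := (d%:R : R).

Lemma vf_diff i v : differentiable (vf i) v.
Proof.
apply: diff_mx => a b.
have -> : (fun v => vf i v a b : C) = (fun v => sigma v i b : C) by apply/funext => u; rewrite mxE.
exact: dsig.
Qed.

Lemma gf_diffV i j v : differentiable (gf i j) v.
Proof. by apply: diff_mx => a b; rewrite (ord1 a); exact: gf_diff. Qed.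

Lemma diff_sum (W U : normedModType C) m (f : 'I_m -> W -> U) x :
  (forall i, differentiable (f i) x) -> differentiable (fun v => \sum_i f i v) x.
Proof.
move=> df; have -> : (fun v => \sum_i f i v) = \sum_i f i by apply/funext => v; rewrite fct_sumE.
exact: differentiable_sum.
Qed.

Lemma diff_scale_row (W : normedModType C) (k : W -> C) (f : W -> V) x :
  differentiable k x -> differentiable f x -> differentiable (fun v => k v *: f v) x.
Proof.
move=> dk df; apply: diff_mx => a b.
have -> : (fun v => (k v *: f v) a b : C) = (fun v => k v * f v a b).
  by apply/funext => v; rewrite mxE.
exact: (differentiableM dk (diff_coord _ _ df)).
Qed.

(** With constant times this is differentiability in [v]; with moving times it gives the dependence
    of a polygon on its endpoint. *)
Lemma euler_comp_diff (W : normedModType C) (X : C -> 'rV[C]_d) (X2 : C -> C -> 'M[C]_d) (p q : W -> C) (w : W -> V) x :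
  (forall i, differentiable (fun t => delta1 X (p t) (q t) 0 i : C) x) ->
  (forall i j, differentiable (fun t => X2 (p t) (q t) i j : C) x) ->
  differentiable w x -> differentiable (fun t => euler X X2 (p t) (q t) (w t)) x.
Proof.
move=> dX dX2 dw.
have d1 : differentiable (fun t => \sum_i delta1 X (p t) (q t) 0 i *: vf i (w t)) x.
  apply: diff_sum => i; apply: diff_scale_row; first exact: dX.
  exact: (differentiable_comp dw (vf_diff i (w x))).
have d2 : differentiable (fun t => \sum_i \sum_j X2 (p t) (q t) i j *: gf i j (w t)) x.
  apply: diff_sum => i; apply: diff_sum => j; apply: diff_scale_row; first exact: dX2.
  exact: (differentiable_comp dw (gf_diffV i j (w x))).
exact: (differentiableD dw (differentiableD d1 d2)).
Qed.

Lemma euler_diff (X : C -> 'rV[C]_d) (X2 : C -> C -> 'M[C]_d) t s v : differentiable (euler X X2 t s) v.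
Proof.
apply: (@euler_comp_diff V X X2 (fun=> t) (fun=> s) id v) => [i|i j|].
- exact: differentiable_cst.
- exact: differentiable_cst.
- exact: ex_diff.
Qed.

Lemma K3c_ge (K1 gam : R) : 0 < gam -> 0 <= K1 -> 1 + K1 <= K3c K1 gam.
Proof.
move=> /pow23_lt1/andP[? ?] K10; rewrite ler_pdivlMr ?subr_gt0//.
by rewrite ler_piMr ?addr_ge0//; lra.
Qed.

Lemma euler_af (D : set C) (X : C -> 'rV[C]_d) (X2 : C -> C -> 'M[C]_d) (B S K gam del : R) : convexC D ->
  rough_data D X X2 K gam -> sigma_bound sigma (B + 4) S -> 0 <= K ->
  0 < gam -> 1 < 3 * gam -> 0 < del <= 1 ->
  small_step (K1e d K S) (K2e d K S) gam (3 * gam) del ->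
  almost_flow D (euler X X2) B (K1e d K S) (K2e d K S) gam (3 * gam) del.
Proof.
move=> cD RD SB K0 g0 g3 /andP[d0 d1] SS.
have S0 : 0 <= S := le_trans ler01 (sb_S SB).
have K10 : 0 <= K1e d K S := K1e_ge0 SB K0.
have K20 : 0 <= K2e d K S.
  have n0 : 0 <= n by exact: ler0n.
  exact: (addr_ge0 (mulr_ge0 n0 (mulr_ge0 K0 (addr_ge0
    (mulr_ge0 (mulr_ge0 (ler0n R _) S0) (exprn_ge0 2 K10))
    (mulr_ge0 (mulr_ge0 (ler0n R _) S0) (mulr_ge0 (mulr_ge0 n0 n0) (mulr_ge0 K0 S0))))))
    (mulr_ge0 (mulr_ge0 n0 n0) (mulr_ge0 K0 (mulr_ge0 (mulr_ge0 (ler0n R _) S0) K10)))).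
have move1 : K1e d K S * del `^ gam <= 1.
  apply: le_trans (ss_K3 SS); apply: ler_wpM2r; first exact: powR_ge0.
  by apply: le_trans (K3c_ge g0 K10); rewrite lerDr.
split.
- exact: cD.
- by apply/andP; split => //; lra.
- exact: g3.
- exact: K10.
- exact: K20.
- by rewrite d0.
- by move=> t s v _ _; exact: euler_diff.
- move=> t s v Dt Ds ts hv; apply: (euler_move SB RD K0 g0) => //.
    exact: le_trans d1.
  by apply: le_trans hv _; rewrite lerDl.
- move=> t u s v Dt Du Ds ts tu us hv.
  have hv4 : nrm v <= B + 4 by apply: le_trans hv _; rewrite lerD2l ler_nat.
  have hv5 : nrm v <= B + 4 + 1 by apply: le_trans hv4 _; rewrite lerDl.
  have us1 : nrm (u - s) <= 1 by apply: le_trans us (le_trans ts d1).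
  apply: (euler_cons dsigma SB RD K0 g0) => //; first exact: le_trans d1.
  have M := euler_move SB RD K0 g0 Du Ds us1 hv5.
  have M2 : K1e d K S * nrm (u - s) `^ gam <= 1.
    apply: le_trans move1; apply: ler_wpM2l => //; apply: powR_mono; first exact: ltW.
    by rewrite nrm_ge0 (le_trans us).
  have := nrm_shift (euler X X2 u s v) v.
  by move: M M2 hv; clear; lra.
Qed.

Lemma euler_data_diff (X X' : C -> 'rV[C]_d) (X2 X2' : C -> C -> 'M[C]_d) t s v (r S a b : R) : sigma_bound sigma r S ->
  nrm v <= r + 1 -> nrm (delta1 X t s - delta1 X' t s) <= a -> nrm (X2 t s - X2' t s) <= b ->
  nrm (euler X X2 t s v - euler X' X2' t s v) <= n * (a * S) + n * (n * (b * S)).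
Proof.
move=> SB hv ha hb.
have -> : euler X X2 t s v - euler X' X2' t s v =
   \sum_i (delta1 X t s - delta1 X' t s) 0 i *: vf i v
   + \sum_i \sum_j (X2 t s - X2' t s) i j *: gf i j v.
  have -> : \sum_i (delta1 X t s - delta1 X' t s) 0 i *: vf i v =
      \sum_i delta1 X t s 0 i *: vf i v - \sum_i delta1 X' t s 0 i *: vf i v.
    by rewrite -sumrB; apply: eq_bigr => i _; rewrite [_ 0 i]mxE [X in _ + X]mxE scalerBl.
  have -> : \sum_i \sum_j (X2 t s - X2' t s) i j *: gf i j v =
      \sum_i \sum_j X2 t s i j *: gf i j v - \sum_i \sum_j X2' t s i j *: gf i j v.
    rewrite -sumrB; apply: eq_bigr => i _; rewrite -sumrB; apply: eq_bigr => j _.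
    by rewrite [_ i j]mxE [X in _ + X]mxE scalerBl.
  by rewrite /euler opprD addrACA subrr add0r opprD addrACA.
apply: nrmD_le; apply: sum_ord_le => i; last apply: sum_ord_le => j.
  by apply: scale_le; [exact: le_trans (mx_nrm_coord _ _ _) ha|exact: (vf_le SB)].
by apply: scale_le; [exact: le_trans (mx_nrm_coord _ _ _) hb|exact: (gf_le SB)].
Qed.

(** Continuity of the step in its times holds up to the boundary, where analyticity is lost; it
    carries estimates from interior points to boundary points. *)
Lemma euler_modulus (D : set C) (X : C -> 'rV[C]_d) (X2 : C -> C -> 'M[C]_d) (r S K gam : R) : sigma_bound sigma r S ->
  rough_data D X X2 K gam -> 0 <= K -> 0 < gam ->
  (forall a b, D a -> D b -> nrm (a - b) <= 1) ->
  exists2 L, 0 <= L & forall t s t' s' v v', D t -> D s -> D t' -> D s' ->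
    nrm v <= r -> nrm v' <= r ->
    nrm (euler X X2 t s v - euler X X2 t' s' v') <=
      L * (nrm (t - t') `^ gam + nrm (s - s') `^ gam + nrm (v - v')).
Proof.
move=> SB RD K0 g0 diam.
have S0 : 0 <= S := le_trans ler01 (sb_S SB).
set L1 := n * (K * S) + n * (n * ((K + K * K) * S)).
set L2 := 1 + (n * (K * (24 * S)) + n * (n * (K * (24 * S)))).
have n0 : 0 <= n by exact: ler0n.
have L10 : 0 <= L1.
  exact: (addr_ge0 (mulr_ge0 n0 (mulr_ge0 K0 S0))
    (mulr_ge0 n0 (mulr_ge0 n0 (mulr_ge0 (addr_ge0 K0 (mulr_ge0 K0 K0)) S0)))).
have KS0 : 0 <= K * (24 * S) := mulr_ge0 K0 (mulr_ge0 (ler0n R _) S0).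
have L20 : 0 <= L2.
  exact: (addr_ge0 ler01 (addr_ge0 (mulr_ge0 n0 KS0) (mulr_ge0 n0 (mulr_ge0 n0 KS0)))).
exists (L1 + L2); first exact: addr_ge0.
move=> t s t' s' v v' Dt Ds Dt' Ds' hv hv'.
have hv1 : nrm v <= r + 1 by apply: le_trans hv _; rewrite lerDl.
set a := nrm (t - t') `^ gam; set b := nrm (s - s') `^ gam.
have a0 : 0 <= a by exact: powR_ge0.
have b0 : 0 <= b by exact: powR_ge0.
have X1 u w : D u -> D w -> nrm (X u - X w) <= K.
  move=> Du Dw; apply: le_trans (rd_X RD Du Dw) _; rewrite ler_piMr// powR_le1//; first exact: ltW.
  by rewrite nrm_ge0 diam.
have D1 : nrm (delta1 X t s - delta1 X t' s') <= K * (a + b).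
  have -> : delta1 X t s - delta1 X t' s' = (X t - X t') - (X s - X s').
    by rewrite /delta1; apply/rowP => c; rewrite !mxE; ring.
  by rewrite mulrDr; apply: nrmB_le; exact: (rd_X RD).
have X2s u w : D u -> D w -> nrm (X2 u w) <= K * nrm (u - w) `^ gam.
  move=> Du Dw; apply: le_trans (rd_X2 RD Du Dw) _; apply: ler_wpM2l => //.
  by apply: pow2_le => //; rewrite nrm_ge0 diam.
(* [X2] is bounded near the diagonal only; Chen's relation through [t'] and [s'] expresses its
   variation by areas over short intervals and products of increments. *)
have D2 : nrm (X2 t s - X2 t' s') <= (K + K * K) * (a + b).
  apply/mx_nrm_le => [|i j]; first by rewrite mulr_ge0 ?addr_ge0// mulr_ge0.
  rewrite !mxE (rd_chen RD Dt Dt' Ds) (rd_chen RD Dt' Ds' Ds).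
  have -> : X2 t t' i j + (X2 t' s' i j + X2 s' s i j + delta1 X t' s' 0 i * delta1 X s' s 0 j)
     + delta1 X t t' 0 i * delta1 X t' s 0 j - X2 t' s' i j =
     (X2 t t' i j + X2 s' s i j) + (delta1 X t t' 0 i * delta1 X t' s 0 j + delta1 X t' s' 0 i * delta1 X s' s 0 j) by ring.
  have -> : (K + K * K) * (a + b) = (K * a + K * b) + (K * a * K + K * (K * b)) by ring.
  have sb : nrm (s' - s) `^ gam = b by rewrite nrmBC.
  apply: nrmD_le; apply: nrmD_le.
  - exact: le_trans (mx_nrm_coord _ _ _) (X2s _ _ Dt Dt').
  - by rewrite -sb; exact: le_trans (mx_nrm_coord _ _ _) (X2s _ _ Ds' Ds).
  - rewrite nrmM; apply: ler_pM => //.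
      exact: le_trans (mx_nrm_coord _ _ _) (rd_X RD Dt Dt').
    exact: le_trans (mx_nrm_coord _ _ _) (X1 _ _ Dt' Ds).
  - rewrite nrmM -sb; apply: ler_pM => //.
      exact: le_trans (mx_nrm_coord _ _ _) (X1 _ _ Dt' Ds').
    exact: le_trans (mx_nrm_coord _ _ _) (rd_X RD Ds' Ds).
have E1 : nrm (euler X X2 t s v - v - (euler X X2 t' s' v - v)) <= L1 * (a + b).
  have -> : L1 * (a + b) = n * (K * (a + b) * S) + n * (n * ((K + K * K) * (a + b) * S)).
    by rewrite /L1; ring.
  have -> : euler X X2 t s v - v - (euler X X2 t' s' v - v) =
     \sum_i (delta1 X t s - delta1 X t' s') 0 i *: vf i v
   + \sum_i \sum_j (X2 t s - X2 t' s') i j *: gf i j v.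
    have -> : \sum_i (delta1 X t s - delta1 X t' s') 0 i *: vf i v =
        \sum_i delta1 X t s 0 i *: vf i v - \sum_i delta1 X t' s' 0 i *: vf i v.
      by rewrite -sumrB; apply: eq_bigr => i _; rewrite [_ 0 i]mxE [X in _ + X]mxE scalerBl.
    have -> : \sum_i \sum_j (X2 t s - X2 t' s') i j *: gf i j v =
        \sum_i \sum_j X2 t s i j *: gf i j v - \sum_i \sum_j X2 t' s' i j *: gf i j v.
      rewrite -sumrB; apply: eq_bigr => i _; rewrite -sumrB; apply: eq_bigr => j _.
      by rewrite [_ i j]mxE [X in _ + X]mxE scalerBl.
    by rewrite /euler ![v + _]addrC !addrK opprD addrACA.
  apply: nrmD_le; apply: sum_ord_le => i; last apply: sum_ord_le => j.
    by apply: scale_le; [exact: le_trans (mx_nrm_coord _ _ _) D1|exact: (vf_le SB)].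
  by apply: scale_le; [exact: le_trans (mx_nrm_coord _ _ _) D2|exact: (gf_le SB)].
have E2 : nrm (euler X X2 t' s' v - euler X X2 t' s' v') <= L2 * nrm (v - v').
  have -> : L2 * nrm (v - v') = nrm (v - v') + (n * (K * (24 * S * nrm (v - v'))) + n * (n * (K * (24 * S * nrm (v - v'))))).
    by rewrite /L2; ring.
  have -> : euler X X2 t' s' v - euler X X2 t' s' v' = (v - v') +
     (\sum_i delta1 X t' s' 0 i *: (vf i v - vf i v')
   + \sum_i \sum_j X2 t' s' i j *: (gf i j v - gf i j v')).
    have -> : \sum_i delta1 X t' s' 0 i *: (vf i v - vf i v') =
        \sum_i delta1 X t' s' 0 i *: vf i v - \sum_i delta1 X t' s' 0 i *: vf i v'.
      by rewrite -sumrB; apply: eq_bigr => i _; rewrite scalerBr.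
    have -> : \sum_i \sum_j X2 t' s' i j *: (gf i j v - gf i j v') =
        \sum_i \sum_j X2 t' s' i j *: gf i j v - \sum_i \sum_j X2 t' s' i j *: gf i j v'.
      rewrite -sumrB; apply: eq_bigr => i _; rewrite -sumrB; apply: eq_bigr => j _.
      by rewrite scalerBr.
    by rewrite /euler opprD addrACA; congr (_ + _); rewrite opprD addrACA.
  apply: nrmD_le => //; apply: nrmD_le; apply: sum_ord_le => i; last apply: sum_ord_le => j.
    by apply: scale_le; [exact: le_trans (mx_nrm_coord _ _ _) (X1 _ _ Dt' Ds')|exact: (vf_lip dsigma SB)].
  apply: scale_le; last exact: (gf_lip dsigma SB).
  apply: le_trans (mx_nrm_coord _ _ _) (le_trans (X2s _ _ Dt' Ds') _).
  by rewrite ler_piMr// powR_le1//; [exact: ltW|rewrite nrm_ge0 diam].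
have -> : euler X X2 t s v - euler X X2 t' s' v' =
   (euler X X2 t s v - v - (euler X X2 t' s' v - v)) + (euler X X2 t' s' v - euler X X2 t' s' v').
  move: (euler X X2 t s v) (euler X X2 t' s' v) (euler X X2 t' s' v') => p q z.
  by apply/rowP => c; rewrite !mxE; ring.
apply: le_trans (nrmD _ _) (le_trans (lerD E1 E2) _).
have N0 := nrm_ge0 (v - v').
have -> : (L1 + L2) * (a + b + nrm (v - v')) =
  L1 * (a + b) + L2 * nrm (v - v') + (L1 * nrm (v - v') + L2 * (a + b)) by ring.
by rewrite lerDl addr_ge0// mulr_ge0// addr_ge0.
Qed.

End EulerFlow.

Section NearDiff.
Variables (R : realType).
Local Notation C := (Cplx R).

Lemma diff_near (V W : normedModType C) (f g : V -> W) x (e : R) : 0 < e ->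
  (forall v, nrm (v - x) < e -> f v = g v) -> differentiable f x -> differentiable g x.
Proof.
move=> e0 fg df.
have [M M0 hM] := linear_lipschitz (diff_continuous df).
have [ME MR] := posC M0.
have xx : f x = g x by apply: fg; rewrite subrr nrm0.
apply: (@nrm_differentiable R V W g x ('d f x) (complex.Re M) _ _).1.
  move=> v; have := hM v; rewrite {1}ME !norm_RtoC -RtoCM RtoC_le.
  exact.
move=> e' /(differentiable_nrm df)[d d0 hd].
exists (Num.min d e) => [|h]; first by rewrite lt_min d0.
rewrite lt_min => /andP[h1 h2]; rewrite -xx -fg; first exact: hd.
by rewrite addrAC subrr add0r.
Qed.

End NearDiff.

(** * Half discs *)

Section HalfDisc.
Variable R : realType.
Local Notation C := (Cplx R).
Local Notation Re := complex.Re.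
Local Notation Im := complex.Im.

Definition hD (rho : R) : set C := [set z : C | nrm z < rho /\ 0 <= Im z].
Definition hU (rho : R) : set C := [set z : C | nrm z < rho /\ 0 < Im z].
(** A convex core of the open half disc: discs of radius [2 * r] around its points stay inside, so
    Cauchy's estimates hold on it with constants depending on [r]. *)
Definition hUr (rho r : R) : set C := [set z : C | nrm z < rho - 2 * r /\ 2 * r < Im z].

Lemma Im_seg (s t : C) (tau : R) : Im (seg s t tau) = (1 - tau) * Im s + tau * Im t.
Proof. by rewrite segE !ReImE /=; ring. Qed.

Lemma nrm_seg_lt (s t : C) (tau m : R) : 0 <= tau <= 1 -> nrm s < m -> nrm t < m ->
  nrm (seg s t tau) < m.
Proof.
move=> h hs ht; have := @seg_ball R C 0 s (t - s) m tau h.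
rewrite !subr0 (addrC s) subrK; exact.
Qed.

Lemma convex_comb_gt (a b tau m : R) : 0 <= tau <= 1 -> m < a -> m < b ->
  m < (1 - tau) * a + tau * b.
Proof.
move=> /andP[t0 t1] ha hb; have [->|tn] := eqVneq tau 0; first by lra.
have tp : 0 < tau by rewrite lt_def tn.
have : (1 - tau) * m <= (1 - tau) * a by apply: ler_wpM2l; [rewrite subr_ge0|exact: ltW].
have : tau * m < tau * b by rewrite ltr_pM2l.
lra.
Qed.

Lemma hD_convex rho : convexC (hD rho).
Proof.
move=> s t [s1 s2] [t1 t2] tau h; split; first exact: nrm_seg_lt.
rewrite Im_seg; case/andP: h => t0 t1'.
by rewrite addr_ge0// mulr_ge0// subr_ge0.
Qed.

Lemma hUr_convex rho r : convexC (hUr rho r).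
Proof.
move=> s t [s1 s2] [t1 t2] tau h; split; first exact: nrm_seg_lt.
by rewrite Im_seg; apply: convex_comb_gt.
Qed.

Lemma hU_sub rho : hU rho `<=` hD rho.
Proof. by move=> z [h1 h2]; split => //; exact: ltW. Qed.

Lemma hUr_ball rho r z w : 0 < r -> hUr rho r z -> nrm (w - z) < 2 * r -> hU rho w.
Proof.
move=> r0 [z1 z2] wz; split; first by have := nrm_shift w z; lra.
have := Im_le (w - z); rewrite !ReImE ler_norml => /andP[? ?]; lra.
Qed.

Lemma hUr_sub rho r : 0 < r -> hUr rho r `<=` hU rho.
Proof. by move=> r0 z zr; apply: (hUr_ball r0 zr); rewrite subrr nrm0; lra. Qed.

Lemma hU_hUr rho s t : hU rho s -> hU rho t ->
  exists2 r, 0 < r & hUr rho r s /\ hUr rho r t.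
Proof.
move=> [s1 s2] [t1 t2].
exists (Num.min (Num.min (Im s) (Im t)) (Num.min (rho - nrm s) (rho - nrm t)) / 3).
  by rewrite divr_gt0// !lt_min s2 t2 !subr_gt0 s1 t1.
set m := Num.min _ _.
have m1 : m <= Im s by rewrite /m !ge_min lexx.
have m2 : m <= Im t by rewrite /m !ge_min lexx orbT.
have m3 : m <= rho - nrm s by rewrite /m !ge_min lexx ?orbT.
have m4 : m <= rho - nrm t by rewrite /m !ge_min lexx ?orbT.
have m0 : 0 < m by rewrite /m !lt_min s2 t2 !subr_gt0 s1 t1.
by split; split; lra.
Qed.

Lemma upper_hD rho : upper (hD rho) = hU rho.
Proof.
apply/seteqP; split => z.
  by move=> /interior_subset[[z1 z2] z3].
move=> zU; have [r r0 [zr _]] := hU_hUr zU zU.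
apply/nrm_nbhs; exists (2 * r); first by lra.
move=> w /(hUr_ball r0 zr)[w1 w2]; split => //; split => //; exact: ltW.
Qed.

Lemma hD_diam rho a b : hD rho a -> hD rho b -> nrm (a - b) < 2 * rho.
Proof. by move=> [h1 _] [h2 _]; have := nrmB a b; lra. Qed.

Lemma hD0 rho : 0 < rho -> hD rho 0.
Proof. by move=> r0; split; rewrite ?nrm0. Qed.

Lemma hU_scale rho z (c : R) : 0 < c <= 1 -> hU rho z -> hU rho (RtoC c * z).
Proof.
move=> /andP[c0 c1] [z1 z2]; split.
  rewrite nrmM nrm_RtoC gtr0_norm//; apply: le_lt_trans z1.
  by rewrite ler_piMl.
by rewrite CImM /= mul0r addr0 mulr_gt0.
Qed.

Lemma hD_scale rho z (c : R) : 0 <= c <= 1 -> hD rho z -> hD rho (RtoC c * z).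
Proof.
move=> /andP[c0 c1] [z1 z2]; split.
  rewrite nrmM nrm_RtoC ger0_norm//; apply: le_lt_trans z1.
  by rewrite ler_piMl.
by rewrite CImM /= mul0r addr0 mulr_ge0.
Qed.

(** A homothety centred at an interior point: it moves the diameter into the open half disc, does
    not increase distances, and tends to the identity as [e] tends to 0. *)
Definition pull (rho e : R) (z : C) : C := seg z (Complex 0 (rho / 2)) e.

Lemma pull_hU rho e z : 0 < rho -> 0 < e <= 1 -> hD rho z -> hU rho (pull rho e z).
Proof.
move=> r0 /andP[e0 e1] [z1 z2]; split.
  apply: nrm_seg_lt => //; first by rewrite (ltW e0).
  by rewrite nrmE /= expr0n add0r sqrtr_sqr gtr0_norm; lra.
rewrite Im_seg /= ltr_wpDl//; first by rewrite mulr_ge0// subr_ge0.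
by rewrite mulr_gt0// divr_gt0.
Qed.

Lemma pull_dist rho e z w : 0 <= e <= 1 -> nrm (pull rho e z - pull rho e w) <= nrm (z - w).
Proof.
move=> /andP[e0 e1]; rewrite /pull !segE.
set p := Complex 0 _.
have -> : z + RtoC e * (p - z) - (w + RtoC e * (p - w)) = RtoC (1 - e) * (z - w).
  by rewrite RtoCD RtoCN RtoC1; ring.
by rewrite nrmM nrm_RtoC ger0_norm ?subr_ge0// ler_piMl// lerBlDr lerDl.
Qed.

Lemma pull_near rho e z : 0 < rho -> 0 <= e -> hD rho z -> nrm (pull rho e z - z) <= e * (2 * rho).
Proof.
move=> r0 e0 [z1 z2]; rewrite /pull segE addrAC subrr add0r nrmM nrm_RtoC ger0_norm//.
apply: ler_wpM2l => //; apply: le_trans (nrmB _ _) _.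
have : nrm (Complex 0 (rho / 2) : C) = rho / 2.
  by rewrite nrmE /= expr0n add0r sqrtr_sqr gtr0_norm; lra.
lra.
Qed.

Lemma half_nbhd0_hD rho : 0 < rho -> half_nbhd0 (hD rho).
Proof.
move=> r0; split; first by move=> z [].
apply/nrm_nbhs; exists rho => // z; rewrite subr0 => z1 z2; by split.
Qed.

Lemma half_nbhd0_sub (Om : set C) : half_nbhd0 Om ->
  exists2 rho, 0 < rho & forall r, r <= rho -> hD r `<=` Om.
Proof.
move=> [_ /nrm_nbhs[rho r0 H]]; exists rho => // r rr z [z1 z2].
by apply: H => //; rewrite subr0; lra.
Qed.

End HalfDisc.

Section HolderBounds.
Variable R : realType.
Local Notation C := (Cplx R).

(** [incr2] covers the case [t = s], where the quotient in [holder2] is 0 whatever the value of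
    [f]. *)
Lemma holder2_le (V : normedModType C) (mu : R) (Om : set C) (f : C -> C -> V) (K : R) :
  0 < mu -> incr2 Om f -> (holder2 mu Om f <= K%:E)%E ->
  forall t s, Om t -> Om s -> nrm (f t s) <= K * nrm (t - s) `^ mu.
Proof.
move=> mu0 f0 fK t s Ot Os.
have [->|ts] := eqVneq t s.
  by rewrite f0// subrr !nrm0 powR0 ?mulr0// gt_eqF.
have n0 : 0 < nrm (t - s) by rewrite nrm_gt0 subr_eq0.
rewrite -ler_pdivrMr ?powR_gt0// -lee_fin; apply: le_trans fK.
by apply: ereal_sup_ubound; exists t => //; exists s.
Qed.

Lemma le_holder2 (V : normedModType C) (mu : R) (Om : set C) (f : C -> C -> V) (K : R) :
  0 <= K -> (forall t s, Om t -> Om s -> nrm (f t s) <= K * nrm (t - s) `^ mu) ->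
  (holder2 mu Om f <= K%:E)%E.
Proof.
move=> K0 H; apply: ge_ereal_sup => _ [t Ot] [s Os <-]; rewrite lee_fin.
have [->|n0] := eqVneq (nrm (t - s) `^ mu) 0; first by rewrite invr0 mulr0.
by rewrite ler_pdivrMr ?H// lt_def n0 powR_ge0.
Qed.

Lemma holder2_finite (V : normedModType C) (mu : R) (Om : set C) (f : C -> C -> V) :
  (holder2 mu Om f < +oo)%E -> exists2 K, 0 <= K & (holder2 mu Om f <= K%:E)%E.
Proof.
case: (holder2 mu Om f) => [r|//|] _.
  by exists `|r| => //; rewrite lee_fin ler_norm.
by exists 0 => //; rewrite leNye.
Qed.

Lemma supnorm_le (V : normedModType C) (Om : set C) (f : C -> V) (K : R) :
  (forall s, Om s -> nrm (f s) <= K) -> (supnorm Om f <= K%:E)%E.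
Proof. by move=> H; apply: ge_ereal_sup => _ [s Os <-]; rewrite lee_fin H. Qed.

Lemma incr2_delta1 (V : normedModType C) (Om : set C) (f : C -> V) : incr2 Om (delta1 f).
Proof. by move=> t _; rewrite /delta1 subrr. Qed.

End HolderBounds.

(** * Integrals along segments *)

Section LineIntegral.
Variable R : realType.
Local Notation C := (Cplx R).
Local Notation Re := complex.Re.
Local Notation Im := complex.Im.
Local Notation mu := (@lebesgue_measure R).

(** A class of integrands that is stable under sums and products and consists of continuous
    functions, which settles integrability once and for all. *)
Definition lipC (phi : R -> C) : Prop := exists2 K : R, 0 <= K &
  forall a b : R, 0 <= a <= 1 -> 0 <= b <= 1 -> nrm (phi a - phi b) <= K * `|a - b|.

Lemma lipC_cst c : lipC (fun=> c).
Proof. by exists 0 => // a b _ _; rewrite subrr nrm0 mul0r. Qed.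

Lemma lipC_bounded phi : lipC phi -> exists2 M : R, 0 <= M &
  forall a : R, 0 <= a <= 1 -> nrm (phi a) <= M.
Proof.
move=> [K K0 H]; exists (nrm (phi 0) + K) => [|a ha]; first by rewrite addr_ge0.
apply: le_trans (nrm_shift _ (phi 0)) _; rewrite lerD2l.
have h0 : 0 <= (0 : R) <= 1 by rewrite lexx ler01.
apply: le_trans (H _ _ ha h0) _; rewrite subr0 ler_piMr//.
by case/andP: ha => a0 a1; rewrite ger0_norm.
Qed.

Lemma lipCD phi psi : lipC phi -> lipC psi -> lipC (fun t => phi t + psi t).
Proof.
move=> [K K0 H] [K' K'0 H']; exists (K + K') => [|a b ha hb]; first exact: addr_ge0.
have -> : phi a + psi a - (phi b + psi b) = (phi a - phi b) + (psi a - psi b) by ring.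
by rewrite mulrDl; apply: nrmD_le; [exact: H|exact: H'].
Qed.

Lemma lipCM phi psi : lipC phi -> lipC psi -> lipC (fun t => phi t * psi t).
Proof.
move=> h1 h2; have [M M0 hM] := lipC_bounded h1; have [M' M'0 hM'] := lipC_bounded h2.
case: h1 => K K0 H; case: h2 => K' K'0 H'.
exists (K * M' + M * K') => [|a b ha hb]; first by rewrite addr_ge0// mulr_ge0.
have -> : phi a * psi a - phi b * psi b = (phi a - phi b) * psi a + phi b * (psi a - psi b) by ring.
have -> : (K * M' + M * K') * `|a - b| = K * `|a - b| * M' + M * (K' * `|a - b|) by ring.
apply: nrmD_le; rewrite nrmM; apply: ler_pM => //; [exact: H|exact: hM'|exact: hM|exact: H'].
Qed.

Definition rlip (g : R -> R) : Prop := exists2 K : R, 0 <= K &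
  forall a b : R, 0 <= a <= 1 -> 0 <= b <= 1 -> `|g a - g b| <= K * `|a - b|.

Lemma lipC_Re phi : lipC phi -> rlip (fun t => Re (phi t)).
Proof.
move=> [K K0 H]; exists K => // a b ha hb; apply: le_trans (H _ _ ha hb).
by rewrite -CReN -CReD; exact: Re_le.
Qed.

Lemma lipC_Im phi : lipC phi -> rlip (fun t => Im (phi t)).
Proof.
move=> [K K0 H]; exists K => // a b ha hb; apply: le_trans (H _ _ ha hb).
by rewrite -CImN -CImD; exact: Im_le.
Qed.

Lemma rlip_continuous g : rlip g -> {within `[0, 1], continuous g}.
Proof.
move=> [K K0 H]; apply/subspace_continuousP => x; rewrite /= in_itv /= => hx.
apply/cvgrPdist_le => e e0; rewrite near_withinE; apply/nbhs_ballP.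
have K1 : 0 < 1 + K by rewrite ltr_pwDl.
exists (e / (1 + K)) => /= [|y]; first exact: divr_gt0.
rewrite /ball /= ltr_pdivlMr// in_itv /= => xy hy.
apply: le_trans (H _ _ hx hy) _; apply: le_trans (ltW xy).
by rewrite mulrC ler_wpM2l// lerDr.
Qed.

Lemma rlip_integrable g : rlip g -> mu.-integrable `[0, 1] (EFin \o g).
Proof.
move=> h; apply: continuous_compact_integrable; first exact: segment_compact.
exact: rlip_continuous.
Qed.

Lemma Cplx_add (a b c e : R) : (Complex a b + Complex c e : C) = Complex (a + c) (b + e).
Proof. by []. Qed.

Lemma cint01D phi psi : lipC phi -> lipC psi ->
  cint01 (fun t => phi t + psi t) = cint01 phi + cint01 psi.
Proof.
move=> h1 h2; rewrite /cint01 Cplx_add; congr (Complex _ _).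
  rewrite -RintegralD//; [|exact: rlip_integrable (lipC_Re h1)|exact: rlip_integrable (lipC_Re h2)].
  by apply: eq_Rintegral => t _; rewrite CReD.
rewrite -RintegralD//; [|exact: rlip_integrable (lipC_Im h1)|exact: rlip_integrable (lipC_Im h2)].
by apply: eq_Rintegral => t _; rewrite CImD.
Qed.

Lemma rlipZ (c : R) g : rlip g -> rlip (fun t => c * g t).
Proof.
move=> [K K0 H]; exists (`|c| * K) => [|a b ha hb]; first exact: mulr_ge0.
by rewrite -mulrBr normrM -mulrA ler_wpM2l// H.
Qed.

Lemma cint01Z (c : C) phi : lipC phi -> cint01 (fun t => c * phi t) = c * cint01 phi.
Proof.
move=> h; have hr := lipC_Re h; have hi := lipC_Im h.
apply: Cplx_eq; rewrite ?CReM ?CImM /=.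
  rewrite -!RintegralZl//; try exact: rlip_integrable.
  rewrite -RintegralB//; [|exact: rlip_integrable (rlipZ _ hr)|exact: rlip_integrable (rlipZ _ hi)].
  by apply: eq_Rintegral => t _; rewrite CReM.
rewrite -!RintegralZl//; try exact: rlip_integrable.
rewrite -RintegralD//; [|exact: rlip_integrable (rlipZ _ hi)|exact: rlip_integrable (rlipZ _ hr)].
by apply: eq_Rintegral => t _; rewrite CImM.
Qed.

Lemma Rint_bound g M : rlip g -> (forall t, 0 <= t <= 1 -> `|g t| <= M) ->
  `|\int[mu]_(t in `[0, 1]) g t| <= M.
Proof.
move=> h hM; have ig := rlip_integrable h.
apply: le_trans (le_normr_Rintegral _ ig) _ => //.
have ia : mu.-integrable `[0, 1] (EFin \o (fun t => `|g t|)).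
  apply: rlip_integrable; case: h => K K0 H; exists K => // a b ha hb.
  by apply: le_trans (H _ _ ha hb); exact: ler_dist_dist.
have ic : mu.-integrable `[0, 1] (EFin \o (fun=> M)).
  by apply: rlip_integrable; exists 0 => // a b _ _; rewrite subrr normr0 mul0r.
have pt t : `[0, 1]%classic t -> `|g t| <= M by rewrite /= in_itv /=; exact: hM.
have L : \int[mu]_(t in `[0, 1]) `|g t| <= \int[mu]_(t in `[0, 1]) M.
  by apply: le_Rintegral.
apply: le_trans L _.
have -> : \int[mu]_(_ in `[0, 1]) M = M * fine (mu `[0, 1]%classic) by exact: Rintegral_cst.
by rewrite lebesgue_measure_itv/= lte_fin ltr01 sube0 mulr1.
Qed.

Lemma cint01_bound phi M : lipC phi -> (forall t, 0 <= t <= 1 -> nrm (phi t) <= M) ->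
  nrm (cint01 phi) <= 2 * M.
Proof.
move=> h hM; apply: le_trans (nrm_le_ReIm _) _ => /=.
rewrite mulr_natl mulr2n; apply: lerD; apply: Rint_bound.
- exact: lipC_Re.
- by move=> t /hM; apply: le_trans; exact: Re_le.
- exact: lipC_Im.
- by move=> t /hM; apply: le_trans; exact: Im_le.
Qed.

Lemma real_FTC (F g : R -> R) : rlip g ->
  (forall t : R, 0 <= t <= 1 -> is_derive t 1 F (g t)) ->
  \int[mu]_(t in `[0, 1]) g t = F 1 - F 0.
Proof.
move=> h dF.
have cF (t : R) : 0 <= t <= 1 -> F @ t --> F t.
  move=> /dF[/derivable1_diffP/differentiable_continuous]; exact.
rewrite /Rintegral (@continuous_FTC2 R g F 0 1)//.
- exact: rlip_continuous.
- split.
  + by move=> t; rewrite in_itv /= => /andP[t0 t1]; have [] := dF t _; rewrite ?ltW.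
  + by apply: cvg_at_right_filter; apply: cF; rewrite lexx ler01.
  + by apply: cvg_at_left_filter; apply: cF; rewrite lexx ler01.
- move=> t; rewrite in_itv /= => /andP[t0 t1].
  rewrite derive1E; have t01 : 0 <= t <= 1 by rewrite !ltW.
  by have [_ ->] := dF _ t01.
Qed.

Lemma cint01_FTC (f : C -> C) (s t : C) :
  (forall a : R, 0 <= a <= 1 -> differentiable f (seg s t a)) ->
  lipC (fun a => 'd f (seg s t a) 1 * (t - s)) ->
  cint01 (fun a => 'd f (seg s t a) 1 * (t - s)) = f t - f s.
Proof.
move=> df h.
have P (al : C) (a : R) : 0 <= a <= 1 ->
    is_derive a 1 (fun t' : R => Re (al * f (seg s t t')))
      (Re (al * ('d f (seg s t a) 1 * (t - s)))).
  move=> ha; have := @is_derive_line R C f s (t - s) a al (df a ha).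
  by rewrite [in X in X -> _]diffC1.
have i1 (z : C) : Re (- iC R * z) = Im z by rewrite !ReImE /=; ring.
apply: Cplx_eq; rewrite ?CReD ?CReN ?CImD ?CImN /=.
  have := @real_FTC (fun t' : R => Re (f (seg s t t'))) _ (lipC_Re h).
  rewrite seg0 seg1; apply => a ha; have := P 1 a ha.
  by under eq_fun do rewrite mul1r; rewrite mul1r.
have := @real_FTC (fun t' : R => Im (f (seg s t t'))) _ (lipC_Im h).
rewrite seg0 seg1; apply => a ha; have := P (- iC R) a ha.
by under eq_fun do rewrite i1; rewrite i1.
Qed.

End LineIntegral.

(** * Interior estimates from holomorphy *)

Section Interior.
Variable R : realType.
Local Notation C := (Cplx R).
Local Notation Re := complex.Re.
Local Notation Im := complex.Im.

(** [holo_diff_lip] is local, so the Lipschitz bound of the derivative holds at first for pairs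
    closer than [r / 2]; for the others twice the bound on the derivative suffices, and [E] is the
    constant that expresses it. *)
Lemma hUr_lip (rho r M : R) (x : C -> C) : 0 < r ->
  (forall z, hU rho z -> differentiable x z /\ nrm (x z) <= M) ->
  exists2 L : R, 0 <= L & forall z w, hUr rho r z -> hUr rho r w ->
    [/\ nrm ('d x z 1) <= L, nrm (x z - x w) <= L * nrm (z - w)
      & nrm ('d x z 1 - 'd x w 1) <= L * nrm (z - w)].
Proof.
move=> r0 Hx.
have hol z : hUr rho r z -> holo z (2 * r) M x.
  by move=> hz w wz; apply: Hx; exact: hUr_ball hz wz.
have [M0|Mneg] := leP 0 M; last first.
  exists 0 => // z w /(hUr_sub r0)/Hx[_ hM].
  by have := le_trans (nrm_ge0 _) hM; rewrite leNgt Mneg.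
have r20 : 0 < 2 * r by rewrite mulr_gt0.
set A := 12 * M / (2 * r).
have A0 : 0 <= A by rewrite divr_ge0 ?(ltW r20)// mulr_ge0.
set B := 2304 * M / (2 * r) ^+ 2.
have B0 : 0 <= B.
  exact: divr_ge0 (mulr_ge0 (ler0n R _) M0) (exprn_ge0 2 (ltW r20)).
have d1 z : hUr rho r z -> nrm ('d x z 1) <= A.
  by move=> hz; have := holo_diff_le (1 : C) r20 (hol z hz); rewrite nrm1 mulr1.
set E := A * (4 / r).
have E0 : 0 <= E by rewrite mulr_ge0// divr_ge0// ltW.
exists (2 * A + B + E) => [|z w hz hw]; first by rewrite !addr_ge0// mulr_ge0.
have A2 : A <= 2 * A by rewrite ler_peMl// ler1n.
split.
- apply: le_trans (d1 z hz) _; apply: le_trans A2 _.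
  by rewrite -addrA lerDl addr_ge0.
- have := @mean_value R C x w (z - w) (A * nrm (z - w)) _.
  rewrite [w + _]addrC subrK => H; apply: le_trans (H _) _.
    move=> t ht; have hp : hUr rho r (w + RtoC t *: (z - w)).
      exact: (hUr_convex hw hz ht).
    split; first exact: (Hx _ (hUr_sub r0 hp)).1.
    by apply: holo_diff_le => //; exact: hol.
  rewrite mulrA; apply: ler_wpM2r => //.
  by rewrite -addrA lerDl addr_ge0.
- have [near|far] := ltP (nrm (z - w)) (r / 2).
    have ww : nrm (w - w) < 2 * r / 4 by rewrite subrr nrm0 divr_gt0.
    have zw : nrm (z - w) < 2 * r / 4 by apply: lt_le_trans near _; lra.
    have := holo_diff_lip (1 : C) r20 (hol w hw) zw ww; rewrite nrm1 mulr1.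
    move/le_trans; apply; apply: ler_wpM2r => //.
    by rewrite addrAC lerDr addr_ge0// mulr_ge0.
  apply: le_trans (nrmB _ _) (le_trans (lerD (d1 z hz) (d1 w hw)) _).
  have : E * (r / 2) <= E * nrm (z - w) by rewrite ler_wpM2l.
  have -> : E * (r / 2) = A + A by rewrite /E; field; rewrite gt_eqF.
  move/le_trans; apply; apply: ler_wpM2r => //.
  by rewrite lerDr addr_ge0// mulr_ge0.
Qed.

Lemma row_hUr_lip n (f : C -> 'rV[C]_n) (rho r M : R) : 0 < r ->
  (forall z, hU rho z -> differentiable f z /\ nrm (f z) <= M) ->
  exists2 L : R, 0 <= L & forall i z w, hUr rho r z -> hUr rho r w ->
    [/\ nrm ('d (fun z => f z 0 i : C) z 1) <= L, nrm (f z 0 i - f w 0 i) <= L * nrm (z - w)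
      & nrm ('d (fun z => f z 0 i : C) z 1 - 'd (fun z => f z 0 i : C) w 1) <= L * nrm (z - w)].
Proof.
move=> r0 Hf.
have H i : exists L : R, 0 <= L /\ forall z w, hUr rho r z -> hUr rho r w ->
    [/\ nrm ('d (fun z => f z 0 i : C) z 1) <= L, nrm (f z 0 i - f w 0 i) <= L * nrm (z - w)
      & nrm ('d (fun z => f z 0 i : C) z 1 - 'd (fun z => f z 0 i : C) w 1) <= L * nrm (z - w)].
  have hM z : hU rho z -> differentiable (fun z => f z 0 i : C) z /\ nrm (f z 0 i : C) <= M.
    move=> /Hf[df fM]; split; first exact: diff_coord.
    exact: le_trans (mx_nrm_coord _ _ _) fM.
  by have [L L0 hL] := hUr_lip r0 hM; exists L.
have [G hG] := choice H.
have G0 i : 0 <= G i by have [] := hG i.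
exists (\sum_i G i) => [|i z w hz hw]; first exact: sumr_ge0.
have Gi : G i <= \sum_i G i by rewrite (bigD1 i)//= lerDl sumr_ge0.
have [h1 h2 h3] := (hG i).2 z w hz hw.
split; first exact: le_trans Gi.
  by apply: le_trans h2 _; exact: ler_wpM2r.
by apply: le_trans h3 _; exact: ler_wpM2r.
Qed.

Lemma derive1_d (f : C -> C) z : differentiable f z -> derive1 f z = 'd f z 1.
Proof. by move=> df; rewrite derive1E'. Qed.

Lemma lipC_seg (S : set C) (g : C -> C) (L : R) s t : convexC S -> 0 <= L -> S s -> S t ->
  (forall z w, S z -> S w -> nrm (g z - g w) <= L * nrm (z - w)) ->
  lipC (fun a => g (seg s t a)).
Proof.
move=> cS L0 Ss St H; exists (L * nrm (t - s)) => [|a b ha hb]; first exact: mulr_ge0.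
apply: le_trans (H _ _ (cS _ _ Ss St a ha) (cS _ _ Ss St b hb)) _.
by rewrite seg_dist -mulrA [nrm _ * _]mulrC.
Qed.

Lemma line_int_bound (S : set C) (f g : C -> C) (L M : R) s t : convexC S -> 0 <= L ->
  S s -> S t ->
  (forall z, S z -> differentiable f z) ->
  (forall z w, S z -> S w -> [/\ nrm ('d f z 1) <= L, nrm (f z - f w) <= L * nrm (z - w)
      & nrm ('d f z 1 - 'd f w 1) <= L * nrm (z - w)]) ->
  (forall z w, S z -> S w -> nrm (g z - g w) <= L * nrm (z - w)) ->
  (forall a, 0 <= a <= 1 -> nrm (g (seg s t a)) <= M) ->
  nrm (line_int f g s t) <= 2 * (L * M * nrm (t - s)).
Proof.
move=> cS L0 Ss St df Hf Hg hM; rewrite /line_int.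
have Sseg a : 0 <= a <= 1 -> S (seg s t a) by apply: cS.
have ext : cint01 (fun a => derive1 f (seg s t a) * g (seg s t a) * (t - s)) =
   cint01 (fun a => 'd f (seg s t a) 1 * g (seg s t a) * (t - s)).
  rewrite /cint01; congr (Complex _ _); apply: eq_Rintegral => a; rewrite inE /= in_itv /= => ha.
    by rewrite derive1_d//; exact: df (Sseg a ha).
  by rewrite derive1_d//; exact: df (Sseg a ha).
rewrite ext; apply: cint01_bound.
  apply: lipCM; last exact: lipC_cst.
  apply: lipCM; last exact: (lipC_seg cS L0).
  apply: (@lipC_seg S (fun z => 'd f z 1) L) => // z w Sz Sw.
  by have [] := Hf z w Sz Sw.
move=> a ha; rewrite !nrmM; apply: ler_wpM2r => //; apply: ler_pM => //; last exact: hM.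
by have [] := Hf _ _ (Sseg a ha) (Sseg a ha).
Qed.

End Interior.

Section LevyInterior.
Variables (R : realType) (d : nat).
Local Notation C := (Cplx R).
Variables (rho gamma K : R) (X : C -> 'rV[C]_d) (X2 : C -> C -> 'M[C]_d).
Hypothesis LA : levy_area gamma (hD rho) X X2.
Hypothesis RD : rough_data (hD rho) X X2 K gamma.
Hypothesis rho0 : 0 < rho.
Hypothesis gam0 : 0 < gamma.
Hypothesis K0 : 0 <= K.

Lemma X_interior : exists M, forall z, hU rho z -> differentiable X z /\ nrm (X z) <= M.
Proof.
exists (nrm (X 0) + K * (2 * rho) `^ gamma) => z zU; split.
  by apply: (levy_path_analytic LA); rewrite upper_hD; exact: zU.
apply: le_trans (nrm_shift _ (X 0)) _; rewrite lerD2l.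
have Dz := hU_sub zU; have D0 := hD0 rho0.
apply: le_trans (rd_X RD Dz D0) _; apply: ler_wpM2l => //.
apply: powR_mono; first exact: ltW.
by rewrite nrm_ge0/= ltW// hD_diam.
Qed.

(** Inside, the area is an iterated integral of a smooth path, hence of second order. The exponent
    [2 * gamma], at most 1 in the theorem, would be too weak to read off a differential equation. *)
Lemma X2_quad r : 0 < r -> exists2 c : R, 0 <= c & forall s t, hUr rho r s -> hUr rho r t ->
  nrm (X2 t s) <= c * nrm (t - s) ^+ 2.
Proof.
move=> r0; have [M hM] := X_interior; have [L L0 hL] := row_hUr_lip r0 hM.
exists (2 * (L * L)) => [|s t hs ht]; first by rewrite !mulr_ge0.
apply/mx_nrm_le => [|i j]; first by rewrite !mulr_ge0 ?exprn_ge0.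
have sin : seg_in (upper (hD rho)) s t.
  by move=> a ha; rewrite upper_hD; apply: (hUr_sub r0); exact: (hUr_convex hs ht).
rewrite (levy_iterated LA sin i j).
have -> : 2 * (L * L) * nrm (t - s) ^+ 2 = 2 * (L * (L * nrm (t - s)) * nrm (t - s)) by ring.
apply: (line_int_bound (@hUr_convex R rho r) L0 hs ht).
- move=> z hz; apply: diff_coord; exact: (hM z (hUr_sub r0 hz)).1.
- by move=> z w hz hw; exact: hL.
- move=> z w hz hw; have [_ h _] := hL j z w hz hw.
  by rewrite opprB addrA subrK.
- move=> a ha; have hp := hUr_convex hs ht ha.
  have [_ h _] := hL j _ _ hp hs; apply: le_trans h _; apply: ler_wpM2l => //.
  have := seg_dist s t 0 a; rewrite seg0 => ->.
  by case/andP: ha => a0 a1; rewrite subr0 ger0_norm// ler_piMl.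
Qed.

End LevyInterior.

(** * Existence *)

Section ScaledData.
Variables (R : realType) (d l : nat).
Local Notation C := (Cplx R).
Local Notation V := 'rV[C]_l.
Variables (rho gam K : R) (X : C -> 'rV[C]_d) (X2 : C -> C -> 'M[C]_d).
Hypothesis LA : levy_area gam (hD rho) X X2.
Hypothesis RD : rough_data (hD rho) X X2 K gam.
Hypothesis rho0 : 0 < rho.

Lemma diff_scale (c : C) (z : C) : differentiable (fun t : C => c * t) z.
Proof. by apply: differentiableM => //; exact: ex_derive. Qed.

Lemma X_diff_coord i z : hU rho z -> differentiable (fun z => X z 0 i : C) z.
Proof.
by move=> zU; apply: diff_coord; apply: (levy_path_analytic LA); rewrite upper_hD; exact: zU.
Qed.

Lemma diff_scaled_comp (W : normedModType C) (f : C -> W) (c z : C) :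
  differentiable f (c * z) -> differentiable (fun t => f (c * t)) z.
Proof. by move=> h; apply: (differentiable_comp (diff_scale c z) h). Qed.

Lemma X_scale_diff (c : R) i z : 0 <= c <= 1 -> hU rho z ->
  differentiable (fun t => X (RtoC c * t) 0 i : C) z.
Proof.
move=> /andP[c0 c1] zU; have [->|cn] := eqVneq c 0.
  have -> : (fun t => X (RtoC 0 * t) 0 i : C) = fun=> X 0 0 i.
    by apply/funext => t; rewrite RtoC0 mul0r.
  exact: differentiable_cst.
apply: (diff_scaled_comp (f := fun z => X z 0 i : C)).
by apply: X_diff_coord; apply: hU_scale => //; rewrite lt_def cn c0 c1.
Qed.

Lemma X2_diff_pair i j (p q : C -> C) z : hU rho (p z) -> hU rho (q z) ->
  differentiable p z -> differentiable q z ->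
  differentiable (fun t => X2 (p t) (q t) i j : C) z.
Proof.
move=> pU qU dp dq; apply: diff_coord.
have h : differentiable (fun w : (C * C)%type => X2 w.1 w.2) (p z, q z).
  by apply: (levy_analytic LA); rewrite upper_hD.
exact: (differentiable_comp (differentiable_pair dp dq) h).
Qed.

Lemma hU_open z : hU rho z -> exists2 e, 0 < e & forall w, nrm (w - z) < e -> hU rho w.
Proof.
move=> zU; have [r r0 [h _]] := hU_hUr zU zU; exists (2 * r); first exact: mulr_gt0.
by move=> w; exact: (hUr_ball r0 h).
Qed.

(** For [b = 0] the base point is the boundary point 0, where [X2] is not assumed analytic; Chen's
    relation through an interior point [p] leaves only interior arguments depending on [t]. *)
Lemma X2_scale_diff (b c : R) i j z : 0 <= b <= 1 -> 0 < c <= 1 -> hU rho z ->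
  differentiable (fun t => X2 (RtoC c * t) (RtoC b * t) i j : C) z.
Proof.
move=> /andP[b0 b1] c01 zU.
have [bz|bn] := eqVneq b 0; last first.
  apply: X2_diff_pair; [exact: hU_scale| |exact: diff_scale|exact: diff_scale].
  by apply: hU_scale => //; rewrite lt_def bn b0 b1.
have [e e0 he] := hU_open zU.
pose p := pull rho 1 0.
have pU : hU rho p by apply: pull_hU => //; [rewrite ltr01 lexx|exact: hD0].
apply: (@diff_near R C C (fun t => (X2 (RtoC c * t) p i j + X2 p 0 i j) + (X (RtoC c * t) 0 i - X p 0 i) * delta1 X p 0 0 j) _ z e e0).
  move=> t /he tU; rewrite bz RtoC0 mul0r (rd_chen RD (hU_sub (hU_scale c01 tU)) (hU_sub pU) (hD0 rho0)).
  by rewrite {3}/delta1 !mxE.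
apply: differentiableD.
  apply: differentiableD; last exact: differentiable_cst.
  apply: X2_diff_pair; [exact: hU_scale|exact: pU|exact: diff_scale|exact: differentiable_cst].
apply: differentiableM; last exact: differentiable_cst.
apply: differentiableB; last exact: differentiable_cst.
by apply: X_scale_diff => //; case/andP: c01 => c0 ->; rewrite ltW.
Qed.

Variable sigma : V -> 'M[C]_(d, l).
Hypothesis dsigma : forall v, differentiable sigma v.
Local Notation E := (euler sigma X X2).

(** All times of the chain are fixed real multiples of the endpoint [t], and a multiple in [(0, 1]]
    of an interior point is interior: this makes the chain holomorphic in [t]. *)
Lemma flow_scaledS (n k : nat) (a : V) (t : C) : flow E k.+1 0 (t / n.+1%:R) a =
  E (RtoC (k.+1%:R / n.+1%:R) * t) (RtoC (k%:R / n.+1%:R) * t) (flow E k 0 (t / n.+1%:R) a).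
Proof.
have q (j : nat) : j%:R * (t / n.+1%:R) = RtoC (j%:R / n.+1%:R) * t :> C.
  by rewrite RtoCM RtoCV !RtoC_nat; ring.
rewrite -[in LHS](addn1 k) flowD /= add0r -!q.
by rewrite -[in RHS](addn1 k) natrD mulrDl mul1r.
Qed.

Lemma flow_scaled_diff (n k : nat) (a : V) (z : C) : (k <= n.+1)%N -> hU rho z ->
  differentiable (fun t : C => flow E k 0 (t / n.+1%:R) a) z.
Proof.
move=> kn zU; elim: k kn => [|k IH] kn; first exact: differentiable_cst.
have -> : (fun t : C => flow E k.+1 0 (t / n.+1%:R) a) =
  fun t => E (RtoC (k.+1%:R / n.+1%:R) * t) (RtoC (k%:R / n.+1%:R) * t)
    (flow E k 0 (t / n.+1%:R) a) by apply/funext => t; exact: flow_scaledS.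
have k01 := @natdiv01 R n k (ltnW kn).
have k01' : 0 < (k.+1%:R / n.+1%:R : R) <= 1.
  by rewrite divr_gt0 ?ltr0n//; case/andP: (@natdiv01 R n k.+1 kn).
apply: euler_comp_diff.
- exact: dsigma.
- move=> i; have -> : (fun t => delta1 X (RtoC (k.+1%:R / n.+1%:R) * t) (RtoC (k%:R / n.+1%:R) * t) 0 i : C) = fun t => X (RtoC (k.+1%:R / n.+1%:R) * t) 0 i - X (RtoC (k%:R / n.+1%:R) * t) 0 i.
    by apply/funext => t; rewrite /delta1 !mxE.
  apply: differentiableB; first by apply: X_scale_diff => //; exact: natdiv01.
  exact: X_scale_diff.
- by move=> i j; exact: X2_scale_diff.
- exact: IH (ltnW kn).
Qed.

End ScaledData.

Section Solution.
Variables (R : realType) (d l : nat).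
Local Notation C := (Cplx R).
Local Notation V := 'rV[C]_l.
Variable sigma : V -> 'M[C]_(d, l).
Hypothesis dsigma : forall v, differentiable sigma v.
Variables (rho gam K B S del : R) (X : C -> 'rV[C]_d) (X2 : C -> C -> 'M[C]_d) (a : V).
Hypothesis LA : levy_area gam (hD rho) X X2.
Hypothesis RD : rough_data (hD rho) X X2 K gam.
Hypothesis rho0 : 0 < rho.
Hypothesis SB : sigma_bound sigma (B + 4) S.
Hypothesis K0 : 0 <= K.
Hypothesis gam0 : 0 < gam.
Hypothesis gam13 : 1 < 3 * gam.
Hypothesis del01 : 0 < del <= 1.
Hypothesis SS : small_step (K1e d K S) (K2e d K S) gam (3 * gam) del.
Hypothesis rhodel : 2 * rho <= del.
Hypothesis aB : nrm a <= B - 1.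
Local Notation E := (euler sigma X X2).
Local Notation K1 := (K1e d K S).
Local Notation K4 := (K4c (K2e d K S) (3 * gam)).
Local Notation D := (hD rho).

Let AF : almost_flow D E B K1 (K2e d K S) gam (3 * gam) del :=
  euler_af dsigma (@hD_convex R rho) RD SB K0 gam0 gam13 del01 SS.

Let D0 : D 0 := hD0 rho0.

Let diam t s : D t -> D s -> nrm (t - s) <= del.
Proof. by move=> Dt Ds; apply: ltW; apply: lt_le_trans (hD_diam Dt Ds) rhodel. Qed.

Let K40 : 0 <= K4 := K4_ge0 AF.
Let del0 : 0 <= del. Proof. by case/andP: del01 => h _; exact: ltW. Qed.

Definition polygon (n : nat) (t : C) : V := flow E n.+1 0 (t / n.+1%:R) a.
Definition rate (n : nat) : R := 4 * (K4 * del `^ (3 * gam) * (n.+1%:R^-1) `^ (3 * gam - 1)).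

Lemma rate_le m n : (m <= n)%N -> rate n <= rate m.
Proof.
move=> mn; apply: ler_wpM2l => //; apply: ler_wpM2l; first exact: mulr_ge0 K40 (powR_ge0 _ _).
apply: powR_mono; first by have := gam13; lra.
by rewrite invr_ge0 ler0n/= lef_pV2 ?posrE ?ltr0n// ler_nat.
Qed.

Lemma rate_small e : 0 < e -> exists n, rate n <= e.
Proof.
move=> e0; have A0 : 0 <= 4 * (K4 * del `^ (3 * gam)).
  exact: mulr_ge0 (ler0n R 4) (mulr_ge0 K40 (powR_ge0 _ _)).
have p0 : 0 < 3 * gam - 1 by have := gam13; lra.
have [n hn] := inv_rate A0 p0 e0; exists n; rewrite /rate mulrA; exact: hn.
Qed.

Let natV (n : nat) (t : C) : 0 + n.+1%:R * (t / n.+1%:R) = t.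
Proof. by rewrite add0r mulrC divfK// pnatr_eq0. Qed.

Let natN (n : nat) (t : C) : n.+1%:R * nrm (t / n.+1%:R) = nrm t.
Proof. by rewrite nrm_divn mulrC divfK// pnatr_eq0. Qed.

Let t_del t : D t -> nrm t <= del.
Proof. by move=> Dt; have := diam Dt D0; rewrite subr0. Qed.

Lemma exists_polygon_limit : exists y : C -> V, forall t, D t -> forall n,
  nrm (polygon n t - y t) <= rate n.
Proof.
have H t : exists z, D t -> forall n, nrm (polygon n t - z) <= rate n.
  have [Dt|nDt] := pselect (D t); last by exists 0.
  have [z hz] := flow_limit AF SS D0 Dt (diam Dt D0) aB.
  by exists z => _ n; have := hz n; rewrite subr0.
by have [y hy] := choice H; exists y.
Qed.

Lemma polygon_move n t : D t -> nrm (polygon n t - a) <= (1 + K1) * nrm t `^ gam.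
Proof.
move=> Dt; have := @flow_move R l D E B K1 _ gam _ del n.+1 0 (t / n.+1%:R) a AF SS.
rewrite natV natN; apply => //; first exact: t_del.
by move: aB; lra.
Qed.

Lemma polygon_bound n t : D t -> nrm (polygon n t) <= B.
Proof.
move=> Dt; have := nrm_shift (polygon n t) a; have := polygon_move n Dt.
have := @small_move R l D E B K1 _ gam _ del (nrm t) AF SS _.
rewrite nrm_ge0 t_del// => /(_ isT); move: aB; lra.
Qed.

Variable y : C -> V.
Hypothesis hy : forall t, D t -> forall n, nrm (polygon n t - y t) <= rate n.

Lemma limit_le t (M : R) (w : V) : D t -> (forall n, nrm (polygon n t - w) <= M) -> nrm (y t - w) <= M.
Proof.
move=> Dt H; apply: le_of_forall_eps => e e0; have [n hn] := rate_small e0.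
apply: le_trans (nrm_tri (polygon n t) _ _) _; rewrite addrC; apply: lerD; first exact: H.
by rewrite nrmBC; apply: le_trans (hy Dt n) hn.
Qed.

Lemma limit_bound t : D t -> nrm (y t) <= B.
Proof.
by move=> Dt; have := @limit_le t B 0 Dt; rewrite subr0; apply => n; rewrite subr0; exact: polygon_bound.
Qed.

Lemma limit_init : y 0 = a.
Proof.
apply/eqP; rewrite -subr_eq0; apply/eqP/nrm_eq0/le_anti; rewrite nrm_ge0 andbT.
apply: limit_le => // n; have := polygon_move n D0.
by rewrite nrm0 powR0 ?mulr0// gt_eqF.
Qed.

Lemma limit_diff z : hU rho z -> differentiable y z.
Proof.
move=> zU; apply: diff_mx => i c; rewrite (ord1 i).
have [e e0 he] := hU_open zU.
apply: (@holo_limit R C (fun n t => polygon n t 0 c) (fun t => y t 0 c) z e B rate) => //.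
- move=> n v /he vU; split; last first.
    apply: le_trans (mx_nrm_coord _ _ _) _; apply: polygon_bound; exact: hU_sub.
  apply: diff_coord; exact: (flow_scaled_diff LA RD rho0 dsigma a (leqnn _) vU).
- exact: rate_le.
- exact: rate_small.
- move=> n v /he/hU_sub vD.
  have -> : polygon n v 0 c - y v 0 c = (polygon n v - y v) 0 c by rewrite !mxE.
  apply: le_trans (mx_nrm_coord _ _ _) _; exact: hy.
Qed.

(* The polygons of [z] restricted to [[0, s]] are polygons of [s], because [s] is
   a rational multiple of [z]. *)
Lemma limit_radial m z s : D z -> s = RtoC (m.+1%:R / m.+2%:R) * z ->
  nrm (y z - E z s (y s)) <= K4 * nrm (z - s) `^ (3 * gam).
Proof.
move=> Dz sE.
have Ds : D s by rewrite sE; apply: hD_scale => //; exact: natdiv01.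
set L := 1 + 24 * K1 * nrm (z - s) `^ gam.
have L0 : 0 <= L.
  have := K1e_ge0 SB K0; rewrite /L => h; apply: addr_ge0 => //.
  by apply: mulr_ge0 (powR_ge0 _ _); apply: mulr_ge0.
have st n : nrm (y z - E z s (y s)) <= K4 * nrm (z - s) `^ (3 * gam) + (1 + L) * rate n.
  (* There are [T + 1 = (m + 2) * (n + 1)] steps on [[0, z]], and the first
     [M + 1 = (m + 1) * (n + 1)] of them end at [s]. *)
  pose T := (n + m.+1 * n.+1)%N; pose M := (n + m * n.+1)%N.
  pose h := z / T.+1%:R : C.
  have TE : T.+1 = (M.+1 + n.+1)%N by rewrite /T /M; lia.
  have hE : h = s / M.+1%:R.
    rewrite /h sE RtoCM RtoCV !RtoC_nat.
    have -> : T.+1 = (m.+2 * n.+1)%N by rewrite /T; lia.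
    have -> : M.+1 = (m.+1 * n.+1)%N by rewrite /M; lia.
    have nz k : (k.+1%:R : C) != 0 by rewrite pnatr_eq0.
    rewrite !natrM; move: (nz m) (nz m.+1) (nz n); move: (m.+1%:R : C) (m.+2%:R : C) (n.+1%:R : C).
    by move=> x w v hx hw hv; field; rewrite hx hw hv.
  have pT : polygon T z = flow E n.+1 s h (polygon M s).
    by rewrite /polygon TE -TE -/h TE flowD hE natV.
  have sz : s + n.+1%:R * h = z.
    have := natV T z; rewrite -/h {1}TE natrD mulrDl addrA => <-.
    by congr (_ + _); rewrite hE natV.
  have nh : n.+1%:R * nrm h = nrm (z - s).
    by rewrite -nrm_natM -sz addrAC subrr add0r.
  have Mb := polygon_bound M Ds; have sb := limit_bound Ds.
  have near : nrm (flow E n.+1 s h (polygon M s) - E z s (polygon M s)) <= K4 * nrm (z - s) `^ (3 * gam).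
    have := @flow_near2 R l D E B K1 _ gam _ del n.+1 s h (polygon M s) AF SS isT Ds.
    rewrite sz nh; apply => //.
    - exact: diam.
    - by move: Mb; lra.
  have lip : nrm (E z s (polygon M s) - E z s (y s)) <= L * rate n.
    apply: le_trans (E_lip AF Dz Ds (diam Dz Ds) _ _) _.
    + by move: Mb; lra.
    + by move: sb; lra.
    apply: ler_wpM2l => //; apply: le_trans (hy Ds M) _; apply: rate_le; exact: leq_addr.
  have yz : nrm (y z - polygon T z) <= rate n.
    by rewrite nrmBC; apply: le_trans (hy Dz T) _; apply: rate_le; exact: leq_addr.
  apply: le_trans (nrm_tri (polygon T z) _ _) _; rewrite (mulrDl 1 L) mul1r [leRHS]addrCA.
  apply: lerD; first exact: yz.
  rewrite pT.
  apply: le_trans (nrm_tri (E z s (polygon M s)) _ _) _; exact: lerD near lip.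
apply: le_of_forall_eps => e e0.
have L1 : 0 < 1 + L by rewrite ltr_pwDl.
have [n hn] := rate_small (divr_gt0 e0 L1).
apply: le_trans (st n) _; rewrite lerD2l mulrC -ler_pdivlMr//.
Qed.

End Solution.

Section LinComb.
Variable R : realType.
Local Notation C := (Cplx R).

Lemma diffMr_app (f : C -> C) (k z : C) : differentiable f z ->
  differentiable (fun x => f x * k) z /\ 'd (fun x => f x * k) z 1 = 'd f z 1 * k.
Proof.
move=> df; split; first by apply: differentiableM => //; exact: differentiable_cst.
have h := congr1 (@^~ (1 : C)) (diffZ k df).
have -> : (fun x => f x * k) = k \*: f by apply/funext => x; rewrite mulrC.
by rewrite [LHS]h mulrC.
Qed.

Lemma diff_lincomb n (f : 'I_n -> C -> C) (k : 'I_n -> C) z :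
  (forall i, differentiable (f i) z) ->
  differentiable (fun x => \sum_i f i x * k i) z /\
  'd (fun x => \sum_i f i x * k i) z 1 = \sum_i 'd (f i) z 1 * k i.
Proof.
elim: n f k => [|n IH] f k df.
  have -> : (fun x => \sum_(i < 0) f i x * k i) = cst 0.
    by apply/funext => x; rewrite big_ord0.
  split; first exact: differentiable_cst.
  by rewrite big_ord0 diff_cst.
have -> : (fun x => \sum_i f i x * k i) =
    (fun x => \sum_(i < n) f (lift ord0 i) x * k (lift ord0 i)) + (fun x => f ord0 x * k ord0).
  by apply/funext => x; rewrite big_ord_recl addrC.
have [d1 e1] := IH (fun i => f (lift ord0 i)) (fun i => k (lift ord0 i)) (fun i => df _).
have [d2 e2] := diffMr_app (k ord0) (df ord0).
split; first exact: differentiableD.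
have h := congr1 (@^~ (1 : C)) (diffD d1 d2).
by rewrite [LHS]h big_ord_recl addrC -e1 -e2.
Qed.

End LinComb.

(** * The differential equation in the open half disc *)

Section Interior.
Variables (R : realType) (d l : nat).
Local Notation C := (Cplx R).
Local Notation V := 'rV[C]_l.
Variable sigma : V -> 'M[C]_(d, l).
Hypothesis dsigma : forall v, differentiable sigma v.
Variables (rho gam K r0 S : R) (X : C -> 'rV[C]_d) (X2 : C -> C -> 'M[C]_d) (y : C -> V).
Hypothesis LA : levy_area gam (hD rho) X X2.
Hypothesis RD : rough_data (hD rho) X X2 K gam.
Hypothesis rho0 : 0 < rho.
Hypothesis SB : sigma_bound sigma r0 S.
Hypothesis K0 : 0 <= K.
Hypothesis gam0 : 0 < gam.
Local Notation E := (euler sigma X X2).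
Hypothesis ydiff : forall z, hU rho z -> differentiable y z.
Hypothesis ybound : forall z, hU rho z -> nrm (y z) <= r0.

Let S0 : 0 <= S. Proof. exact: le_trans ler01 (sb_S SB). Qed.

(* Its derivative vanishes where [y] takes the value [v], so that its increments
   are of second order. *)
Definition frozen (v : V) (c : 'I_l) (x : C) : C :=
  y x 0 c - \sum_i X x 0 i * sigma v i c.

Lemma frozen_diff v c z : hU rho z -> differentiable (frozen v c) z /\
  'd (frozen v c) z 1 = 'd (fun x => y x 0 c : C) z 1 - \sum_i 'd (fun x => X x 0 i : C) z 1 * sigma v i c.
Proof.
move=> zU; have dy : differentiable (fun x => y x 0 c : C) z by apply: diff_coord; exact: ydiff.
have [d2 e2] := @diff_lincomb R d (fun i x => X x 0 i) (fun i => sigma v i c) z (fun i => X_diff_coord LA i zU).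
split; first exact: differentiableB.
by rewrite -e2; exact: diffB_app.
Qed.

Lemma defectE c t s : (y t - E t s (y s)) 0 c =
  frozen (y s) c t - frozen (y s) c s - \sum_i \sum_j X2 t s i j * gf sigma i j (y s) 0 c.
Proof.
rewrite /E /frozen /delta1 !mxE !summxE.
have -> : \sum_i ((X t - X s) 0 i *: vf sigma i (y s)) 0 c =
    \sum_i X t 0 i * sigma (y s) i c - \sum_i X s 0 i * sigma (y s) i c.
  by rewrite -sumrB; apply: eq_bigr => i _; rewrite !mxE; ring.
have -> : \sum_i (\sum_j X2 t s i j *: gf sigma i j (y s)) 0 c =
    \sum_i \sum_j X2 t s i j * gf sigma i j (y s) 0 c.
  by apply: eq_bigr => i _; rewrite summxE; apply: eq_bigr => j _; rewrite !mxE.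
ring.
Qed.

Lemma interior_bounds r : 0 < r -> exists2 Q : R, 0 <= Q & forall s t, hUr rho r s -> hUr rho r t ->
  [/\ forall c, nrm (\sum_i \sum_j X2 t s i j * gf sigma i j (y s) 0 c) <= Q * nrm (t - s) ^+ 2,
      forall c, nrm (\sum_i (X t 0 i - X s 0 i) * (sigma (y t) i c - sigma (y s) i c)) <= Q * nrm (t - s) ^+ 2
    & forall c, nrm (\sum_i 'd (fun x => X x 0 i : C) t 1 * (sigma (y t) i c - sigma (y s) i c)) <= Q * nrm (t - s)].
Proof.
move=> rp.
have [M hM] := X_interior LA RD rho0 gam0 K0; have [L L0 hL] := row_hUr_lip rp hM.
have hMy z : hU rho z -> differentiable y z /\ nrm (y z) <= r0.
  by move=> zU; split; [exact: ydiff|exact: ybound].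
have [Ly Ly0 hLy] := row_hUr_lip rp hMy.
have [q q0 hq] := X2_quad LA RD rho0 gam0 K0 rp.
have sumle (T : 'I_d -> C) (A : R) : (forall i, nrm (T i) <= A) -> nrm (\sum_i T i) <= d%:R * A.
  move=> H; apply: le_trans (nrm_sum _ _ _) _.
  apply: le_trans (ler_sum _ (fun i _ => H i)) _.
  by rewrite sumr_const card_ord mulr_natl.
have A0 : 0 <= d%:R * (d%:R * (q * S)) by rewrite !mulr_ge0.
have B0 : 0 <= d%:R * (L * (24 * S * Ly)).
  by apply: mulr_ge0 => //; apply: mulr_ge0 => //; apply: mulr_ge0 => //; exact: mulr_ge0.
exists (d%:R * (d%:R * (q * S)) + d%:R * (L * (24 * S * Ly))) => [|s t hs ht]; first exact: addr_ge0.
have dsg i c : nrm (sigma (y t) i c - sigma (y s) i c) <= 24 * S * Ly * nrm (t - s).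
  have ys : nrm (y s) <= r0 by apply: ybound; exact: hUr_sub hs.
  have yt : nrm (y t) <= r0 by apply: ybound; exact: hUr_sub ht.
  apply: le_trans (ball_lip (sg_bholo dsigma SB i c) yt ys) _.
  rewrite -[in leRHS]mulrA; apply: ler_wpM2l; first exact: mulr_ge0.
  apply/mx_nrm_le => [|i' c']; first exact: mulr_ge0.
  by rewrite (ord1 i') !mxE; have [] := hLy c' t s ht hs.
split => c.
- rewrite mulrDl; apply: le_trans (_ : _ <= d%:R * (d%:R * (q * S)) * nrm (t - s) ^+ 2) _; last first.
    by rewrite lerDl; apply: mulr_ge0 => //; exact: exprn_ge0.
  rewrite -!mulrA; apply: (@sumle _ _) => i; apply: (@sumle _ _) => j.
  rewrite nrmM [S * _]mulrC [q * (_ * _)]mulrA; apply: ler_pM => //.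
    by apply: le_trans (mx_nrm_coord _ _ _) _; exact: hq.
  apply: (sb_gf SB); apply: le_trans (ybound (hUr_sub rp hs)) _.
  by rewrite lerDl.
- rewrite mulrDl; apply: le_trans (_ : _ <= d%:R * (L * (24 * S * Ly)) * nrm (t - s) ^+ 2) _; last first.
    by rewrite lerDr; apply: mulr_ge0 => //; exact: exprn_ge0.
  rewrite -mulrA; apply: (@sumle _ _) => i; rewrite nrmM.
  have -> : L * (24 * S * Ly) * nrm (t - s) ^+ 2 = (L * nrm (t - s)) * (24 * S * Ly * nrm (t - s)) by ring.
  apply: ler_pM => //; by have [] := hL i t s ht hs.
- rewrite mulrDl; apply: le_trans (_ : _ <= d%:R * (L * (24 * S * Ly)) * nrm (t - s)) _; last first.
    by rewrite lerDr; apply: mulr_ge0.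
  rewrite -!mulrA; apply: (@sumle _ _) => i; rewrite nrmM !mulrA -!(mulrA L).
  apply: ler_pM => //; by have [] := hL i t s ht hs.
Qed.

Lemma frozen_change c s t : frozen (y t) c t - frozen (y t) c s =
  (y t - E t s (y s)) 0 c + \sum_i \sum_j X2 t s i j * gf sigma i j (y s) 0 c
  - \sum_i (X t 0 i - X s 0 i) * (sigma (y t) i c - sigma (y s) i c).
Proof.
rewrite defectE /frozen.
have -> : \sum_i (X t 0 i - X s 0 i) * (sigma (y t) i c - sigma (y s) i c) =
    (\sum_i X t 0 i * sigma (y t) i c - \sum_i X s 0 i * sigma (y t) i c) -
    (\sum_i X t 0 i * sigma (y s) i c - \sum_i X s 0 i * sigma (y s) i c).
  by rewrite -!sumrB; apply: eq_bigr => i _; ring.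
ring.
Qed.

(** If the derivative of [frozen (y z) c] at [z] had modulus [A > 0], the increment from [s] to [z]
    would be of order [A * x] with [x = nrm (z - s)], whereas the radial estimate and the quadratic
    bounds make it [o(x)]. Points on one ray suffice because a complex derivative is determined by a
    single direction. *)
Lemma radial_ode (K4 th : R) z c : 0 <= K4 -> 1 < th -> hU rho z ->
  (forall m s, s = RtoC (m.+1%:R / m.+2%:R) * z ->
     nrm (y z - E z s (y s)) <= K4 * nrm (z - s) `^ th) ->
  'd (fun x => y x 0 c : C) z 1 = \sum_i 'd (fun x => X x 0 i : C) z 1 * sigma (y z) i c.
Proof.
move=> K40 th1 zU rad; have [dF eF] := frozen_diff (y z) c zU.
apply/eqP; rewrite -subr_eq0 -eF; apply/negPn/negP; rewrite -nrm_gt0.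
set A := nrm _ => A0.
have z0 : 0 < nrm z.
  by rewrite nrm_gt0; apply/negP => /eqP h; case: zU; rewrite h /= ltxx.
(* The point [s] will be chosen between [z / 2] and [z], so one convex core containing these two
   ends contains it as well. *)
have half : 0 < (2^-1 : R) <= 1 by lra.
have [r rp [hr1 hr2]] := hU_hUr (hU_scale half zU) zU.
have [Q Q0 hQ] := interior_bounds rp.
have A4 : 0 < A / 4 by rewrite divr_gt0.
have [d1 d10 hd1] := differentiable_nrm dF A4.
have th10 : 0 < th - 1 by rewrite subr_gt0.
have [d2 d20 hd2] := powR_small K40 th10 A4.
have d3p : 0 < A / 4 / (1 + 2 * Q) by rewrite divr_gt0// ltr_pwDl// mulr_ge0.
(* Below this distance each of the three errors is at most a quarter of [A * x]. *)
pose e := Num.min (d1 / 2) (Num.min d2 (A / 4 / (1 + 2 * Q))).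
have e0 : 0 < e by rewrite /e !lt_min d20 d3p divr_gt0.
have [m hm] := inv_rate (ltW z0) (@ltr01 R) e0.
have := hm m.+1 (leqnSn m); rewrite powRr1 ?invr_ge0// => {}hm.
have nz : (m.+2%:R : R) != 0 by rewrite pnatr_eq0.
have E1 : m.+1%:R = m.+2%:R - 1 :> R by rewrite -[m.+2]addn1 natrD addrK.
pose s := RtoC (m.+1%:R / m.+2%:R) * z.
have zs : z - s = RtoC (m.+2%:R^-1) * z.
  rewrite /s -{1}[z]mul1r -mulrBl -RtoC1 -RtoCN -RtoCD; congr (RtoC _ * _).
  by rewrite E1; field.
have nzs : nrm (z - s) = nrm z * m.+2%:R^-1.
  by rewrite zs nrmM nrm_RtoC ger0_norm ?invr_ge0// mulrC.
set x := nrm (z - s) in nzs.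
have x0 : 0 < x by rewrite nzs mulr_gt0// invr_gt0.
have [x1 x2 x3] : [/\ x <= d1 / 2, x <= d2 & x <= A / 4 / (1 + 2 * Q)].
  by move: hm; rewrite -nzs /e !le_min => /and3P[].
have hs : hUr rho r s.
  have k01 : 0 <= (m%:R / m.+2%:R : R) <= 1.
    rewrite divr_ge0//= ler_pdivrMr ?ltr0n// mul1r ler_nat; exact: leq_trans (leqnSn m) (leqnSn _).
  have sE : s = seg (RtoC 2^-1 * z) z (m%:R / m.+2%:R); last by rewrite sE; exact: hUr_convex.
  rewrite segE; apply/esym; rewrite /s -[in X in _ * (X - _)](mul1r z) -RtoC1 -mulrBl -RtoCN -RtoCD mulrA -RtoCM -mulrDl -RtoCD; congr (RtoC _ * _).
  have E2 : m%:R = m.+2%:R - 2 :> R by rewrite -[m.+2]addn2 natrD addrK.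
  by rewrite E1 E2; field.
have hz := hr2.
have [b1 b2 _] := hQ s z hs hz.
have up : nrm (frozen (y z) c z - frozen (y z) c s) <= K4 * x `^ th + Q * x ^+ 2 + Q * x ^+ 2.
  rewrite frozen_change; apply: nrmB_le (b2 c); apply: nrmD_le (b1 c).
  exact: le_trans (mx_nrm_coord _ _ _) (rad m s erefl).
have lo := hd1 (s - z) _; rewrite [z + _]addrC subrK [nrm (s - z)]nrmBC in lo.
have {}lo : nrm (frozen (y z) c s - frozen (y z) c z - 'd (frozen (y z) c) z (s - z)) <= A / 4 * x.
  by apply: lo; rewrite -/x; apply: le_lt_trans x1 _; rewrite ltr_pdivrMr// ltr_pMr// ltr1n.
have Ax : nrm ('d (frozen (y z) c) z (s - z)) = A * x.
  by rewrite diffC1 nrmM [nrm (s - z)]nrmBC.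
have := nrm_shift ('d (frozen (y z) c) z (s - z)) (frozen (y z) c s - frozen (y z) c z).
rewrite Ax [nrm ('d _ _ _ - _)]nrmBC [nrm (frozen _ _ s - _)]nrmBC => fin.
have p1 : K4 * x `^ th <= A / 4 * x.
  have t1 : 0 < (1 : R) < th by rewrite ltr01 th1.
  rewrite (powR_split (ltW x0) t1) powRr1 ?(ltW x0)// mulrA; apply: ler_wpM2r; first exact: ltW.
  by apply: hd2; rewrite (ltW x0) x2.
have p2 : Q * x ^+ 2 + Q * x ^+ 2 <= A / 4 * x.
  have -> : Q * x ^+ 2 + Q * x ^+ 2 = 2 * Q * x * x by ring.
  apply: ler_wpM2r; first exact: ltW.
  have q1 : 0 < 1 + 2 * Q by rewrite ltr_pwDl// mulr_ge0.
  move: x3; rewrite ler_pdivlMr//; apply: le_trans.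
  by rewrite mulrDr mulr1 [x * _]mulrC lerDr ltW.
have Ax0 : 0 < A * x by rewrite mulr_gt0.
have A4x : A / 4 * x = A * x / 4 by rewrite mulrAC.
have tot := le_trans fin (lerD up lo).
have : A * x <= A / 4 * x + A / 4 * x + A / 4 * x.
  apply: le_trans tot _; apply: lerD => //; rewrite -addrA; exact: lerD.
rewrite A4x; move: (A * x) Ax0 => w w0 hw; have : w <= 0 by move: hw; lra.
by rewrite leNgt w0.
Qed.

(** By the differential equation the derivative of [frozen (y s) c] at [p] involves only
    [sigma (y p) - sigma (y s)], which is of order [nrm (p - s)]; the mean value inequality then
    gives order 2, with a constant depending on [r]. *)
Lemma interior_davie r : 0 < r ->
  (forall z c, hU rho z ->
   'd (fun x => y x 0 c : C) z 1 = \sum_i 'd (fun x => X x 0 i : C) z 1 * sigma (y z) i c) ->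
  exists2 q, 0 <= q & davie (hUr rho r) E y q 2.
Proof.
move=> rp ode; have [Q Q0 hQ] := interior_bounds rp.
exists (2 * Q + Q) => [|s t hs ht]; first by rewrite addr_ge0// mulr_ge0.
rewrite powR_mulrn//; apply/mx_nrm_le => [|i c].
  by apply: mulr_ge0; [rewrite addr_ge0// mulr_ge0|exact: exprn_ge0].
have [b1 _ _] := hQ s t hs ht.
rewrite (ord1 i) defectE mulrDl; apply: nrmB_le (b1 c).
have := @mean_value R C (frozen (y s) c) s (t - s) (Q * nrm (t - s) * nrm (t - s)) _.
rewrite [s + (t - s)]addrC subrK => mv; apply: le_trans (mv _) _; last first.
  by rewrite expr2 !mulrA.
move=> tau h; have hp : hUr rho r (s + RtoC tau *: (t - s)) by exact: (hUr_convex hs ht h).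
have pU := hUr_sub rp hp; have [dF eF] := frozen_diff (y s) c pU.
have bd : nrm ('d (frozen (y s) c) (s + RtoC tau *: (t - s)) 1) <= Q * nrm (t - s).
  have mB (A P P' : 'I_d -> C) : \sum_i A i * P i - \sum_i A i * P' i = \sum_i A i * (P i - P' i).
    by rewrite -sumrB; apply: eq_bigr => i' _; rewrite mulrBr.
  set p := s + _ in hp pU dF eF *.
  pose A i' := 'd (fun x => X x 0 i' : C) p 1.
  have eF' := etrans eF (etrans (congr1 (fun w => w - \sum_i A i * sigma (y s) i c) (ode _ c pU))
    (mB A (fun i => sigma (y p) i c) (fun i => sigma (y s) i c))).
  have [_ _ b3] := hQ s _ hs hp.
  apply: (eq_ind_r (fun w => nrm w <= Q * nrm (t - s)) _ eF').
  apply: le_trans (b3 c) _; apply: ler_wpM2l => //.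
  rewrite /p [s + _]addrC addrK nrmZ nrm_RtoC; case/andP: h => h0 h1.
  by rewrite ger0_norm// ler_piMl.
split; first exact: dF.
by rewrite diffC1 nrmM; apply: ler_wpM2r.
Qed.

End Interior.

(** * Davie's estimate up to the boundary *)

Section Extension.
Variables (R : realType) (d l : nat).
Local Notation C := (Cplx R).
Local Notation V := 'rV[C]_l.
Variable sigma : V -> 'M[C]_(d, l).
Hypothesis dsigma : forall v, differentiable sigma v.
Variables (rho gam K B S del : R) (X : C -> 'rV[C]_d) (X2 : C -> C -> 'M[C]_d) (a : V).
Hypothesis LA : levy_area gam (hD rho) X X2.
Hypothesis RD : rough_data (hD rho) X X2 K gam.
Hypothesis rho0 : 0 < rho.
Hypothesis SB : sigma_bound sigma (B + 4) S.
Hypothesis K0 : 0 <= K.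
Hypothesis gam0 : 0 < gam.
Hypothesis gam13 : 1 < 3 * gam.
Hypothesis del01 : 0 < del <= 1.
Hypothesis SS : small_step (K1e d K S) (K2e d K S) gam (3 * gam) del.
Hypothesis rhodel : 2 * rho <= del.
Hypothesis aB : nrm a <= B - 1.
Local Notation E := (euler sigma X X2).
Local Notation K1 := (K1e d K S).
Local Notation K4 := (K4c (K2e d K S) (3 * gam)).
Local Notation D := (hD rho).

Let AF : almost_flow D E B K1 (K2e d K S) gam (3 * gam) del :=
  euler_af dsigma (@hD_convex R rho) RD SB K0 gam0 gam13 del01 SS.

Let rho1 : 2 * rho <= 1.
Proof. by case/andP: del01 => _ h; exact: le_trans rhodel h. Qed.

Let diam t s : D t -> D s -> nrm (t - s) <= del.
Proof. by move=> Dt Ds; apply: ltW; apply: lt_le_trans (hD_diam Dt Ds) rhodel. Qed.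

Let diam1 t s : D t -> D s -> nrm (t - s) <= 1.
Proof. by move=> Dt Ds; apply: ltW; apply: lt_le_trans (hD_diam Dt Ds) rho1. Qed.

Lemma partial_polygon_bound n k t : (k <= n.+1)%N -> D t ->
  nrm (flow E k 0 (t / n.+1%:R) a) <= B.
Proof.
move=> kn Dt; have D0 := hD0 rho0.
have Dk : D (0 + k%:R * (t / n.+1%:R)).
  have := hD_convex D0 Dt (@natdiv01 R n k kn).
  by rewrite -seg_natdiv subr0.
have nk : k%:R * nrm (t / n.+1%:R) = nrm (0 + k%:R * (t / n.+1%:R) - 0) by rewrite subr0 add0r nrm_natM.
have kd : k%:R * nrm (t / n.+1%:R) <= del by rewrite nk; exact: diam.
have mv : nrm (flow E k 0 (t / n.+1%:R) a - a) <= (1 + K1) * (k%:R * nrm (t / n.+1%:R)) `^ gam.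
  by apply: (flow_move AF SS) => //; move: aB; lra.
have sm : (1 + K1) * (k%:R * nrm (t / n.+1%:R)) `^ gam <= 1.
  by apply: (small_move AF SS); rewrite kd andbT nk.
have := nrm_shift (flow E k 0 (t / n.+1%:R) a) a.
move: mv sm aB; lra.
Qed.

(** [H] may grow with [n]: uniform continuity of each polygon up to the boundary is all that
    [limit_unif_cont] requires, since the polygons converge uniformly. *)
Lemma polygon_holder n k : (k <= n.+1)%N -> exists2 H : R, 0 <= H & forall t t', D t -> D t' ->
  nrm (flow E k 0 (t / n.+1%:R) a - flow E k 0 (t' / n.+1%:R) a) <= H * nrm (t - t') `^ gam.
Proof.
have [L L0 hL] := euler_modulus dsigma SB RD K0 gam0 diam1.
elim: k => [_|k IH kn].
  by exists 0 => // t t' _ _ /=; rewrite subrr nrm0 mul0r.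
have [H H0 hH] := IH (ltnW kn).
exists (L * (1 + 1 + H)) => [|t t' Dt Dt']; first by rewrite mulr_ge0// !addr_ge0.
have B4 (w : V) : nrm w <= B -> nrm w <= B + 4 by move=> h; apply: le_trans h _; rewrite lerDl.
have k1 := @natdiv01 R n k (ltnW kn); have k2 := @natdiv01 R n k.+1 kn.
have sc (q : R) : 0 <= q <= 1 -> nrm (RtoC q * t - RtoC q * t') `^ gam <= nrm (t - t') `^ gam.
  move=> /andP[q0 q1]; apply: powR_mono; first exact: ltW.
  by rewrite nrm_ge0/= -mulrBr nrmM nrm_RtoC ger0_norm// ler_piMl.
rewrite !flow_scaledS.
apply: le_trans (hL _ _ _ _ _ _ (hD_scale k2 Dt) (hD_scale k1 Dt) (hD_scale k2 Dt') (hD_scale k1 Dt') _ _) _.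
- by apply: B4; exact: partial_polygon_bound (ltnW kn) Dt.
- by apply: B4; exact: partial_polygon_bound (ltnW kn) Dt'.
rewrite -mulrA; apply: ler_wpM2l => //; rewrite mulrDl mulrDl mul1r.
by apply: lerD; [apply: lerD; exact: sc|exact: hH].
Qed.

Variable y : C -> V.
Hypothesis hy : forall t, D t -> forall n,
  nrm (polygon sigma X X2 a n t - y t) <= rate d gam K S del n.

Lemma limit_unif_cont e : 0 < e -> exists2 dl : R, 0 < dl & forall t t', D t -> D t' ->
  nrm (t - t') <= dl -> nrm (y t - y t') <= e.
Proof.
move=> e0; have e3 : 0 < e / 3 by rewrite divr_gt0.
have [n hn] := rate_small dsigma RD SB K0 gam0 gam13 del01 SS e3.
have [H H0 hH] := polygon_holder (leqnn n.+1).
have [dl dl0 hdl] := powR_small H0 gam0 e3.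
exists dl => // t t' Dt Dt' tt.
have h1 := le_trans (hy Dt n) hn; have h2 := le_trans (hy Dt' n) hn.
have h3 : nrm (polygon sigma X X2 a n t - polygon sigma X X2 a n t') <= e / 3.
  by apply: le_trans (hH t t' Dt Dt') _; apply: hdl; rewrite nrm_ge0.
have -> : e = e / 3 + (e / 3 + e / 3) by field.
apply: le_trans (nrm_tri (polygon sigma X X2 a n t) _ _) _; apply: lerD; first by rewrite nrmBC.
by apply: le_trans (nrm_tri (polygon sigma X X2 a n t') _ _) _; exact: lerD.
Qed.

Lemma limit_spec : [/\ y 0 = a, forall t, D t -> nrm (y t) <= B,
  davie D E y K4 (3 * gam), forall z, hU rho z -> differentiable y z
  & forall z c, hU rho z ->
   'd (fun x => y x 0 c : C) z 1 = \sum_i 'd (fun x => X x 0 i : C) z 1 * sigma (y z) i c].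
Proof.
have yB t : D t -> nrm (y t) <= B.
  exact: (limit_bound dsigma RD rho0 SB K0 gam0 gam13 del01 SS rhodel aB hy).
have yd z : hU rho z -> differentiable y z.
  exact: (limit_diff dsigma LA RD rho0 SB K0 gam0 gam13 del01 SS rhodel aB hy).
have yB4 z : hU rho z -> nrm (y z) <= B + 4.
  by move=> /hU_sub/yB h; apply: le_trans h _; rewrite lerDl.
have K40 : 0 <= K4 := K4_ge0 AF.
have ode z c : hU rho z ->
   'd (fun x => y x 0 c : C) z 1 = \sum_i 'd (fun x => X x 0 i : C) z 1 * sigma (y z) i c.
  move=> zU; apply: (radial_ode dsigma LA RD rho0 SB K0 gam0 yd yB4 c K40 gam13 zU) => m s sE.
  exact: (limit_radial dsigma RD rho0 SB K0 gam0 gam13 del01 SS rhodel aB hy (hU_sub zU) sE).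
split => //.
  exact: (limit_init dsigma RD rho0 SB K0 gam0 gam13 del01 SS rhodel aB hy).
(* The constant [q] depends on [r], hence on the pair of points; [flow_follow] removes it and leaves
   [K4] for all interior pairs. *)
have daU s t : hU rho s -> hU rho t -> nrm (y t - E t s (y s)) <= K4 * nrm (t - s) `^ (3 * gam).
  move=> sU tU; have [r r0 [hs ht]] := hU_hUr sU tU.
  have [q q0 dq] := interior_davie dsigma LA RD rho0 SB K0 gam0 yd yB4 r0 ode.
  have sub : hUr rho r `<=` D by move=> z /(hUr_sub r0)/hU_sub.
  have b12 : 1 < (2 : R) by rewrite ltr1n.
  apply: (flow_follow AF SS sub (@hUr_convex R rho r) dq b12 q0 hs ht).
    by apply: diam; exact: hU_sub.
  move=> tau htau; apply: yB; apply: sub; exact: (hUr_convex hs ht htau).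
have [L L0 hL] := euler_modulus dsigma SB RD K0 gam0 diam1.
move=> s t Ds Dt; apply: le_of_forall_eps => e e0.
have L1 : 0 < 1 + L * (1 + 1 + 1) by rewrite ltr_pwDl// mulr_ge0// !addr_ge0.
pose e1 := e / (1 + L * (1 + 1 + 1)).
have e10 : 0 < e1 by exact: divr_gt0.
have [dl dl0 hdl] := limit_unif_cont e10.
have [d2 d20 hd2] := powR_small (@ler01 R) gam0 e10.
(* Both points are pulled into the interior by a homothety so close to the identity that the changes
   of [y] and [E] total at most [e]. *)
pose ep := Num.min 1 (Num.min dl d2).
have ep0 : 0 < ep by rewrite /ep !lt_min ltr01 dl0 d20.
have ep1 : ep <= 1 by rewrite /ep ge_min lexx.
have epd : ep <= dl by rewrite /ep !ge_min lexx orbT.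
have epd2 : ep <= d2 by rewrite /ep !ge_min lexx !orbT.
have ep01 : 0 < ep <= 1 by rewrite ep0.
have near w : D w -> nrm (pull rho ep w - w) <= ep.
  move=> Dw; apply: le_trans (pull_near rho0 (ltW ep0) Dw) _.
  by rewrite ler_piMr// ltW.
have pU w : D w -> hU rho (pull rho ep w) by exact: pull_hU.
have pD w : D w -> D (pull rho ep w) by move=> /pU/hU_sub.
have ny w : D w -> nrm (y w - y (pull rho ep w)) <= e1.
  by move=> Dw; apply: hdl => //; [exact: pD|rewrite nrmBC; exact: le_trans (near w Dw) epd].
have np w : D w -> nrm (pull rho ep w - w) `^ gam <= e1.
  move=> Dw; rewrite -[leLHS]mul1r; apply: hd2; rewrite nrm_ge0/=; exact: le_trans (near w Dw) epd2.
have B4 (w : V) : nrm w <= B -> nrm w <= B + 4 by move=> h; apply: le_trans h _; rewrite lerDl.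
have h2 := daU _ _ (pU s Ds) (pU t Dt).
have {}h2 : nrm (y (pull rho ep t) - E (pull rho ep t) (pull rho ep s) (y (pull rho ep s))) <=
    K4 * nrm (t - s) `^ (3 * gam).
  apply: le_trans h2 _; apply: ler_wpM2l => //; apply: powR_mono; first by rewrite mulr_ge0// ltW.
  by rewrite nrm_ge0/=; apply: pull_dist; rewrite ep1 ltW.
have h3 : nrm (E (pull rho ep t) (pull rho ep s) (y (pull rho ep s)) - E t s (y s)) <= L * (1 + 1 + 1) * e1.
  apply: le_trans (hL _ _ _ _ _ _ (pD t Dt) (pD s Ds) Dt Ds (B4 _ (yB _ (pD s Ds))) (B4 _ (yB _ Ds))) _.
  rewrite -mulrA; apply: ler_wpM2l => //; rewrite !mulrDl mul1r.
  by apply: lerD; [apply: lerD; exact: np|rewrite nrmBC; exact: ny].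
have eE : e = e1 + L * (1 + 1 + 1) * e1.
  by rewrite -{1}[e1]mul1r -mulrDl /e1 mulrC divfK// gt_eqF.
rewrite eE addrCA; apply: le_trans (nrm_tri (y (pull rho ep t)) _ _) _.
apply: lerD (ny t Dt) _.
apply: le_trans (nrm_tri (E (pull rho ep t) (pull rho ep s) (y (pull rho ep s))) _ _) _.
exact: lerD.
Qed.

End Extension.

Lemma exists_davie (R : realType) (d l : nat) (sigma : 'rV[Cplx R]_l -> 'M[Cplx R]_(d, l))
    (rho gam K B S del : R) (X : Cplx R -> 'rV[Cplx R]_d)
    (X2 : Cplx R -> Cplx R -> 'M[Cplx R]_d) (a : 'rV[Cplx R]_l) :
  (forall v, differentiable sigma v) -> levy_area gam (hD rho) X X2 ->
  rough_data (hD rho) X X2 K gam -> 0 < rho -> sigma_bound sigma (B + 4) S ->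
  0 <= K -> 0 < gam -> 1 < 3 * gam -> 0 < del <= 1 ->
  small_step (K1e d K S) (K2e d K S) gam (3 * gam) del ->
  2 * rho <= del -> nrm a <= B - 1 ->
  exists y : Cplx R -> 'rV[Cplx R]_l,
  [/\ y 0 = a, forall t, hD rho t -> nrm (y t) <= B,
  davie (hD rho) (euler sigma X X2) y (K4c (K2e d K S) (3 * gam)) (3 * gam),
  forall z, hU rho z -> differentiable y z
  & forall z c, hU rho z ->
   'd (fun x => y x 0 c : Cplx R) z 1 =
   \sum_i 'd (fun x => X x 0 i : Cplx R) z 1 * sigma (y z) i c].
Proof.
move=> ds LA RD rho0 SB K0 g0 g1 d01 SS rd aB.
have [y hy] := exists_polygon_limit ds RD rho0 SB K0 g0 g1 d01 SS rd aB.
by exists y; exact: (limit_spec ds LA RD rho0 SB K0 g0 g1 d01 SS rd aB hy).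
Qed.

(** * From Davie's estimate to the integral equation *)

Section ControlledIntro.
Variable R : realType.
Local Notation C := (Cplx R).

Lemma powR_exp_le (x p q : R) : 0 <= x <= 1 -> 0 < p <= q -> x `^ q <= x `^ p.
Proof.
move=> /andP[x0 x1] /andP[p0 pq]; have [->|xn] := eqVneq x 0.
  by rewrite !powR0// gt_eqF// (lt_le_trans p0).
by apply: ger_powR => //; rewrite lt_def xn x0.
Qed.

Lemma holder_weaken (W : normedModType C) (D : set C) (f : C -> C -> W) (M p q : R) :
  (forall t s, D t -> D s -> nrm (t - s) <= 1) -> 0 <= M -> 0 < p <= q ->
  (forall t s, D t -> D s -> nrm (f t s) <= M * nrm (t - s) `^ q) ->
  (holder2 p D f <= M%:E)%E.
Proof.
move=> diam M0 pq H; apply: le_holder2 => // t s Dt Ds.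
apply: le_trans (H t s Dt Ds) _; apply: ler_wpM2l => //.
by apply: powR_exp_le; rewrite // nrm_ge0 diam.
Qed.

(** The hypotheses carry the exponent [gam] that Davie's estimate provides; on a set of diameter at
    most 1 it can be lowered to [kap]. The remainder is analytic in its first argument because it is
    affine in [z] and [X]. *)
Lemma mk_controlled d k (X : C -> 'rV[C]_d) (z : C -> 'rV[C]_k) (zeta : C -> 'M[C]_(d, k))
    (rho gam kap M : R) : 2 * rho <= 1 -> 0 < kap <= gam -> 0 <= M ->
  (forall t, hU rho t -> differentiable X t) ->
  (forall t s, hD rho t -> hD rho s -> nrm (z t - z s) <= M * nrm (t - s) `^ gam) ->
  (forall t s, hD rho t -> hD rho s -> nrm (zeta t - zeta s) <= M * nrm (t - s) `^ gam) ->
  (forall t, hD rho t -> nrm (zeta t) <= M) ->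
  (forall t s, hD rho t -> hD rho s -> nrm (remainder X z zeta t s) <= M * nrm (t - s) `^ (2 * gam)) ->
  (forall t, hU rho t -> differentiable z t) ->
  (forall t, hU rho t -> differentiable zeta t) ->
  controlled kap (hD rho) X (z 0) z zeta.
Proof.
move=> rho1 kg M0 dX Hz Hzeta Bzeta Hr dz dzeta.
have diam t s : hD rho t -> hD rho s -> nrm (t - s) <= 1.
  by move=> Dt Ds; apply: ltW; apply: lt_le_trans (hD_diam Dt Ds) rho1.
split.
- by apply: le_lt_trans (holder_weaken diam M0 kg _) (ltry M); exact: Hz.
- by [].
- by apply: le_lt_trans (holder_weaken diam M0 kg _) (ltry M); exact: Hzeta.
- by apply: le_lt_trans (supnorm_le Bzeta) (ltry M).
- split; first by move=> t _; rewrite /remainder /delta1 !subrr mul0mx subr0.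
  have kg2 : 0 < 2 * kap <= 2 * gam by case/andP: kg => k0 kg; rewrite mulr_gt0// ler_wpM2l.
  exact: le_lt_trans (holder_weaken diam M0 kg2 Hr) (ltry M).
- rewrite upper_hD; exact: dz.
- rewrite upper_hD; exact: dzeta.
- move=> s Ds sU; rewrite upper_hD => t tU.
  apply: diff_mx => i c; rewrite (ord1 i).
  have -> : (fun v => remainder X z zeta v s 0 c) =
      (fun v => (z v 0 c - z s 0 c) - \sum_j (X v 0 j - X s 0 j) * zeta s j c).
    by apply/funext => v; rewrite /remainder /delta1 !mxE; congr (_ - _); apply: eq_bigr => j _; rewrite !mxE.
  apply: differentiableB.
    apply: differentiableB; last exact: differentiable_cst.
    by apply: diff_coord; exact: dz.
  have dXj j : differentiable (fun v => X v 0 j - X s 0 j : C) t.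
    apply: differentiableB; last exact: differentiable_cst.
    by apply: diff_coord; exact: dX.
  by have [] := @diff_lincomb R d (fun j v => X v 0 j - X s 0 j) (fun j => zeta s j c) t dXj.
Qed.

(** Additivity over [n + 1] equal pieces of a segment bounds [A t s] by a multiple of
    [(n + 1) ^ (1 - nu)]. *)
Lemma additive_zero (D : set C) (A : C -> C -> C) (c nu : R) : convexC D -> 1 < nu -> 0 <= c ->
  (forall t u s, D t -> D u -> D s -> A t s = A t u + A u s) ->
  (forall t s, D t -> D s -> nrm (A t s) <= c * nrm (t - s) `^ nu) ->
  forall t s, D t -> D s -> A t s = 0.
Proof.
move=> cD nu1 c0 add bd t s Dt Ds.
have As : A s s = 0 by have /eqP := add s s s Ds Ds Ds; rewrite eq_sym -subr_eq0 addrK => /eqP.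
have step n : nrm (A t s) <= c * nrm (t - s) `^ nu * (n.+1%:R^-1) `^ (nu - 1).
  have ind k : (k <= n.+1)%N -> nrm (A (seg s t (k%:R / n.+1%:R)) s) <= k%:R * (c * (nrm (t - s) / n.+1%:R) `^ nu).
    elim: k => [_|k IH kn]; first by rewrite !mul0r seg0 As nrm0.
    have D1 := cD _ _ Ds Dt _ (@natdiv01 R n k.+1 kn); have D2 := cD _ _ Ds Dt _ (@natdiv01 R n k (ltnW kn)).
    have -> : k.+1%:R * (c * (nrm (t - s) / n.+1%:R) `^ nu) =
        c * (nrm (t - s) / n.+1%:R) `^ nu + k%:R * (c * (nrm (t - s) / n.+1%:R) `^ nu).
      by rewrite -natr1 mulrDl mul1r addrC.
    rewrite (add _ _ _ D1 D2 Ds); apply: nrmD_le (IH (ltnW kn)); apply: le_trans (bd _ _ D1 D2) _.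
    rewrite seg_dist -mulrBl.
    have -> : k.+1%:R - k%:R = 1 :> R by rewrite -natr1 addrC addKr.
    by rewrite mul1r ger0_norm ?invr_ge0// [_^-1 * _]mulrC.
  have := ind n.+1 (leqnn _); rewrite divff ?pnatr_eq0// seg1 => h; apply: le_trans h _.
  by rewrite mulrCA powR_divn// mulrA.
have p0 : 0 < nu - 1 by rewrite subr_gt0.
apply: nrm_eq0; apply: le_anti; rewrite nrm_ge0 andbT; apply: le_of_forall_eps => e e0.
have [n hn] := inv_rate (mulr_ge0 c0 (powR_ge0 (nrm (t - s)) nu)) p0 e0.
by rewrite add0r; exact: le_trans (step n) (hn n (leqnn n)).
Qed.

End ControlledIntro.

(** * Increments with a shift bound *)

Section ShiftClass.
Variables (R : realType) (D : set (Cplx R)) (kap : R).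
Local Notation C := (Cplx R).

(** Boundedness is included to make the class stable under products; the germ then belongs to it as
    a polynomial in members. *)
Definition shift3 (F : C -> C -> C -> C) : Prop := exists2 M : R, 0 <= M &
  forall t u s, D t -> D u -> D s -> nrm (F t u s) <= M /\
  forall eps : R, 0 < eps <= 1 -> D (up_shift eps t) -> D (up_shift eps u) ->
    D (up_shift eps s) ->
    nrm (F (up_shift eps t) (up_shift eps u) (up_shift eps s) - F t u s) <= M * eps `^ kap.

Lemma shift3D F G : shift3 F -> shift3 G -> shift3 (fun t u s => F t u s + G t u s).
Proof.
move=> [M M0 hM] [N N0 hN]; exists (M + N) => [|t u s Dt Du Ds]; first exact: addr_ge0.
have [a1 a2] := hM t u s Dt Du Ds; have [b1 b2] := hN t u s Dt Du Ds.
split=> [|e e01 h1 h2 h3]; first exact: nrmD_le.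
by rewrite opprD addrACA mulrDl; apply: nrmD_le; [exact: a2|exact: b2].
Qed.

Lemma shift3M F G : shift3 F -> shift3 G -> shift3 (fun t u s => F t u s * G t u s).
Proof.
move=> [M M0 hM] [N N0 hN]; exists (M * N + (M * N + M * N)) => [|t u s Dt Du Ds].
  by rewrite !addr_ge0// mulr_ge0.
have [a1 a2] := hM t u s Dt Du Ds; have [b1 b2] := hN t u s Dt Du Ds.
split=> [|e e01 h1 h2 h3].
  by rewrite nrmM; apply: le_trans (ler_pM _ _ a1 b1) _; rewrite // lerDl addr_ge0// mulr_ge0.
have [c1 _] := hN _ _ _ h1 h2 h3.
move: (F _ _ _) (F t u s) (G _ _ _) (G t u s) (a2 e e01 h1 h2 h3) (b2 e e01 h1 h2 h3) a1 b1 c1.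
move=> f' f g' g A1 A2 A3 A4 A5.
have -> : f' * g' - f * g = (f' - f) * g' + f * (g' - g) by ring.
apply: le_trans (_ : _ <= (M * N + M * N) * e `^ kap) _; last first.
  by apply: ler_wpM2r; [exact: powR_ge0|rewrite lerDr mulr_ge0].
rewrite [leRHS]mulrDl; apply: nrmD_le; rewrite nrmM.
  by rewrite mulrAC; apply: ler_pM.
by rewrite -mulrA; apply: ler_pM.
Qed.

Lemma shift3_cst c : shift3 (fun _ _ _ => c).
Proof.
exists (nrm c) => // t u s _ _ _; split => // e _ _ _ _.
by rewrite subrr nrm0 mulr_ge0// powR_ge0.
Qed.

Lemma shift3_sum n (F : 'I_n -> C -> C -> C -> C) : (forall i, shift3 (F i)) ->
  shift3 (fun t u s => \sum_i F i t u s).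
Proof.
elim: n F => [|n IH] F h.
  have -> : (fun t u s => \sum_(i < 0) F i t u s) = fun _ _ _ => 0.
    by apply/funext => t; apply/funext => u; apply/funext => s; rewrite big_ord0.
  exact: shift3_cst.
have -> : (fun t u s => \sum_i F i t u s) =
    fun t u s => F ord0 t u s + \sum_(i < n) F (lift ord0 i) t u s.
  by apply/funext => t; apply/funext => u; apply/funext => s; rewrite big_ord_recl.
by apply: shift3D => //; exact: IH.
Qed.

Lemma shift3N F : shift3 F -> shift3 (fun t u s => - F t u s).
Proof.
move=> [M M0 hM]; exists M => // t u s Dt Du Ds; have [a1 a2] := hM t u s Dt Du Ds.
split=> [|e e01 h1 h2 h3]; first by rewrite nrmN.
by rewrite -opprD nrmN; exact: a2.
Qed.

Lemma shift3_path (f : C -> C) (gam M : R) : 0 <= M -> 0 < kap <= gam ->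
  (forall t, D t -> nrm (f t) <= M) ->
  (forall t s, D t -> D s -> nrm (f t - f s) <= M * nrm (t - s) `^ gam) ->
  [/\ shift3 (fun t _ _ => f t), shift3 (fun _ u _ => f u) & shift3 (fun _ _ s => f s)].
Proof.
move=> M0 kg bd ho.
have sh t eps : 0 < eps <= 1 -> D t -> D (up_shift eps t) ->
    nrm (f (up_shift eps t) - f t) <= M * eps `^ kap.
  move=> /andP[e0 e1] Dt De; apply: le_trans (ho _ _ De Dt) _; apply: ler_wpM2l => //.
  rewrite /up_shift [t + _]addrC addrK.
  have -> : nrm (Complex 0 eps : C) = eps by rewrite nrmE /= expr0n add0r sqrtr_sqr gtr0_norm.
  by apply: powR_exp_le; rewrite // e1 ltW.
split; exists M => // t u s Dt Du Ds; split; try exact: bd;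
  by move=> e e01 h1 h2 h3; apply: sh.
Qed.

Lemma shift3_inCm3 F : incr3 (V := C) D F -> shift3 F -> inCm3 (V := C) kap D F.
Proof.
move=> iF [M M0 hM]; split => //; apply: le_lt_trans (ltry M).
apply: ge_ereal_sup => _ [e [t [u [s [e01 [Dt Du Ds] [h1 h2 h3] ->]]]]]; rewrite lee_fin.
have e0 : 0 < e by case/andP: e01.
have ek : 0 < e `^ kap by exact: powR_gt0.
have [_ h] := hM t u s Dt Du Ds; have := h e e01 h1 h2 h3.
by rewrite powRN ler_pdivrMl// mulrC.
Qed.

End ShiftClass.

Section DavieBounds.
Variables (R : realType) (d l : nat).
Local Notation C := (Cplx R).
Local Notation V := 'rV[C]_l.
Variable sigma : V -> 'M[C]_(d, l).
Hypothesis dsigma : forall v, differentiable sigma v.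
Variables (rho gam K S r c4 : R) (X : C -> 'rV[C]_d) (X2 : C -> C -> 'M[C]_d) (y : C -> V).
Local Notation E := (euler sigma X X2).
Local Notation D := (hD rho).
Hypothesis RD : rough_data D X X2 K gam.
Hypothesis rho1 : 2 * rho <= 1.
Hypothesis SB : sigma_bound sigma r S.
Hypothesis K0 : 0 <= K.
Hypothesis gam0 : 0 < gam.
Hypothesis c40 : 0 <= c4.
Hypothesis yB : forall t, D t -> nrm (y t) <= r.
Hypothesis yda : davie D E y c4 (3 * gam).

Let S0 : 0 <= S. Proof. exact: le_trans ler01 (sb_S SB). Qed.

Let diam t s : D t -> D s -> nrm (t - s) <= 1.
Proof. by move=> Dt Ds; apply: ltW; apply: lt_le_trans (hD_diam Dt Ds) rho1. Qed.

Let r1 t : D t -> nrm (y t) <= r + 1.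
Proof. by move=> Dt; apply: le_trans (yB Dt) _; rewrite lerDl. Qed.

Lemma path_move t s : D t -> D s ->
  nrm (y t - y s) <= (c4 + K1e d K S) * nrm (t - s) `^ gam.
Proof.
move=> Dt Ds; apply: le_trans (nrm_tri (E t s (y s)) _ _) _; rewrite mulrDl; apply: lerD.
  apply: le_trans (yda Ds Dt) _; apply: ler_wpM2l => //.
  apply: powR_exp_le; first by rewrite nrm_ge0 diam.
  by rewrite gam0/= ler_peMl ?(ltW gam0)// ler1n.
exact: (euler_move SB RD K0 gam0 Dt Ds (diam Dt Ds) (r1 Ds)).
Qed.

(** The second-order term dominates the defect of Davie's estimate, so the remainder is of order
    [2 * gam]. *)
Lemma remainderE (zeta : C -> 'M[C]_(d, l)) t s : zeta s = sigma (y s) ->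
  remainder X y zeta t s =
  (y t - E t s (y s)) + \sum_i \sum_j X2 t s i j *: gf sigma i j (y s).
Proof.
move=> zE; rewrite /remainder /delta1 zE mulmx_sum_row /E /delta1.
have -> : \sum_i (X t - X s) 0 i *: vf sigma i (y s) = \sum_i (X t - X s) 0 i *: row i (sigma (y s)) by [].
have alg (a b v w : V) : v - w - b = v - (w + (b + a)) + a.
  by apply/rowP => j; rewrite !mxE; ring.
exact: alg.
Qed.

Definition remc := c4 + d%:R * d%:R * (K * S).

Lemma remc_ge0 : 0 <= remc.
Proof. by rewrite addr_ge0// !mulr_ge0. Qed.

Lemma path_remainder (zeta : C -> 'M[C]_(d, l)) t s : zeta s = sigma (y s) -> D t -> D s ->
  nrm (remainder X y zeta t s) <= remc * nrm (t - s) `^ (2 * gam).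
Proof.
move=> zE Dt Ds; rewrite (remainderE t zE) /remc mulrDl; apply: nrmD_le.
  apply: le_trans (yda Ds Dt) _; apply: ler_wpM2l => //.
  apply: powR_exp_le; first by rewrite nrm_ge0 diam.
  by rewrite mulr_gt0//= ler_wpM2r ?(ltW gam0)// ler_nat.
exact: (second_le SB RD Dt Ds (r1 Ds)).
Qed.

Definition compc := 24 * S * (c4 + K1e d K S).

Lemma compc_ge0 : 0 <= compc.
Proof. by rewrite mulr_ge0// ?mulr_ge0// addr_ge0// (K1e_ge0 SB K0). Qed.

Lemma sigma_path_move i c t s : D t -> D s ->
  nrm (sigma (y t) i c - sigma (y s) i c) <= compc * nrm (t - s) `^ gam.
Proof.
move=> Dt Ds; apply: le_trans (ball_lip (sg_bholo dsigma SB i c) (yB Dt) (yB Ds)) _.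
rewrite /compc -[leRHS]mulrA; apply: ler_wpM2l; first by rewrite mulr_ge0.
exact: path_move.
Qed.

Lemma gf_path_move i j c t s : D t -> D s ->
  nrm (gf sigma i j (y t) 0 c - gf sigma i j (y s) 0 c) <= compc * nrm (t - s) `^ gam.
Proof.
move=> Dt Ds; apply: le_trans (ball_lip (gf_bholo dsigma SB i j c) (yB Dt) (yB Ds)) _.
rewrite /compc -[leRHS]mulrA; apply: ler_wpM2l; first by rewrite mulr_ge0.
exact: path_move.
Qed.

Definition crem := 4608 * S * (c4 + K1e d K S) ^+ 2 + 12 * S * remc.

Lemma crem_ge0 : 0 <= crem.
Proof.
exact: addr_ge0 (mulr_ge0 (mulr_ge0 (ler0n R 4608) S0) (sqr_ge0 _))
  (mulr_ge0 (mulr_ge0 (ler0n R 12) S0) remc_ge0).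
Qed.

Lemma comp_remainder i c t s : D t -> D s ->
  nrm (sigma (y t) i c - sigma (y s) i c - \sum_j delta1 X t s 0 j * gf sigma i j (y s) 0 c) <=
  crem * nrm (t - s) `^ (2 * gam).
Proof.
move=> Dt Ds.
have -> : sigma (y t) i c - sigma (y s) i c - \sum_j delta1 X t s 0 j * gf sigma i j (y s) 0 c =
  (vf sigma i (y t) - vf sigma i (y s) - \sum_j delta1 X t s 0 j *: gf sigma i j (y s)) 0 c.
  by rewrite !mxE summxE; congr (_ - _); apply: eq_bigr => j _; rewrite !mxE.
apply: le_trans (mx_nrm_coord _ _ _) _.
have ex : y t - y s = \sum_j delta1 X t s 0 j *: vf sigma j (y s) +
    remainder X y (fun s => sigma (y s)) t s.
  rewrite /remainder mulmx_sum_row /delta1.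
  have -> : \sum_i (X t - X s) 0 i *: vf sigma i (y s) = \sum_i (X t - X s) 0 i *: row i (sigma (y s)) by [].
  by rewrite [RHS]addrC subrK.
apply: le_trans (vf_expand dsigma SB i (yB Ds) (yB Dt) ex) _.
have pm := path_move Dt Ds; have pr := @path_remainder (fun s => sigma (y s)) t s erefl Dt Ds.
rewrite /crem [leRHS]mulrDl; apply: lerD.
  rewrite -[leRHS]mulrA; apply: ler_wpM2l; first exact: mulr_ge0 (ler0n R 4608) S0.
  have -> : nrm (t - s) `^ (2 * gam) = (nrm (t - s) `^ gam) ^+ 2.
    by rewrite mulrC powRrM powR_mulrn ?powR_ge0.
  rewrite -exprMn; apply: lerXn2r; rewrite ?nnegrE//.
  by rewrite mulr_ge0 ?powR_ge0// addr_ge0// (K1e_ge0 SB K0).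
by rewrite -[leRHS]mulrA; apply: ler_wpM2l pr; exact: mulr_ge0 (ler0n R 12) S0.
Qed.

Lemma comp_derivE (zeta : C -> 'M[C]_(d, l)) c s i j : zeta s = sigma (y s) ->
  comp_deriv sigma y zeta c s j i = gf sigma i j (y s) 0 c.
Proof. by move=> zE; rewrite !mxE zE. Qed.

End DavieBounds.

(** * Membership in the domain of the sewing map *)

Section SewingDomain.
Variable R : realType.
Local Notation C := (Cplx R).

Lemma holder3_le (W : normedModType C) (p q : R) (D : set C) (h : C -> C -> C -> W) (M : R) :
  0 <= M -> (forall t u s, D t -> D u -> D s ->
    nrm (h t u s) <= M * (nrm (u - s) `^ p * nrm (t - u) `^ q)) ->
  (holder3 p q D h <= M%:E)%E.
Proof.
move=> M0 H; apply: ge_ereal_sup => _ [t [u [s [Dt Du Ds ->]]]]; rewrite lee_fin.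
have := H t u s Dt Du Ds; set x := _ * nrm (t - u) `^ q => hx.
have x0 : 0 <= x by rewrite mulr_ge0 ?powR_ge0.
have [->|n0] := eqVneq x 0; first by rewrite invr0 mulr0.
by rewrite ler_pdivrMr// lt_def n0.
Qed.

(** The class is defined by series; a sum of two increments is padded with zeros. *)
Lemma inC3_two (D : set C) (h A0 A1 : C -> C -> C -> C) (p0 p1 mu M : R) (p : C) :
  D p -> 0 <= M -> 0 < p0 < mu -> 0 < p1 < mu ->
  incr3 (V := C) D A0 -> incr3 (V := C) D A1 ->
  (forall t u s, h t u s = A0 t u s + A1 t u s) ->
  (forall t u s, D t -> D u -> D s ->
    nrm (A0 t u s) <= M * (nrm (u - s) `^ p0 * nrm (t - u) `^ (mu - p0))) ->
  (forall t u s, D t -> D u -> D s ->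
    nrm (A1 t u s) <= M * (nrm (u - s) `^ p1 * nrm (t - u) `^ (mu - p1))) ->
  inC3 (V := C) mu D h.
Proof.
move=> Dp M0 hp0 hp1 i0 i1 hE b0 b1.
split=> [t s Dt Ds|].
  rewrite !hE; have [-> ->] := i0 t s Dt Ds; have [-> ->] := i1 t s Dt Ds.
  by rewrite addr0.
exists (fun n => if n is 0%N then A0 else if n is 1%N then A1 else fun _ _ _ => 0).
exists (fun n => if n is 0%N then p0 else p1).
have sum2 (T : nmodType) (f : nat -> T) n : (forall k, (1 < k)%N -> f k = 0) ->
    (1 < n)%N -> \sum_(0 <= k < n) f k = f 0%N + f 1%N.
  move=> f0; case: n => [|[|n]]// _; rewrite big_ltn// big_ltn// big_nat big1 ?addr0// => k.
  by case/andP => k2 _; exact: f0.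
split.
- move=> [|[|n]]; split => //; move=> t s _ _; by split.
- move=> t u s Dt Du Ds; rewrite hE; apply: cvg_near_cst.
  exists 2%N => // n /= n2; rewrite /series /=; apply: (sum2 C) => // -[|[|k]]//.
- rewrite (_ : (\sum_(0 <= i <oo) _)%E = (holder3 p0 (mu - p0)%R D A0 + holder3 p1 (mu - p1)%R D A1)%E); last first.
    apply: lim_near_cst => //; exists 2%N => // n /= n2.
    set f := (X in (\sum_(0 <= i < n) X i)%E); apply: (sum2 (\bar R) f) => // -[|[|k]]// _.
    apply: le_anti; apply/andP; split.
      by apply: holder3_le => // t u s _ _ _; rewrite nrm0 mul0r.
    (* The point [p] makes the set of quotients nonempty: the supremum of the empty set is [-oo],
       not 0. *)
    apply: ereal_sup_ubound; exists p, p, p; split => //.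
    by rewrite nrm0 mul0r.
  apply: lte_add_pinfty.
    exact: le_lt_trans (holder3_le M0 b0) (ltry M).
  exact: le_lt_trans (holder3_le M0 b1) (ltry M).
Qed.

Lemma shift2_bound (W : normedModType C) (beta : R) (D : set C) (f : C -> C -> W) :
  inCm2 beta D f -> exists2 M : R, 0 <= M & forall (eps : R) t s, 0 < eps <= 1 ->
    D t -> D s -> D (up_shift eps t) -> D (up_shift eps s) ->
    nrm (f (up_shift eps t) (up_shift eps s) - f t s) <= M * eps `^ beta.
Proof.
move=> [_ h].
have [M M0 hM] : exists2 M : R, 0 <= M & (shift_norm2 beta D f <= M%:E)%E.
  move: h; case: (shift_norm2 beta D f) => [r|//|] _.
    by exists `|r| => //; rewrite lee_fin ler_norm.
  by exists 0 => //; rewrite leNye.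
exists M => // e t s e01 Dt Ds De Des.
have e0 : 0 < e by case/andP: e01.
rewrite -ler_pdivrMr ?powR_gt0// mulrC -powRN -lee_fin; apply: le_trans hM.
by apply: ereal_sup_ubound; exists e, t, s.
Qed.

End SewingDomain.

Section IntegralSums.
Variable R : realType.
Local Notation C := (Cplx R).

Lemma eq_cint01 (phi psi : R -> C) : (forall a, 0 <= a <= 1 -> phi a = psi a) ->
  cint01 phi = cint01 psi.
Proof.
by move=> H; rewrite /cint01; congr (Complex _ _); apply: eq_Rintegral => a;
  rewrite inE /= in_itv /= => ha; rewrite H.
Qed.

Lemma lipC_sum n (phi : 'I_n -> R -> C) : (forall i, lipC (phi i)) ->
  lipC (fun a => \sum_i phi i a).
Proof.
elim: n phi => [|n IH] phi h.
  have -> : (fun a => \sum_(i < 0) phi i a) = fun=> 0 by apply/funext => a; rewrite big_ord0.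
  exact: lipC_cst.
have -> : (fun a => \sum_i phi i a) = fun a => phi ord0 a + \sum_(i < n) phi (lift ord0 i) a.
  by apply/funext => a; rewrite big_ord_recl.
by apply: lipCD => //; exact: IH.
Qed.

Lemma cint01_sum n (phi : 'I_n -> R -> C) : (forall i, lipC (phi i)) ->
  cint01 (fun a => \sum_i phi i a) = \sum_i cint01 (phi i).
Proof.
elim: n phi => [|n IH] phi h.
  have -> : (fun a => \sum_(i < 0) phi i a) = fun=> 0 * 0 by apply/funext => a; rewrite big_ord0 mul0r.
  by rewrite big_ord0 (cint01Z 0 (lipC_cst 0)) mul0r.
have -> : (fun a => \sum_i phi i a) = fun a => phi ord0 a + \sum_(i < n) phi (lift ord0 i) a.
  by apply/funext => a; rewrite big_ord_recl.
rewrite cint01D ?big_ord_recl ?IH//; exact: lipC_sum.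
Qed.

End IntegralSums.

(** The computation behind [defect_delta2], over an arbitrary commutative ring: additivity of the
    path and Chen's relation are its only inputs. *)
Lemma chen_algebra (K : comRingType) d (yt yu ys : K) (xts xtu xus su ss : 'I_d -> K)
    (ats atu aus gu gs : 'I_d -> 'I_d -> K) :
  (forall i, xts i = xtu i + xus i) ->
  (forall i j, ats i j = atu i j + aus i j + xtu i * xus j) ->
  yt - ys - \sum_i (xts i * ss i + \sum_j ats i j * gs i j)
  - (yt - yu - \sum_i (xtu i * su i + \sum_j atu i j * gu i j))
  - (yu - ys - \sum_i (xus i * ss i + \sum_j aus i j * gs i j)) =
  \sum_i (xtu i * (su i - ss i - \sum_j xus j * gs i j) + \sum_j atu i j * (gu i j - gs i j)).
Proof.
move=> xE aE.
have alg (a b e p q w : K) : a - e - p - (a - b - q) - (b - e - w) = q + w - p by ring.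
rewrite alg -big_split -sumrB; apply: eq_bigr => i _ /=.
have -> : \sum_j ats i j * gs i j =
    \sum_j atu i j * gs i j + \sum_j aus i j * gs i j + xtu i * \sum_j xus j * gs i j.
  rewrite mulr_sumr -!big_split; apply: eq_bigr => j _ /=.
  by rewrite aE; ring.
have -> : \sum_j atu i j * (gu i j - gs i j) = \sum_j atu i j * gu i j - \sum_j atu i j * gs i j.
  by rewrite -sumrB; apply: eq_bigr => j _; ring.
by rewrite xE; ring.
Qed.

(** * Davie's estimate implies the equation *)

Section SolvesFromDavie.
Variables (R : realType) (d l : nat).
Local Notation C := (Cplx R).
Local Notation V := 'rV[C]_l.
Variable sigma : V -> 'M[C]_(d, l).
Hypothesis dsigma : forall v, differentiable sigma v.
Variables (rho gam kap K S r c4 : R) (X : C -> 'rV[C]_d) (X2 : C -> C -> 'M[C]_d) (y : C -> V).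
Local Notation E := (euler sigma X X2).
Local Notation D := (hD rho).
Hypothesis LA : levy_area gam D X X2.
Hypothesis RD : rough_data D X X2 K gam.
Hypothesis rho0 : 0 < rho.
Hypothesis rho1 : 2 * rho <= 1.
Hypothesis SB : sigma_bound sigma r S.
Hypothesis K0 : 0 <= K.
Hypothesis gam0 : 0 < gam.
Hypothesis c40 : 0 <= c4.
Hypothesis yB : forall t, D t -> nrm (y t) <= r.
Hypothesis yda : davie D E y c4 (3 * gam).
Hypothesis ydiff : forall z, hU rho z -> differentiable y z.
Hypothesis ode : forall z c, hU rho z ->
   'd (fun x => y x 0 c : C) z 1 = \sum_i 'd (fun x => X x 0 i : C) z 1 * sigma (y z) i c.
Hypothesis kap3 : 1 < 3 * kap.
Hypothesis kapgam : kap <= gam.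

Let S0 : 0 <= S. Proof. exact: le_trans ler01 (sb_S SB). Qed.
Let kap0 : 0 < kap. Proof. by have := kap3; lra. Qed.
Let kg : 0 < kap <= gam. Proof. by rewrite kap0. Qed.

Let diam t s : D t -> D s -> nrm (t - s) <= 1.
Proof. by move=> Dt Ds; apply: ltW; apply: lt_le_trans (hD_diam Dt Ds) rho1. Qed.

Let r1 t : D t -> nrm (y t) <= r + 1.
Proof. by move=> Dt; apply: le_trans (yB Dt) _; rewrite lerDl. Qed.

Section Column.
Variable c : 'I_l.

Definition colpath (s : C) : 'rV[C]_d := (col c (sigma (y s)))^T.
Definition colder (s : C) : 'M[C]_d := comp_deriv sigma y (fun s => sigma (y s)) c s.
(** The increment that turns out to be [Lambda h]: what the integral adds to its explicit terms. *)
Definition defect (t s : C) : C := (y t - E t s (y s)) 0 c.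

Lemma colpathE s i : colpath s 0 i = sigma (y s) i c.
Proof. by rewrite !mxE. Qed.

Lemma colderE s i j : colder s j i = gf sigma i j (y s) 0 c.
Proof. by rewrite !mxE. Qed.

Lemma colremE t s i : remainder X colpath colder t s 0 i =
  sigma (y t) i c - sigma (y s) i c - \sum_j delta1 X t s 0 j * gf sigma i j (y s) 0 c.
Proof.
have subE (A B : 'rV[C]_d) : (A - B) 0 i = A 0 i - B 0 i by rewrite !mxE.
have mulE (A : 'rV[C]_d) (B : 'M[C]_d) : (A *m B) 0 i = \sum_j A 0 j * B j i by rewrite mxE.
rewrite /remainder {1}/delta1 !subE mulE !colpathE.
by congr (_ - _); apply: eq_bigr => j _; rewrite colderE.
Qed.

Lemma germE t u s : rough_germ X X2 colpath colder t u s =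
  \sum_i (delta1 X t u 0 i * (sigma (y u) i c - sigma (y s) i c
            - \sum_j delta1 X u s 0 j * gf sigma i j (y s) 0 c)
         + \sum_j X2 t u i j * (gf sigma i j (y u) 0 c - gf sigma i j (y s) 0 c)).
Proof.
rewrite /rough_germ -big_split; apply: eq_bigr => i _ /=; congr (_ + _).
  by rewrite colremE.
apply: eq_bigr => j _; have subE (A B : 'M[C]_d) : (A - B) j i = A j i - B j i by rewrite !mxE.
congr (_ * _); apply: etrans (subE (colder u) (colder s)) _.
congr (_ - _).
  exact: (colderE u i j).
exact: (colderE s i j).
Qed.

Lemma defect_sumE t s : defect t s = y t 0 c - y s 0 c -
  \sum_i (delta1 X t s 0 i * sigma (y s) i c + \sum_j X2 t s i j * gf sigma i j (y s) 0 c).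
Proof.
rewrite /defect /E !mxE !summxE big_split /=.
have -> : \sum_i (delta1 X t s 0 i *: vf sigma i (y s)) 0 c = \sum_i delta1 X t s 0 i * sigma (y s) i c.
  by apply: eq_bigr => i _; rewrite !mxE.
have -> : \sum_i (\sum_j X2 t s i j *: gf sigma i j (y s)) 0 c =
    \sum_i \sum_j X2 t s i j * gf sigma i j (y s) 0 c.
  by apply: eq_bigr => i _; rewrite summxE; apply: eq_bigr => j _; rewrite !mxE.
ring.
Qed.

Lemma defect_delta2 t u s : D t -> D u -> D s ->
  delta2 (V := C) defect t u s = rough_germ X X2 colpath colder t u s.
Proof.
move=> Dt Du Ds; rewrite /delta2 !defect_sumE germE.
apply: chen_algebra => i => [|j]; last exact: (rd_chen RD Dt Du Ds i j).
by rewrite /delta1 !mxE; ring.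
Qed.

Lemma defect_le t s : D t -> D s -> nrm (defect t s) <= c4 * nrm (t - s) `^ (3 * gam).
Proof. by move=> Dt Ds; apply: le_trans (mx_nrm_coord _ _ _) (yda Ds Dt). Qed.

Lemma colder_move t s i j : D t -> D s ->
  nrm (delta1 colder t s j i : C) <= compc d K S c4 * nrm (t - s) `^ gam.
Proof.
move=> Dt Ds; have subE (A B : 'M[C]_d) : (A - B) j i = A j i - B j i by rewrite !mxE.
have -> : delta1 colder t s j i = gf sigma i j (y t) 0 c - gf sigma i j (y s) 0 c.
  rewrite /delta1; apply: etrans (subE (colder t) (colder s)) _; congr (_ - _).
    exact: (colderE t i j).
  exact: (colderE s i j).
exact: (gf_path_move dsigma RD rho1 SB K0 gam0 c40 yB yda i j c Dt Ds).
Qed.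

Lemma colrem_le t s i : D t -> D s ->
  nrm (remainder X colpath colder t s 0 i : C) <= crem d K S c4 * nrm (t - s) `^ (2 * gam).
Proof.
move=> Dt Ds; rewrite colremE.
exact: (comp_remainder dsigma RD rho1 SB K0 gam0 c40 yB yda i c Dt Ds).
Qed.

Let colremc := crem d K S c4.
Let colmovc := compc d K S c4.
Let sumd (T : 'I_d -> C) (A : R) : (forall i, nrm (T i) <= A) -> nrm (\sum_i T i) <= d%:R * A.
Proof.
move=> H; apply: le_trans (nrm_sum _ _ _) _.
apply: le_trans (ler_sum _ (fun i _ => H i)) _.
by rewrite sumr_const card_ord mulr_natl.
Qed.

Let X2tt t : D t -> X2 t t = 0.
Proof.
move=> Dt; apply: nrm_eq0; apply: le_anti; rewrite nrm_ge0 andbT.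
have := rd_X2 RD Dt Dt; rewrite subrr nrm0 powR0 ?mulr0//.
by rewrite mulf_neq0// gt_eqF.
Qed.

Let gap t s (p q : R) : D t -> D s -> 0 < p <= q -> nrm (t - s) `^ q <= nrm (t - s) `^ p.
Proof. by move=> Dt Ds; apply: powR_exp_le; rewrite nrm_ge0 diam. Qed.

(** The two sums of the germ are the two members of the series, with exponents [2 * kap] and [kap]
    on [u - s]. *)
Lemma germ_inC3 : inC3 (V := C) (3 * kap) D (rough_germ X X2 colpath colder).
Proof.
have cr0 : 0 <= colremc := crem_ge0 SB K0 c40.
have cm0 : 0 <= colmovc := compc_ge0 SB K0 c40.
have k2 : 0 < 2 * kap <= 2 * gam by rewrite mulr_gt0// ler_wpM2l.
pose M := d%:R * (K * colremc) + d%:R * (d%:R * (K * colmovc)).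
have M1 : 0 <= d%:R * (K * colremc) by apply: mulr_ge0 => //; exact: mulr_ge0.
have M2 : 0 <= d%:R * (d%:R * (K * colmovc)).
  by apply: mulr_ge0 => //; apply: mulr_ge0 => //; exact: mulr_ge0.
apply: (@inC3_two R D _ (fun t u s => \sum_i delta1 X t u 0 i * remainder X colpath colder u s 0 i)
  (fun t u s => \sum_i \sum_j X2 t u i j * delta1 colder u s j i) (2 * kap) kap (3 * kap) M 0).
- exact: hD0.
- exact: addr_ge0.
- by rewrite mulr_gt0// ltr_pM2r// ltr_nat.
- by rewrite kap0 ltr_pMl// ltr1n.
- move=> t s Dt Ds; split; apply: big1 => i _.
    by rewrite {1}/delta1 subrr mxE mul0r.
  by rewrite /remainder {2 3}/delta1 !subrr mul0mx subr0 [X in _ * X]mxE mulr0.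
- move=> t s Dt Ds; split; apply: big1 => i _; apply: big1 => j _.
    by rewrite X2tt// mxE mul0r.
  by rewrite /delta1 subrr [X in _ * X]mxE mulr0.
- by [].
- move=> t u s Dt Du Ds; have -> : 3 * kap - 2 * kap = kap by ring.
  rewrite /M [leRHS]mulrDl; apply: le_trans (_ : _ <= d%:R * (K * colremc) * (nrm (u - s) `^ (2 * kap) * nrm (t - u) `^ kap)) _; last first.
    by rewrite lerDl; apply: mulr_ge0 => //; rewrite mulr_ge0 ?powR_ge0.
  rewrite -[leRHS]mulrA; apply: (@sumd _ _) => i; rewrite nrmM.
  have -> : K * colremc * (nrm (u - s) `^ (2 * kap) * nrm (t - u) `^ kap) =
     (K * nrm (t - u) `^ kap) * (colremc * nrm (u - s) `^ (2 * kap)) by ring.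
  apply: ler_pM => //.
    apply: le_trans (X_coord RD i Dt Du) _; apply: ler_wpM2l => //; exact: gap.
  apply: le_trans (colrem_le i Du Ds) _; apply: ler_wpM2l => //; exact: gap.
- move=> t u s Dt Du Ds; have -> : 3 * kap - kap = 2 * kap by ring.
  rewrite /M [leRHS]mulrDl; apply: le_trans (_ : _ <= d%:R * (d%:R * (K * colmovc)) * (nrm (u - s) `^ kap * nrm (t - u) `^ (2 * kap))) _; last first.
    by rewrite lerDr; apply: mulr_ge0 => //; rewrite mulr_ge0 ?powR_ge0.
  rewrite -!(mulrA d%:R); apply: (@sumd _ _) => i; apply: (@sumd _ _) => j; rewrite nrmM.
  have -> : K * colmovc * (nrm (u - s) `^ kap * nrm (t - u) `^ (2 * kap)) =
     (K * nrm (t - u) `^ (2 * kap)) * (colmovc * nrm (u - s) `^ kap) by ring.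
  apply: ler_pM => //.
    apply: le_trans (X2_coord RD i j Dt Du) _; apply: ler_wpM2l => //; exact: gap.
  apply: le_trans (colder_move i j Du Ds) _; apply: ler_wpM2l => //; exact: gap.
Qed.

(** The germ is a polynomial in [X], in [sigma] and [gf] along [y], and in [X2]. The paths have the
    shift bound because they are Hoelder continuous, [X2] has it by the assumption on the area. *)
Lemma germ_inCm3 : inCm3 (V := C) kap D (rough_germ X X2 colpath colder).
Proof.
apply: shift3_inCm3; first by have [] := germ_inC3.
have le1 t s (p : R) : 0 < p -> D t -> D s -> nrm (t - s) `^ p <= 1.
  by move=> p0 Dt Ds; apply: powR_le1; [exact: ltW|rewrite nrm_ge0 diam].
have KX0 : 0 <= nrm (X 0) + K by rewrite addr_ge0.
have shX i := @shift3_path R D kap (fun t => X t 0 i) gam (nrm (X 0) + K) KX0 kg.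
have {}shX i : [/\ shift3 D kap (fun t _ _ => X t 0 i), shift3 D kap (fun _ u _ => X u 0 i)
    & shift3 D kap (fun _ _ s => X s 0 i)].
  apply: shX => [t Dt|t s Dt Ds].
    apply: le_trans (mx_nrm_coord _ _ _) _; apply: le_trans (nrm_shift _ (X 0)) _.
    rewrite lerD2l; apply: le_trans (rd_X RD Dt (hD0 rho0)) _.
    by rewrite ler_piMr// le1//; exact: hD0.
  have -> : X t 0 i - X s 0 i = delta1 X t s 0 i by rewrite /delta1 !mxE.
  apply: le_trans (X_coord RD i Dt Ds) _; apply: ler_wpM2r; first exact: powR_ge0.
  by rewrite lerDr.
have cm0 : 0 <= colmovc := compc_ge0 SB K0 c40.
have SC0 : 0 <= S + colmovc by rewrite addr_ge0.
have shS i := @shift3_path R D kap (fun t => sigma (y t) i c) gam (S + colmovc) SC0 kg.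
have {}shS i : [/\ shift3 D kap (fun t _ _ => sigma (y t) i c), shift3 D kap (fun _ u _ => sigma (y u) i c)
    & shift3 D kap (fun _ _ s => sigma (y s) i c)].
  apply: shS => [t Dt|t s Dt Ds].
    by apply: le_trans (sb_vf SB _ _ (r1 Dt)) _; rewrite lerDl.
  apply: le_trans (sigma_path_move dsigma RD rho1 SB K0 gam0 c40 yB yda i c Dt Ds) _.
  by apply: ler_wpM2r; rewrite ?powR_ge0// lerDr.
have shG i j := @shift3_path R D kap (fun t => gf sigma i j (y t) 0 c) gam (S + colmovc) SC0 kg.
have {}shG i j : [/\ shift3 D kap (fun t _ _ => gf sigma i j (y t) 0 c),
    shift3 D kap (fun _ u _ => gf sigma i j (y u) 0 c)
    & shift3 D kap (fun _ _ s => gf sigma i j (y s) 0 c)].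
  apply: shG => [t Dt|t s Dt Ds].
    by apply: le_trans (sb_gf SB _ _ _ (r1 Dt)) _; rewrite lerDl.
  apply: le_trans (gf_path_move dsigma RD rho1 SB K0 gam0 c40 yB yda i j c Dt Ds) _.
  by apply: ler_wpM2r; rewrite ?powR_ge0// lerDr.
have [M M0 hM] := shift2_bound (levy_shift LA).
have shX2 i j : shift3 D kap (fun t u _ => X2 t u i j).
  exists (K + M) => [|t u s Dt Du Ds]; first exact: addr_ge0.
  split.
    apply: le_trans (X2_coord RD i j Dt Du) _.
    apply: le_trans (_ : _ <= K) _; last by rewrite lerDl.
    by rewrite ler_piMr// le1// mulr_gt0.
  move=> e e01 h1 h2 h3.
  have -> : X2 (up_shift e t) (up_shift e u) i j - X2 t u i j =
      (X2 (up_shift e t) (up_shift e u) - X2 t u) i j by rewrite !mxE.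
  apply: le_trans (mx_nrm_coord _ _ _) _; apply: le_trans (hM e t u e01 Dt Du h1 h2) _.
  apply: ler_pM => //; first exact: powR_ge0; first by rewrite lerDr.
  by case/andP: e01 => e0 e1; apply: powR_exp_le; rewrite // e1 ltW.
have -> : rough_germ X X2 colpath colder = fun t u s =>
  \sum_i ((X t 0 i + - X u 0 i) * (sigma (y u) i c + - sigma (y s) i c
            + - \sum_j (X u 0 j + - X s 0 j) * gf sigma i j (y s) 0 c)
         + \sum_j X2 t u i j * (gf sigma i j (y u) 0 c + - gf sigma i j (y s) 0 c)).
  apply/funext => t; apply/funext => u; apply/funext => s; rewrite germE.
  apply: eq_bigr => i _; congr (_ * (_ - _) + _); first by rewrite /delta1 !mxE.
  by apply: eq_bigr => j _; congr (_ * _); rewrite /delta1 !mxE.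
apply: shift3_sum => i; have [X1 X1' X1''] := shX i; have [S1 S2 S3] := shS i.
apply: shift3D.
  apply: shift3M; first by apply: shift3D => //; exact: shift3N.
  apply: shift3D; first by apply: shift3D => //; exact: shift3N.
  apply: shift3N; apply: shift3_sum => j; have [Y1 Y2 Y3] := shX j; have [G1 G2 G3] := shG i j.
  by apply: shift3M => //; apply: shift3D => //; exact: shift3N.
apply: shift3_sum => j; have [G1 G2 G3] := shG i j.
by apply: shift3M => //; apply: shift3D => //; exact: shift3N.
Qed.

Lemma sigma_path_diff i z : hU rho z -> differentiable (fun z => sigma (y z) i c : C) z.
Proof.
move=> zU; exact: (differentiable_comp (ydiff zU) (dsig dsigma i c (y z))).
Qed.

(** On an interior segment the three parts of the integrand integrate exactly: [dX sigma(y)] to the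
    increment of [y] by the differential equation, [dX] to the increment of [X], and [dX (X - X_s)]
    to [X2], which is the iterated integral there. *)
Lemma germ_line_int s t : hU rho s -> hU rho t ->
  \sum_i line_int (fun v => X v 0 i) (fun v => remainder X colpath colder v s 0 i) s t = defect t s.
Proof.
move=> sU tU; have [q q0 [hs ht]] := hU_hUr sU tU.
have [M hM] := X_interior LA RD rho0 gam0 K0; have [L L0 hL] := row_hUr_lip q0 hM.
have hq a : 0 <= a <= 1 -> hUr rho q (seg s t a) by exact: hUr_convex.
have hu a : 0 <= a <= 1 -> hU rho (seg s t a) by move=> /hq/(hUr_sub q0).
pose dX i (a : R) : C := 'd (fun x => X x 0 i : C) (seg s t a) 1.
pose P i (a : R) : C := sigma (y (seg s t a)) i c.
pose Q j (a : R) : C := X (seg s t a) 0 j - X s 0 j.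
have dXl i : lipC (dX i).
  apply: (@lipC_seg R (hUr rho q) (fun z => 'd (fun x => X x 0 i : C) z 1) L) => //; first exact: hUr_convex.
  by move=> z w hz hw; have [] := hL i z w hz hw.
have Ql j : lipC (Q j).
  apply: lipCD; last exact: lipC_cst.
  apply: (@lipC_seg R (hUr rho q) (fun z => X z 0 j) L) => //; first exact: hUr_convex.
  by move=> z w hz hw; have [] := hL j z w hz hw.
have Pl i : lipC (P i).
  have hS z : hU rho z -> differentiable (fun z => sigma (y z) i c : C) z /\ nrm (sigma (y z) i c : C) <= S.
    move=> zU; split; first exact: sigma_path_diff.
    by apply: (sb_vf SB); exact: r1 (hU_sub zU).
  have [L' L'0 hL'] := hUr_lip q0 hS.
  apply: (@lipC_seg R (hUr rho q) (fun z => sigma (y z) i c) L') => //; first exact: hUr_convex.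
  by move=> z w hz hw; have [] := hL' z w hz hw.
have l1 i : lipC (fun a => dX i a * P i a * (t - s)).
  by apply: lipCM; [exact: lipCM|exact: lipC_cst].
have l2 i : lipC (fun a => dX i a * (t - s)) by apply: lipCM; last exact: lipC_cst.
have l3 i j : lipC (fun a => dX i a * Q j a * (t - s)).
  by apply: lipCM; [exact: lipCM|exact: lipC_cst].
have lZ k (phi : R -> C) : lipC phi -> lipC (fun a => k * phi a).
  by move=> h; apply: lipCM => //; exact: lipC_cst.
have dXE i a : 0 <= a <= 1 -> derive1 (fun v => X v 0 i : C) (seg s t a) = dX i a.
  by move=> ha; apply: derive1_d; exact: (X_diff_coord LA i (hu a ha)).
have B i : cint01 (fun a => dX i a * (t - s)) = X t 0 i - X s 0 i.
  apply: (@cint01_FTC R (fun x => X x 0 i) s t); last exact: l2.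
  move=> a ha; exact: (X_diff_coord LA i (hu a ha)).
have CE i j : cint01 (fun a => dX i a * Q j a * (t - s)) = X2 t s i j.
  have sin : seg_in (upper D) s t by move=> a ha; rewrite upper_hD; exact: hu.
  rewrite (levy_iterated LA sin i j) /line_int; apply: eq_cint01 => a ha.
  by rewrite dXE.
have A : \sum_i cint01 (fun a => dX i a * P i a * (t - s)) = y t 0 c - y s 0 c.
  rewrite -cint01_sum//.
  have e1 a : 0 <= a <= 1 -> \sum_i dX i a * P i a * (t - s) = 'd (fun x => y x 0 c : C) (seg s t a) 1 * (t - s).
    move=> ha; rewrite -mulr_suml; congr (_ * _); exact: esym (ode c (hu a ha)).
  rewrite (eq_cint01 e1); apply: (@cint01_FTC R (fun x => y x 0 c) s t).
    move=> a ha; apply: diff_coord; exact: ydiff (hu a ha).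
  have [K' K'0 H'] := lipC_sum l1; exists K' => // a b ha hb.
  have := H' a b ha hb; rewrite (e1 a ha) (e1 b hb); exact: id.
rewrite defect_sumE -A -sumrB; apply: eq_bigr => i _.
rewrite /line_int.
rewrite (@eq_cint01 R _ (fun a => dX i a * P i a * (t - s) + (- sigma (y s) i c * (dX i a * (t - s)) +
    \sum_j - gf sigma i j (y s) 0 c * (dX i a * Q j a * (t - s))))); last first.
  move=> a ha; rewrite dXE// colremE.
  have -> : \sum_j delta1 X (seg s t a) s 0 j * gf sigma i j (y s) 0 c =
      \sum_j Q j a * gf sigma i j (y s) 0 c.
    by apply: eq_bigr => j _; rewrite /delta1 !mxE.
  have -> : \sum_j - gf sigma i j (y s) 0 c * (dX i a * Q j a * (t - s)) =
     - dX i a * (t - s) * \sum_j Q j a * gf sigma i j (y s) 0 c.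
    by rewrite mulr_sumr; apply: eq_bigr => j _; move: (gf _ _ _ _ _ _) => g; ring.
  rewrite -/(P i a); move: (dX i a) (P i a) (sigma (y s) i c) (\sum_j _) => p1 p2 p3 p4; ring.
have ls : lipC (fun a => \sum_j - gf sigma i j (y s) 0 c * (dX i a * Q j a * (t - s))).
  by apply: lipC_sum => j; apply: lZ; exact: l3.
rewrite cint01D//; last by apply: lipCD => //; exact: lZ.
rewrite cint01D//; last exact: lZ.
rewrite (cint01Z (- sigma (y s) i c) (l2 i)) B cint01_sum => [|j]; last exact: lZ.
have -> : \sum_j cint01 (fun a => - gf sigma i j (y s) 0 c * (dX i a * Q j a * (t - s))) =
    - \sum_j X2 t s i j * gf sigma i j (y s) 0 c.
  rewrite -sumrN; apply: eq_bigr => j _; rewrite (cint01Z (- gf sigma i j (y s) 0 c) (l3 i j)) CE.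
  by rewrite mulNr mulrC.
have -> : delta1 X t s 0 i = X t 0 i - X s 0 i by rewrite /delta1 !mxE.
move: (sigma (y s) i c) (cint01 _) => a b.
rewrite opprD; congr (_ + (_ + _)); ring.
Qed.

Let dX t : hU rho t -> differentiable X t.
Proof. by move=> tU; apply: (levy_path_analytic LA); rewrite upper_hD; exact: tU. Qed.

Lemma col_controlled : controlled kap D X (colpath 0) colpath colder.
Proof.
have cr0 : 0 <= colremc := crem_ge0 SB K0 c40.
have cm0 : 0 <= colmovc := compc_ge0 SB K0 c40.
have M0 : 0 <= S + (colmovc + colremc) := addr_ge0 S0 (addr_ge0 cm0 cr0).
have m1 : colmovc <= S + (colmovc + colremc) := ler_wpDl S0 (ler_wpDr cr0 (lexx _)).
have m2 : colremc <= S + (colmovc + colremc) := ler_wpDl S0 (ler_wpDl cm0 (lexx _)).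
have m3 : S <= S + (colmovc + colremc) := ler_wpDr (addr_ge0 cm0 cr0) (lexx _).
apply: (mk_controlled rho1 kg M0 dX).
- move=> t s Dt Ds; apply/mx_nrm_le => [|i' i]; first by rewrite mulr_ge0 ?powR_ge0.
  rewrite (ord1 i').
  have -> : (colpath t - colpath s) 0 i = sigma (y t) i c - sigma (y s) i c by rewrite !mxE.
  apply: le_trans (sigma_path_move dsigma RD rho1 SB K0 gam0 c40 yB yda i c Dt Ds) _.
  by apply: ler_wpM2r; rewrite ?powR_ge0.
- move=> t s Dt Ds; apply/mx_nrm_le => [|j i]; first by rewrite mulr_ge0 ?powR_ge0.
  by apply: le_trans (colder_move i j Dt Ds) _; apply: ler_wpM2r; rewrite ?powR_ge0.
- move=> t Dt; apply/mx_nrm_le => // j i.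
  have -> : colder t j i = gf sigma i j (y t) 0 c by exact: colderE.
  exact: le_trans (sb_gf SB _ _ _ (r1 Dt)) m3.
- move=> t s Dt Ds; apply/mx_nrm_le => [|i' i]; first by rewrite mulr_ge0 ?powR_ge0.
  rewrite (ord1 i'); apply: le_trans (colrem_le i Dt Ds) _.
  by apply: ler_wpM2r; rewrite ?powR_ge0.
- move=> t tU; apply: diff_mx => i' i; rewrite (ord1 i').
  have -> : (fun v => colpath v 0 i) = (fun v => sigma (y v) i c) by apply/funext => v; exact: colpathE.
  exact: sigma_path_diff.
- move=> t tU; apply: diff_mx => j i.
  have -> : (fun v => colder v j i) = (fun v => gf sigma i j (y v) 0 c) by apply/funext => v; exact: colderE.
  exact: (differentiable_comp (ydiff tU) (gf_diff dsigma i j c (y t))).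
Qed.

Lemma germ_delta_of_integral : delta_of_integral D (rough_germ X X2 colpath colder).
Proof.
exists d, X, (remainder X colpath colder); rewrite upper_hD; split.
- exact: dX.
- by move=> t _; rewrite /remainder /delta1 !subrr mul0mx subr0.
- move=> s sU; have [Ds su] : D s /\ upper_half s by split; [exact: hU_sub|case: sU].
  have := ctrl_rem_analytic col_controlled Ds su; rewrite upper_hD; exact.
- move=> t u s h1 h2 h3.
  have e0 : 0 <= (0 : R) <= 1 by rewrite lexx ler01.
  have e1 : 0 <= (1 : R) <= 1 by rewrite lexx ler01.
  have sU : hU rho s by have := h1 0 e0; rewrite seg0.
  have tU : hU rho t by have := h1 1 e1; rewrite seg1.
  have uU : hU rho u by have := h2 0 e0; rewrite seg0.
  rewrite -(defect_delta2 (hU_sub tU) (hU_sub uU) (hU_sub sU)) /delta2.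
  by rewrite !germ_line_int.
Qed.

Lemma germ_is_Lambda : is_Lambda D (rough_germ X X2 colpath colder) defect.
Proof.
exists (3 * kap), kap; split.
- split => //; [exact: germ_inC3|exact: germ_inCm3|exact: germ_delta_of_integral].
- move=> t v u s Dt Dv Du Ds; rewrite /delta3 -(defect_delta2 Dv Du Ds) -(defect_delta2 Dt Du Ds).
  rewrite -(defect_delta2 Dt Dv Ds) -(defect_delta2 Dt Dv Du) /delta2.
  move: (defect t s) (defect t u) (defect t v) (defect u s) (defect v s) (defect v u) => *; ring.
- move=> nu /andP[nu1 nuk]; split.
    by move=> t Dt; rewrite defect_sumE subrr add0r big1 ?oppr0// => i _; rewrite {1}/delta1 subrr mxE mul0r add0r big1// => j _; rewrite X2tt// mxE mul0r.
  have nug : 0 < nu <= 3 * gam.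
    by rewrite (lt_trans ltr01 nu1)/= (le_trans (ltW nuk))// ler_pM2l.
  exact: le_lt_trans (holder_weaken diam c40 nug defect_le) (ltry c4).
- exact: defect_delta2.
(* Two increments with the same coboundary differ by an additive one, here of order [nu > 1]. *)
- move=> nu L' /andP[nu1 nuk] [iL' hL'] dL' t s Dt Ds.
  have nu0 : 0 < nu by exact: lt_trans ltr01 nu1.
  have [K' K'0 bK'] := holder2_finite hL'.
  apply/eqP; rewrite -subr_eq0; apply/eqP.
  apply: (@additive_zero R D (fun t s => L' t s - defect t s) (K' + c4) nu) => //.
  + exact: hD_convex.
  + exact: addr_ge0.
  + move=> t' u' s' Dt' Du' Ds'; have := dL' _ _ _ Dt' Du' Ds'.
    rewrite -(defect_delta2 Dt' Du' Ds') /delta2 => e.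
    apply/eqP; rewrite -subr_eq0; apply/eqP.
    have alg (a b g x z w : C) : a - x - (b - z + (g - w)) = (a - b - g) - (x - z - w) by ring.
    by rewrite alg e subrr.
  + move=> t' s' Dt' Ds'; rewrite mulrDl; apply: nrmB_le.
      exact: (holder2_le nu0 iL' bK').
    apply: le_trans (defect_le Dt' Ds') _; apply: ler_wpM2l => //; apply: gap => //.
    by rewrite nu0/= (le_trans (ltW nuk))// ler_pM2l.
Qed.

End Column.

Lemma path_controlled : controlled kap D X (y 0) y (fun s => sigma (y s)).
Proof.
have cr0 : 0 <= remc d K S c4 := remc_ge0 SB K0 c40.
have cm0 : 0 <= compc d K S c4 := compc_ge0 SB K0 c40.
have pm0 : 0 <= c4 + K1e d K S by rewrite addr_ge0// (K1e_ge0 SB K0).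
pose M := (c4 + K1e d K S) + (S + (compc d K S c4 + remc d K S c4)).
have M0 : 0 <= M := addr_ge0 pm0 (addr_ge0 S0 (addr_ge0 cm0 cr0)).
have m1 : c4 + K1e d K S <= M := ler_wpDr (addr_ge0 S0 (addr_ge0 cm0 cr0)) (lexx _).
have m2 : S <= M := ler_wpDl pm0 (ler_wpDr (addr_ge0 cm0 cr0) (lexx _)).
have m3 : compc d K S c4 <= M := ler_wpDl pm0 (ler_wpDl S0 (ler_wpDr cr0 (lexx _))).
have m4 : remc d K S c4 <= M := ler_wpDl pm0 (ler_wpDl S0 (ler_wpDl cm0 (lexx _))).
have dX t : hU rho t -> differentiable X t.
  by move=> tU; apply: (levy_path_analytic LA); rewrite upper_hD; exact: tU.
apply: (mk_controlled rho1 kg M0 dX).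
- move=> t s Dt Ds; apply: le_trans (path_move RD rho1 SB K0 gam0 c40 yB yda Dt Ds) _.
  by apply: ler_wpM2r; rewrite ?powR_ge0.
- move=> t s Dt Ds; apply/mx_nrm_le => [|i c]; first by rewrite mulr_ge0 ?powR_ge0.
  have -> : (sigma (y t) - sigma (y s)) i c = sigma (y t) i c - sigma (y s) i c by rewrite !mxE.
  apply: le_trans (sigma_path_move dsigma RD rho1 SB K0 gam0 c40 yB yda i c Dt Ds) _.
  by apply: ler_wpM2r; rewrite ?powR_ge0.
- move=> t Dt; apply/mx_nrm_le => // i c; exact: le_trans (sb_vf SB _ _ (r1 Dt)) m2.
- move=> t s Dt Ds; apply: le_trans (path_remainder RD rho1 SB gam0 c40 yB yda (zeta := fun s => sigma (y s)) erefl Dt Ds) _.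
  by apply: ler_wpM2r; rewrite ?powR_ge0.
- exact: ydiff.
- move=> t tU; exact: (differentiable_comp (ydiff tU) (dsigma (y t))).
Qed.

Lemma davie_solves : solves kap D sigma (y 0) X X2 y (fun s => sigma (y s)).
Proof.
split => [||c]; [exact: path_controlled|by []|].
split; first exact: col_controlled.
exists (defect c); first exact: germ_is_Lambda.
move=> t s Dt Ds; rewrite defect_sumE big_split /=.
have -> : delta1 y t s 0 c = y t 0 c - y s 0 c by rewrite /delta1 !mxE.
have e1 : \sum_i delta1 X t s 0 i * (col c (sigma (y s)))^T 0 i = \sum_i delta1 X t s 0 i * sigma (y s) i c.
  by apply: eq_bigr => i _; rewrite -colpathE.
have e2 : \sum_i \sum_j X2 t s i j * comp_deriv sigma y (fun s => sigma (y s)) c s j i =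
    \sum_i \sum_j X2 t s i j * gf sigma i j (y s) 0 c.
  by apply: eq_bigr => i _; apply: eq_bigr => j _; congr (_ * _); exact: colderE.
rewrite e1 e2; move: (\sum_i _) (\sum_i _) (y t 0 c) (y s 0 c) => p1 p2 p3 p4; ring.
Qed.
End SolvesFromDavie.

(** * Uniqueness and continuity *)

Section DavieFromSolves.
Variables (R : realType) (d l : nat).
Local Notation C := (Cplx R).
Local Notation V := 'rV[C]_l.
Variables (sigma : V -> 'M[C]_(d, l)) (rho kap : R) (a : V).
Variables (X : C -> 'rV[C]_d) (X2 : C -> C -> 'M[C]_d) (y : C -> V) (zeta : C -> 'M[C]_(d, l)).
Local Notation D := (hD rho).
Hypothesis rho1 : 2 * rho <= 1.
Hypothesis kap0 : 0 < kap.
Hypothesis SO : solves kap D sigma a X X2 y zeta.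

Lemma solves_init : y 0 = a.
Proof. by case: SO => h _ _; exact: ctrl_init h. Qed.

Lemma solves_deriv s : D s -> zeta s = sigma (y s).
Proof. by case: SO => _ h _; exact: h. Qed.

Lemma solves_holder : exists2 H : R, 0 <= H &
  forall s t, D s -> D t -> nrm (y t - y s) <= H * nrm (t - s) `^ kap.
Proof.
case: SO => h _ _; have [H H0 hH] := holder2_finite (ctrl_holder h).
exists H => // s t Ds Dt; exact: (holder2_le kap0 (@incr2_delta1 R _ D y) hH Dt Ds).
Qed.

Lemma solves_davie_col c : exists nu : R, exists M : R, [/\ 1 < nu, 0 <= M &
  forall t s, D t -> D s -> nrm (defect sigma X X2 y c t s) <= M * nrm (t - s) `^ nu].
Proof.
case: SO => _ hz /(_ c)[_ [L [mu [beta [[mu1 _ _ _ _] _ Lnu _ _]]] eqL]].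
(* [Lambda h] is controlled for exponents strictly below [mu] only; the midpoint is one of them. *)
have nu1 : 1 < (1 + mu) / 2 < mu by apply/andP; split; lra.
have [iL /holder2_finite[M M0 hM]] := Lnu _ nu1.
exists ((1 + mu) / 2), M; split => //; first by case/andP: nu1.
move=> t s Dt Ds; have -> : defect sigma X X2 y c t s = L t s.
  have := eqL t s Dt Ds.
  have -> : delta1 y t s 0 c = y t 0 c - y s 0 c by rewrite /delta1 !mxE.
  have e1 : \sum_i delta1 X t s 0 i * (col c (sigma (y s)))^T 0 i = \sum_i delta1 X t s 0 i * sigma (y s) i c.
    by apply: eq_bigr => i _; congr (_ * _); rewrite !mxE.
  have e2 : \sum_i \sum_j X2 t s i j * comp_deriv sigma y zeta c s j i =
      \sum_i \sum_j X2 t s i j * gf sigma i j (y s) 0 c.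
    apply: eq_bigr => i _; apply: eq_bigr => j _; congr (_ * _).
    exact: comp_derivE (hz s Ds).
  rewrite e1 e2 defect_sumE big_split /= => ->.
  by rewrite addrAC subrr add0r.
have nu0 : 0 < (1 + mu) / 2 by lra.
exact: (holder2_le nu0 iL hM Dt Ds).
Qed.

Lemma solves_davie : exists nu : R, exists2 M : R, 1 < nu /\ 0 <= M &
  davie D (euler sigma X X2) y M nu.
Proof.
have [nf /choice[Mf hf]] := choice solves_davie_col.
(* Each column has its own exponent [nf c]. [fin_bound] yields upper bounds, so it is applied to the
   inverses: [1 + N^-1] lies below every exponent, and on a set of diameter at most 1 exponents may
   be lowered. *)
have [N N1 hN] : exists2 N, 1 <= N & forall c (a : unit), True -> (nf c - 1)^-1 <= N.
  by apply: (@fin_bound R _ _ (fun=> True) (fun c _ => (nf c - 1)^-1)) => c; exists (nf c - 1)^-1.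
have N0 : 0 < N by exact: lt_le_trans ltr01 N1.
have Mf0 c : 0 <= Mf c by have [] := hf c.
exists (1 + N^-1); exists (\sum_c Mf c).
  by rewrite ltrDl invr_gt0 N0; split => //; exact: sumr_ge0.
move=> s t Ds Dt.
have S0 : 0 <= \sum_c Mf c by exact: sumr_ge0.
apply/mx_nrm_le => [|i c]; first by rewrite mulr_ge0 ?powR_ge0.
rewrite (ord1 i); have [n1 _ h] := hf c; apply: le_trans (h t s Dt Ds) _.
apply: ler_pM; rewrite ?powR_ge0//.
  by rewrite (bigD1 c)//= lerDl; exact: sumr_ge0.
apply: powR_exp_le.
  rewrite nrm_ge0/=; apply: ltW; exact: lt_le_trans (hD_diam Dt Ds) rho1.
have n0 : 0 < nf c - 1 by rewrite subr_gt0.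
apply/andP; split; first by rewrite addr_gt0// invr_gt0.
have := hN c tt I; rewrite -[in X in X -> _]lef_pV2 ?posrE ?invr_gt0// invrK; lra.
Qed.

End DavieFromSolves.

(** Below the threshold [x0] the bound with the larger exponent is strong enough, above it the sup
    bound is; [e'] is the target value at the threshold. *)
Lemma interpolate (R : realType) (M p q e : R) : 0 <= M -> 0 < p < q -> 0 < e ->
  exists2 e' : R, 0 < e' & forall x v : R, 0 <= x -> v <= M * x `^ q -> v <= e' -> v <= e * x `^ p.
Proof.
move=> M0 /andP[p0 pq] e0; have qp : 0 < q - p by rewrite subr_gt0.
have [x0 x00 hx] := powR_small M0 qp e0.
exists (e * x0 `^ p); first by rewrite mulr_gt0// powR_gt0.
move=> x v xp v1 v2; have [xx|xx] := leP x x0.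
  apply: le_trans v1 _; have pq' : 0 < p < q by rewrite p0.
  rewrite (powR_split xp pq') mulrA; apply: ler_wpM2r; first exact: powR_ge0.
  by apply: hx; rewrite xp.
apply: le_trans v2 _; apply: ler_wpM2l; first exact: ltW.
by apply: powR_mono; rewrite ?(ltW p0)// !ltW.
Qed.

(** * Comparison of two paths along the rays from 0 *)

Section RayCompare.
Variables (R : realType) (l : nat).
Local Notation C := (Cplx R).
Local Notation V := 'rV[C]_l.

(** [flow_compare] reaches only as far as [del], so it is iterated along the ray. The radius [B - 3]
    for [y1], plus a distance of at most 1 between the paths, gives the [B - 2] that [flow_compare]
    demands of [y2]. *)
Lemma ray_compare (rho : R) (E1 : C -> C -> V -> V) (B K1 K2 gam th del c1 nu1 eps : R) (y1 : C -> V) :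
  small_step K1 K2 gam th del -> 0 <= K2 -> 1 < th -> 0 < del -> 0 < rho ->
  davie (hD rho) E1 y1 c1 nu1 -> 1 < nu1 -> 0 <= c1 ->
  (forall p, hD rho p -> nrm (y1 p) <= B - 3) -> 0 < eps ->
  exists2 eta : R, 0 < eta & forall E2 y2 c2 nu2 H kap,
    almost_flow (hD rho) E2 B K1 K2 gam th del ->
    (forall t s v, hD rho t -> hD rho s -> nrm v <= B -> nrm (E1 t s v - E2 t s v) <= eta) ->
    davie (hD rho) E2 y2 c2 nu2 -> 1 < nu2 -> 0 <= c2 -> 0 <= H -> 0 < kap ->
    (forall a b, hD rho a -> hD rho b -> nrm (y2 b - y2 a) <= H * nrm (b - a) `^ kap) ->
    nrm (y1 0 - y2 0) <= eta ->
    forall t, hD rho t -> nrm (y1 t - y2 t) <= eps.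
Proof.
move=> SS K20 th1 del0 rho0 da1 nu11 c10 yB eps0.
have yB' p : hD rho p -> nrm (y1 p) <= B by move=> /yB; lra.
have [N hN] := inv_rate (ltW rho0) (@ltr01 R) del0.
pose e := Num.min eps 1.
have e0 : 0 < e by rewrite /e lt_min eps0 ltr01.
have eeps : e <= eps by rewrite /e ge_min lexx.
have e1 : e <= 1 by rewrite /e ge_min lexx orbT.
(* Iterating [x -> 2 * x + f] from [f] gives [(2 ^+ k.+1 - 1) * f] after [k] pieces, which stays
   below [e] up to [k = N + 1]. *)
pose f := e / 2 ^+ N.+2.
have f0 : 0 < f by rewrite divr_gt0// exprn_gt0.
have [eta eta0 heta] := flow_compare SS K20 th1 da1 nu11 c10 del0 yB' f0.
exists (Num.min eta f); first by rewrite lt_min eta0 f0.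
move=> E2 y2 c2 nu2 H kap AF2 E12 da2 nu21 c20 H0 kap0 ho2 init t Dt.
have D0 := hD0 rho0.
have key k : (k <= N.+1)%N ->
    nrm (y1 (seg 0 t (k%:R / N.+1%:R)) - y2 (seg 0 t (k%:R / N.+1%:R))) <= (2 ^+ k.+1 - 1) * f.
  elim: k => [_|k IH kn].
    rewrite mul0r seg0 expr1; have -> : 2 - 1 = 1 :> R by lra.
    by rewrite mul1r; apply: le_trans init _; rewrite ge_min lexx orbT.
  have D1 := hD_convex D0 Dt (@natdiv01 R N k (ltnW kn)).
  have D2 := hD_convex D0 Dt (@natdiv01 R N k.+1 kn).
  have {}IH := IH (ltnW kn).
  have small : (2 ^+ k.+1 - 1) * f <= 1.
    apply: le_trans (_ : _ <= e) _ => //.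
    rewrite /f mulrCA ler_piMr ?(ltW e0)// ler_pdivrMr ?exprn_gt0// mul1r.
    apply: le_trans (_ : _ <= 2 ^+ k.+1) _; first by rewrite gerBl.
    by apply: ler_weXn2l; [rewrite ler1n|rewrite ltnW// ltnS ltnW].
  have st : nrm (y1 (seg 0 t (k.+1%:R / N.+1%:R)) - y2 (seg 0 t (k.+1%:R / N.+1%:R))) <=
      2 * nrm (y1 (seg 0 t (k%:R / N.+1%:R)) - y2 (seg 0 t (k%:R / N.+1%:R))) + f.
    apply: (heta E2 y2 c2 nu2 H kap) => //.
    - move=> t' s' v Dt' Ds' vB; apply: le_trans (E12 _ _ _ Dt' Ds' vB) _.
      by rewrite ge_min lexx.
    - rewrite seg_dist -mulrBl.
      have -> : k.+1%:R - k%:R = 1 :> R by rewrite -natr1 addrC addKr.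
      rewrite mul1r ger0_norm ?invr_ge0// mulrC subr0.
      have := hN N (leqnn N); rewrite powRr1 ?invr_ge0//; apply: le_trans.
      by apply: ler_wpM2r; [rewrite invr_ge0|apply: ltW; case: Dt].
    - have := nrm_shift (y2 (seg 0 t (k%:R / N.+1%:R))) (y1 (seg 0 t (k%:R / N.+1%:R))).
      rewrite [nrm (y2 _ - _)]nrmBC; have := yB _ D1; move: IH small; lra.
  apply: le_trans st _; rewrite exprS.
  have -> : (2 * 2 ^+ k.+1 - 1) * f = 2 * ((2 ^+ k.+1 - 1) * f) + f by ring.
  by rewrite lerD2r ler_pM2l.
have := key N.+1 (leqnn _); rewrite divff ?pnatr_eq0// seg1 => h.
apply: le_trans h _; apply: le_trans (_ : _ <= e) _ => //.
rewrite /f mulrCA ler_piMr ?(ltW e0)// ler_pdivrMr ?exprn_gt0// mul1r.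
by rewrite gerBl.
Qed.

End RayCompare.

Section RoughPaths.
Variables (R : realType) (d l : nat).
Local Notation C := (Cplx R).
Local Notation V := 'rV[C]_l.

Lemma levy_restrict (gam : R) (A B : set C) (X : C -> 'rV[C]_d) (X2 : C -> C -> 'M[C]_d) :
  A `<=` B -> levy_area gam B X X2 -> levy_area gam A X X2.
Proof.
move=> AB LB.
have uAB : upper A `<=` upper B.
  apply: interiorS => z [Az Uz]; split => //; exact: AB.
have hS (W : normedModType C) mu (f : C -> C -> W) : (holder2 mu A f <= holder2 mu B f)%E.
  by apply: le_ereal_sup => _ [t At] [s As <-]; exists t; [exact: AB|exists s; [exact: AB|]].
split.
- by apply: le_lt_trans (levy_path_holder LB); exact: hS.
- by move=> z /uAB; exact: (levy_path_analytic LB).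
- have [i2 h2] := levy_holder LB; split; first by move=> t /AB; exact: i2.
  by apply: le_lt_trans h2; exact: hS.
- have [i2 h2] := levy_shift LB; split; first by move=> t /AB; exact: i2.
  apply: le_lt_trans h2; apply: le_ereal_sup => _ [e [t [s [e01 [At As] [A1 A2] ->]]]].
  by exists e, t, s; split => //; split; exact: AB.
- by move=> [z w] [/uAB hz /uAB hw]; exact: (levy_analytic LB).
- by move=> s t h; apply: (levy_iterated LB) => tau htau; apply: uAB; exact: h.
- by move=> t u s /AB Bt /AB Bu /AB Bs; exact: (levy_chen LB).
Qed.

Lemma chen_rough (gam K : R) (D : set C) (X : C -> 'rV[C]_d) (X2 : C -> C -> 'M[C]_d) :
  levy_area gam D X X2 ->
  (forall t s, D t -> D s -> nrm (X t - X s) <= K * nrm (t - s) `^ gam) ->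
  (forall t s, D t -> D s -> nrm (X2 t s) <= K * nrm (t - s) `^ (2 * gam)) ->
  rough_data D X X2 K gam.
Proof.
move=> LA h1 h2; split => // t u s Dt Du Ds i j.
rewrite -(levy_chen LA Dt Du Ds) /delta2 !mxE; ring.
Qed.

Lemma levy_rough (gam : R) (D : set C) (X : C -> 'rV[C]_d) (X2 : C -> C -> 'M[C]_d) :
  0 < gam -> levy_area gam D X X2 -> exists2 K : R, 0 <= K & rough_data D X X2 K gam.
Proof.
move=> gam0 LA; have [K1 K10 h1] := holder2_finite (levy_path_holder LA).
have [i2 /holder2_finite[K2 K20 h2]] := levy_holder LA.
have gam20 : 0 < 2 * gam by rewrite mulr_gt0.
exists (K1 + K2); first exact: addr_ge0.
apply: chen_rough => // t s Dt Ds.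
  apply: le_trans (holder2_le gam0 (@incr2_delta1 R _ D X) h1 Dt Ds) _.
  by apply: ler_wpM2r; rewrite ?powR_ge0// lerDl.
apply: le_trans (holder2_le gam20 i2 h2 Dt Ds) _.
by apply: ler_wpM2r; rewrite ?powR_ge0// lerDr.
Qed.

Lemma close_bounds (gam eta : R) (D : set C) (a a' : V) (X X' : C -> 'rV[C]_d)
    (X2 X2' : C -> C -> 'M[C]_d) : 0 < gam ->
  levy_area gam D X X2 -> levy_area gam D X' X2' ->
  close_data gam eta D a a' X X' X2 X2' ->
  [/\ nrm (a' - a) <= eta,
   forall t s, D t -> D s -> nrm (delta1 X' t s - delta1 X t s) <= eta * nrm (t - s) `^ gam
   & forall t s, D t -> D s -> nrm (X2' t s - X2 t s) <= eta * nrm (t - s) `^ (2 * gam)].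
Proof.
move=> gam0 LA LA' [h0 h1 h2]; split; first exact: ltW.
  move=> t s Dt Ds; have := holder2_le gam0 (@incr2_delta1 R _ D (fun s => X' s - X s)) (ltW h1) Dt Ds.
  by rewrite /delta1 opprB addrACA [- X t + _]addrC addrACA opprB.
have gam20 : 0 < 2 * gam by rewrite mulr_gt0.
have i2 : incr2 D (fun t s => X2' t s - X2 t s).
  move=> t Dt; have [i _] := levy_holder LA; have [i' _] := levy_holder LA'.
  by rewrite i// i'// subrr.
by move=> t s Dt Ds; exact: (holder2_le gam20 i2 (ltW h2) Dt Ds).
Qed.

(** All data at distance at most 1 share the constant [K + 1]; this makes step sizes and radii
    uniform over a neighbourhood of the data. *)
Lemma close_rough (gam eta K : R) (D : set C) (a a' : V) (X X' : C -> 'rV[C]_d)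
    (X2 X2' : C -> C -> 'M[C]_d) : 0 < gam -> eta <= 1 ->
  levy_area gam D X X2 -> levy_area gam D X' X2' ->
  rough_data D X X2 K gam -> close_data gam eta D a a' X X' X2 X2' ->
  rough_data D X' X2' (K + 1) gam.
Proof.
move=> gam0 eta1 LA LA' RD cl; have [_ h1 h2] := close_bounds gam0 LA LA' cl.
apply: chen_rough => // t s Dt Ds.
  apply: le_trans (nrm_shift _ (X t - X s)) _; rewrite mulrDl; apply: lerD; first exact: (rd_X RD).
  apply: le_trans (h1 t s Dt Ds) _; apply: ler_wpM2r => //; exact: powR_ge0.
apply: le_trans (nrm_shift _ (X2 t s)) _; rewrite mulrDl; apply: lerD; first exact: (rd_X2 RD).
apply: le_trans (h2 t s Dt Ds) _; apply: ler_wpM2r => //; exact: powR_ge0.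
Qed.

End RoughPaths.

Section Solutions.
Variables (R : realType) (d l : nat).
Local Notation C := (Cplx R).
Local Notation V := 'rV[C]_l.
Variable sigma : V -> 'M[C]_(d, l).
Hypothesis dsigma : forall v, differentiable sigma v.
Variables (rho gam : R).
Hypothesis rho0 : 0 < rho.
Hypothesis rho1 : 2 * rho <= 1.
Hypothesis gam13 : 1 < 3 * gam.
Local Notation D := (hD rho).

Let gam0 : 0 < gam. Proof. by have := gam13; lra. Qed.

Let diam t s : D t -> D s -> nrm (t - s) <= 1.
Proof. by move=> Dt Ds; apply: ltW; apply: lt_le_trans (hD_diam Dt Ds) rho1. Qed.

Let n1 t : D t -> nrm t <= 1.
Proof. by move=> Dt; have := diam Dt (hD0 rho0); rewrite subr0. Qed.

Lemma exists_step (B K S : R) : 0 <= K -> 0 <= S -> exists2 del0 : R, 0 < del0 <= 1 &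
  forall del, 0 < del <= del0 -> small_step (K1e d K S) (K2e d K S) gam (3 * gam) del.
Proof.
move=> K0 S0.
have k1 : 0 <= K1e d K S by rewrite !mulr_ge0// addr_ge0// mulr_ge0.
have k2 : 0 <= K2e d K S.
  rewrite /K2e; apply: addr_ge0; last first.
    exact: mulr_ge0 (mulr_ge0 (ler0n R d) (ler0n R d)) (mulr_ge0 K0 (mulr_ge0 (mulr_ge0 (ler0n R 24) S0) k1)).
  apply: mulr_ge0 (ler0n R d) (mulr_ge0 K0 (addr_ge0 _ _)).
    exact: mulr_ge0 (mulr_ge0 (ler0n R 4608) S0) (sqr_ge0 _).
  exact: mulr_ge0 (mulr_ge0 (ler0n R 12) S0) (mulr_ge0 (mulr_ge0 (ler0n R d) (ler0n R d)) (mulr_ge0 K0 S0)).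
have g3 : 0 < gam < 3 * gam by rewrite gam0 ltr_pMl// ltr1n.
exact: exists_small_step k1 k2 g3 gam13.
Qed.

Lemma exists_solution (kap K B S del : R) (a : V) (X : C -> 'rV[C]_d) (X2 : C -> C -> 'M[C]_d) :
  levy_area gam D X X2 -> rough_data D X X2 K gam -> sigma_bound sigma (B + 4) S -> 0 <= K ->
  0 < del <= 1 -> small_step (K1e d K S) (K2e d K S) gam (3 * gam) del ->
  2 * rho <= del -> nrm a <= B - 1 -> 1 < 3 * kap -> kap <= gam ->
  exists y zeta, solves kap D sigma a X X2 y zeta.
Proof.
move=> LA RD SB K0 del01 SS rdel aB k3 kg.
have AF := euler_af dsigma (@hD_convex R rho) RD SB K0 gam0 gam13 del01 SS.
have [y [yi yB yd ydf ode]] := exists_davie dsigma LA RD rho0 SB K0 gam0 gam13 del01 SS rdel aB.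
have yB4 t : D t -> nrm (y t) <= B + 4 by move=> /yB h; apply: le_trans h _; rewrite lerDl.
exists y, (fun s => sigma (y s)); rewrite -yi.
exact: (davie_solves dsigma LA RD rho0 rho1 SB K0 gam0 (K4_ge0 AF) yB4 yd ydf ode k3 kg).
Qed.

(** Up to distance [del] the constant of [flow_follow] serves; beyond it the trivial bound does,
    divided by the power of [del]. *)
Definition unifc (B K S del : R) : R :=
  K4c (K2e d K S) (3 * gam) + (B + B + K1e d K S) / del `^ (3 * gam).

Lemma davie_uniform (K B S del c nu : R) (X : C -> 'rV[C]_d) (X2 : C -> C -> 'M[C]_d) (y : C -> V) :
  rough_data D X X2 K gam -> sigma_bound sigma (B + 4) S -> 0 <= K ->
  0 < del <= 1 -> small_step (K1e d K S) (K2e d K S) gam (3 * gam) del ->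
  davie D (euler sigma X X2) y c nu -> 1 < nu -> 0 <= c -> (forall t, D t -> nrm (y t) <= B) ->
  0 <= unifc B K S del /\ davie D (euler sigma X X2) y (unifc B K S del) (3 * gam).
Proof.
move=> RD SB K0 del01 SS da nu1 c0 yB.
have AF := euler_af dsigma (@hD_convex R rho) RD SB K0 gam0 gam13 del01 SS.
have del0 : 0 < del by case/andP: del01.
have K40 := K4_ge0 AF; have k10 := K1e_ge0 (d := d) SB K0.
have B0 : 0 <= B := le_trans (nrm_ge0 _) (yB _ (hD0 rho0)).
have bk0 : 0 <= B + B + K1e d K S := addr_ge0 (addr_ge0 B0 B0) k10.
have dp : 0 < del `^ (3 * gam) by rewrite powR_gt0.
have u2 : 0 <= (B + B + K1e d K S) / del `^ (3 * gam) by rewrite divr_ge0// ltW.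
split; first exact: addr_ge0.
move=> s t Ds Dt; rewrite /unifc [leRHS]mulrDl.
have [near|far] := leP (nrm (t - s)) del.
  apply: le_trans (_ : _ <= K4c (K2e d K S) (3 * gam) * nrm (t - s) `^ (3 * gam)) _; last first.
    by rewrite lerDl mulr_ge0 ?powR_ge0.
  apply: (flow_follow AF SS (@subset_refl _ D) (@hD_convex R rho) da nu1 c0 Ds Dt near).
  by move=> tau htau; apply: yB; exact: hD_convex.
apply: le_trans (_ : _ <= (B + B + K1e d K S) / del `^ (3 * gam) * nrm (t - s) `^ (3 * gam)) _; last first.
  by rewrite lerDr mulr_ge0 ?powR_ge0.
apply: le_trans (_ : _ <= B + B + K1e d K S) _; last first.
  rewrite mulrAC -mulrA; apply: ler_peMr => //; rewrite ler_pdivlMr// mul1r.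
  apply: powR_mono; first by rewrite mulr_ge0// ltW.
  by rewrite !ltW.
have mv : nrm (euler sigma X X2 t s (y s) - y s) <= K1e d K S.
  have r1 : nrm (y s) <= B + 4 + 1 by apply: le_trans (yB s Ds) _; rewrite -addrA lerDl addr_ge0.
  apply: le_trans (euler_move SB RD K0 gam0 Dt Ds (diam Dt Ds) r1) _.
  by rewrite ler_piMr// powR_le1 ?nrm_ge0 ?diam// ltW.
apply: le_trans (nrm_tri (y s) _ _) _; apply: lerD; last by rewrite nrmBC.
by apply: nrmB_le; exact: yB.
Qed.

Section Close.
Variables (kap : R) (a1 : V) (X1 : C -> 'rV[C]_d) (X21 : C -> C -> 'M[C]_d)
  (y1 : C -> V) (zeta1 : C -> 'M[C]_(d, l)).
Hypothesis kap0 : 0 < kap.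
Hypothesis LA1 : levy_area gam D X1 X21.
Hypothesis SO1 : solves kap D sigma a1 X1 X21 y1 zeta1.

(* The constants are uniform over all solutions for data close to [X1, X21]. *)
Lemma solution_close : exists B K S c4 : R,
  [/\ sigma_bound sigma (B + 4) S, 0 <= K, 0 <= c4,
   [/\ rough_data D X1 X21 K gam, forall t, D t -> nrm (y1 t) <= B
     & davie D (euler sigma X1 X21) y1 c4 (3 * gam)]
   & forall e, 0 < e -> exists2 eta : R, 0 < eta &
     forall a2 X2 X22 y2 zeta2, levy_area gam D X2 X22 ->
       solves kap D sigma a2 X2 X22 y2 zeta2 ->
       close_data gam eta D a1 a2 X1 X2 X21 X22 ->
       [/\ rough_data D X2 X22 K gam, forall t, D t -> nrm (y2 t) <= B,
           davie D (euler sigma X2 X22) y2 c4 (3 * gam)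
         & forall t, D t -> nrm (y2 t - y1 t) <= e]].
Proof.
have [K' K'0 RD1'] := levy_rough gam0 LA1.
have K0 : 0 <= K' + 1 by rewrite addr_ge0.
have RD1 : rough_data D X1 X21 (K' + 1) gam by apply: rough_data_widen RD1'; rewrite lerDl.
set K := K' + 1 in K0 RD1 *.
have [H H0 hH] := solves_holder kap0 SO1.
(* A bound for [y1] on the half disc, plus the 3 that [ray_compare] requires. *)
pose B := nrm (y1 0) + H + 3.
have yB p : D p -> nrm (y1 p) <= B - 3.
  move=> Dp; rewrite /B addrK; apply: le_trans (nrm_shift _ (y1 0)) _; rewrite lerD2l.
  apply: le_trans (hH 0 p (hD0 rho0) Dp) _; rewrite subr0 ler_piMr//.
  by apply: powR_le1; rewrite ?(ltW kap0)// nrm_ge0 n1.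
have yB' p : D p -> nrm (y1 p) <= B by move=> /yB; lra.
have [S SB] := exists_sigma_bound dsigma (B + 4).
have S0 : 0 <= S by exact: le_trans ler01 (sb_S SB).
have [del del01 hdel] := exists_step B K0 S0.
have del0 : 0 < del by case/andP: del01.
have SS : small_step (K1e d K S) (K2e d K S) gam (3 * gam) del by apply: hdel; rewrite del0 lexx.
have [nu1 [M1 [nu11 M10] da1]] := solves_davie rho1 SO1.
have [c40 da1'] := davie_uniform RD1 SB K0 del01 SS da1 nu11 M10 yB'.
exists B, K, S, (unifc B K S del); split => // e e0.
have K20 : 0 <= K2e d K S := af_K2 (euler_af dsigma (@hD_convex R rho) RD1 SB K0 gam0 gam13 del01 SS).
pose e1 := Num.min e 1.
have e10 : 0 < e1 by rewrite /e1 lt_min e0 ltr01.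
have [eta1 eta10 heta] := ray_compare SS K20 gam13 del0 rho0 da1 nu11 M10 yB e10.
(* [eta * A] bounds the change of the Euler step when the data move by [eta]; the 1 in [1 + A] takes
   care of the initial values. *)
pose A := d%:R * S + d%:R * (d%:R * S).
have A0 : 0 <= A by rewrite addr_ge0// !mulr_ge0.
have A1 : 0 < 1 + A by rewrite ltr_pwDl.
pose eta := Num.min 1 (eta1 / (1 + A)).
have eta0 : 0 < eta by rewrite /eta lt_min ltr01 divr_gt0.
have etaA : eta * (1 + A) <= eta1 by rewrite -ler_pdivlMr// /eta ge_min lexx orbT.
have eta1' : eta <= 1 by rewrite /eta ge_min lexx.
have etae : eta <= eta1.
  by apply: le_trans etaA; rewrite mulrDr mulr1 lerDl mulr_ge0// ltW.
exists eta; first exact: eta0.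
move=> a2 X2 X22 y2 zeta2 LA2 SO2 cl.
have RD2 : rough_data D X2 X22 K gam := close_rough gam0 eta1' LA1 LA2 RD1' cl.
have [cl0 cl1 cl2] := close_bounds gam0 LA1 LA2 cl.
have AF2 := euler_af dsigma (@hD_convex R rho) RD2 SB K0 gam0 gam13 del01 SS.
have [nu2 [M2 [nu21 M20] da2]] := solves_davie rho1 SO2.
have [H2 H20 hH2] := solves_holder kap0 SO2.
have close t : D t -> nrm (y1 t - y2 t) <= e1.
  apply: (heta _ y2 M2 nu2 H2 kap AF2 _ da2 nu21 M20 H20 kap0 hH2); last first.
    rewrite (solves_init SO1) (solves_init SO2) nrmBC; exact: le_trans cl0 etae.
  move=> t' s' v Dt' Ds' vB.
  have v1 : nrm v <= B + 4 + 1 by apply: le_trans vB _; rewrite -addrA lerDl addr_ge0.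
  have le1 p : 0 < p -> eta * nrm (t' - s') `^ p <= eta.
    by move=> p0; rewrite ler_piMr ?(ltW eta0)// powR_le1 ?nrm_ge0 ?diam// ltW.
  have d1 : nrm (delta1 X1 t' s' - delta1 X2 t' s') <= eta.
    by rewrite nrmBC; apply: le_trans (cl1 _ _ Dt' Ds') _; exact: le1.
  have d2 : nrm (X21 t' s' - X22 t' s') <= eta.
    by rewrite nrmBC; apply: le_trans (cl2 _ _ Dt' Ds') _; apply: le1; rewrite mulr_gt0.
  apply: le_trans (euler_data_diff SB v1 d1 d2) _; apply: le_trans etaA.
  have -> : d%:R * (eta * S) + d%:R * (d%:R * (eta * S)) = eta * A by rewrite /A; ring.
  by rewrite ler_pM2l// lerDr.
have y2B t : D t -> nrm (y2 t) <= B.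
  move=> Dt; apply: le_trans (nrm_shift _ (y1 t)) _.
  have -> : B = (B - 3) + 3 by rewrite subrK.
  apply: lerD; first exact: yB.
  rewrite nrmBC; apply: le_trans (close t Dt) _; rewrite /e1 ge_min; apply/orP; right.
  by rewrite ler1n.
have [_ da2'] := davie_uniform RD2 SB K0 del01 SS da2 nu21 M20 y2B.
split => // t Dt; rewrite nrmBC; apply: le_trans (close t Dt) _.
by rewrite /e1 ge_min lexx.
Qed.

(** Identical data are close at every scale, so [solution_close] applies with arbitrary [e]. *)
Lemma solution_unique y2 zeta2 : solves kap D sigma a1 X1 X21 y2 zeta2 ->
  forall s, D s -> y2 s = y1 s /\ zeta2 s = zeta1 s.
Proof.
move=> SO2 s Ds; have [B [K [S [c4 [_ _ _ _ H]]]]] := solution_close.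
have yE : y2 s = y1 s.
  apply/eqP; rewrite -subr_eq0; apply/eqP/nrm_eq0/le_anti; rewrite nrm_ge0 andbT.
  apply: le_of_forall_eps => e e0; rewrite add0r; have [eta eta0 h] := H e e0.
  have [|_ _ _ hy] := h a1 X1 X21 y2 zeta2 LA1 SO2; last exact: hy.
  split.
  - by rewrite subrr nrm0.
  - apply: le_lt_trans (_ : (_ <= 0%:E)%E) _; last by rewrite lte_fin.
    by apply: le_holder2 => // t u _ _; rewrite /delta1 !subrr nrm0 mul0r.
  - apply: le_lt_trans (_ : (_ <= 0%:E)%E) _; last by rewrite lte_fin.
    by apply: le_holder2 => // t u _ _; rewrite !subrr nrm0 mul0r.
by rewrite (solves_deriv SO1 Ds) (solves_deriv SO2 Ds) yE.
Qed.

End Close.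
End Solutions.

(** * Continuity in the norm of controlled paths *)

Section Continuity.
Variables (R : realType) (d l : nat).
Local Notation C := (Cplx R).
Local Notation V := 'rV[C]_l.
Variable sigma : V -> 'M[C]_(d, l).
Hypothesis dsigma : forall v, differentiable sigma v.
Variables (rho gam kap : R).
Hypothesis rho0 : 0 < rho.
Hypothesis rho1 : 2 * rho <= 1.
Hypothesis gam13 : 1 < 3 * gam.
Hypothesis kap0 : 0 < kap.
Hypothesis kapgam : kap < gam.
Local Notation D := (hD rho).

Let gam0 : 0 < gam. Proof. by have := gam13; lra. Qed.

Lemma close_data_widen (eta eta' : R) (a a' : V) (X X' : C -> 'rV[C]_d)
    (X2 X2' : C -> C -> 'M[C]_d) : eta <= eta' ->
  close_data gam eta D a a' X X' X2 X2' -> close_data gam eta' D a a' X X' X2 X2'.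
Proof.
by move=> h [h0 h1 h2]; split; [exact: lt_le_trans h|apply: lt_le_trans h1 _; rewrite lee_fin|
  apply: lt_le_trans h2 _; rewrite lee_fin].
Qed.

Lemma sigma_close (r S e : R) v w i c : sigma_bound sigma r S -> nrm v <= r -> nrm w <= r ->
  nrm (v - w) <= e -> nrm (sigma v i c - sigma w i c) <= 24 * S * e.
Proof.
move=> SB vr wr vw; apply: le_trans (ball_lip (sg_bholo dsigma SB i c) vr wr) _.
by apply: ler_wpM2l => //; exact: mulr_ge0 (ler0n R 24) (le_trans ler01 (sb_S SB)).
Qed.

Variables (a1 : V) (X1 : C -> 'rV[C]_d) (X21 : C -> C -> 'M[C]_d)
  (y1 : C -> V) (zeta1 : C -> 'M[C]_(d, l)).
Hypothesis LA1 : levy_area gam D X1 X21.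
Hypothesis SO1 : solves kap D sigma a1 X1 X21 y1 zeta1.

Lemma solution_continuous eps : 0 < eps -> exists2 eta : R, 0 < eta &
  forall a2 X2 X22 y2 zeta2, levy_area gam D X2 X22 ->
    solves kap D sigma a2 X2 X22 y2 zeta2 ->
    close_data gam eta D a1 a2 X1 X2 X21 X22 ->
    (Qdist kap D X1 X2 y1 zeta1 y2 zeta2 < eps%:E)%E.
Proof.
move=> eps0; have [B [K [S [c4 [SB K0 c40 [RD1 yB1 da1] H]]]]] :=
  solution_close dsigma rho0 rho1 gam13 kap0 LA1 SO1.
have S0 : 0 <= S by exact: le_trans ler01 (sb_S SB).
have yB4 (y : C -> V) : (forall t, D t -> nrm (y t) <= B) -> forall t, D t -> nrm (y t) <= B + 4.
  by move=> h t /h h'; apply: le_trans h' _; rewrite lerDl.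
have P0 : 0 <= c4 + K1e d K S by rewrite addr_ge0// (K1e_ge0 SB K0).
have Z0 : 0 <= compc d K S c4 := compc_ge0 SB K0 c40.
have M0 : 0 <= remc d K S c4 := remc_ge0 SB K0 c40.
(* [Qdist] has four components; four times [eps / 8] is strictly below [eps]. *)
have e80 : 0 < eps / 8 by rewrite divr_gt0.
have kg : 0 < kap < gam by rewrite kap0.
have kg2 : 0 < 2 * kap < 2 * gam by rewrite mulr_gt0// ltr_pM2l.
have [e1 e10 i1] := interpolate (addr_ge0 P0 P0) kg e80.
have [e2 e20 i2] := interpolate (addr_ge0 Z0 Z0) kg e80.
have [e3 e30 i3] := interpolate (addr_ge0 M0 M0) kg2 e80.
pose m := Num.min (Num.min e1 e2) (Num.min (e3 / 2) (eps / 8)).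
have m0 : 0 < m by rewrite /m !lt_min e10 e20 e80 divr_gt0.
have [m1 m2 m3 m4] : [/\ m <= e1, m <= e2, m <= e3 / 2 & m <= eps / 8].
  by split; rewrite /m !ge_min lexx ?orbT.
have S24 : 0 <= 24 * S := mulr_ge0 (ler0n R 24) S0.
have Q0 : 0 <= d%:R * (K * (24 * S)) := mulr_ge0 (ler0n R d) (mulr_ge0 K0 S24).
(* [W] dominates every coefficient with which the sup distance [e] enters a component of [Qdist], so
   that each such multiple of [e] is at most [m]. *)
pose W := (1 + 1) + ((24 * S + 24 * S) + d%:R * (K * (24 * S))).
have W0 : 0 < W by rewrite ltr_pwDl// !addr_ge0.
pose e := m / W.
have e0 : 0 < e by exact: divr_gt0.
have eW (w : R) : w <= W -> w * e <= m.
  by move=> h; rewrite /e mulrCA -[leRHS]mulr1; apply: ler_wpM2l; rewrite ?(ltW m0)// ler_pdivrMr// mul1r.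
have [eta eta0 heta] := H e e0.
(* The remainder contains the driving path itself, so its sup distance also involves [X2 - X1],
   which is controlled by [f]. *)
pose f := m / (1 + d%:R * S).
have dS : 0 <= d%:R * S := mulr_ge0 (ler0n R d) S0.
have f0 : 0 < f by rewrite divr_gt0// ltr_pwDl.
have fm : d%:R * (f * S) <= m.
  have -> : d%:R * (f * S) = m * ((d%:R * S) / (1 + d%:R * S)) by rewrite /f; ring.
  by rewrite ler_piMr ?(ltW m0)// ler_pdivrMr ?ltr_pwDl// mul1r lerDr.
exists (Num.min eta f); first by rewrite lt_min eta0 f0.
move=> a2 X2 X22 y2 zeta2 LA2 SO2 cl.
have cle : close_data gam eta D a1 a2 X1 X2 X21 X22.
  by apply: close_data_widen cl; rewrite ge_min lexx.
have clf : close_data gam f D a1 a2 X1 X2 X21 X22.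
  by apply: close_data_widen cl; rewrite ge_min lexx orbT.
have [RD2 yB2 da2 y21] := heta _ _ _ _ _ LA2 SO2 cle.
have [_ X12 _] := close_bounds gam0 LA1 LA2 clf.
have z1 := solves_deriv SO1; have z2 := solves_deriv SO2.
have diam t s : D t -> D s -> nrm (t - s) <= 1.
  by move=> Dt Ds; apply: ltW; apply: lt_le_trans (hD_diam Dt Ds) rho1.
have sg t i c : D t -> nrm (sigma (y2 t) i c - sigma (y1 t) i c) <= 24 * S * e.
  by move=> Dt; apply: (sigma_close i c SB (yB4 _ yB2 t Dt) (yB4 _ yB1 t Dt)); exact: y21.
have b1 : (holder1 kap D (fun s => (y2 s - y1 s)%R) <= (eps / 8)%:E)%E.
  apply: le_holder2; first exact: ltW.
  move=> t s Dt Ds; apply: i1 => //.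
    have -> : delta1 (fun s => y2 s - y1 s) t s = (y2 t - y2 s) - (y1 t - y1 s).
      by rewrite /delta1 !opprD !opprK addrACA.
    rewrite mulrDl; apply: nrmB_le.
      exact: (path_move RD2 rho1 SB K0 gam0 c40 (yB4 _ yB2) da2 Dt Ds).
    exact: (path_move RD1 rho1 SB K0 gam0 c40 (yB4 _ yB1) da1 Dt Ds).
  apply: le_trans (nrmB_le (y21 t Dt) (y21 s Ds)) _; apply: le_trans m1.
  have -> : e + e = (1 + 1) * e by ring.
  by apply: eW; rewrite lerDl !addr_ge0.
have b2 : (supnorm D (fun s => (zeta2 s - zeta1 s)%R) <= (eps / 8)%:E)%E.
  apply: supnorm_le => s Ds; rewrite (z1 s Ds) (z2 s Ds).
  apply/mx_nrm_le => [|i c]; first exact: ltW.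
  have -> : (sigma (y2 s) - sigma (y1 s)) i c = sigma (y2 s) i c - sigma (y1 s) i c by rewrite !mxE.
  apply: le_trans (sg s i c Ds) _; apply: le_trans m4; apply: eW.
  exact: ler_wpDl (addr_ge0 ler01 ler01) (ler_wpDr Q0 (ler_wpDr S24 (lexx _))).
have b3 : (holder1 kap D (fun s => (zeta2 s - zeta1 s)%R) <= (eps / 8)%:E)%E.
  apply: le_holder2; first exact: ltW.
  move=> t s Dt Ds; rewrite /delta1 (z1 s Ds) (z2 s Ds) (z1 t Dt) (z2 t Dt).
  apply/mx_nrm_le => [|i c]; first by rewrite mulr_ge0 ?powR_ge0// ltW.
  apply: i2 => //.
    have -> : (sigma (y2 t) - sigma (y1 t) - (sigma (y2 s) - sigma (y1 s))) i c =
       (sigma (y2 t) i c - sigma (y2 s) i c) - (sigma (y1 t) i c - sigma (y1 s) i c).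
      by rewrite !mxE !opprD !opprK addrACA.
    rewrite mulrDl; apply: nrmB_le.
      exact: (sigma_path_move dsigma RD2 rho1 SB K0 gam0 c40 (yB4 _ yB2) da2 i c Dt Ds).
    exact: (sigma_path_move dsigma RD1 rho1 SB K0 gam0 c40 (yB4 _ yB1) da1 i c Dt Ds).
  have -> : (sigma (y2 t) - sigma (y1 t) - (sigma (y2 s) - sigma (y1 s))) i c =
     (sigma (y2 t) i c - sigma (y1 t) i c) - (sigma (y2 s) i c - sigma (y1 s) i c).
    by rewrite !mxE.
  apply: le_trans (nrmB_le (sg t i c Dt) (sg s i c Ds)) _; apply: le_trans m2.
  rewrite -(mulrDl (24 * S)); apply: eW.
  exact: ler_wpDl (addr_ge0 ler01 ler01) (ler_wpDr Q0 (lexx _)).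
have b4 : (holder2 (2 * kap)%R D (fun t s => (remainder X2 y2 zeta2 t s - remainder X1 y1 zeta1 t s)%R)
    <= (eps / 8)%:E)%E.
  apply: le_holder2; first exact: ltW.
  move=> t s Dt Ds; apply: i3 => //.
    rewrite mulrDl; apply: nrmB_le.
      exact: (path_remainder RD2 rho1 SB gam0 c40 (yB4 _ yB2) da2 (z2 s Ds) Dt Ds).
    exact: (path_remainder RD1 rho1 SB gam0 c40 (yB4 _ yB1) da1 (z1 s Ds) Dt Ds).
  have XS : nrm (delta1 X2 t s *m sigma (y2 s) - delta1 X1 t s *m sigma (y1 s)) <=
      d%:R * (f * S) + d%:R * (K * (24 * S)) * e.
    have g0 : 0 <= d%:R * (f * S) + d%:R * (K * (24 * S)) * e.
      exact: addr_ge0 (mulr_ge0 (ler0n R d) (mulr_ge0 (ltW f0) S0)) (mulr_ge0 Q0 (ltW e0)).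
    apply/mx_nrm_le => // i' c; rewrite (ord1 i').
    have -> : (delta1 X2 t s *m sigma (y2 s) - delta1 X1 t s *m sigma (y1 s)) 0 c =
       \sum_i ((delta1 X2 t s - delta1 X1 t s) 0 i * sigma (y2 s) i c +
               delta1 X1 t s 0 i * (sigma (y2 s) i c - sigma (y1 s) i c)).
      rewrite 3!mxE [in LHS]mxE -sumrB; apply: eq_bigr => i _.
      have -> : (delta1 X2 t s - delta1 X1 t s) 0 i = delta1 X2 t s 0 i - delta1 X1 t s 0 i by rewrite !mxE.
      ring.
    apply: le_trans (nrm_sum _ _ _) _.
    apply: le_trans (_ : _ <= \sum_(i < d) (f * S + K * (24 * S * e))) _; last first.
      rewrite sumr_const card_ord -[leLHS]mulr_natl [leLHS]mulrDr; apply: lerD => //.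
      by rewrite -!mulrA.
    apply: ler_sum => i _; apply: nrmD_le; rewrite nrmM; apply: ler_pM => //.
    - apply: le_trans (mx_nrm_coord _ _ _) _; apply: le_trans (X12 t s Dt Ds) _.
      by rewrite ler_piMr ?(ltW f0)// powR_le1 ?(ltW gam0)// nrm_ge0 diam.
    - apply: (sb_vf SB); apply: le_trans (yB4 _ yB2 s Ds) _; by rewrite lerDl.
    - apply: le_trans (X_coord RD1 i Dt Ds) _.
      by rewrite ler_piMr// powR_le1 ?(ltW gam0)// nrm_ge0 diam.
    - exact: sg.
  have -> : remainder X2 y2 zeta2 t s - remainder X1 y1 zeta1 t s =
      ((y2 t - y1 t) - (y2 s - y1 s)) -
      (delta1 X2 t s *m sigma (y2 s) - delta1 X1 t s *m sigma (y1 s)).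
    rewrite /remainder (z1 s Ds) (z2 s Ds).
    move: (delta1 X2 t s *m _) (delta1 X1 t s *m _) => p q.
    by rewrite /delta1; apply/rowP => j; rewrite !mxE; ring.
  apply: le_trans (nrmB_le (nrmB_le (y21 t Dt) (y21 s Ds)) XS) _.
  have -> : e + e + (d%:R * (f * S) + d%:R * (K * (24 * S)) * e) =
    (1 + 1 + d%:R * (K * (24 * S))) * e + d%:R * (f * S) by ring.
  have -> : e3 = e3 / 2 + e3 / 2 by field.
  apply: lerD; last exact: le_trans fm m3.
  apply: le_trans m3; apply: eW; rewrite /W lerD2l; exact: ler_wpDl (addr_ge0 S24 S24) (lexx _).
rewrite /Qdist /Qnorm.
have tot : ((eps / 8)%:E + (eps / 8)%:E + (eps / 8)%:E + (eps / 8)%:E < eps%:E)%E.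
  by rewrite -!EFinD lte_fin; lra.
apply: le_lt_trans tot.
by apply: leeD b4; apply: leeD b3; apply: leeD b2.
Qed.

End Continuity.

Theorem theorem3p5 (R : realType) (d l : nat) (gamma : R)
    (Om : set (Cplx R))
    (X : Cplx R -> 'rV[Cplx R]_d) (X2 : Cplx R -> Cplx R -> 'M[Cplx R]_d)
    (sigma : 'rV[Cplx R]_l -> 'M[Cplx R]_(d, l)) (a : 'rV[Cplx R]_l) :
  1 / 3 < gamma <= 1 / 2 ->
  half_nbhd0 Om -> bounded_set Om ->
  levy_area gamma Om X X2 ->
  analytic_on setT sigma ->
  exists Om0 : set (Cplx R),
    [/\ half_nbhd0 Om0, Om0 `<=` Om,
        (* (1) *)
        forall kappa : R, 1 / 3 < kappa < gamma ->
          exists y zeta, solves kappa Om0 sigma a X X2 y zeta /\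
            forall y' zeta', solves kappa Om0 sigma a X X2 y' zeta' ->
              forall s, Om0 s -> y' s = y s /\ zeta' s = zeta s
      & (* (2): the solution map on Om0 is defined on a neighborhood of the
           given data, and it is continuous wherever it is defined *)
        forall kappa : R, 1 / 3 < kappa < gamma ->
          (exists2 rho : R, 0 < rho &
            forall a' X' X2', levy_area gamma Om0 X' X2' ->
              close_data gamma rho Om0 a a' X X' X2 X2' ->
              exists y zeta, solves kappa Om0 sigma a' X' X2' y zeta)
          /\
          (forall a1 X1 X21 y1 zeta1, levy_area gamma Om0 X1 X21 ->
            solves kappa Om0 sigma a1 X1 X21 y1 zeta1 ->
            forall eps : R, 0 < eps -> exists2 eta : R, 0 < eta &
            forall a2 X2' X22 y2 zeta2, levy_area gamma Om0 X2' X22 ->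
              solves kappa Om0 sigma a2 X2' X22 y2 zeta2 ->
              close_data gamma eta Om0 a1 a2 X1 X2' X21 X22 ->
              (Qdist kappa Om0 X1 X2' y1 zeta1 y2 zeta2 < eps%:E)%E)].
Proof.
move=> /andP[g13 _] nb _ LOm ds0.
have ds v : differentiable sigma v by exact: ds0.
have g0 : 0 < gamma by lra.
have g1 : 1 < 3 * gamma by lra.
have [K' K'0 RDOm] := levy_rough g0 LOm.
(* One unit is for initial values at distance less than 1 from [a], the other for the displacement
   of the solution. *)
pose B := nrm a + 2.
have [S SB] := exists_sigma_bound ds (B + 4).
have S0 : 0 <= S by exact: le_trans ler01 (sb_S SB).
(* With [K' + 1] in place of [K'] the step size, and hence the half disc, serves all data within
   distance 1 of the given ones. *)
have K0 : 0 <= K' + 1 by rewrite addr_ge0.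
have [del del01 hdel] := exists_step d g1 B K0 S0.
have del0 : 0 < del by case/andP: del01.
have SS : small_step (K1e d (K' + 1) S) (K2e d (K' + 1) S) gamma (3 * gamma) del.
  by apply: hdel; rewrite del0 lexx.
have [r0 r00 hr] := half_nbhd0_sub nb.
(* Any two points of this half disc are at distance at most [del], that is, one admissible step
   apart. [del] is chosen without reference to [kappa], so one half disc works for all [kappa]. *)
pose rho := Num.min r0 (del / 2).
have rho0 : 0 < rho by rewrite /rho lt_min r00 divr_gt0.
have rhodel : 2 * rho <= del by rewrite mulrC -ler_pdivlMr// /rho ge_min lexx orbT.
have rho1 : 2 * rho <= 1 by case/andP: del01 => _; exact: le_trans.
have sub : hD rho `<=` Om by apply: hr; rewrite /rho ge_min lexx.
have LA := levy_restrict sub LOm.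
have RD' : rough_data (hD rho) X X2 K' gamma.
  by split=> [t s /sub Dt /sub Ds|t s /sub Dt /sub Ds|t u s /sub Dt /sub Du /sub Ds];
    [exact: (rd_X RDOm)|exact: (rd_X2 RDOm)|exact: (rd_chen RDOm)].
have RD : rough_data (hD rho) X X2 (K' + 1) gamma by apply: rough_data_widen RD'; rewrite lerDl.
exists (hD rho); split.
- exact: half_nbhd0_hD.
- exact: sub.
- move=> kappa /andP[k13 kg].
  have k3 : 1 < 3 * kappa by lra.
  have k0 : 0 < kappa by lra.
  have aB : nrm a <= B - 1 by rewrite /B; lra.
  have [y [zeta SO]] := exists_solution ds rho0 rho1 g1 LA RD SB K0 del01 SS rhodel aB k3 (ltW kg).
  exists y, zeta; split; first exact: SO.
  by move=> y' zeta' SO'; exact: (solution_unique ds rho0 rho1 g1 k0 LA SO SO').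
- move=> kappa /andP[k13 kg].
  have k3 : 1 < 3 * kappa by lra.
  have k0 : 0 < kappa by lra.
  split.
    exists 1 => // a' X' X2' LA' cl.
    have RDn := close_rough g0 (lexx 1) LA LA' RD' cl.
    have aB : nrm a' <= B - 1.
      case: cl => h _ _; apply: le_trans (nrm_shift _ a) _; rewrite /B; lra.
    exact: (exists_solution ds rho0 rho1 g1 LA' RDn SB K0 del01 SS rhodel aB k3 (ltW kg)).
  move=> a1 X1 X21 y1 zeta1 LA1 SO1 eps eps0.
  exact: (solution_continuous ds rho0 rho1 g1 k0 kg LA1 SO1 eps0).
Qed.
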